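(* Let $S\in\mathfrak{L}(A^2)$ be a radial operator with eigenvalue sequence $\lambda(S)=\{\lambda_n\}_{n\ge 0}$ (i.e. $Se_n=\lambda_n e_n$ for all $n\ge 0$). Then the following statements are equivalent: (1) $S\in\mathfrak{T}$ (or equivalently, $T_{B_k(S)}\to S$ in operator norm as $k\to\infty$); (2) $\lambda(S)\in\overline{d_2}^{\,\ell^\infty}$; (3) $\lambda(S)\in\overline{d_1}^{\,\ell^\infty}$.
   Context: $\mathbb{D}$ is the open unit disk in $\mathbb{C}$, $dA$ is normalized area measure on $\mathbb{D}$ (so $A(\mathbb{D})=1$). The Bergman space $A^2$ is the closed subspace of analytic functions in $L^2(\mathbb{D},dA)$, with inner product $\langle f,g\rangle=\int_{\mathbb{D}} f\overline{g}\,dA$ and orthonormal basis $e_n(z)=\sqrt{n+1}\,z^n$, $n\ge 0$. $\mathfrak{L}(A^2)$ is the algebra of bounded operators on $A^2$. An operator $S\in\mathfrak{L}(A^2)$ is called radial if it is diagonal with respect to $\{e_n\}$: $Se_n=\lambda_n e_n$ for all $n\geq 0$, and then $\lambda(S)=\{\lambda_n\}_{n\ge0}$ (a bounded sequence) is its eigenvalue sequence. For $a\in L^\infty(\mathbb{D})$ the Toeplitz operator with symbol $a$ is $T_af(z)=\int_{\mathbb{D}}\frac{a(w)f(w)}{(1-\overline{w}z)^2}\,dA(w)$, $f\in A^2$. The Toeplitz algebra $\mathfrak{T}$ is the (norm-)closed subalgebra of $\mathfrak{L}(A^2)$ generated by $\{T_a: a\in L^\infty(\mathbb{D})\}$. For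 an integer $k\ge0$ and $z\in\mathbb{D}$ let $K_z^k(\omega)=(1-\overline{z}\omega)^{-(2+k)}$, $\omega\in\mathbb{D}$. The $k$-Berezin transform of $S\in\mathfrak{L}(A^2)$ is the function $$B_k(S)(z)=(k+1)(1-|z|^2)^{2+k}\sum_{j=0}^{k}\binom{k}{j}(-1)^j\langle S(\omega^jK_z^k),\omega^jK_z^k\rangle,\quad z\in\mathbb{D},$$ which belongs to $L^\infty(\mathbb{D})\cap C^\infty(\mathbb{D})$. $\ell^\infty$ is the Banach space of bounded complex sequences $x=\{x_n\}_{n\ge0}$ with the sup norm. Put $\Delta^1_n(x)=x_{n+1}-x_n$, $\Delta^2_n(x)=x_{n+2}-2x_{n+1}+x_n$, and $$d_1=\{x\in\ell^\infty:\ \|x\|_{d_1}=\sup_{n\ge0}(n+1)|\Delta^1_n(x)|<\infty\},\quad d_2=\{x\in\ell^\infty:\ \|x\|_{d_2}=\sup_{n\ge0}(n+2)^2|\Delta^2_n(x)|<\infty\}.$$ $\overline{d_i}^{\,\ell^\infty}$ denotes the closure of $d_i$ in $\ell^\infty$. *)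

(* Defs.v *)
From HB Require Import structures.
From mathcomp Require Import all_boot all_order all_algebra.
From mathcomp Require Import all_classical all_reals all_analysis measurable_realfun.
From mathcomp Require Import complex ring.

Set Implicit Arguments.
Unset Strict Implicit.
Unset Printing Implicit Defensive.

Import Order.TTheory GRing.Theory Num.Theory.
Import numFieldNormedType.Exports.

Local Open Scope classical_set_scope.
Local Open Scope ring_scope.

(* the norm [`|z|] of [z : R[i]] is itself an element of [R[i]]; [cnorm z] is
   the modulus as a real number *)

Notation cnorm := Normc.normc.

Section Area.
Context {R : realType}.
Local Notation C := R[i].

Local Notation Rm := (measurableTypeR R).

Definition plane (p : R * R) : C := (p.1 +i* p.2)%C.

Definition disk : set C := [set z | cnorm z < 1].

Definition pdisk : set (Rm * Rm) := plane @^-1` disk.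

Lemma invpi_ge0 : 0 <= pi^-1 :> R.
Proof. by rewrite invr_ge0 pi_ge0. Qed.

(* normalized so that the disk has measure one; functions on the complex plane
   are integrated through their pullback along [plane] *)
Definition area : {measure set (Rm * Rm)%type -> \bar R} :=
  mscale (NngNum invpi_ge0) (lebesgue_measure \x lebesgue_measure)%E.

Definition cintegral (F : C -> C) : C :=
  (Rintegral area pdisk (fun p => complex.Re (F (plane p))) +i*
   Rintegral area pdisk (fun p => complex.Im (F (plane p))))%C.

Definition cmeasurable (F : C -> C) : Prop :=
  measurable_fun pdisk (fun p => complex.Re (F (plane p))) /\
  measurable_fun pdisk (fun p => complex.Im (F (plane p))).

Definition square_integrable (F : C -> C) : Prop :=
  cmeasurable F /\
  area.-integrable pdisk (fun p => ((cnorm (F (plane p))) ^+ 2)%:E).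

Definition Linfty : set (C -> C) :=
  [set a | cmeasurable a /\
    exists M : R, {ae area, forall p, pdisk p -> cnorm (a (plane p)) <= M}].

(* complex differentiability: the scalars of the normed module [R[i]^o] are
   the complex numbers *)
Definition analytic (F : C -> C) : Prop :=
  forall z, disk z -> derivable (F : C^o -> C^o) z 1.



Lemma cnormE (z : C) : cnorm z = Num.sqrt (complex.Re z ^+ 2 + complex.Im z ^+ 2).
Proof. by case: z. Qed.

Lemma cnorm_ge0 (z : C) : 0 <= cnorm z.
Proof. by rewrite cnormE sqrtr_ge0. Qed.

Lemma sqr_cnorm (z : C) : cnorm z ^+ 2 = complex.Re z ^+ 2 + complex.Im z ^+ 2.
Proof. by rewrite cnormE sqr_sqrtr// addr_ge0// sqr_ge0. Qed.

Lemma pdiskE : pdisk = [set p | p.1 ^+ 2 + p.2 ^+ 2 < 1].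
Proof.
have E (a : R) : (Num.sqrt a < 1) = (a < 1).
  by rewrite -[X in _ < X]sqrtr1 ltr_sqrt ?ltr01// sqrtr1.
by apply/seteqP; split=> -[x y]; rewrite /pdisk /disk /= E.
Qed.

Lemma measurable_sqr_sum :
  measurable_fun setT (fun p : Rm * Rm => p.1 ^+ 2 + p.2 ^+ 2).
Proof.
apply: measurable_funD; apply: measurable_funX.
  exact: measurable_fst.
exact: measurable_snd.
Qed.

Lemma pdisk_measurable : measurable pdisk.
Proof.
rewrite pdiskE -[X in measurable X]setTI.
have := measurable_sqr_sum measurableT (measurable_itv `]-oo, 1[).
by congr measurable; apply/seteqP; split=> -[x y] /=; rewrite in_itv.
Qed.

Lemma area_pdisk_lty : (area pdisk < +oo)%E.
Proof.
apply: (@le_lt_trans _ _ (area (`[-1, 1] `*` `[-1, 1]))).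
  apply: le_measure; rewrite ?inE; first exact: pdisk_measurable.
    by apply: measurableX; exact: measurable_itv.
  rewrite pdiskE => -[x y] /= xy; rewrite !in_itv /= -!ler_norml.
  by split; rewrite -(@ler_pXn2r _ 2)// ?nnegrE// expr1n real_normK ?num_real//;
     apply: le_trans (ltW xy); rewrite ?lerDl ?lerDr sqr_ge0.
rewrite /area /= /mscale /= product_measure1E; try exact: measurable_itv.
have E : lebesgue_measure (`[-1, 1]%classic : set R) = 2%:E.
  by rewrite lebesgue_measure_itv /= lte_fin gtrN // -EFinB opprK.
by rewrite [X in (_ * (X * X))%E]E -!EFinM ltry.
Qed.

(* an element of the Bergman space is a function on the disk: extending it by
   zero makes Leibniz equality coincide with equality on the disk *)
Definition in_bergman (f : C -> C) : Prop :=
  [/\ forall z, ~ disk z -> f z = 0, analytic f & square_integrable f].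

Definition bergman_pred : {pred (C -> C)} := fun f => `[< in_bergman f >].


Lemma cmeasurable_cst (c : C) : cmeasurable (fun=> c).
Proof. by split; exact: measurable_cst. Qed.

Lemma cmeasurable_id : cmeasurable (fun z => z).
Proof.
split; apply: measurable_funTS; first exact: measurable_fst.
exact: measurable_snd.
Qed.

Lemma cmeasurableD (f g : C -> C) :
  cmeasurable f -> cmeasurable g -> cmeasurable (fun z => f z + g z).
Proof.
move=> [rf mf] [rg mg]; split.
  apply: (eq_measurable_fun ((fun p => complex.Re (f (plane p))) \+
    (fun p => complex.Re (g (plane p))))); last exact: measurable_funD.
  by move=> p _ /=; case: (f _) (g _) => [? ?] [].
apply: (eq_measurable_fun ((fun p => complex.Im (f (plane p))) \+
  (fun p => complex.Im (g (plane p))))); last exact: measurable_funD.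
by move=> p _ /=; case: (f _) (g _) => [? ?] [].
Qed.

Lemma cmeasurableM (f g : C -> C) :
  cmeasurable f -> cmeasurable g -> cmeasurable (fun z => f z * g z).
Proof.
move=> [rf mf] [rg mg]; split.
  apply: (eq_measurable_fun
    (((fun p => complex.Re (f (plane p))) \* (fun p => complex.Re (g (plane p))))
   \- ((fun p => complex.Im (f (plane p))) \* (fun p => complex.Im (g (plane p)))))).
    by move=> p _ /=; case: (f _) (g _) => [? ?] [].
  by apply: measurable_funB; exact: measurable_funM.
apply: (eq_measurable_fun
  (((fun p => complex.Re (f (plane p))) \* (fun p => complex.Im (g (plane p))))
 \+ ((fun p => complex.Im (f (plane p))) \* (fun p => complex.Re (g (plane p)))))).
  by move=> p _ /=; case: (f _) (g _) => [? ?] [].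
by apply: measurable_funD; exact: measurable_funM.
Qed.

Lemma cmeasurableX (f : C -> C) n :
  cmeasurable f -> cmeasurable (fun z => f z ^+ n).
Proof.
move=> mf; elim: n => [|n IHn]; first exact: cmeasurable_cst.
have := cmeasurableM mf IHn.
by congr cmeasurable; apply/funext => z; rewrite exprS.
Qed.

Lemma measurable_sqr_cnorm (f : C -> C) : cmeasurable f ->
  measurable_fun pdisk (fun p => cnorm (f (plane p)) ^+ 2).
Proof.
move=> [rf mf].
apply: (eq_measurable_fun ((fun p => complex.Re (f (plane p)) ^+ 2) \+
  (fun p => complex.Im (f (plane p)) ^+ 2))).
  by move=> p _; rewrite /= sqr_cnorm.
by apply: measurable_funD; exact: measurable_funX.
Qed.

Lemma cmeasurableV (f : C -> C) :
  cmeasurable f -> cmeasurable (fun z => (f z)^-1).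
Proof.
move=> mf; have [rf imf] := mf.
have mV : measurable_fun pdisk (fun p => (cnorm (f (plane p)) ^+ 2)^-1).
  apply: (eq_measurable_fun
    ((fun x : R => x `^ (-1)) \o (fun p => cnorm (f (plane p)) ^+ 2))).
    by move=> p _ /=; rewrite powR_inv1// sqr_ge0.
  apply: measurableT_comp; first exact: measurable_powR.
  exact: measurable_sqr_cnorm.
split.
  apply: (eq_measurable_fun ((fun p => complex.Re (f (plane p))) \*
    (fun p => (cnorm (f (plane p)) ^+ 2)^-1))); last exact: measurable_funM.
  by move=> p _ /=; rewrite sqr_cnorm; case: (f _).
apply: (eq_measurable_fun ((\- (fun p => complex.Im (f (plane p)))) \*
    (fun p => (cnorm (f (plane p)) ^+ 2)^-1))).
  by move=> p _ /=; rewrite sqr_cnorm; case: (f _) => a b; rewrite /= mulNr.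
by apply: measurable_funM => //; exact: measurable_funN.
Qed.

Lemma sqr_cnormD (z w : C) :
  cnorm (z + w) ^+ 2 <= 2 * (cnorm z ^+ 2 + cnorm w ^+ 2).
Proof.
rewrite !sqr_cnorm; case: z w => [a b] [c d] /=.
rewrite -subr_ge0; have -> : 2 * (a ^+ 2 + b ^+ 2 + (c ^+ 2 + d ^+ 2)) -
  ((a + c) ^+ 2 + (b + d) ^+ 2) = (a - c) ^+ 2 + (b - d) ^+ 2 by ring.
by apply: addr_ge0; exact: sqr_ge0.
Qed.

Lemma square_integrableD (f g : C -> C) : square_integrable f ->
  square_integrable g -> square_integrable (fun z => f z + g z).
Proof.
move=> [mf If] [mg Ig]; have mfg := cmeasurableD mf mg; split=> //.
apply: (le_integrable pdisk_measurable _ _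
  (integrableZl pdisk_measurable 2 (integrableD pdisk_measurable If Ig))).
  by apply/measurable_EFinP; exact: (measurable_sqr_cnorm mfg).
move=> p _ /=; rewrite lee_fin ger0_norm ?sqr_ge0// ger0_norm.
  exact: sqr_cnormD.
by rewrite mulr_ge0// addr_ge0// sqr_ge0.
Qed.

Lemma square_integrableZ (c : C) (f : C -> C) :
  square_integrable f -> square_integrable (fun z => c * f z).
Proof.
move=> [mf If]; split; first exact: cmeasurableM (cmeasurable_cst c) mf.
have := integrableZl pdisk_measurable (cnorm c ^+ 2) If.
congr (area.-integrable); apply/funext => p /=.
by rewrite -EFinM Normc.normcM exprMn.
Qed.

Lemma bergman_submod : submod_closed bergman_pred.
Proof.
split.
  apply/asboolP; split; first by [].
    by move=> z _; exact: derivable_cst.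
  split; first exact: (cmeasurable_cst 0).
  apply: (eq_integrable pdisk_measurable (cst 0%E)); last exact: integrable0.
  by move=> p _; rewrite /cst sqr_cnorm /= expr0n /= addr0.
move=> c f g /asboolP[zf af If] /asboolP[zg ag Ig]; apply/asboolP; split.
- move=> z Dz; have -> : (c *: f + g) z = c * f z + g z by [].
  by rewrite zf// zg// mulr0 addr0.
- by move=> z Dz; apply: derivableD; [apply: derivableZ; exact: af|exact: ag].
- exact: (square_integrableD (square_integrableZ c If) Ig).
Qed.

HB.instance Definition _ := GRing.isSubmodClosed.Build C (C -> C) bergman_pred
  bergman_submod.

Record bergman : Type := Bergman {
  bergman_fun :> C -> C;
  _ : bergman_fun \in bergman_pred }.

HB.instance Definition _ := [isSub for bergman_fun].
HB.instance Definition _ := [Choice of bergman by <:].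
HB.instance Definition _ := [SubChoice_isSubLmodule of bergman by <:].

(* the restriction of [g] to the disk when it belongs to the Bergman space, and
   0 otherwise; [to_bergmanE] below covers the basis vectors and the kernels,
   and Toeplitz operators with bounded symbols map into the Bergman space
   because the Bergman projection is bounded *)
Definition to_bergman (g : C -> C) : bergman := insubd 0 (fun z => if cnorm z < 1 then g z else 0).

Lemma disk_nbhs (z : C) : disk z -> \forall w \near (z : C^o), cnorm w < 1.
Proof.
rewrite /disk /= => z1; apply/nbhs_ballP; exists (1 - cnorm z)%:C%C => /=.
  by rewrite ltcR subr_gt0.
move=> w; rewrite /ball /= ltcR => zw.
have -> : w = z - (z - w) by rewrite opprB addrC subrK.
by apply: le_lt_trans (ler_normD (z : Rcomplex R) _) _; rewrite normrN -ltrBrDl.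
Qed.

Lemma to_bergmanE (g : C -> C) : analytic g -> cmeasurable g ->
  (exists M : R, forall z, disk z -> cnorm (g z) <= M) ->
  to_bergman g = (fun z => if cnorm z < 1 then g z else 0) :> (C -> C).
Proof.
move=> ag mg [M gM]; rewrite /to_bergman; set h := fun z : C => if _ then _ else _.
suff hP : h \in bergman_pred by rewrite insubdK.
have hE z : disk z -> h z = g z by rewrite /h => ->.
have mh : cmeasurable h.
  have [rg ig] := mg; split.
    apply: eq_measurable_fun rg => p; rewrite inE => Dp /=.
    by rewrite hE.
  apply: eq_measurable_fun ig => p; rewrite inE => Dp /=.
  by rewrite hE.
apply/asboolP; split.
- by move=> z; rewrite /disk /= /h; case: ifP.
- move=> z Dz; apply: near_eq_derivable (ag z Dz).
  by near=> w; rewrite /h ifT//; near: w; exact: disk_nbhs.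
- split=> //.
  apply: measurable_bounded_integrable; first exact: pdisk_measurable.
  + exact: area_pdisk_lty.
  + exact: measurable_sqr_cnorm.
  + exists (M ^+ 2); split; first exact: num_real.
    move=> x Mx p Dp; rewrite /= hE// ger0_norm ?sqr_ge0// (le_trans _ (ltW Mx))//.
    by rewrite ler_pXn2r// ?nnegrE ?cnorm_ge0 ?gM// (le_trans _ (gM _ Dp)) ?cnorm_ge0.
Unshelve. all: by end_near. Qed.


Definition inner (f g : bergman) : C := cintegral (fun w => f w * (g w)^*).

Definition bnorm (f : bergman) : R := Num.sqrt (complex.Re (inner f f)).

Definition bbasis (n : nat) : bergman :=
  to_bergman (fun z => (Num.sqrt n.+1%:R)%:C%C * z ^+ n).

Definition bkernel (k : nat) (z : C) (w : C) : C := ((1 - z^* * w) ^+ (2 + k))^-1.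

Lemma analyticM (f g : C -> C) :
  analytic f -> analytic g -> analytic (fun z => f z * g z).
Proof. by move=> af ag z Dz; apply: derivableM; [exact: af|exact: ag]. Qed.

Lemma analyticX (f : C -> C) n : analytic f -> analytic (fun z => f z ^+ n).
Proof.
move=> af; elim: n => [|n IHn].
  by move=> z _; exact: derivable_cst.
have := analyticM af IHn.
by congr analytic; apply/funext => z; rewrite exprS.
Qed.

Lemma analytic_id : analytic (fun z => z).
Proof. by move=> z _; exact: derivable_id. Qed.

Lemma cnormX (z : C) n : cnorm (z ^+ n) = cnorm z ^+ n.
Proof.
elim: n => [|n IHn]; first by rewrite !expr0 Normc.normc1.
by rewrite !exprS Normc.normcM IHn.
Qed.

Lemma bbasisE n : bbasis n =
  (fun z => if cnorm z < 1 then (Num.sqrt n.+1%:R)%:C%C * z ^+ n else 0) :> (C -> C).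
Proof.
apply: to_bergmanE.
- apply: (@analyticM (fun=> _) (fun z => z ^+ n)).
    by move=> z _; exact: derivable_cst.
  exact: (analyticX analytic_id).
- apply: (@cmeasurableM (fun=> _) (fun z => z ^+ n)); first exact: cmeasurable_cst.
  by apply: (@cmeasurableX (fun w => w)); exact: cmeasurable_id.
- exists (cnorm (Num.sqrt n.+1%:R)%:C%C) => z z1.
  rewrite Normc.normcM cnormX ler_piMr ?cnorm_ge0// exprn_ile1 ?cnorm_ge0//.
  exact: ltW.
Qed.

Lemma cnorm_sub1 (z w : C) : disk z -> disk w -> 1 - cnorm z <= cnorm (1 - z^* * w).
Proof.
move=> z1 w1.
have zw : cnorm (z^* * w) <= cnorm z.
  rewrite Normc.normcM (_ : cnorm z^* = cnorm z).
    by rewrite ler_piMr ?cnorm_ge0//; exact: ltW.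
  by case: {z1} z => a b; rewrite /= sqrrN.
have h : cnorm 1 <= cnorm (1 - z^* * w) + cnorm (z^* * w).
  rewrite -[X in cnorm X <= _](subrK (z^* * w)).
  exact: (ler_normD ((1 - z^* * w : C) : Rcomplex R) (z^* * w)).
rewrite Normc.normc1 in h.
by rewrite lerBlDr (le_trans h)// lerD2l.
Qed.

Lemma bkernelE k z j : disk z ->
  to_bergman (fun w => w ^+ j * bkernel k z w) =
  (fun w => if cnorm w < 1 then w ^+ j * bkernel k z w else 0) :> (C -> C).
Proof.
move=> z1; have z0 : 0 < 1 - cnorm z by rewrite subr_gt0.
have nz w : disk w -> 1 - z^* * w != 0.
  move=> w1; apply/eqP => zw0; have := cnorm_sub1 z1 w1.
  by rewrite zw0 Normc.normc0 leNgt z0.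
apply: to_bergmanE.
- apply: (@analyticM (fun w => w ^+ j) (bkernel k z)).
    exact: (analyticX analytic_id).
  have ak : analytic (fun w => (1 - z^* * w) ^+ (2 + k)).
    apply: analyticX => w Dw.
    apply: derivableB; first exact: derivable_cst.
    by apply: derivableM; [exact: derivable_cst|exact: derivable_id].
  by move=> w Dw; apply: derivableV; [rewrite expf_neq0 ?nz|exact: ak].
- apply: (@cmeasurableM (fun w => w ^+ j) (bkernel k z)).
    by apply: (@cmeasurableX (fun w => w)); exact: cmeasurable_id.
  apply: (@cmeasurableV (fun w => (1 - z^* * w) ^+ (2 + k))).
  apply: (@cmeasurableX (fun w => 1 - z^* * w)).
  have := cmeasurableD (cmeasurable_cst 1)
    (cmeasurableM (cmeasurable_cst (- z^*)) cmeasurable_id).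
  by congr cmeasurable; apply/funext => w; rewrite mulNr.
- exists (((1 - cnorm z) ^+ (2 + k))^-1) => w Dw.
  rewrite Normc.normcM cnormX Normc.normcV cnormX.
  apply: (@le_trans _ _ (1 * (cnorm (1 - z^* * w) ^+ (2 + k))^-1)).
    rewrite ler_wpM2r ?invr_ge0 ?exprn_ge0 ?cnorm_ge0//.
    by rewrite exprn_ile1 ?cnorm_ge0//; exact: ltW.
  have zw : 0 < cnorm (1 - z^* * w) by exact: lt_le_trans (cnorm_sub1 z1 Dw).
  rewrite mul1r lef_pV2 ?posrE ?exprn_gt0//.
  by rewrite lerXn2r ?nnegrE ?cnorm_ge0 ?(ltW z0)// cnorm_sub1.
Qed.

Definition opnorm (T : bergman -> bergman) : \bar R :=
  ereal_sup [set (bnorm (T f))%:E | f in [set f | bnorm f <= 1]].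

Definition bounded_operator : set (bergman -> bergman) :=
  [set T | linear T /\ (opnorm T < +oo)%E].

Definition toeplitz (a : C -> C) (f : bergman) : bergman :=
  to_bergman (fun z => cintegral (fun w => a w * f w / (1 - w^* * z) ^+ 2)).

(* the product of operators is composition; the last clause is closedness in the
   operator norm *)
Definition closed_subalgebra (A : set (bergman -> bergman)) : Prop :=
  [/\ A `<=` bounded_operator,
      forall (c : C) T U, A T -> A U -> A (c *: T + U),
      forall T U, A T -> A U -> A (T \o U) &
      forall T, bounded_operator T ->
        (forall e : R, 0 < e -> exists2 U, A U & (opnorm (T - U)%R < e%:E)%E) ->
        A T].

Definition toeplitz_algebra : set (bergman -> bergman) :=
  smallest closed_subalgebra [set toeplitz a | a in Linfty].

(* the symbol [a] only matters on the disk, so the values of [berezin k S]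
   outside of it are irrelevant *)
Definition berezin (k : nat) (S : bergman -> bergman) (z : C) : C :=
  k.+1%:R * ((1 - cnorm z ^+ 2) ^+ (2 + k))%:C%C *
  \sum_(j < k.+1) 'C(k, j)%:R * (-1) ^+ j *
    inner (S (to_bergman (fun w => w ^+ j * bkernel k z w)))
          (to_bergman (fun w => w ^+ j * bkernel k z w)).

Definition supnorm (x : nat -> C) : \bar R :=
  ereal_sup (range (fun n => (cnorm (x n))%:E)).

Definition linfty : set (nat -> C) := [set x | (supnorm x < +oo)%E].

(* each [d_i] is defined by the finiteness of its seminorm, the supremum being
   taken in the extended reals *)
Definition d1 : set (nat -> C) := [set x | linfty x /\
  (ereal_sup (range (fun n => (n.+1%:R * cnorm (x n.+1 - x n)%R)%R%:E)) < +oo)%E].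

Definition d2 : set (nat -> C) := [set x | linfty x /\
  (ereal_sup (range (fun n =>
     (n.+2%:R ^+ 2 * cnorm (x n.+2 - 2 * x n.+1 + x n)%R)%R%:E)) < +oo)%E].

Definition linfty_closure (A : set (nat -> C)) : set (nat -> C) :=
  [set x | linfty x /\
    forall e : R, 0 < e -> exists2 y, A y & (supnorm (x - y)%R < e%:E)%E].

End Area.

(* Main.v *)
Require Import Defs.
From mathcomp Require Import all_boot all_order all_algebra.
From mathcomp Require Import all_classical all_reals all_analysis measurable_realfun.
From mathcomp Require Import complex ring lra zify.

(** The four conditions are linked through a fifth one, slow oscillation of
    the eigenvalue sequence: lambda_(n+j) - lambda_n is small, uniformly in
    n, once j/n is small. The circle of implications is: Toeplitz algebra,
    slow oscillation, norm convergence of T_(B_k S), closure of d2, closure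
    of d1, slow oscillation again; and norm convergence puts S back in the
    Toeplitz algebra because B_k S is bounded.

    The Bergman space is handled as a weighted l2 space: f corresponds to
    its Taylor coefficients c_n, with squared norm the sum of |c_n|^2/(n+1).
    Expanding an analytic function in a power series rests on Goursat's
    theorem for polar rectangles ([goursat], [cauchy_series]); orthogonality
    of the monomials is Green's formula for (r^2 - |z|^2) z^n conj(z)^m
    ([mom_green]); together they give [taylor], and Fatou's lemma gives the
    converse [power_series_L2], [synthesis]. In this model a Toeplitz
    operator with bounded symbol a is f |-> P(a f), where P F has
    coefficients (n+1) times the integral of F conj(z)^n ([toeplitz_bdd]).

    Toeplitz algebra implies slow oscillation. Call T localized if, for f
    with no coefficient of index below N, the coefficients of T f of index
    much smaller than N are negligible, and T almost commutes with
    multiplication by z^j for j much smaller than N. Localized operators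
    form a closed algebra ([localized_lin], [localized_comp],
    [localized_lim]), and Toeplitz operators are localized
    ([localized_toeplitz]) because multiplication by z^s nearly annihilates
    low-order functions while conj(z)^j maps high-order functions almost
    into the Bergman space ([N2_bshift_low], [N2_hankel]). For a radial S
    the commutator with z^j, applied to e_n, is (lambda_(n+j) - lambda_n)
    z^j e_n.

    Slow oscillation implies norm convergence. T_(B_k S) is radial and its
    n-th eigenvalue is the sum over p of w_k(n,p) lambda_p, for an explicit
    kernel w_k ([berezin_eigen_cvg], [kerw]). With L u(n) =
    (n+1)[(n+2)(u_(n+1) - u_n) - n(u_n - u_(n-1))] one has w_(k+1) = w_k - L
    w_k/((k+1)(k+2)) ([kerw_step]). From this recursion and the maximum
    principle for L, w_k is symmetric, nonnegative and of total mass one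
    ([kerwC], [kerw_ge0], [cvg_kerw_sum]), and the average of
    ((p-n)/(p+n+2))^2 against w_k(n,.) is at most 6/(k+1), uniformly in n
    ([kerw_relgap]). A kernel concentrated on indices p comparable to n
    reproduces slowly oscillating sequences in the limit ([slow_eigen]).
    Boundedness of B_k S is a separate matter, since its defining sum
    cancels heavily: the identity |1 - conj(z) w|^2 - |z - w|^2 = (1 -
    |z|^2)(1 - |w|^2), applied k times to the quadratic form of S, turns it
    into a sum without cancellation ([form_identity], [berezin_bound]).

    Norm convergence implies closure of d2: the eigenvalues of a Toeplitz
    operator with bounded radial symbol are moments, whose second
    differences are O(1/n^2) ([eigen_d2]). Then d2 is contained in d1
    ([d2_sub_d1]), and a sequence in d1 oscillates slowly
    ([closure_d1_slow]). *)

Set Implicit Arguments.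
Unset Strict Implicit.
Unset Printing Implicit Defensive.

Import Order.TTheory GRing.Theory Num.Theory.
Import numFieldNormedType.Exports.

Local Open Scope classical_set_scope.
Local Open Scope ring_scope.

(** * The averaging kernel of order k *)
Section Kernel.
Context {R : realType}.
Implicit Types (u v : nat -> R) (k n m p : nat).

(** Divergence form: the difference of the fluxes (n+1)(n+2)(u_(n+1) - u_n)
    and n(n+1)(u_n - u_(n-1)). At n = 0 the factor 0 of the second flux
    neutralizes the truncated predecessor n.-1. *)
Definition lapl u n : R :=
  n.+1%:R * (n.+2%:R * (u n.+1 - u n) - n%:R * (u n - u n.-1)).

(** The step sizes of [kerw_step]; they sum to 1 and telescope ([ckE]). *)
Definition ck k : R := (k.+1%:R * k.+2%:R)^-1.

Definition frat n k : R := n`!%:R / (n + k)`!%:R.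

(** (n+1) times the integral over the disk of t^(n+m) (1-t)^(k+2), where t =
    |z|^2, against normalized area; see [beta_integral]. *)
Definition kerJ k n m : R := n.+1%:R * k.+2`!%:R * frat (n + m) k.+3.

(** The coefficient of lambda_p t^m (1-t)^(k+2) in the k-Berezin transform
    of the diagonal operator with eigenvalues lambda; see [berezin_trunc]. *)
Definition kerb k m p : R :=
  k.+1%:R / p.+1%:R * ((-1) ^+ (p - m) * 'C(k, p - m)%:R) *
  'C(m + k.+1, k.+1)%:R ^+ 2.

(** The weight of lambda_p in the n-th eigenvalue of the Toeplitz operator
    with symbol B_k(S); see [bpoly_moment]. *)
Definition kerw k n p : R := \sum_(m < p.+1) kerb k m p * kerJ k n m.

Lemma factR_neq0 n : n`!%:R != 0 :> R.
Proof. by rewrite pnatr_eq0 -lt0n fact_gt0. Qed.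

Lemma frat_gt0 n k : 0 < frat n k.
Proof. by rewrite divr_gt0// ltr0n fact_gt0. Qed.

Lemma fratSl n k : frat n.+1 k = n.+1%:R / (n + k).+1%:R * frat n k.
Proof.
rewrite /frat addSn !factS !natrM; field.
have := ler0n R n; have := ler0n R k; rewrite factR_neq0 lt0r_neq0//; lra.
Qed.

Lemma fratSr n k : frat n k.+1 = frat n k / (n + k).+1%:R.
Proof.
by rewrite /frat addnS factS natrM invfM mulrA mulrAC.
Qed.

(** Both sides are rational multiples of the same ratio of factorials. The
    right-hand side is a difference in m up to the weights m^2 and
    (m+k+2)^2, which prepares a summation by parts against [kerb]. *)
Lemma kerJ_step k n m :
  kerJ k n m - ck k * lapl (fun i => kerJ k i m) n =
  ck k * ((m + k.+2)%:R ^+ 2 * kerJ k.+1 n m - m%:R ^+ 2 * kerJ k.+1 n m.-1).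
Proof.
have hk := ler0n R k; have hn := ler0n R n; have hm := ler0n R m.
have rk := ler0n R k; rewrite /ck /lapl /kerJ [k.+3`!]factS natrM.
have fk : k.+2`!%:R != 0 :> R := factR_neq0 _.
case: n m hn hm => [|n] [|m] hn hm; rewrite /= ?addn0 ?add0n.
- rewrite fratSl !fratSr !add0n; field.
  by rewrite !lt0r_neq0//; lra.
- rewrite !fratSl !fratSr; field.
  by rewrite !lt0r_neq0//; lra.
- rewrite !fratSl !fratSr; field.
  by rewrite !lt0r_neq0//; lra.
- rewrite !addSn !addnS !fratSl !fratSr; field.
  by rewrite !lt0r_neq0//; lra.
Qed.

Lemma binR_left k m :
  m.+1%:R * 'C(m.+1 + k.+1, k.+1)%:R = (m + k.+2)%:R * 'C(m + k.+1, k.+1)%:R :> R.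
Proof.
have := mul_bin_down (m.+1 + k.+1) k.+1.
by rewrite addnK -!natrM => <-; congr (_ %:R); congr (_ * _)%N; rewrite ?addSn ?addnS.
Qed.

Lemma binR_diag k m :
  (m + k.+2)%:R * 'C(m + k.+1, k.+1)%:R = k.+2%:R * 'C(m + k.+2, k.+2)%:R :> R.
Proof. by rewrite -!natrM addnS mul_bin_diag. Qed.

Lemma laplD u v n : lapl (fun i => u i + v i) n = lapl u n + lapl v n.
Proof. by rewrite /lapl; ring. Qed.

Lemma laplZ a u n : lapl (fun i => a * u i) n = a * lapl u n.
Proof. by rewrite /lapl; ring. Qed.

Lemma lapl_sum (I : Type) (r : seq I) (P : pred I) (F : nat -> I -> R) n :
  lapl (fun i => \sum_(j <- r | P j) F i j) n = \sum_(j <- r | P j) lapl (F ^~ j) n.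
Proof.
rewrite /lapl !(big_morph (fun x => - x) (@opprD R) (@oppr0 R)).
by rewrite -!big_split/= !mulr_sumr -sumrN -big_split/= mulr_sumr.
Qed.

(** Pascal's rule for the binomial of k and p - m, once the weights
    (m+k+2)^2 and (m+1)^2 have been absorbed into the squared binomials. *)
Lemma kerb_step k m p : (m < p)%N ->
  ck k * ((m + k.+2)%:R ^+ 2 * kerb k m p - m.+1%:R ^+ 2 * kerb k m.+1 p) =
  kerb k.+1 m p.
Proof.
move=> mp; rewrite /kerb -(subnSK mp); set q := (p - m.+1)%N.
have hk := ler0n R k; have hp := ler0n R p.
have -> : (m + k.+2)%:R ^+ 2 * (k.+1%:R / p.+1%:R * ((-1) ^+ q.+1 * 'C(k, q.+1)%:R) *
  'C(m + k.+1, k.+1)%:R ^+ 2) = k.+1%:R / p.+1%:R * ((-1) ^+ q.+1 * 'C(k, q.+1)%:R) *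
  ((m + k.+2)%:R * 'C(m + k.+1, k.+1)%:R) ^+ 2 :> R by ring.
have -> : m.+1%:R ^+ 2 * (k.+1%:R / p.+1%:R * ((-1) ^+ q * 'C(k, q)%:R) *
  'C(m.+1 + k.+1, k.+1)%:R ^+ 2) = k.+1%:R / p.+1%:R * ((-1) ^+ q * 'C(k, q)%:R) *
  (m.+1%:R * 'C(m.+1 + k.+1, k.+1)%:R) ^+ 2 :> R by ring.
rewrite binR_left binR_diag binS natrD exprS /ck; field.
by rewrite !lt0r_neq0//; lra.
Qed.

Lemma kerb_step_diag p k :
  ck k * ((p + k.+2)%:R ^+ 2 * kerb k p p) = kerb k.+1 p p.
Proof.
have hk := ler0n R k; have hp := ler0n R p.
rewrite /kerb subnn !bin0 [X in _ * X]mulrCA -(exprMn _ (p + k.+2)%:R) binR_diag /ck; field.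
by rewrite !lt0r_neq0//; lra.
Qed.

(** Summation by parts of [kerJ_step] against [kerb_step]. The kernels of
    all orders thus come from [kerw0E] by the operators 1 - ck k * lapl. *)
Lemma kerw_step k n p :
  kerw k.+1 n p = kerw k n p - ck k * lapl (fun i => kerw k i p) n.
Proof.
rewrite /kerw lapl_sum.
under [X in _ = _ - _ * X]eq_bigr do rewrite laplZ.
rewrite mulr_sumr -sumrB.
under [RHS]eq_bigr => i _ do
  rewrite (mulrCA (ck k)) -mulrBr kerJ_step (mulrCA _ (ck k)) mulrBr mulrBr.
rewrite sumrB [X in _ - X]big_ord_recl/= expr0n/= !(mul0r, mulr0) add0r.
rewrite !big_ord_recr/= addrAC -sumrB; congr (_ + _).
  by apply: eq_bigr => i _; rewrite -kerb_step// /bump/= !add1n/=; ring.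
by rewrite -kerb_step_diag; ring.
Qed.

Lemma kerw0E n p :
  kerw 0 n p = 2 * n.+1%:R * p.+1%:R /
    ((n + p).+1%:R * (n + p).+2%:R * (n + p).+3%:R).
Proof.
rewrite /kerw big_ord_recr big1 => [/=|i _ /=].
  rewrite add0r /kerb subnn /kerJ !fratSr /frat addn0 divff ?factR_neq0//.
  have hn := ler0n R n; have hp := ler0n R p.
  rewrite bin1 addn1 !bin0 !addnS !addn0 !factS fact0; field.
  by rewrite !lt0r_neq0//; lra.
by rewrite /kerb bin0n subn_eq0 leqNgt ltn_ord/= mulr0 mulr0 !mul0r.
Qed.

Lemma kerw0C n p : kerw 0 n p = kerw 0 p n.
Proof. by rewrite !kerw0E addnC; ring. Qed.

Lemma lapl_kerw0 n p : lapl (fun i => kerw 0 i p) n = lapl (kerw 0 n) p.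
Proof.
have hn := ler0n R n; have hp := ler0n R p; rewrite /lapl !kerw0E.
case: n p hn hp => [|n] [|p] hn hp; rewrite /= ?addn0 ?add0n ?addSn ?addnS; field;
  by rewrite ?lt0r_neq0//; lra.
Qed.

Lemma laplC (F : nat -> nat -> R) n p :
  lapl (fun i => lapl (F i) p) n = lapl (fun j => lapl (F ^~ j) n) p.
Proof. by rewrite /lapl; ring. Qed.

Lemma lapl_ext u v : u =1 v -> lapl u =1 lapl v.
Proof. by move=> uv n; rewrite /lapl !uv. Qed.

(** For k = 0 this is an explicit rational identity; the recursion preserves
    it because the two Laplacians act on different variables ([laplC]). *)
Lemma lapl_kerw k n p : lapl (fun i => kerw k i p) n = lapl (kerw k n) p.
Proof.
elim: k n p => [|k IH] n p; first exact: lapl_kerw0.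
rewrite (@lapl_ext _ (fun i => kerw k i p + - ck k * lapl (kerw k i) p)); last first.
  by move=> i; rewrite kerw_step IH mulNr.
rewrite (@lapl_ext (kerw k.+1 n) (fun j => kerw k n j + - ck k * lapl (kerw k ^~ j) n)).
  rewrite laplD [RHS]laplD (laplZ (- ck k) (fun i => lapl (kerw k i) p)).
  by rewrite (laplZ (- ck k) (fun j => lapl (kerw k ^~ j) n)) laplC IH.
by move=> j; rewrite kerw_step mulNr.
Qed.

Lemma kerwC k n p : kerw k n p = kerw k p n.
Proof.
elim: k n p => [|k IH] n p; first exact: kerw0C.
rewrite !kerw_step IH lapl_kerw; congr (_ - _ * _).
by apply: lapl_ext => j; exact: IH.
Qed.

(** Subtracting e (n+1) from u makes the maximum attained. There the
    Laplacian of the difference is at most 0, and that of e (n+1) is 2 e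
    (n+1), which c <= 1/2 absorbs. *)
Lemma max_principle c B M u : 0 <= c -> c * 2 <= 1 ->
  (forall n, u n - c * lapl u n <= B) -> (forall n, u n <= M) ->
  forall n, u n <= B.
Proof.
move=> c0 c1 uB uM n0; apply/ler_addgt0Pr => e' e'0.
pose e := e' / n0.+1%:R; have e0 : 0 < e by rewrite divr_gt0.
pose v n := u n - e * n.+1%:R.
have [N hN] : exists N, M - v 0%N <= e * N.+1%:R.
  exists (Num.bound ((M - v 0%N) / e)); rewrite -ler_pdivrMl// mulrC.
  have [h|h] := leP 0 ((M - v 0%N) / e).
    by rewrite (le_trans (ltW (archi_boundP h)))// ler_nat.
  by rewrite (le_trans (ltW h)).
pose i0 := [arg max_(i > (ord0 : 'I_N.+1)) v i]%O.
have vi n : v n <= v i0.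
  rewrite /i0; case: arg_maxP => //= i _ imax.
  have [nN|Nn] := ltnP n N.+1; first exact: (imax (Ordinal nN)).
  apply: le_trans (imax ord0 isT) => /=.
  rewrite /v lerBlDr -lerBlDl (le_trans (lerB (uM n) (lexx _)))//.
  by rewrite (le_trans hN)// ler_wpM2l ?(ltW e0)// ler_nat ltnW// ltnS.
have hl : lapl u i0 <= 2 * e * i0.+1%:R.
  have -> : lapl u i0 = lapl v i0 + 2 * e * i0.+1%:R.
    by rewrite /lapl /v; case: (i0 : nat) => [|i] /=; ring.
  rewrite gerDr /lapl mulr_ge0_le0// subr_le0.
  by apply: (@le_trans _ _ 0); [rewrite mulr_ge0_le0// subr_le0 | rewrite mulr_ge0// subr_ge0].
have h1 : v i0 <= B.
  have := uB i0; rewrite /v; have : c * lapl u i0 <= e * i0.+1%:R.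
    apply: le_trans (ler_wpM2l c0 hl) _; rewrite mulrA mulrA ler_wpM2r// -[leRHS]mul1r ler_wpM2r ?(ltW e0)//.
  lra.
have := le_trans (vi n0) h1; rewrite /v /e divfK ?pnatr_eq0//; lra.
Qed.

Lemma lapl_succ n : lapl (fun i => i.+1%:R) n = 2 * n.+1%:R.
Proof. by rewrite /lapl; case: n => [|n] /=; ring. Qed.

Lemma laplN u n : lapl (fun i => - u i) n = - lapl u n.
Proof. by rewrite /lapl; ring. Qed.

Lemma ckE k : ck k = k.+1%:R^-1 - k.+2%:R^-1.
Proof.
have hk := ler0n R k; rewrite /ck; field.
by rewrite !lt0r_neq0//; lra.
Qed.

Lemma ck_ge0 k : 0 <= ck k.
Proof. by rewrite invr_ge0 mulr_ge0. Qed.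

Lemma ck_le k : ck k * 2 <= 1.
Proof.
rewrite mulrC ler_pdivrMr ?mulr_gt0// mul1r -natrM ler_nat; lia.
Qed.

(** Backward iteration of [max_principle] from a large order, where [e] is
    small, down to order k: the step from j + 1 to j costs ck j * A, and
    these costs sum to at most A / (k+1). Smallness at large order is only
    pointwise in n, so the barrier d a_j (n+1) takes care of large n; a_j =
    (j+2)/j is chosen so that a_(j+1) = a_j (1 - 2 ck j), which makes the
    barrier pass through the step unchanged. *)
Lemma max_chain (e : nat -> nat -> R) (M A : R) : 0 <= A ->
  (forall k n, e k n <= M) ->
  (forall k n, e k n - ck k * lapl (e k) n <= e k.+1 n + ck k * A) ->
  (forall n (eps : R), 0 < eps -> exists K0, forall K, (K0 <= K)%N -> e K n <= eps) ->
  forall k n, (0 < k)%N -> e k n <= A / k.+1%:R.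
Proof.
move=> A0 eM eS e0 k n k0; apply/ler_addgt0Pr => d' d'0.
pose a j : R := j.+2%:R / j%:R.
pose d := d' / (1 + a k * n.+1%:R).
have ak0 j : 0 <= a j by rewrite divr_ge0.
have d0 : 0 < d by rewrite divr_gt0// ltr_pwDl// mulr_ge0.
have step j B : (0 < j)%N -> (forall n, e j.+1 n - d * a j.+1 * n.+1%:R <= B) ->
    forall n, e j n - d * a j * n.+1%:R <= B + ck j * A.
  move=> j0 hB; apply: (max_principle (c := ck j) (M := M)).
  - exact: ck_ge0.
  - exact: ck_le.
  - move=> i.
    have -> : lapl (fun n => e j n - d * a j * n.+1%:R) i =
       lapl (e j) i - d * a j * (2 * i.+1%:R).
      by rewrite laplD -(lapl_succ i) -laplZ -laplN.
    have := hB i; have := eS j i.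
    have -> : a j.+1 = a j * (1 - ck j * 2).
      have hj : 0 < j%:R :> R by rewrite ltr0n.
      rewrite /a /ck; field.
      by rewrite !lt0r_neq0//; lra.
    lra.
  - move=> i; apply: le_trans (eM j i); rewrite gerBl mulr_ge0// mulr_ge0//.
    exact: ltW.
have chain m B : (forall n, e (k + m)%N n - d * a (k + m)%N * n.+1%:R <= B) ->
   forall n, e k n - d * a k * n.+1%:R <= B + (k.+1%:R^-1 - (k + m).+1%:R^-1) * A.
  elim: m B => [|m IH] B hB i; first by rewrite addn0 subrr mul0r addr0 -{1 2}(addn0 k).
  rewrite addnS in hB; have := step _ _ (leq_trans k0 (leq_addr m k)) hB.
  move/IH => /(_ i); rewrite ckE addnS.
  move: (k.+1%:R^-1 : R) ((k + m).+1%:R^-1 : R) ((k + m).+2%:R^-1 : R) => x y z.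
  lra.
have [N hN] : exists N, M <= d * N.+1%:R.
  exists (Num.bound (M / d)); rewrite -ler_pdivrMl// mulrC.
  have [h|h] := leP 0 (M / d).
    by rewrite (le_trans (ltW (archi_boundP h)))// ler_nat.
  by rewrite (le_trans (ltW h)).
have [K1 hK1] : exists K1, forall K, (K1 <= K)%N -> forall i, (i < N)%N -> e K i <= d.
  elim: N {hN} => [|N [K1 IH]]; first by exists 0%N.
  have [K2 hK2] := e0 N d d0; exists (maxn K1 K2) => K; rewrite geq_max => /andP[h1 h2] i.
  by rewrite ltnS leq_eqVlt => /orP[/eqP->|]; [exact: hK2|exact: IH].
have aK1 K : (0 < K)%N -> 1 <= a K.
  by move=> K0; rewrite ler_pdivlMr ?ltr0n// mul1r ler_nat; lia.
have hd i : e (k + K1)%N i - d * a (k + K1)%N * i.+1%:R <= d.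
  have a1 : 1 <= a (k + K1)%N by apply: aK1; rewrite addn_gt0 k0.
  have [iN|Ni] := ltnP i N.
    apply: le_trans (hK1 _ (leq_addl k K1) i iN).
    by rewrite gerBl mulr_ge0// mulr_ge0// ltW.
  apply: (@le_trans _ _ 0); last exact: ltW.
  rewrite subr_le0 (le_trans (eM _ _))// (le_trans hN)// -mulrA ler_wpM2l ?(ltW d0)//.
  by rewrite -[leLHS]mul1r ler_pM// ler_nat.
have := chain _ _ hd n.
have : (k.+1%:R^-1 - (k + K1).+1%:R^-1) * A <= A / k.+1%:R.
  by rewrite mulrC ler_wpM2l// gerBl invr_ge0.
have : d + d * a k * n.+1%:R = d'.
  rewrite -mulrA -{1}(mulr1 d) -mulrDr /d divfK// lt0r_neq0// ltr_pwDl// mulr_ge0//.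
move=> h1 h2; rewrite lerBlDr => /le_trans; apply.
by rewrite -h1 addrAC [leRHS]addrC lerD2l.
Qed.

Lemma leq_expn2r a b q : (a <= b)%N -> (a ^ q <= b ^ q)%N.
Proof. by case: q => // q ab; rewrite leq_exp2r. Qed.

Lemma bin_le_expn n q : ('C(n, q) <= n ^ q)%N.
Proof.
elim: n q => [|n IH] [|q]; rewrite ?bin0 ?expn0 ?bin0n//.
rewrite binS (leq_trans (leq_add (IH q.+1) (IH q)))// expnS [leqRHS]expnS.
rewrite -[X in (_ + X <= _)%N]mul1n -mulnDl addn1 leq_mul//.
exact: leq_expn2r.
Qed.

Lemma fact_mul_expn j q : (j`! * j.+1 ^ q <= (j + q)`!)%N.
Proof.
elim: q => [|q IH]; first by rewrite expn0 muln1 addn0.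
by rewrite expnS mulnCA addnS factS leq_mul// ltnS leq_addr.
Qed.

Lemma kerJ_ge0 k n m : 0 <= kerJ k n m.
Proof. by rewrite /kerJ !mulr_ge0// ltW// frat_gt0. Qed.

(** Replacing the factor n+1 by n+m+1 turns the right-hand side into an
    exact difference. *)
Lemma kerJ_telescope k n m :
  kerJ k n m <= k.+2`!%:R / k.+1%:R *
    (frat (n + m).+1 k.+1 - frat (n.+1 + m).+1 k.+1).
Proof.
have hk := ler0n R k; have hn := ler0n R n; have hm := ler0n R m.
have -> : k.+2`!%:R / k.+1%:R * (frat (n + m).+1 k.+1 - frat (n.+1 + m).+1 k.+1) =
   (n + m).+1%:R * k.+2`!%:R * frat (n + m) k.+3 :> R.
  rewrite addSn !fratSl !fratSr; field.
  by rewrite !lt0r_neq0//; lra.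
rewrite /kerJ ler_wpM2r ?(ltW (frat_gt0 _ _))//.
by rewrite ler_wpM2r// ler_nat ltnS leq_addr.
Qed.

Lemma kerJ_tail k m a N :
  \sum_(a <= n < N) kerJ k n m <= k.+2`!%:R / k.+1%:R * frat (a + m).+1 k.+1.
Proof.
apply: (@le_trans _ _ (\sum_(a <= n < N) k.+2`!%:R / k.+1%:R *
    (frat (n + m).+1 k.+1 - frat (n.+1 + m).+1 k.+1))).
  by apply: ler_sum => n _; exact: kerJ_telescope.
rewrite -mulr_sumr ler_wpM2l//.
have [aN|Na] := leqP a N; last first.
  by rewrite big_geq ?(ltW (frat_gt0 _ _))// ltnW.
rewrite (eq_bigr (fun n => - ((frat (n.+1 + m).+1 k.+1) - frat (n + m).+1 k.+1))) => [|i _].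
  rewrite sumrN (telescope_sumr (fun n => frat (n + m).+1 k.+1) aN) opprB gerBl.
  exact: ltW (frat_gt0 _ _).
by rewrite opprB.
Qed.

Lemma kerb_bound k m p : (m <= p)%N ->
  `|kerb k m p| <= k.+1%:R * ((k + p).+1 ^ (p + m))%:R.
Proof.
move=> mp; rewrite /kerb !normrM normrX normrN1 expr1n mul1r !ger0_norm// ?exprn_ge0//.
rewrite -mulrA ler_pM//.
  by rewrite ler_pdivrMr// ler_peMr// ler1n.
rewrite -!natrM ler_nat mulnn.
have -> : (p + m = (p - m) + (m * 2))%N by lia.
rewrite expnD expnM leq_mul//.
  by rewrite (leq_trans (bin_le_expn _ _))// leq_expn2r//; lia.
rewrite leq_exp2r// -bin_sub ?leq_addl// addnK (leq_trans (bin_le_expn _ _))//.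
by rewrite leq_expn2r//; lia.
Qed.

(** A bound in terms of p alone, so that letting the order grow for fixed p
    gives 0 in the limit. *)
Definition tailC p : nat := (p.+1 * ((p + p).+2`! * p.+1 ^ (p + p)))%N.

(** For fixed p, the coefficients [kerb] grow with k, but the tail of [kerJ]
    decays one power of k faster. *)
Lemma kerw_tail k p N :
  \sum_(p.+1 <= n < N) `|kerw k n p| <= (tailC p)%:R / k.+3%:R.
Proof.
apply: (@le_trans _ _ (\sum_(p.+1 <= n < N) \sum_(m < p.+1) `|kerb k m p| * kerJ k n m)).
  apply: ler_sum => n _; apply: le_trans (ler_norm_sum _ _ _) _.
  by apply: ler_sum => m _; rewrite normrM (ger0_norm (kerJ_ge0 _ _ _)).
rewrite exchange_big/=.
apply: (@le_trans _ _ (\sum_(m < p.+1) ((p + p).+2`! * p.+1 ^ (p + p))%:R / k.+3%:R)).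
  apply: ler_sum => -[m /= mp] _; rewrite ltnS in mp; rewrite -mulr_sumr.
  apply: le_trans (ler_wpM2l (normr_ge0 _) (kerJ_tail _ _ _ _)) _.
  apply: le_trans (ler_wpM2r _ (kerb_bound _ mp)) _.
    by rewrite mulr_ge0// ltW// frat_gt0.
  have aux (a b c f : R) : a != 0 -> a * b * (c / a * f) = b * c * f.
    by move=> a0; field.
  rewrite aux// /frat mulrA ler_pdivrMr ?ltr0n ?fact_gt0// [leRHS]mulrAC ler_pdivlMr//.
  rewrite -!natrM ler_nat.
  have h1 : ((k + p).+1 ^ (p + m) <= p.+1 ^ (p + p) * k.+3 ^ (p + m))%N.
    apply: (@leq_trans ((p.+1 * k.+3) ^ (p + m))).
      by apply: leq_expn2r; nia.
    by rewrite expnMn leq_mul// leq_pexp2l//; lia.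
  have h2 := fact_mul_expn k.+2 (p + m).+1.
  have h3 : ((p.+1 + m).+1`! <= (p + p).+2`!)%N by apply: leq_fact; lia.
  have -> : ((p.+1 + m).+1 + k.+1 = k.+2 + (p + m).+1)%N by lia.
  apply: (@leq_trans ((p + p).+2`! * p.+1 ^ (p + p) * (k.+2`! * k.+3 ^ (p + m).+1))).
    rewrite expnS.
    have -> : ((p + p).+2`! * p.+1 ^ (p + p) * (k.+2`! * (k.+3 * k.+3 ^ (p + m))) =
      (p.+1 ^ (p + p) * k.+3 ^ (p + m)) * k.+2`! * (p + p).+2`! * k.+3)%N by ring.
    by rewrite leq_mul// leq_mul// leq_mul.
  by rewrite leq_mul.
by rewrite sumr_const card_ord -[leLHS]mulr_natl mulrA -natrM.
Qed.

Lemma leq_tailC n p : (n <= p)%N -> (tailC n <= tailC p)%N.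
Proof.
move=> np; rewrite leq_mul// leq_mul//; first by apply: leq_fact; lia.
by rewrite (leq_trans (leq_expn2r _ (_ : n.+1 <= p.+1)%N))// leq_pexp2l//; lia.
Qed.

Lemma kerw_offdiag k n p : n != p -> `|kerw k n p| <= (tailC p)%:R / k.+3%:R.
Proof.
have le i j : (i < j)%N -> `|kerw k j i| <= (tailC i)%:R / k.+3%:R.
  move=> ij; apply: le_trans (kerw_tail k i j.+1).
  by rewrite big_nat_recr//= lerDr sumr_ge0.
rewrite neq_ltn => /orP[np|pn]; last exact: le.
rewrite kerwC (le_trans (le _ _ np))// ler_wpM2r ?invr_ge0// ler_nat leq_tailC//.
exact: ltnW.
Qed.

(** Closed form of the partial sums, found from the telescoping of [kerw0E]. *)
Lemma kerw0_sum n P : \sum_(p < P) kerw 0 n p =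
  1 - n.+1%:R * (n + (P + P)).+2%:R / ((n + P).+1%:R * (n + P).+2%:R).
Proof.
have hn := ler0n R n.
elim: P => [|P IH].
  rewrite big_ord0 !addn0; field.
  by rewrite !lt0r_neq0//; lra.
have hP := ler0n R P.
rewrite big_ord_recr/= IH kerw0E !addSn !addnS; field.
by rewrite !lt0r_neq0//; lra.
Qed.

(** Mass one holds for k = 0 by [kerw0_sum], and the recursion keeps it
    since the Laplacian kills constants. *)
Lemma cvg_kerw_sum k n : \sum_(p < P) kerw k n p @[P --> \oo] --> (1 : R).
Proof.
elim: k n => [|k IH] n.
  apply: (@squeeze_cvgr _ _ _ _ (fun P => 1 - (n.+1 * 2)%:R * harmonic P) (fun=> 1)).
  - near=> P; rewrite kerw0_sum lerD2l lerN2 gerDl oppr_le0.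
    rewrite divr_ge0 ?mulr_ge0// andbT /harmonic/=.
    rewrite ler_pdivrMr ?mulr_gt0// mulrAC ler_pdivlMr// -!natrM ler_nat; nia.
  - rewrite -[X in _ --> X]subr0; apply: cvgB; first exact: cvg_cst.
    rewrite -[X in _ --> X](mulr0 (n.+1 * 2)%:R); apply: cvgM; first exact: cvg_cst.
    exact: cvg_harmonic.
  - exact: cvg_cst.
have -> : (fun P => \sum_(p < P) kerw k.+1 n p) = (fun P => \sum_(p < P) kerw k n p -
    ck k * lapl (fun i => \sum_(p < P) kerw k i p) n).
  apply/funext => P; rewrite lapl_sum mulr_sumr -sumrB.
  by apply: eq_bigr => p _; rewrite kerw_step.
have E : 1 = 1 - ck k * lapl (fun=> 1) n by rewrite /lapl; ring.
rewrite [X in _ --> X]E; apply: cvgB; first exact: IH.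
apply: cvgM; first exact: cvg_cst.
apply: cvgM; first exact: cvg_cst.
by apply: cvgB; (apply: cvgM; first exact: cvg_cst); apply: cvgB; exact: IH.
Unshelve. all: by end_near. Qed.

(** Mass one together with the decay of the off-diagonal entries. *)
Lemma kerw_diag k p : `|1 - kerw k p p| <= (p.+1 * tailC p)%:R / k.+3%:R.
Proof.
have cs : `|\sum_(n < P) kerw k p n - kerw k p p| @[P --> \oo] --> `|1 - kerw k p p|.
  by apply: cvg_norm; apply: cvgB; [exact: cvg_kerw_sum|exact: cvg_cst].
rewrite -(cvg_lim (@Rhausdorff R) cs); apply: limr_le; first exact: cvgP cs.
near=> P.
have pP : (p < P)%N by near: P; exact: nbhs_infty_gt.
rewrite -(big_mkord xpredT (fun n => kerw k p n)) (@big_cat_nat _ _ _ p.+1)//=.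
rewrite big_nat_recr//= addrAC addrK.
have -> : (p.+1 * tailC p)%:R / k.+3%:R =
   p%:R * ((tailC p)%:R / k.+3%:R) + (tailC p)%:R / k.+3%:R :> R.
  by rewrite natrM -natr1; ring.
apply: le_trans (ler_normD _ _) _; apply: lerD.
  apply: le_trans (ler_norm_sum _ _ _) _.
  apply: (@le_trans _ _ (\sum_(0 <= i < p) (tailC p)%:R / k.+3%:R)).
    apply: ler_sum_nat => i /andP[_ ip].
    by rewrite kerwC kerw_offdiag// neq_ltn ip.
  by rewrite sumr_const_nat subn0 -[leLHS]mulr_natl.
apply: le_trans (ler_norm_sum _ _ _) _.
rewrite (eq_bigr (fun n => `|kerw k n p|)) => [|i _]; last by rewrite kerwC.
exact: kerw_tail.
Unshelve. all: by end_near. Qed.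

Lemma archi_div (a e : R) : 0 < e -> exists K0, forall K, (K0 <= K)%N -> a / K.+1%:R <= e.
Proof.
move=> e0; exists (Num.bound (`|a| / e)) => K hK.
rewrite ler_pdivrMr// -ler_pdivrMl// (le_trans _ (_ : `|a| / e <= _))//.
  by rewrite mulrC ler_wpM2r ?invr_ge0 ?(ltW e0)// ler_norm.
have h : 0 <= `|a| / e by rewrite divr_ge0// ltW.
by rewrite (le_trans (ltW (archi_boundP h)))// ler_nat ltnW.
Qed.

(** For large order the kernel is within e of the identity, hence at least
    -e; the maximum principle carries this bound back down to order k. *)
Lemma kerw_ge0 k n p : 0 <= kerw k n p.
Proof.
rewrite -oppr_le0; apply/ler_addgt0Pr => e e0; rewrite add0r.
have [K0 hK0] := archi_div (p.+1 * tailC p)%:R e0.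
have hK K i : (K0 <= K)%N -> - kerw K i p <= e.
  move=> K0K; have h : (p.+1 * tailC p)%:R / K.+3%:R <= e by apply: hK0; lia.
  apply: le_trans h; have [->|ip] := eqVneq i p.
    apply: le_trans (kerw_diag K p); apply: le_trans (ler_norm _).
    by rewrite lerDr.
  apply: le_trans (ler_norm _) _; rewrite normrN (le_trans (kerw_offdiag _ ip))//.
  by rewrite ler_wpM2r ?invr_ge0// ler_nat leq_pmull.
have down j : (forall i, - kerw j.+1 i p <= e) -> forall i, - kerw j i p <= e.
  move=> hj; apply: (@max_principle (ck j) e
    ((tailC p)%:R / j.+3%:R + `|kerw j p p|)); [exact: ck_ge0|exact: ck_le| |].
    by move=> i; rewrite laplN mulrN opprK (le_trans _ (hj i))// kerw_step opprB addrC.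
  move=> i; apply: le_trans (ler_norm _) _; rewrite normrN.
  have [->|ip] := eqVneq i p; first by rewrite lerDr divr_ge0.
  by rewrite (le_trans (kerw_offdiag _ ip))// lerDl.
have : forall i, - kerw (k + K0) i p <= e by move=> i; apply: hK; rewrite leq_addl.
elim: K0 {hK0 hK} => [|j IH]; first by rewrite addn0; apply.
by rewrite addnS => /down.
Qed.

Lemma kerw_sum_le1 k n P : \sum_(p < P) kerw k n p <= 1.
Proof.
have cs := @cvg_kerw_sum k n; have nd : nondecreasing_seq (fun P => \sum_(p < P) kerw k n p).
  apply/nondecreasing_seqP => Q; rewrite big_ord_recr/= lerDl; exact: kerw_ge0.
have := nondecreasing_cvgn_le nd (cvgP _ cs) P.
by rewrite (cvg_lim (@Rhausdorff R) cs).
Qed.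

(** The squared relative distance of two indices. Up to lower-order shifts
    it is homogeneous of degree 0, and the Laplacian preserves degrees, so
    its Laplacian is bounded ([lapl_relgap]). *)
Definition relgap n p : R := ((p%:R - n%:R) / (p + n).+2%:R) ^+ 2.

Lemma relgap_ge0 n p : 0 <= relgap n p.
Proof. exact: sqr_ge0. Qed.

Lemma relgap_le1 n p : relgap n p <= 1.
Proof.
have hn := ler0n R n; have hp := ler0n R p.
rewrite /relgap -real_normK ?num_real// expr_le1// normrM normfV [X in _ / X]ger0_norm//.
rewrite ler_pdivrMr// mul1r ler_norml; apply/andP; split; lra.
Qed.

Lemma lapl_relgapE n m (x := m.+1%:R : R) (N := n.+1%:R) (y := x + N) :
  lapl (relgap n) m = 8 * (x * N ^+ 2) / (y * (y ^+ 2 - 1)) +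
  4 * N ^+ 2 * (x * (x * (6 * y ^+ 2 - 2) - 4 * y ^+ 3)) / (y * (y ^+ 2 - 1)) ^+ 2.
Proof.
have hn := ler0n R n; have hm := ler0n R m.
rewrite /lapl /relgap /y /x /N.
case: m hm {x y} => [|m] hm /=; rewrite ?addSn ?addnS; field.
  by rewrite !lt0r_neq0//; nra.
by rewrite !lt0r_neq0//; nra.
Qed.

Lemma lapl_relgap_aux1 (x N : R) : 1 <= x -> 1 <= N ->
  8 * (x * N ^+ 2) <= 3 * ((x + N) * ((x + N) ^+ 2 - 1)).
Proof.
move=> x1 N1.
have q1 : x <= x ^+ 3 by rewrite -[leLHS]expr1 ler_weXn2l.
have q2 : N <= N ^+ 3 by rewrite -[leLHS]expr1 ler_weXn2l.
have q3 : 0 <= x ^+ 2 * N by rewrite mulr_ge0 ?sqr_ge0//; lra.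
have q4 : 0 <= x * N ^+ 2 by rewrite mulr_ge0 ?sqr_ge0//; lra.
rewrite [X in _ <= X](_ : _ = 3 * x ^+ 3 + 9 * (x ^+ 2 * N) + 9 * (x * N ^+ 2)
   + 3 * N ^+ 3 - 3 * x - 3 * N); last by ring.
move: q1 q2 q3 q4; move: (x ^+ 3) (N ^+ 3) (x ^+ 2 * N) (x * N ^+ 2) => a b c d.
lra.
Qed.

Lemma lapl_relgap_aux2 (x N : R) : 1 <= x -> 1 <= N ->
  24 * (x * N) ^+ 2 <= 3 * ((x + N) ^+ 2 - 1) ^+ 2.
Proof.
move=> x1 N1.
have h : 3 * (x * N) <= (x + N) ^+ 2 - 1.
  rewrite -subr_ge0 (_ : _ - _ = (x - N) ^+ 2 + (x * N - 1)); last by ring.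
  by rewrite addr_ge0 ?sqr_ge0// subr_ge0 -[leLHS]mulr1 ler_pM.
have xN0 : 0 <= x * N by rewrite mulr_ge0//; lra.
have h9 : 9 * (x * N) ^+ 2 <= ((x + N) ^+ 2 - 1) ^+ 2.
  rewrite (_ : 9 * _ = (3 * (x * N)) ^+ 2); last by ring.
  rewrite ler_pXn2r// nnegrE; first by rewrite mulr_ge0.
  by apply: le_trans h; rewrite mulr_ge0.
have := sqr_ge0 (x * N); move: h9; move: (_ ^+ 2) (_ ^+ 2) => a b; lra.
Qed.

Lemma lapl_relgap n m : lapl (relgap n) m <= 6.
Proof.
rewrite lapl_relgapE; set x : R := m.+1%:R; set N : R := n.+1%:R.
have x1 : 1 <= x by rewrite ler1n.
have N1 : 1 <= N by rewrite ler1n.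
move: x N x1 N1 => x N x1 N1.
have y2 : 2 <= x + N by lra.
have yy : 0 < (x + N) ^+ 2 - 1.
  by rewrite subr_gt0 exprn_egt1// (lt_le_trans _ y2)// ltr1n.
have yyy : 0 < (x + N) * ((x + N) ^+ 2 - 1) by rewrite mulr_gt0//; lra.
rewrite (_ : 6 = 3 + 3); last by ring.
apply: lerD; first by rewrite ler_pdivrMr//; exact: lapl_relgap_aux1.
rewrite ler_pdivrMr ?exprn_gt0//.
apply: (@le_trans _ _ (24 * (x * N) ^+ 2 * (x + N) ^+ 2)).
  rewrite -subr_ge0 (_ : _ - _ = 8 * (x * N) ^+ 2 + 16 * N ^+ 2 * (x * (x + N) ^+ 3)); last by ring.
  by rewrite addr_ge0// !mulr_ge0 ?sqr_ge0 ?exprn_ge0//; lra.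
rewrite (_ : 3 * _ = 3 * ((x + N) ^+ 2 - 1) ^+ 2 * (x + N) ^+ 2); last by ring.
by rewrite ler_wpM2r ?sqr_ge0// lapl_relgap_aux2.
Qed.

(** Each step of the recursion changes the average of [relgap] by at most 6
    ck j, and the averages vanish as the order grows ([kerw_diag]);
    [max_chain] sums the steps. *)
Lemma kerw_relgap k n P : (0 < k)%N ->
  \sum_(p < P) kerw k n p * relgap n p <= 6 / k.+1%:R.
Proof.
move=> k0.
pose e j m := \sum_(p < P) kerw j m p * relgap n p - relgap n m.
have := @max_chain e 1 6 _ _ _ _ k n k0; rewrite /e.
have -> : relgap n n = 0 by rewrite /relgap subrr mul0r expr0n.
rewrite subr0; apply => //.
- move=> j m; rewrite lerBlDr (le_trans _ (_ : 1 <= _))//; last by rewrite lerDl relgap_ge0.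
  apply: le_trans (kerw_sum_le1 j m P); apply: ler_sum => p _.
  by rewrite ler_piMr ?kerw_ge0// relgap_le1.
- move=> j m; rewrite laplD laplN lapl_sum.
  have -> : \sum_(p < P) kerw j.+1 m p * relgap n p = \sum_(p < P) kerw j m p * relgap n p -
      ck j * \sum_(p < P) lapl (fun i => kerw j i p * relgap n p) m.
    rewrite mulr_sumr -sumrB; apply: eq_bigr => p _; rewrite kerw_step mulrBl; congr (_ - _).
    by rewrite -mulrA; congr (_ * _); rewrite mulrC -laplZ; apply: lapl_ext => i; rewrite mulrC.
  have := ler_wpM2l (ck_ge0 j) (lapl_relgap n m); lra.
- move=> m eps eps0; have [K0 hK0] := archi_div (m.+1 * tailC m)%:R eps0.
  exists K0 => K K0K; have h : (m.+1 * tailC m)%:R / K.+3%:R <= eps by apply: hK0; lia.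
  apply: le_trans h; apply: le_trans (kerw_diag K m); apply: le_trans (ler_norm _).
  rewrite lerBlDr.
  apply: (@le_trans _ _ (\sum_(p < P + m.+1) kerw K m p * relgap n p)).
    rewrite -(big_mkord xpredT (fun p => kerw K m p * relgap n p)).
    rewrite -[leRHS](big_mkord xpredT (fun p => kerw K m p * relgap n p)).
    rewrite [leRHS](@big_cat_nat _ _ _ P)//= ?leq_addr// lerDl sumr_ge0// => i _.
    by rewrite mulr_ge0 ?kerw_ge0 ?relgap_ge0.
  have hm : (m < P + m.+1)%N by rewrite ltn_addl.
  have := kerw_sum_le1 K m (P + m.+1).
  rewrite (bigD1 (Ordinal hm))//= => hs; rewrite (bigD1 (Ordinal hm))//=.
  have h1 : \sum_(i < P + m.+1 | i != Ordinal hm) kerw K m i * relgap n i <=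
     \sum_(i < P + m.+1 | i != Ordinal hm) kerw K m i.
    by apply: ler_sum => i _; rewrite ler_piMr ?kerw_ge0// relgap_le1.
  have h0 : 0 <= \sum_(i < P + m.+1 | i != Ordinal hm) kerw K m i.
    by apply: sumr_ge0 => i _; exact: kerw_ge0.
  have h2 : kerw K m m * relgap n m <= relgap n m.
    by rewrite ler_piMl ?relgap_ge0// (le_trans _ hs)// lerDl.
  rewrite addrC lerD// lerBrDl; exact: le_trans (lerD (lexx _) h1) hs.
Qed.

End Kernel.

(** * Real parts, imaginary parts and moduli *)
Section ComplexBasics.
Context {R : realType}.
Local Notation C := R[i].
Implicit Types (z w : C) (x : R).
Local Notation Re := complex.Re.
Local Notation Im := complex.Im.

Lemma ReD z w : Re (z + w : C) = Re z + Re w. Proof. by case: z w => [? ?] []. Qed.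

Lemma ImD z w : Im (z + w : C) = Im z + Im w. Proof. by case: z w => [? ?] []. Qed.

Lemma ReN z : Re (- z : C) = - Re z. Proof. by case: z. Qed.

Lemma ImN z : Im (- z : C) = - Im z. Proof. by case: z. Qed.

Lemma ReM z w : Re (z * w : C) = Re z * Re w - Im z * Im w.
Proof. by case: z w => [? ?] []. Qed.

Lemma ImM z w : Im (z * w : C) = Re z * Im w + Im z * Re w.
Proof. by case: z w => [? ?] []. Qed.

Lemma Re_conj z : Re (z^* : C) = Re z. Proof. by case: z. Qed.

Lemma Im_conj z : Im (z^* : C) = - Im z. Proof. by case: z. Qed.

Lemma complex_eq z w : Re z = Re w -> Im z = Im w -> z = w.
Proof. by case: z w => [a b] [c d] /= -> ->. Qed.

Lemma cnorm_le_add z w : cnorm (z + w) <= cnorm z + cnorm w.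
Proof. exact: (ler_normD (z : Rcomplex R) w). Qed.

Lemma cnormN z : cnorm (- z) = cnorm z.
Proof. exact: (normrN (z : Rcomplex R)). Qed.

Lemma cnormBC z w : cnorm (z - w) = cnorm (w - z).
Proof. by rewrite -cnormN opprB. Qed.

Lemma cnorm_le_sub z w : cnorm z - cnorm w <= cnorm (z - w).
Proof. by rewrite lerBlDr -[X in cnorm X <= _](subrK w); exact: cnorm_le_add. Qed.

Lemma cnorm0 : cnorm (0 : C) = 0. Proof. exact: Normc.normc0. Qed.

Lemma cnorm1 : cnorm (1 : C) = 1. Proof. exact: Normc.normc1. Qed.

Lemma cnormM z w : cnorm (z * w) = cnorm z * cnorm w.
Proof. exact: Normc.normcM. Qed.

Lemma cnormV z : cnorm z^-1 = (cnorm z)^-1.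
Proof. exact: Normc.normcV. Qed.

Lemma cnorm_eq0 z : (cnorm z == 0) = (z == 0).
Proof. by apply/eqP/eqP => [/Normc.eq0_normc|->]//; rewrite cnorm0. Qed.

Lemma cnorm_conj z : cnorm z^* = cnorm z.
Proof. by case: z => a b; rewrite /= sqrrN. Qed.

Lemma cnorm_real x : cnorm x%:C%C = `|x|.
Proof. by rewrite /= expr0n/= addr0 sqrtr_sqr. Qed.

Lemma cnorm_nat n : cnorm (n%:R : C) = n%:R.
Proof.
have -> : (n%:R : C) = (n%:R : R)%:C%C by rewrite rmorph_nat.
by rewrite cnorm_real ger0_norm.
Qed.

Lemma ler_Re z : `|Re z| <= cnorm z.
Proof. by rewrite cnormE -sqrtr_sqr ler_wsqrtr// lerDl sqr_ge0. Qed.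

Lemma ler_Im z : `|Im z| <= cnorm z.
Proof. by rewrite cnormE -sqrtr_sqr ler_wsqrtr// lerDr sqr_ge0. Qed.

Lemma cnorm_le_ReIm z : cnorm z <= `|Re z| + `|Im z|.
Proof.
rewrite cnormE -[leRHS]ger0_norm ?addr_ge0// -sqrtr_sqr ler_wsqrtr// sqrrD.
by rewrite !real_normK ?num_real// addrAC lerDl mulrn_wge0// mulr_ge0.
Qed.

Lemma cnorm_sum (I : Type) (r : seq I) (P : pred I) (F : I -> C) :
  cnorm (\sum_(i <- r | P i) F i) <= \sum_(i <- r | P i) cnorm (F i).
Proof.
elim/big_ind2: _ => //; first by rewrite cnorm0.
by move=> a b c d ab cd; rewrite (le_trans (cnorm_le_add _ _))// lerD.
Qed.

Lemma mul_conj z : z * z^* = (cnorm z ^+ 2)%:C%C.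
Proof. by apply: complex_eq; rewrite ?ReM ?ImM sqr_cnorm; case: z => a b /=; ring. Qed.

Lemma real_complexD x y : (x + y)%:C%C = x%:C%C + y%:C%C :> C.
Proof. by rewrite rmorphD. Qed.

Lemma real_complexM x y : (x * y)%:C%C = x%:C%C * y%:C%C :> C.
Proof. by rewrite rmorphM. Qed.

Lemma Re_sum (I : Type) (r : seq I) (P : pred I) (F : I -> C) :
  Re (\sum_(i <- r | P i) F i) = \sum_(i <- r | P i) Re (F i).
Proof. by rewrite (big_morph (@complex.Re R) ReD (erefl _ : complex.Re (0 : C) = 0)). Qed.

Lemma Im_sum (I : Type) (r : seq I) (P : pred I) (F : I -> C) :
  Im (\sum_(i <- r | P i) F i) = \sum_(i <- r | P i) Im (F i).
Proof. by rewrite (big_morph (@complex.Im R) ImD (erefl _ : complex.Im (0 : C) = 0)). Qed.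

End ComplexBasics.

(** * Complex-valued integrals *)
Section ComplexIntegral.
Context {R : realType} d {T : measurableType d} (mu : {measure set T -> \bar R}).
Local Notation C := R[i].
Variables (D : set T) (mD : measurable D).
Implicit Types (F G : T -> C).
Local Notation Re := complex.Re.
Local Notation Im := complex.Im.

Definition cint F : C := (Rintegral mu D (fun x => Re (F x)) +i*
  Rintegral mu D (fun x => Im (F x)))%C.

Definition cintegrable F := mu.-integrable D (fun x => (Re (F x))%:E) /\
  mu.-integrable D (fun x => (Im (F x))%:E).

Definition cmeas F := measurable_fun D (fun x => Re (F x)) /\
  measurable_fun D (fun x => Im (F x)).

Lemma eq_cint F G : {in D, F =1 G} -> cint F = cint G.
Proof.
by move=> FG; congr (_ +i* _)%C; apply: eq_Rintegral => x Dx; rewrite FG.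
Qed.

Lemma eq_cintegrable F G : {in D, F =1 G} -> cintegrable F -> cintegrable G.
Proof.
move=> FG [h1 h2]; split.
  by apply: eq_integrable h1 => // x Dx; rewrite FG.
by apply: eq_integrable h2 => // x Dx; rewrite FG.
Qed.

Lemma cintegrable_cmeas F : cintegrable F -> cmeas F.
Proof.
by move=> [/measurable_int/measurable_EFinP h1 /measurable_int/measurable_EFinP h2].
Qed.

Lemma cintegrable0 : cintegrable (fun=> 0).
Proof. by split; exact: integrable0. Qed.

Lemma cintegrableD F G : cintegrable F -> cintegrable G ->
  cintegrable (fun x => F x + G x).
Proof.
move=> [f1 f2] [g1 g2]; split.
  apply: eq_integrable (integrableD mD f1 g1) => // x _ /=.
  by rewrite ReD EFinD.
apply: eq_integrable (integrableD mD f2 g2) => // x _ /=.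
by rewrite ImD EFinD.
Qed.

Lemma cintegrableZ c F : cintegrable F -> cintegrable (fun x => c * F x).
Proof.
move=> [f1 f2]; split.
  apply: eq_integrable (integrableB mD (integrableZl mD (Re c) f1)
    (integrableZl mD (Im c) f2)) => // x _ /=.
  by rewrite ReM EFinB !EFinM.
apply: eq_integrable (integrableD mD (integrableZl mD (Re c) f2)
    (integrableZl mD (Im c) f1)) => // x _ /=.
by rewrite ImM EFinD !EFinM.
Qed.

Lemma cintD F G : cintegrable F -> cintegrable G ->
  cint (fun x => F x + G x) = cint F + cint G.
Proof.
move=> [f1 f2] [g1 g2]; apply: complex_eq; rewrite ?ReD ?ImD /=.
  by rewrite -RintegralD//; apply: eq_Rintegral => x _; rewrite ReD.
by rewrite -RintegralD//; apply: eq_Rintegral => x _; rewrite ImD.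
Qed.

Lemma integrable_scale (r : R) (f : T -> R) : mu.-integrable D (EFin \o f) ->
  mu.-integrable D (EFin \o (fun x => r * f x)).
Proof. by move=> h; apply: eq_integrable (integrableZl mD r h). Qed.

Lemma cintZ c F : cintegrable F -> cint (fun x => c * F x) = c * cint F.
Proof.
move=> [f1 f2]; apply: complex_eq; rewrite ?ReM ?ImM /=.
  rewrite -!RintegralZl// -RintegralB//; [|exact: integrable_scale..].
  by apply: eq_Rintegral => x _; rewrite ReM.
rewrite -!RintegralZl// -RintegralD//; [|exact: integrable_scale..].
by apply: eq_Rintegral => x _; rewrite ImM.
Qed.

Lemma cintegrableN F : cintegrable F -> cintegrable (fun x => - F x).
Proof.
by move=> h; apply: eq_cintegrable (cintegrableZ (-1) h) => x _; rewrite mulN1r.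
Qed.

Lemma cintegrableB F G : cintegrable F -> cintegrable G ->
  cintegrable (fun x => F x - G x).
Proof. by move=> f g; apply: cintegrableD => //; exact: cintegrableN. Qed.

Lemma cintB F G : cintegrable F -> cintegrable G ->
  cint (fun x => F x - G x) = cint F - cint G.
Proof.
move=> f g; rewrite cintD//; last exact: cintegrableN.
rewrite -[X in _ = _ + X]mulN1r -cintZ//; congr (_ + _).
by apply: eq_cint => x _; rewrite mulN1r.
Qed.

Lemma cint0 : cint (fun=> 0) = 0.
Proof. by apply: complex_eq; rewrite /= /Rintegral integral0. Qed.

Lemma cintegrable_sum (I : Type) (r : seq I) (P : pred I) (F : I -> T -> C) :
  (forall i, P i -> cintegrable (F i)) ->
  cintegrable (fun x => \sum_(i <- r | P i) F i x).
Proof.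
move=> h; elim: r => [|i r IH].
  by apply: eq_cintegrable cintegrable0 => x _; rewrite big_nil.
have [Pi|nPi] := boolP (P i).
  by apply: eq_cintegrable (cintegrableD (h i Pi) IH) => x _; rewrite big_cons Pi.
by apply: eq_cintegrable IH => x _; rewrite big_cons (negbTE nPi).
Qed.

Lemma cint_sum (I : Type) (r : seq I) (P : pred I) (F : I -> T -> C) :
  (forall i, P i -> cintegrable (F i)) ->
  cint (fun x => \sum_(i <- r | P i) F i x) = \sum_(i <- r | P i) cint (F i).
Proof.
move=> h; elim: r => [|i r IH].
  by rewrite [RHS]big_nil -[RHS]cint0; apply: eq_cint => x _; rewrite big_nil.
rewrite big_cons; case: ifPn => Pi; last first.
  by rewrite -IH; apply: eq_cint => x _; rewrite big_cons (negbTE Pi).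
rewrite -IH -cintD//; [|exact: h|exact: cintegrable_sum].
by apply: eq_cint => x _; rewrite big_cons Pi.
Qed.

Lemma cint_conj F : cintegrable F -> cint (fun x => (F x)^*) = (cint F)^*.
Proof.
move=> [f1 f2]; apply: complex_eq; rewrite ?Re_conj ?Im_conj /=.
  by apply: eq_Rintegral => x _; rewrite Re_conj.
rewrite -[RHS]mulN1r -RintegralZl//.
by apply: eq_Rintegral => x _; rewrite Im_conj mulN1r.
Qed.

(** The constant 2 comes from bounding real and imaginary parts separately. *)
Lemma cint_bound F M : (mu D < +oo)%E -> cintegrable F -> 0 <= M ->
  (forall x, D x -> cnorm (F x) <= M) -> cnorm (cint F) <= 2 * (M * fine (mu D)).
Proof.
move=> muD [f1 f2] M0 FM; apply: le_trans (cnorm_le_ReIm _) _ => /=.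
have iM : mu.-integrable D (EFin \o cst M).
  apply: measurable_bounded_integrable => //; exists `|M|; split; first exact: num_real.
  by move=> y My x Dx /=; exact: ltW.
have -> : 2 * (M * fine (mu D)) = M * fine (mu D) + M * fine (mu D) by ring.
rewrite lerD//.
  apply: le_trans (le_normr_Rintegral mD f1) _.
  rewrite -Rintegral_cst//; apply: le_Rintegral => //.
    exact: (integrable_norm f1).
  by move=> x Dx; rewrite (le_trans (ler_Re _))// FM.
apply: le_trans (le_normr_Rintegral mD f2) _.
rewrite -Rintegral_cst//; apply: le_Rintegral => //.
  exact: (integrable_norm f2).
by move=> x Dx; rewrite (le_trans (ler_Im _))// FM.
Qed.

Lemma cintegrable_bounded F M : (mu D < +oo)%E -> cmeas F ->
  (forall x, D x -> cnorm (F x) <= M) -> cintegrable F.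
Proof.
move=> muD [m1 m2] FM; split; apply: measurable_bounded_integrable => //.
  exists M; split; first exact: num_real.
  by move=> y My x Dx /=; rewrite (le_trans (ler_Re _))// (le_trans (FM _ Dx))// ltW.
exists M; split; first exact: num_real.
by move=> y My x Dx /=; rewrite (le_trans (ler_Im _))// (le_trans (FM _ Dx))// ltW.
Qed.

Lemma cmeasM F G : cmeas F -> cmeas G -> cmeas (fun x => F x * G x).
Proof.
move=> [f1 f2] [g1 g2]; split.
  apply: eq_measurable_fun (measurable_funB (measurable_funM f1 g1)
    (measurable_funM f2 g2)) => x _; by rewrite ReM.
apply: eq_measurable_fun (measurable_funD (measurable_funM f1 g2)
    (measurable_funM f2 g1)) => x _; by rewrite ImM.
Qed.

Lemma cmeas_conj F : cmeas F -> cmeas (fun x => (F x)^*).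
Proof.
move=> [f1 f2]; split.
  by apply: eq_measurable_fun f1 => x _; rewrite Re_conj.
by apply: eq_measurable_fun (measurable_funN f2) => x _; rewrite Im_conj.
Qed.

Lemma cmeas_lim (F_ : nat -> T -> C) F : (forall n, cmeas (F_ n)) ->
  (forall x, D x -> cnorm (F_ n x - F x) @[n --> \oo] --> (0 : R)) -> cmeas F.
Proof.
move=> mF cF; split.
  apply: (measurable_fun_cvg (fun n => (mF n).1)) => x Dx.
  apply/cvgrPdist_le => e e0; near=> n.
  rewrite distrC -ReN -ReD (le_trans (ler_Re _))//; near: n.
  by have /cvgr0Pnorm_le/(_ _ e0) := cF x Dx; apply: filterS => n /=; rewrite ger0_norm ?cnorm_ge0.
apply: (measurable_fun_cvg (fun n => (mF n).2)) => x Dx.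
apply/cvgrPdist_le => e e0; near=> n.
rewrite distrC -ImN -ImD (le_trans (ler_Im _))//; near: n.
by have /cvgr0Pnorm_le/(_ _ e0) := cF x Dx; apply: filterS => n /=; rewrite ger0_norm ?cnorm_ge0.
Unshelve. all: by end_near. Qed.

(** Dominated convergence for the real and the imaginary part. *)
Lemma cint_dominated (F_ : nat -> T -> C) F (g : T -> R) :
  (forall n, cmeas (F_ n)) -> cmeas F -> mu.-integrable D (EFin \o g) ->
  (forall x, D x -> cnorm (F_ n x - F x) @[n --> \oo] --> (0 : R)) ->
  (forall n x, D x -> cnorm (F_ n x) <= g x) ->
  cnorm (cint (F_ n) - cint F) @[n --> \oo] --> (0 : R).
Proof.
move=> mF mf ig cF Fg.
have part (h_ : nat -> T -> R) (h : T -> R) :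
    (forall n, measurable_fun D (h_ n)) -> measurable_fun D h ->
    (forall x, D x -> h_ n x @[n --> \oo] --> h x) ->
    (forall n x, D x -> `|h_ n x| <= g x) ->
    `|Rintegral mu D (h_ n) - Rintegral mu D h| @[n --> \oo] --> (0 : R).
  move=> mh_ mh ch hg.
  have [] := @dominated_convergence _ _ R mu D mD (fun n x => (h_ n x)%:E)
     (fun x => (h x)%:E) (EFin \o g).
  - by move=> n; exact/measurable_EFinP.
  - exact/measurable_EFinP.
  - by apply: aeW => x Dx; apply: cvg_EFin; [exact: nearW|exact: ch].
  - exact: ig.
  - by apply: aeW => x n Dx; rewrite lee_fin; exact: hg.
  move=> ih _ cI.
  have ihn n : mu.-integrable D (EFin \o h_ n).
    apply: (le_integrable mD _ _ ig); first exact/measurable_EFinP.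
    move=> x Dx /=; rewrite lee_fin (le_trans (hg _ _ Dx))// ler_norm//.
  have cI' : (Rintegral mu D (h_ n) @[n --> \oo] --> Rintegral mu D h).
    apply: fine_cvg; rewrite fineK//; exact: integrable_fin_num.
  rewrite -(normr0 R) -(subrr (Rintegral mu D h)); apply: cvg_norm.
  by apply: cvgB => //; exact: cvg_cst.
have c1 := part (fun n x => Re (F_ n x)) (fun x => Re (F x)) (fun n => (mF n).1) mf.1.
have c2 := part (fun n x => Im (F_ n x)) (fun x => Im (F x)) (fun n => (mF n).2) mf.2.
have cR x : D x -> Re (F_ n x) @[n --> \oo] --> Re (F x).
  move=> Dx; apply/cvgrPdist_le => e e0; near=> n.
  rewrite distrC -ReN -ReD (le_trans (ler_Re _))//; near: n.
  by have /cvgr0Pnorm_le/(_ _ e0) := cF x Dx; apply: filterS => n /=; rewrite ger0_norm ?cnorm_ge0.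
have cI x : D x -> Im (F_ n x) @[n --> \oo] --> Im (F x).
  move=> Dx; apply/cvgrPdist_le => e e0; near=> n.
  rewrite distrC -ImN -ImD (le_trans (ler_Im _))//; near: n.
  by have /cvgr0Pnorm_le/(_ _ e0) := cF x Dx; apply: filterS => n /=; rewrite ger0_norm ?cnorm_ge0.
have gR n x : D x -> `|Re (F_ n x)| <= g x.
  by move=> Dx; rewrite (le_trans (ler_Re _))// Fg.
have gI n x : D x -> `|Im (F_ n x)| <= g x.
  by move=> Dx; rewrite (le_trans (ler_Im _))// Fg.
have c : `|Rintegral mu D (fun x => Re (F_ n x)) - Rintegral mu D (fun x => Re (F x))| +
  `|Rintegral mu D (fun x => Im (F_ n x)) - Rintegral mu D (fun x => Im (F x))|
  @[n --> \oo] --> (0 : R).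
  by rewrite -[X in _ --> X](addr0 0); apply: cvgD; [exact: c1|exact: c2].
apply: (squeeze_cvgr _ (cvg_cst 0) c).
by near=> n; apply/andP; split; [exact: cnorm_ge0|exact: cnorm_le_ReIm].
Unshelve. all: by end_near. Qed.

End ComplexIntegral.

(** * Calculus along curves in the complex plane *)
Section RealVariable.
Context {R : realType}.
Local Notation C := R[i].
Local Notation Re := complex.Re.
Local Notation Im := complex.Im.
Local Notation mu := (@lebesgue_measure R).
Implicit Types (F G : R -> C) (x a b : R) (c : C).

Definition cder F x c := is_derive x 1 (fun t => Re (F t)) (Re c) /\
  is_derive x 1 (fun t => Im (F t)) (Im c).

Definition ccont F x := (Re (F t) @[t --> x] --> Re (F x)) /\
  (Im (F t) @[t --> x] --> Im (F x)).

Lemma cder_ccont F x c : cder F x c -> ccont F x.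
Proof.
move=> [d1 d2]; split.
  by apply: differentiable_continuous; apply/derivable1_diffP; case: d1.
by apply: differentiable_continuous; apply/derivable1_diffP; case: d2.
Qed.

Lemma cder_eq F x c c' : cder F x c -> c = c' -> cder F x c'.
Proof. by move=> h <-. Qed.

Lemma cder_cst c x : cder (fun=> c) x 0.
Proof. by split; exact: is_derive_cst. Qed.

Lemma cder_real x : cder (fun t => t%:C%C) x 1.
Proof. by split; [exact: is_derive_id|exact: is_derive_cst]. Qed.

Lemma cderD F G x c c' : cder F x c -> cder G x c' ->
  cder (fun t => F t + G t) x (c + c').
Proof.
move=> [f1 f2] [g1 g2]; split.
  have -> : (fun t => Re (F t + G t)) = (fun t => Re (F t)) + (fun t => Re (G t)).
    by apply/funext => t; rewrite ReD.
  by rewrite ReD; exact: is_deriveD.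
have -> : (fun t => Im (F t + G t)) = (fun t => Im (F t)) + (fun t => Im (G t)).
  by apply/funext => t; rewrite ImD.
by rewrite ImD; exact: is_deriveD.
Qed.

Lemma cderM F G x c c' : cder F x c -> cder G x c' ->
  cder (fun t => F t * G t) x (c * G x + F x * c').
Proof.
move=> [f1 f2] [g1 g2]; split.
  have -> : (fun t => Re (F t * G t)) = (fun t => Re (F t)) * (fun t => Re (G t)) -
      (fun t => Im (F t)) * (fun t => Im (G t)).
    by apply/funext => t; rewrite ReM.
  apply: is_derive_eq; rewrite ReD !ReM /GRing.scale/=; ring.
have -> : (fun t => Im (F t * G t)) = (fun t => Re (F t)) * (fun t => Im (G t)) +
    (fun t => Im (F t)) * (fun t => Re (G t)).
  by apply/funext => t; rewrite ImM.
apply: is_derive_eq; rewrite ImD !ImM /GRing.scale/=; ring.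
Qed.

Lemma cderX F n x c : cder F x c ->
  cder (fun t => F t ^+ n) x (n%:R * F x ^+ n.-1 * c).
Proof.
move=> h; elim: n => [|n IH]; first by rewrite !mul0r; exact: cder_cst.
have -> : (fun t => F t ^+ n.+1) = (fun t => F t * F t ^+ n).
  by apply/funext => t; rewrite exprS.
apply: cder_eq (cderM h IH) _ => /=.
by case: n {IH} => [|n] /=; rewrite ?exprS -?natr1; ring.
Qed.

Lemma cderN F x c : cder F x c -> cder (fun t => - F t) x (- c).
Proof.
move=> h; have -> : (fun t => - F t) = (fun t => (-1) * F t).
  by apply/funext => t; rewrite mulN1r.
by apply: cder_eq (cderM (cder_cst (-1) x) h) _; rewrite mul0r add0r mulN1r.
Qed.

Lemma cderB F G x c c' : cder F x c -> cder G x c' ->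
  cder (fun t => F t - G t) x (c - c').
Proof. by move=> f g; apply: cderD => //; exact: cderN. Qed.

Lemma ccontM F G x : ccont F x -> ccont G x -> ccont (fun t => F t * G t) x.
Proof.
move=> [f1 f2] [g1 g2]; split.
  rewrite ReM; under eq_fun do rewrite ReM.
  by apply: cvgB; apply: cvgM.
rewrite ImM; under eq_fun do rewrite ImM.
by apply: cvgD; apply: cvgM.
Qed.

Lemma ccont_integrable F a b : (forall x, x \in `[a, b] -> ccont F x) ->
  cintegrable mu `[a, b] F.
Proof.
move=> cF; split; (apply: continuous_compact_integrable; first exact: segment_compact).
  by apply: continuous_in_subspaceT => x; rewrite inE => xab; have [] := cF x xab.
by apply: continuous_in_subspaceT => x; rewrite inE => xab; have [] := cF x xab.
Qed.

Lemma Rint_FTC (f g : R -> R) a b : a <= b ->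
  (forall x, is_derive x 1 f (g x)) -> continuous g ->
  Rintegral mu `[a, b] g = f b - f a.
Proof.
rewrite le_eqVlt => /predU1P[<- _ _|ab df cg].
  by rewrite set_itv1 Rintegral_set1 subrr.
have cf x : f t @[t --> x] --> f x.
  apply: (@differentiable_continuous _ R R); apply/derivable1_diffP.
  by have [] := df x.
rewrite /Rintegral (@continuous_FTC2 _ _ f)//.
- exact: continuous_subspaceT.
- split.
  + by move=> x _; have [] := df x.
  + by apply: cvg_at_right_filter; exact: cf.
  + by apply: cvg_at_left_filter; exact: cf.
- by move=> x _; rewrite derive1E; have [] := df x.
Qed.

Lemma cint_FTC F F' a b : a <= b -> (forall x, cder F x (F' x)) ->
  (forall x, ccont F' x) -> cint mu `[a, b] F' = F b - F a.
Proof.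
move=> ab dF cF'; apply: complex_eq; rewrite ?ReD ?ImD ?ReN ?ImN /=.
  apply: (@Rint_FTC (fun t => Re (F t))) => // x; first by have [] := dF x.
  by have [] := cF' x.
apply: (@Rint_FTC (fun t => Im (F t))) => // x; first by have [] := dF x.
by have [] := cF' x.
Qed.

Lemma cint_itvU F a b x : a <= x -> x <= b -> cintegrable mu `[a, b] F ->
  cint mu `[a, b] F = cint mu `[a, x] F + cint mu `[x, b] F.
Proof.
move=> ax xb [i1 i2].
have part (f : R -> R) : mu.-integrable `[a, b] (EFin \o f) ->
   Rintegral mu `[a, b] f = Rintegral mu `[a, x] f + Rintegral mu `[x, b] f.
  move=> fi; have := @Rintegral_itvB R f (BLeft a) (BRight b) x fi.
  rewrite !bnd_simp => /(_ ax xb); rewrite Rintegral_itv_obnd_cbnd; first lra.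
  apply: integrableS fi => //; apply: subset_itvr; rewrite bnd_simp //.
by apply: complex_eq; rewrite ?ReD ?ImD /=; exact: part.
Qed.

End RealVariable.

(** * Goursat's theorem on polar rectangles *)
Section ComplexDiff.
Context {R : realType}.
Local Notation C := R[i].
Local Notation Re := complex.Re.
Local Notation Im := complex.Im.
Local Notation mu := (@lebesgue_measure R).
Implicit Types (F G : C -> C) (z w c : C) (x : R).

(** Differentiability with real moduli; the derivatives of [R[i]^o] measure
    distances by complex numbers. *)
Definition cdiff F z c := forall e : R, 0 < e -> exists2 dl : R, 0 < dl &
  forall w, cnorm (w - z) < dl ->
    cnorm (F w - F z - c * (w - z)) <= e * cnorm (w - z).

Definition cnear F z := forall e : R, 0 < e -> exists2 dl : R, 0 < dl &
  forall w, cnorm (w - z) < dl -> cnorm (F w - F z) <= e.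

Lemma derivable_cdiff F z : derivable (F : C^o -> C^o) z 1 -> exists c, cdiff F z c.
Proof.
move/cvg_ex => [/= c] /cvgrPdist_le dF; exists c => e e0.
have := dF e%:C%C; rewrite ltcR => /(_ e0).
rewrite near_withinE => /nbhs_ballP[dl /=]; case: dl => dl dl'.
rewrite ltcE/= => /andP[/eqP -> dl0] H.
exists dl => // w wz; have [->|wz0] := eqVneq w z.
  by rewrite !subrr mulr0 subr0 cnorm0 mulr0.
have h0 : w - z != 0 by rewrite subr_eq0.
have := H (w - z); rewrite /ball/= sub0r normrN; move=> /(_ _ h0).
rewrite ltcR => /(_ wz); rewrite [_%:A]mulr1 subrK lecR /GRing.scale/= => h.
rewrite -ler_pdivrMr; last by rewrite lt_def cnorm_eq0 h0 cnorm_ge0.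
rewrite -cnormV -cnormM cnormBC in h *; apply: le_trans h; rewrite le_eqVlt; apply/orP; left.
apply/eqP; congr cnorm; field; exact: h0.
Qed.

Lemma cdiff_derivable F z c : cdiff F z c -> derivable (F : C^o -> C^o) z 1.
Proof.
move=> dF; apply/cvg_ex; exists c; apply/cvgrPdist_le => -[e e'].
rewrite ltcE/= => /andP[/eqP -> e0].
have [dl dl0 H] := dF e e0; rewrite near_withinE; apply/nbhs_ballP; exists dl%:C%C => /=.
  by rewrite ltcR.
move=> h; rewrite /ball/= sub0r normrN ltcR => hd h0.
rewrite [_%:A]mulr1 lecR /GRing.scale/=.
have := H (h + z); rewrite addrK => /(_ hd) {}H.
have h0' : 0 < cnorm h by rewrite lt_def cnorm_eq0 h0 cnorm_ge0.
rewrite cnormBC (_ : _ - c = (F (h + z) - F z - c * h) / h); last by field.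
by rewrite cnormM cnormV ler_pdivrMr.
Qed.

Lemma cdiff_near F z c : cdiff F z c -> cnear F z.
Proof.
move=> dF e e0; have [dl dl0 H] := dF 1 ltr01.
have k0 : 0 < 1 + cnorm c by rewrite ltr_pwDl// cnorm_ge0.
exists (Num.min dl (e / (1 + cnorm c))); first by rewrite lt_min dl0 divr_gt0.
move=> w; rewrite lt_min => /andP[/H h1 h2].
rewrite -[F w - F z](subrK (c * (w - z))).
apply: le_trans (cnorm_le_add _ _) _; rewrite cnormM.
apply: le_trans (lerD h1 (lexx _)) _; rewrite -mulrDl mulrC -ler_pdivlMr//.
exact: ltW.
Qed.

Lemma cnear_ccont_comp F (g : R -> C) x :
  (forall e : R, 0 < e -> \forall t \near x, cnorm (g t - g x) < e) ->
  cnear F (g x) -> ccont (fun t => F (g t)) x.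
Proof.
move=> cg nF; split; apply/cvgrPdist_le => e e0; have [dl dl0 H] := nF e e0.
  near=> t; rewrite distrC -ReN -ReD (le_trans (ler_Re _))// H//.
  by near: t; exact: cg.
near=> t; rewrite distrC -ImN -ImD (le_trans (ler_Im _))// H//.
by near: t; exact: cg.
Unshelve. all: by end_near. Qed.

Lemma ccont_near (g : R -> C) x : ccont g x ->
  forall e : R, 0 < e -> \forall t \near x, cnorm (g t - g x) < e.
Proof.
move=> [c1 c2] e e0; have e20 : 0 < e / 2 by rewrite divr_gt0.
near=> t; rewrite (le_lt_trans (cnorm_le_ReIm _))// ReD ImD ReN ImN [ltRHS]splitr ltrD//.
  by rewrite distrC; near: t; move/cvgrPdist_lt: c1; exact.
by rewrite distrC; near: t; move/cvgrPdist_lt: c2; exact.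
Unshelve. all: by end_near. Qed.

Lemma ccont_comp F (g : R -> C) x : ccont g x -> cnear F (g x) ->
  ccont (fun t => F (g t)) x.
Proof. by move=> /ccont_near; exact: cnear_ccont_comp. Qed.

Definition eix x : C := (cos x +i* sin x)%C.

Lemma cnorm_eix x : cnorm (eix x) = 1.
Proof. by rewrite /= cos2Dsin2 sqrtr1. Qed.

Lemma cder_eix x : cder eix x ('i%C * eix x).
Proof.
have -> : 'i%C * eix x = (- sin x +i* cos x)%C.
  by apply: complex_eq => /=; ring.
by split; [exact: is_derive_cos|exact: is_derive_sin].
Qed.

Lemma ccont_eix x : ccont eix x.
Proof. exact: cder_ccont (cder_eix x). Qed.

Lemma ccont_cst c x : ccont (fun=> c) x.
Proof. exact: cder_ccont (cder_cst c x). Qed.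

Definition polar (r x : R) : C := r%:C%C * eix x.

Lemma cnorm_pol r x : 0 <= r -> cnorm (polar r x) = r.
Proof. by move=> r0; rewrite cnormM cnorm_eix cnorm_real mulr1 ger0_norm. Qed.

Lemma ccont_pol_angle r x : ccont (polar r) x.
Proof. by apply: ccontM; [exact: ccont_cst|exact: ccont_eix]. Qed.

Lemma ccont_pol_radius r x : ccont (polar ^~ x) r.
Proof. by apply: ccontM; [exact: cder_ccont (cder_real r)|exact: ccont_cst]. Qed.

Lemma cint_itv_bound (F : R -> C) (a b M : R) : a <= b -> cintegrable mu `[a, b] F ->
  0 <= M -> (forall x, a <= x <= b -> cnorm (F x) <= M) ->
  cnorm (cint mu `[a, b] F) <= 2 * (M * (b - a)).
Proof.
move=> ab iF M0 FM.
have mE : mu `[a, b]%classic = (b - a)%:E.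
  rewrite lebesgue_measure_itv/= lte_fin; move: ab; rewrite le_eqVlt.
  by move=> /predU1P[->|->]//; rewrite ltxx subrr.
have E1 : (mu `[a, b]%classic < +oo)%E by rewrite mE ltry.
have E2 : fine (mu `[a, b]%classic) = b - a by rewrite mE.
rewrite -E2; apply: (@cint_bound R _ _ mu _ (measurable_itv `[a, b])) => //.
Qed.

Lemma eix_lipschitz a b : cnorm (eix b - eix a) <= 2 * `|b - a|.
Proof.
wlog ab : a b / a <= b.
  by move=> h; have [/h//|/ltW/h] := leP a b; rewrite cnormBC distrC.
have c' x : ccont (fun t => 'i%C * eix t) x by apply: ccontM; [exact: ccont_cst|exact: ccont_eix].
rewrite -(cint_FTC ab cder_eix c').
rewrite [X in _ <= 2 * X]ger0_norm ?subr_ge0// -(mul1r (b - a)).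
apply: cint_itv_bound => //; first by apply: ccont_integrable => x _; exact: c'.
by move=> x _; rewrite cnormM cnorm_eix mulr1 /= expr0n/= add0r expr1n sqrtr1.
Qed.

Lemma pol_lipschitz r r' x x' : 0 <= r <= 1 ->
  cnorm (polar r x - polar r' x') <= 2 * (`|r - r'| + `|x - x'|).
Proof.
move=> /andP[r0 r1].
have -> : polar r x - polar r' x' = r%:C%C * (eix x - eix x') + (r - r')%:C%C * eix x'.
  by rewrite /polar rmorphB; ring.
apply: le_trans (cnorm_le_add _ _) _; rewrite !cnormM cnorm_eix !cnorm_real mulr1 (ger0_norm r0).
have h := eix_lipschitz x' x.
have : r * cnorm (eix x - eix x') <= 2 * `|x - x'|.
  by apply: le_trans h; rewrite ler_piMl// cnorm_ge0.
have : 0 <= `|r - r'| by [].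
lra.
Qed.

Definition lower_half (I : R * R) := (I.1, (I.1 + I.2) / 2).
Definition upper_half (I : R * R) := ((I.1 + I.2) / 2, I.2).

Lemma nested_length (I : nat -> R * R) :
  (forall n, I n.+1 = lower_half (I n) \/ I n.+1 = upper_half (I n)) ->
  forall n, (I n).2 - (I n).1 = ((I 0%N).2 - (I 0%N).1) / 2 ^+ n.
Proof.
move=> IS; elim=> [|n IH]; first by rewrite expr0 divr1.
have := IH; rewrite exprS invfM mulrCA => <-.
by case: (IS n) => -> /=; field.
Qed.

Lemma nested_point (I : nat -> R * R) : (I 0%N).1 <= (I 0%N).2 ->
  (forall n, I n.+1 = lower_half (I n) \/ I n.+1 = upper_half (I n)) ->
  exists x, forall n, (I n).1 <= x <= (I n).2.
Proof.
move=> I0 IS.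
have le n : (I n).1 <= (I n).2.
  by rewrite -subr_ge0 nested_length// divr_ge0 ?subr_ge0// exprn_ge0.
have nd n m : (n <= m)%N -> (I n).1 <= (I m).1 /\ (I m).2 <= (I n).2.
  move=> /subnK <-; elim: (m - n)%N => [//|k [h1 h2]]; rewrite addSn.
  have := le (k + n)%N; case: (IS (k + n)%N) => -> /=; split; lra.
have cross n m : (I n).1 <= (I m).2.
  have [h1 _] := nd _ _ (leq_maxl n m); have [_ h2] := nd _ _ (leq_maxr n m).
  exact: le_trans h1 (le_trans (le _) h2).
pose A := [set (I n).1 | n in setT].
have A0 : A !=set0 by exists (I 0%N).1, 0%N.
exists (sup A) => n; apply/andP; split.
  apply: ub_le_sup; last by exists n.
  by exists (I 0%N).2 => _ [m _ <-]; exact: cross.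
by apply: ge_sup => // _ [m _ <-]; exact: cross.
Qed.

Lemma pow2_small (L e : R) : 0 < e -> exists n, L / 2 ^+ n < e.
Proof.
move=> e0; exists (Num.bound (L / e)); rewrite ltr_pdivrMr ?exprn_gt0// -ltr_pdivrMl// mulrC.
have [h|h] := leP 0 (L / e); last by rewrite (lt_le_trans h)// exprn_ge0.
rewrite (lt_le_trans (archi_boundP h))// -natrX ler_nat ltnW// ltn_expl//.
Qed.

(** Compactness of a rectangle, as an induction principle: if P failed for
    the rectangle, it would fail along a nested sequence of quarters, hence
    for arbitrarily small rectangles around their common point. *)
Lemma bisection (P : R * R -> R * R -> Prop) (I J : R * R) :
  I.1 <= I.2 -> J.1 <= J.2 ->
  (forall I' J', I'.1 <= I'.2 -> J'.1 <= J'.2 ->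
    P (lower_half I') (lower_half J') -> P (upper_half I') (lower_half J') ->
    P (lower_half I') (upper_half J') -> P (upper_half I') (upper_half J') -> P I' J') ->
  (forall x y, I.1 <= x <= I.2 -> J.1 <= y <= J.2 -> exists2 dl, 0 < dl &
    forall I' J', I'.1 <= x <= I'.2 -> J'.1 <= y <= J'.2 ->
      I'.2 - I'.1 < dl -> J'.2 - J'.1 < dl -> P I' J') ->
  P I J.
Proof.
move=> I0 J0 merge loc; apply: contrapT => nP.
have next (q : (R * R) * (R * R)) : exists q' : (R * R) * (R * R),
    q.1.1 <= q.1.2 -> q.2.1 <= q.2.2 -> ~ P q.1 q.2 ->
    [/\ ~ P q'.1 q'.2, q'.1 = lower_half q.1 \/ q'.1 = upper_half q.1 &
       q'.2 = lower_half q.2 \/ q'.2 = upper_half q.2].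
  have [h1|] := pselect (P (lower_half q.1) (lower_half q.2)); last first.
    by exists (lower_half q.1, lower_half q.2) => *; split=> //; left.
  have [h2|] := pselect (P (upper_half q.1) (lower_half q.2)); last first.
    by exists (upper_half q.1, lower_half q.2) => *; split=> //; [right|left].
  have [h3|] := pselect (P (lower_half q.1) (upper_half q.2)); last first.
    by exists (lower_half q.1, upper_half q.2) => *; split=> //; [left|right].
  exists (upper_half q.1, upper_half q.2) => q1 q2 nq; split=> //; [|by right|by right].
  by move=> h4; apply: nq; apply: merge.
have [f fP] := choice next.
pose q n := iter n f (I, J).
have qP n : [/\ (q n).1.1 <= (q n).1.2, (q n).2.1 <= (q n).2.2 & ~ P (q n).1 (q n).2].
  elim: n => [//|n [h1 h2 h3]]; have [h4 h5 h6] := fP _ h1 h2 h3; rewrite /q iterS; split=> //.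
    by case: h5 => -> /=; move: h1; rewrite /q; lra.
  by case: h6 => -> /=; move: h2; rewrite /q; lra.
have S1 n : (q n.+1).1 = lower_half (q n).1 \/ (q n.+1).1 = upper_half (q n).1.
  by have [h1 h2 h3] := qP n; have [] := fP _ h1 h2 h3.
have S2 n : (q n.+1).2 = lower_half (q n).2 \/ (q n.+1).2 = upper_half (q n).2.
  by have [h1 h2 h3] := qP n; have [] := fP _ h1 h2 h3.
have [x xP] := @nested_point (fun n => (q n).1) I0 S1.
have [y yP] := @nested_point (fun n => (q n).2) J0 S2.
have [dl dl0 H] := loc x y (xP 0%N) (yP 0%N).
have [n1 n1P] := pow2_small (I.2 - I.1) dl0.
have [n2 n2P] := pow2_small (J.2 - J.1) dl0.
have small n (L : R) : (n <= maxn n1 n2)%N -> 0 <= L -> L / 2 ^+ n < dl ->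
    L / 2 ^+ maxn n1 n2 < dl.
  move=> nn L0; apply: le_lt_trans; rewrite ler_wpM2l// lef_pV2 ?posrE ?exprn_gt0//.
  by rewrite ler_weXn2l// ler1n.
have [_ _] := qP (maxn n1 n2); apply; apply: H => //.
  rewrite (nested_length S1); apply: small n1P; rewrite ?leq_maxl ?subr_ge0//.
rewrite (nested_length S2); apply: small n2P; rewrite ?leq_maxr ?subr_ge0//.
Qed.

Definition arc_int (F : C -> C) (r c d : R) : C :=
  cint mu `[c, d] (fun t => 'i%C * polar r t * F (polar r t)).
Definition ray_int (F : C -> C) (t a b : R) : C :=
  cint mu `[a, b] (fun r => eix t * F (polar r t)).
(** The integral of F(w) dw along the boundary of the polar rectangle of the
    points r e^(it), r in I, t in J. Polar rectangles are stable under
    bisection and close up to annuli, so Cauchy integrals over circles come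
    out directly. *)
Definition sector_int (F : C -> C) (I J : R * R) : C :=
  (arc_int F I.2 J.1 J.2 - arc_int F I.1 J.1 J.2) -
  (ray_int F J.2 I.1 I.2 - ray_int F J.1 I.1 I.2).

Lemma arc_ccont F r t : cnear F (polar r t) ->
  ccont (fun t => 'i%C * polar r t * F (polar r t)) t.
Proof.
move=> nF; apply: ccontM; first by apply: ccontM; [exact: ccont_cst|exact: ccont_pol_angle].
by apply: ccont_comp => //; exact: ccont_pol_angle.
Qed.

Lemma ray_ccont F r t : cnear F (polar r t) -> ccont (fun r => eix t * F (polar r t)) r.
Proof.
move=> nF; apply: ccontM; first exact: ccont_cst.
by apply: (ccont_comp (g := polar ^~ t)) => //; exact: ccont_pol_radius.
Qed.

Lemma arc_integrable F (r a b : R) : (forall t, a <= t <= b -> cnear F (polar r t)) ->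
  cintegrable mu `[a, b] (fun t => 'i%C * polar r t * F (polar r t)).
Proof.
by move=> nF; apply: ccont_integrable => t; rewrite in_itv/= => /nF; exact: arc_ccont.
Qed.

Lemma ray_integrable F (t a b : R) : (forall r, a <= r <= b -> cnear F (polar r t)) ->
  cintegrable mu `[a, b] (fun r => eix t * F (polar r t)).
Proof.
by move=> nF; apply: ccont_integrable => r; rewrite in_itv/= => /nF; exact: ray_ccont.
Qed.

Lemma cder_pol_angle r t : cder (polar r) t ('i%C * polar r t).
Proof.
by apply: cder_eq (cderM (cder_cst r%:C%C t) (cder_eix t)) _; rewrite /polar; ring.
Qed.

Lemma cder_pol_radius r t : cder (polar ^~ t) r (eix t).
Proof.
by apply: cder_eq (cderM (cder_real r) (cder_cst (eix t) r)) _; rewrite mul1r mulr0 addr0.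
Qed.

Lemma cnear_affine (u v : C) z : cnear (fun w => u + v * w) z.
Proof.
apply: (@cdiff_near _ _ v) => e e0; exists 1 => // w _.
by rewrite (_ : _ - _ = 0) ?cnorm0 ?mulr_ge0 ?cnorm_ge0 ?(ltW e0)//; ring.
Qed.

Lemma cnearB F G z : cnear F z -> cnear G z -> cnear (fun w => F w - G w) z.
Proof.
move=> nF nG e e0; have e20 : 0 < e / 2 by rewrite divr_gt0.
have [d1 d10 H1] := nF _ e20; have [d2 d20 H2] := nG _ e20.
exists (Num.min d1 d2); first by rewrite lt_min d10.
move=> w; rewrite lt_min => /andP[/H1 h1 /H2 h2].
rewrite (_ : _ - _ = (F w - F z) - (G w - G z)); last by ring.
by rewrite (le_trans (cnorm_le_add _ _))// cnormN [leRHS]splitr lerD.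
Qed.

(** An affine function has a primitive. *)
Lemma sector_affine (u v : C) (I J : R * R) : I.1 <= I.2 -> J.1 <= J.2 ->
  sector_int (fun w => u + v * w) I J = 0.
Proof.
move=> I0 J0; pose H w := u * w + v / 2 * w ^+ 2.
have dH (g : R -> C) x c : cder g x c -> cder (fun t => H (g t)) x (c * (u + v * g x)).
  move=> dg; apply: cder_eq (cderD (cderM (cder_cst u x) dg)
    (cderM (cder_cst (v / 2) x) (cderX 2 dg))) _.
  by rewrite /= expr1; field.
have A r : arc_int (fun w => u + v * w) r J.1 J.2 = H (polar r J.2) - H (polar r J.1).
  apply: (cint_FTC J0 (F := fun t => H (polar r t))) => x.
    exact: dH (cder_pol_angle r x).
  by apply: (@arc_ccont (fun w => u + v * w)); exact: cnear_affine.
have B t : ray_int (fun w => u + v * w) t I.1 I.2 = H (polar I.2 t) - H (polar I.1 t).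
  apply: (cint_FTC I0 (F := fun r => H (polar r t))) => x.
    exact: (dH (polar ^~ t)) (cder_pol_radius x t).
  by apply: (@ray_ccont (fun w => u + v * w)); exact: cnear_affine.
by rewrite /sector_int !A !B; ring.
Qed.

Lemma sector_bound F (I J : R * R) (M : R) : 0 <= I.1 -> I.1 <= I.2 <= 1 -> J.1 <= J.2 ->
  (forall r t, I.1 <= r <= I.2 -> J.1 <= t <= J.2 -> cnear F (polar r t) /\
     cnorm (F (polar r t)) <= M) -> 0 <= M ->
  cnorm (sector_int F I J) <= 4 * M * ((I.2 - I.1) + (J.2 - J.1)).
Proof.
move=> I0 /andP[I12 I1] J12 FM M0.
have A r : I.1 <= r <= I.2 -> cnorm (arc_int F r J.1 J.2) <= 2 * (M * (J.2 - J.1)).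
  move=> rI; apply: cint_itv_bound => //.
    by apply: arc_integrable => t tJ; have [] := FM _ _ rI tJ.
  move=> t tJ; have [_ h] := FM _ _ rI tJ; apply: le_trans h.
  have r0 : 0 <= r by move: rI I0 => /andP[]; lra.
  rewrite !cnormM cnorm_eix cnorm_real mulr1 ger0_norm// /= expr0n/= add0r expr1n sqrtr1 mul1r.
  by rewrite ler_piMl ?cnorm_ge0//; move: rI I1 => /andP[]; lra.
have B t : J.1 <= t <= J.2 -> cnorm (ray_int F t I.1 I.2) <= 2 * (M * (I.2 - I.1)).
  move=> tJ; apply: cint_itv_bound => //.
    by apply: ray_integrable => r rI; have [] := FM _ _ rI tJ.
  move=> r rI; have [_ h] := FM _ _ rI tJ; apply: le_trans h.
  by rewrite cnormM cnorm_eix mul1r.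
have a1 := A I.1; have a2 := A I.2; have b1 := B J.1; have b2 := B J.2.
rewrite !lexx I12 J12 in a1 a2 b1 b2.
rewrite /sector_int (le_trans (cnorm_le_add _ _))// cnormN.
have := cnorm_le_add (arc_int F I.2 J.1 J.2) (- arc_int F I.1 J.1 J.2).
have := cnorm_le_add (ray_int F J.2 I.1 I.2) (- ray_int F J.1 I.1 I.2).
rewrite !cnormN; move: (a1 isT) (a2 isT) (b1 isT) (b2 isT); lra.
Qed.

Lemma sectorB F G (I J : R * R) : I.1 <= I.2 -> J.1 <= J.2 ->
  (forall r t, I.1 <= r <= I.2 -> J.1 <= t <= J.2 -> cnear F (polar r t)) ->
  (forall r t, I.1 <= r <= I.2 -> J.1 <= t <= J.2 -> cnear G (polar r t)) ->
  sector_int (fun w => F w - G w) I J = sector_int F I J - sector_int G I J.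
Proof.
move=> I12 J12 nF nG.
have A r : I.1 <= r <= I.2 -> arc_int (fun w => F w - G w) r J.1 J.2 =
    arc_int F r J.1 J.2 - arc_int G r J.1 J.2.
  move=> rI; rewrite /arc_int -cintB//.
  - by apply: eq_cint => t _; rewrite mulrBr.
  - by apply: arc_integrable => t; exact: nF.
  - by apply: arc_integrable => t; exact: nG.
have B t : J.1 <= t <= J.2 -> ray_int (fun w => F w - G w) t I.1 I.2 =
    ray_int F t I.1 I.2 - ray_int G t I.1 I.2.
  move=> tJ; rewrite /ray_int -cintB//.
  - by apply: eq_cint => r _; rewrite mulrBr.
  - by apply: ray_integrable => r rI; exact: nF.
  - by apply: ray_integrable => r rI; exact: nG.
by rewrite /sector_int !A ?B ?lexx ?I12 ?J12//; ring.
Qed.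

Lemma sector_split F (I J : R * R) : I.1 <= I.2 -> J.1 <= J.2 ->
  (forall r t, I.1 <= r <= I.2 -> J.1 <= t <= J.2 -> cnear F (polar r t)) ->
  sector_int F I J =
    sector_int F (lower_half I) (lower_half J) + sector_int F (upper_half I) (lower_half J) +
    sector_int F (lower_half I) (upper_half J) + sector_int F (upper_half I) (upper_half J).
Proof.
move=> I12 J12 nF.
have A r : I.1 <= r <= I.2 -> arc_int F r J.1 J.2 =
    arc_int F r J.1 ((J.1 + J.2) / 2) + arc_int F r ((J.1 + J.2) / 2) J.2.
  move=> rI; apply: cint_itvU; [lra|lra|].
  by apply: arc_integrable => t; exact: nF.
have B t : J.1 <= t <= J.2 -> ray_int F t I.1 I.2 =
    ray_int F t I.1 ((I.1 + I.2) / 2) + ray_int F t ((I.1 + I.2) / 2) I.2.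
  move=> tJ; apply: cint_itvU; [lra|lra|].
  by apply: ray_integrable => r rI; exact: nF.
by rewrite /sector_int /= !A ?B ?lexx ?I12 ?J12//; ring.
Qed.

(** Near the point where F is differentiable, F is affine up to e times the
    distance, so the boundary integral over a small rectangle of size l is
    O(e l^2). This bound is additive under division into quarters, and
    [bisection] extends it to the whole rectangle. *)
Theorem goursat F (I J : R * R) : 0 <= I.1 -> I.1 <= I.2 <= 1 -> J.1 <= J.2 ->
  (forall r t, I.1 <= r <= I.2 -> J.1 <= t <= J.2 -> exists c, cdiff F (polar r t) c) ->
  sector_int F I J = 0.
Proof.
move=> I0 I12 J12 dF; apply/eqP; rewrite -cnorm_eq0 eq_le cnorm_ge0 andbT.
have nF r t : I.1 <= r <= I.2 -> J.1 <= t <= J.2 -> cnear F (polar r t).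
  by move=> h1 h2; have [c] := dF _ _ h1 h2; exact: cdiff_near.
pose l (I' J' : R * R) : R := (I'.2 - I'.1) + (J'.2 - J'.1).
suff key e : 0 < e -> cnorm (sector_int F I J) <= 8 * e * l I J ^+ 2.
  apply/ler_addgt0Pr => e e0; rewrite add0r.
  have k0 : 0 < 8 * (1 + l I J ^+ 2) by rewrite mulr_gt0// ltr_pwDl// sqr_ge0.
  apply: le_trans (key (e / (8 * (1 + l I J ^+ 2))) _) _; first by rewrite divr_gt0.
  rewrite [leLHS](_ : _ = e * (8 * l I J ^+ 2 / (8 * (1 + l I J ^+ 2)))); last by ring.
  by rewrite ler_piMr ?(ltW e0)// ler_pdivrMr// mul1r ler_pM2l// lerDr ler01.
move=> e0.
pose P I' J' := (I.1 <= I'.1) && (I'.2 <= I.2) && (J.1 <= J'.1) && (J'.2 <= J.2) ->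
  cnorm (sector_int F I' J') <= 8 * e * l I' J' ^+ 2.
suff : P I J by apply; rewrite !lexx.
move/andP: I12 => [I12 I1].
apply: bisection => //.
- move=> I' J' I'12 J'12 h1 h2 h3 h4 /andP[/andP[/andP[s1 s2] s3] s4].
  rewrite sector_split//; last first.
    move=> r t /andP[r1 r2] /andP[t1 t2]; apply: nF.
      by rewrite (le_trans s1)// (le_trans r2).
    by rewrite (le_trans s3)// (le_trans t2).
  have sub (a b : bool) : (I.1 <= (if a then lower_half I' else upper_half I').1) &&
      ((if a then lower_half I' else upper_half I').2 <= I.2) &&
      (J.1 <= (if b then lower_half J' else upper_half J').1) &&
      ((if b then lower_half J' else upper_half J').2 <= J.2).
    by case: a b => [] [] /=; lra.
  have := h1 (sub true true); have := h2 (sub false true).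
  have := h3 (sub true false); have := h4 (sub false false).
  have E (a b : bool) : l (if a then lower_half I' else upper_half I')
     (if b then lower_half J' else upper_half J') = l I' J' / 2.
    by case: a b => [] []; rewrite /l /=; field.
  rewrite (E true true) (E true false) (E false true) (E false false) => k1 k2 k3 k4.
  rewrite (_ : 8 * e * l I' J' ^+ 2 = 8 * e * (l I' J' / 2) ^+ 2 + 8 * e * (l I' J' / 2) ^+ 2 +
    8 * e * (l I' J' / 2) ^+ 2 + 8 * e * (l I' J' / 2) ^+ 2); last by field.
  do 3 (apply: le_trans (cnorm_le_add _ _) _; apply: lerD => //).
move=> x y xI yJ; have [c dc] := dF _ _ xI yJ; have [dl dl0 H] := dc e e0.
(* by [pol_lipschitz], points of a rectangle of sides below dl/8 are within
   dl of each other *)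
exists (dl / 8); first by rewrite divr_gt0.
move=> I' J' xI' yJ' I'l J'l /andP[/andP[/andP[s1 s2] s3] s4].
have I'12 : I'.1 <= I'.2 by move/andP: xI' => [/le_trans]; exact.
have J'12 : J'.1 <= J'.2 by move/andP: yJ' => [/le_trans]; exact.
have sub1 r : I'.1 <= r <= I'.2 -> I.1 <= r <= I.2.
  by move=> /andP[r1 r2]; rewrite (le_trans s1)// (le_trans r2).
have sub2 t : J'.1 <= t <= J'.2 -> J.1 <= t <= J.2.
  by move=> /andP[r1 r2]; rewrite (le_trans s3)// (le_trans r2).
pose A w := (F (polar x y) - c * polar x y) + c * w.
have nA z : cnear A z by exact: cnear_affine.
rewrite -[sector_int F I' J'](subr0) -[X in _ - X](@sector_affine (F (polar x y) - c * polar x y) c I' J')//.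
rewrite -sectorB//; last by move=> r t /sub1 h1 /sub2 h2; exact: nF.
have l0 : 0 <= l I' J' by rewrite /l addr_ge0// subr_ge0.
rewrite (_ : 8 * e * l I' J' ^+ 2 = 4 * (e * (2 * l I' J')) * l I' J'); last by ring.
apply: sector_bound => //; last by rewrite mulr_ge0// ?mulr_ge0// ltW.
- exact: le_trans s1.
- by rewrite I'12 (le_trans s2).
move=> r t rI' tJ'; split.
  by apply: cnearB => //; apply: nF; [exact: sub1|exact: sub2].
have dist : cnorm (polar r t - polar x y) <= 2 * l I' J'.
  apply: le_trans (pol_lipschitz _ _ _ _) _.
    by have /andP[r1 r2] := sub1 _ rI'; rewrite (le_trans I0)//= (le_trans r2).
  rewrite ler_pM2l// /l lerD// ler_norml; move: rI' tJ' xI' yJ' => /andP[? ?] /andP[? ?] /andP[? ?] /andP[? ?]; apply/andP; split; lra.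
have := H (polar r t) _; rewrite (_ : F (polar r t) - F (polar x y) - _ =
  F (polar r t) - (F (polar x y) - c * polar x y + c * polar r t)); last by ring.
move=> h; apply: le_trans (h _) _.
  by apply: le_lt_trans dist _; rewrite /l; lra.
by rewrite ler_wpM2l// ltW.
Qed.

End ComplexDiff.

(** * Cauchy's formula and power series *)
Section Cauchy.
Context {R : realType}.
Local Notation C := R[i].
Local Notation Re := complex.Re.
Local Notation Im := complex.Im.
Local Notation mu := (@lebesgue_measure R).
Implicit Types (F G : C -> C) (z w c : C) (x : R).

(** Local boundedness, extended by [bisection]. *)
Lemma pol_bounded F (I J : R * R) : 0 <= I.1 -> I.1 <= I.2 <= 1 -> J.1 <= J.2 ->
  (forall r t, I.1 <= r <= I.2 -> J.1 <= t <= J.2 -> cnear F (polar r t)) ->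
  exists2 K : R, 0 <= K & forall r t, I.1 <= r <= I.2 -> J.1 <= t <= J.2 ->
    cnorm (F (polar r t)) <= K.
Proof.
move=> I0 /andP[I12 I1] J12 nF.
pose P I' J' := exists2 K : R, 0 <= K & forall r t, I.1 <= r <= I.2 -> J.1 <= t <= J.2 ->
  I'.1 <= r <= I'.2 -> J'.1 <= t <= J'.2 -> cnorm (F (polar r t)) <= K.
suff : P I J by move=> [K K0 KP]; exists K => // r t rI tJ; exact: KP.
apply: bisection => //.
- move=> I' J' _ _ [K1 K10 h1] [K2 K20 h2] [K3 K30 h3] [K4 K40 h4].
  exists (K1 + K2 + K3 + K4); first by rewrite !addr_ge0.
  move=> r t rI tJ rI' tJ'.
  have [rm|mr] := leP r ((I'.1 + I'.2) / 2); have [tm|mt] := leP t ((J'.1 + J'.2) / 2).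
  + have := h1 r t rI tJ; rewrite /= rm tm; move: rI' tJ' => /andP[-> _] /andP[-> _] /(_ isT isT); lra.
  + have := h3 r t rI tJ; rewrite /= rm (ltW mt); move: rI' tJ' => /andP[-> _] /andP[_ ->] /(_ isT isT); lra.
  + have := h2 r t rI tJ; rewrite /= tm (ltW mr); move: rI' tJ' => /andP[_ ->] /andP[-> _] /(_ isT isT); lra.
  + have := h4 r t rI tJ; rewrite /= (ltW mt) (ltW mr); move: rI' tJ' => /andP[_ ->] /andP[_ ->] /(_ isT isT); lra.
move=> x y xI yJ; have [dl dl0 H] := nF _ _ xI yJ 1 ltr01.
exists (dl / 8); first by rewrite divr_gt0.
move=> I' J' xI' yJ' I'l J'l; exists (cnorm (F (polar x y)) + 1).
  by rewrite addr_ge0// cnorm_ge0.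
move=> r t rI tJ rI' tJ'; rewrite -lerBlDl.
apply: le_trans (cnorm_le_sub _ _) _; apply: H.
apply: le_lt_trans (pol_lipschitz _ _ _ _) _.
  by move: rI => /andP[r1 r2]; rewrite (le_trans I0)//= (le_trans r2).
have h1 : `|r - x| <= I'.2 - I'.1.
  by rewrite ler_norml; move: rI' xI' => /andP[? ?] /andP[? ?]; apply/andP; split; lra.
have h2 : `|t - y| <= J'.2 - J'.1.
  by rewrite ler_norml; move: tJ' yJ' => /andP[? ?] /andP[? ?]; apply/andP; split; lra.
lra.
Qed.

Lemma eix_2pi : eix (pi *+ 2) = eix 0 :> C.
Proof. by rewrite /eix cos2pi sin2pi cos0 sin0. Qed.

Lemma cdiff_local F G z c : (exists2 dl : R, 0 < dl & forall w, cnorm (w - z) < dl -> F w = G w) ->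
  cdiff F z c -> cdiff G z c.
Proof.
move=> [d1 d10 FG] dF e e0; have [d2 d20 H] := dF e e0.
exists (Num.min d1 d2); first by rewrite lt_min d10.
move=> w; rewrite lt_min => /andP[h1 h2]; rewrite -!FG//; first exact: H.
by rewrite subrr cnorm0.
Qed.

Definition dquot F z c w := if w == z then c else (F w - F z) / (w - z).

Lemma dquot_cnear F z c : cdiff F z c -> cnear (dquot F z c) z.
Proof.
move=> dF e e0; have [dl dl0 H] := dF e e0; exists dl => // w wz.
rewrite /dquot eqxx; case: eqVneq => [_|wz0]; first by rewrite subrr cnorm0 ltW.
have h0 : w - z != 0 by rewrite subr_eq0.
rewrite (_ : _ - c = (F w - F z - c * (w - z)) / (w - z)); last by field.
by rewrite cnormM cnormV ler_pdivrMr ?H// lt_def cnorm_eq0 h0 cnorm_ge0.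
Qed.

Lemma dquot_cdiff F z c w : w != z -> (exists c', cdiff F w c') ->
  exists c', cdiff (dquot F z c) w c'.
Proof.
move=> wz [c' /cdiff_derivable dF].
have h0 : w - z != 0 by rewrite subr_eq0.
have dN : derivable ((fun w => F w - F z) : C^o -> C^o) w 1.
  by apply: derivableB; [exact: dF|exact: derivable_cst].
have dD : derivable ((fun w => w - z) : C^o -> C^o) w 1.
  by apply: derivableB; [exact: derivable_id|exact: derivable_cst].
have dQ : derivable ((fun w => (w - z)^-1) : C^o -> C^o) w 1.
  by apply: derivableV; [exact: h0|exact: dD].
have dP : derivable ((fun w => (F w - F z) / (w - z)) : C^o -> C^o) w 1.
  by apply: derivableM; [exact: dN|exact: dQ].
have [c2 d2] := derivable_cdiff dP; exists c2; apply: cdiff_local d2.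
exists (cnorm (w - z)); first by rewrite lt_def cnorm_eq0 h0 cnorm_ge0.
move=> w' h; rewrite /dquot; case: eqVneq => // E; move: h.
by rewrite E cnormBC ltxx.
Qed.

Section CauchyIntegral.
Variables (f : C -> C) (df : forall w, disk w -> exists c, cdiff f w c).

Let arc0 F r := arc_int F r 0 (pi *+ 2).

Lemma twopi_ge0 : 0 <= pi *+ 2 :> R.
Proof. by rewrite mulrn_wge0// pi_ge0. Qed.

(** [goursat] on an annulus cut along one ray: the two ray integrals cancel
    by periodicity. *)
Lemma arc_const F a b : 0 <= a -> a <= b < 1 ->
  (forall r t, a <= r <= b -> exists c, cdiff F (polar r t) c) ->
  arc0 F a = arc0 F b.
Proof.
move=> a0 /andP[ab b1] dF.
have := @goursat R F (a, b) (0, pi *+ 2) a0 _ twopi_ge0 _ => /=.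
rewrite ab (ltW b1) => /(_ isT) H; have := H (fun r t rI _ => dF r t rI).
rewrite /sector_int /= /ray_int /polar eix_2pi subrr subr0 => /eqP.
by rewrite subr_eq0 => /eqP.
Qed.

(** The difference quotient g is differentiable off z and continuous at z.
    Its circle integrals are therefore constant for radii below |z|, where
    they vanish because they do at radius 0, and constant for radii above
    |z|; continuity of the circle integral in the radius joins the two
    ranges. When z = 0 only the second range is present, and the integrals
    tend to 0 with the radius. *)
Lemma arc_dquot z c (r : R) : disk z -> cdiff f z c -> cnorm z < r < 1 ->
  arc0 (dquot f z c) r = 0.
Proof.
move=> Dz dz /andP[zr r1]; set g := dquot f z c; set s := cnorm z.
have s0 : 0 <= s := cnorm_ge0 _.
have r0 : 0 < r by exact: le_lt_trans zr.
have dg w : disk w -> w != z -> exists c, cdiff g w c.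
  by move=> Dw wz; apply: dquot_cdiff => //; exact: df.
have ng w : disk w -> cnear g w.
  move=> Dw; have [->|wz] := eqVneq w z; first exact: dquot_cnear.
  by have [c'] := dg w Dw wz; exact: cdiff_near.
have Dpol (a t : R) : 0 <= a < 1 -> disk (polar a t).
  by move=> /andP[a0 a1]; rewrite /disk /mkset cnorm_pol.
have zpol (a t : R) : 0 <= a -> a != s -> polar a t != z.
  by move=> a0; apply: contra => /eqP E; rewrite /s -E cnorm_pol.
have arc00 : arc0 g 0 = 0.
  rewrite /arc0 /arc_int -[RHS](cint0 mu `[0, pi *+ 2]); apply: eq_cint => t _.
  by rewrite /polar !mul0r mulr0 mul0r.
have left a : 0 <= a < s -> arc0 g a = 0.
  move=> /andP[a0 a1]; rewrite -arc00; apply/esym; apply: arc_const => //.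
    by rewrite a0 (lt_trans a1).
  move=> b t /andP[b0 b1]; apply: dg; first by apply: Dpol; rewrite b0 (le_lt_trans b1)// (lt_trans a1).
  by apply: zpol => //; rewrite lt_eqF// (le_lt_trans b1).
have right a : s < a <= r -> arc0 g a = arc0 g r.
  move=> /andP[a0 a1]; apply: arc_const; first by rewrite ltW// (le_lt_trans s0).
    by rewrite a1.
  move=> b t /andP[b0 b1]; have b00 : 0 <= b by rewrite ltW// (le_lt_trans s0)// (lt_le_trans a0).
  apply: dg; first by apply: Dpol; rewrite b00 (le_lt_trans b1).
  by apply: zpol => //; rewrite gt_eqF// (lt_le_trans a0).
have [K K0 KP] : exists2 K : R, 0 <= K & forall a t, 0 <= a <= r -> 0 <= t <= pi *+ 2 ->
    cnorm (g (polar a t)) <= K.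
  apply: (@pol_bounded g (0, r) (0, pi *+ 2)) => /=; first by [].
  - by rewrite !ltW.
  - exact: twopi_ge0.
  by move=> a t /andP[a0 ar] _; apply: ng; apply: Dpol; rewrite a0 (le_lt_trans ar).
have [z0|z0] := eqVneq s 0.
  apply/eqP; rewrite -cnorm_eq0 eq_le cnorm_ge0 andbT; apply/ler_addgt0Pr => e e0; rewrite add0r.
  pose k := 2 * (K * (pi *+ 2)) + 1; have k0 : 0 < k.
    by rewrite ltr_wpDl// mulr_ge0// mulr_ge0// twopi_ge0.
  pose a := Num.min r (e / k).
  have a0 : 0 < a by rewrite lt_min r0 divr_gt0.
  have ar : a <= r by rewrite ge_min lexx.
  rewrite -(right a); last by rewrite z0 a0.
  apply: (@le_trans _ _ (2 * (a * K * (pi *+ 2 - 0)))).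
    apply: cint_itv_bound.
    - exact: twopi_ge0.
    - by apply: arc_integrable => t _; apply: ng; apply: Dpol; rewrite ltW//= (le_lt_trans ar).
    - by rewrite mulr_ge0// ltW.
    move=> t tJ; rewrite !cnormM cnorm_eix cnorm_real mulr1 ger0_norm ?(ltW a0)//.
    rewrite /= expr0n/= add0r expr1n sqrtr1 mul1r ler_wpM2l ?(ltW a0)// KP// ar andbT.
    exact: ltW.
  rewrite subr0; apply: (@le_trans _ _ (a * k)).
    rewrite [leRHS](_ : _ = 2 * (a * K * (pi *+ 2)) + a); last by rewrite /k; ring.
    by rewrite lerDl ltW.
  by rewrite -ler_pdivlMr// /a ge_min lexx orbT.
have sgt0 : 0 < s by rewrite lt_def z0 s0.
have cont : ccont (arc0 g) s.
  have cr t a : 0 < a < r -> ccont (fun r => 'i%C * polar r t * g (polar r t)) a.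
    move=> /andP[a0 ar]; apply: ccontM.
      by apply: ccontM; [exact: ccont_cst|exact: ccont_pol_radius].
    apply: (ccont_comp (g := polar ^~ t)); first exact: ccont_pol_radius.
    by apply: ng; apply: Dpol; rewrite ltW//= (lt_trans ar).
  have ig a : 0 < a < r -> cintegrable mu `[0, pi *+ 2] (fun t => 'i%C * polar a t * g (polar a t)).
    move=> /andP[a0 ar]; apply: arc_integrable => t _; apply: ng; apply: Dpol.
    by rewrite ltW//= (lt_trans ar).
  have iK : mu.-integrable `[0, pi *+ 2] (EFin \o (fun=> K)).
    apply: continuous_compact_integrable; first exact: segment_compact.
    by apply: continuous_subspaceT => x; exact: cvg_cst.
  have bd a t : 0 < a < r -> 0 <= t <= pi *+ 2 -> cnorm ('i%C * polar a t * g (polar a t)) <= K.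
    move=> /andP[a0 ar] tJ; rewrite !cnormM cnorm_eix cnorm_real mulr1 ger0_norm ?(ltW a0)//.
    rewrite /= expr0n/= add0r expr1n sqrtr1 mul1r; apply: le_trans (_ : cnorm (g (polar a t)) <= _).
      by rewrite ler_piMl ?cnorm_ge0// ltW// (lt_trans ar).
    by apply: KP => //; rewrite !ltW.
  split.
    apply: (@continuity_under_integral R _ _ mu
      (fun a t => Re ('i%C * polar a t * g (polar a t))) `[0, pi *+ 2]%classic _ 0 r _ _ (fun=> K)) => //.
    - by move=> a; rewrite /= in_itv/= => /ig[].
    - by apply: aeW => t _ a; rewrite inE/= in_itv/= => /(cr t)[].
    - move=> a; rewrite /= in_itv/= => ha; apply: aeW => t; rewrite /= in_itv/= => ht.
      exact: le_trans (ler_Re _) (bd _ _ ha ht).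
    - by rewrite inE/= in_itv/= sgt0.
  apply: (@continuity_under_integral R _ _ mu
    (fun a t => Im ('i%C * polar a t * g (polar a t))) `[0, pi *+ 2]%classic _ 0 r _ _ (fun=> K)) => //.
  - by move=> a; rewrite /= in_itv/= => /ig[].
  - by apply: aeW => t _ a; rewrite inE/= in_itv/= => /(cr t)[].
  - move=> a; rewrite /= in_itv/= => ha; apply: aeW => t; rewrite /= in_itv/= => ht.
    exact: le_trans (ler_Im _) (bd _ _ ha ht).
  - by rewrite inE/= in_itv/= sgt0.
apply/eqP; rewrite -cnorm_eq0 eq_le cnorm_ge0 andbT; apply/ler_addgt0Pr => e e0; rewrite add0r.
have e20 : 0 < e / 2 by rewrite divr_gt0.
have /nbhs_ballP[dl /= dl0 H] := ccont_near cont e20.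
pose h := Num.min (dl / 2) (Num.min (s / 2) (r - s)).
have h0 : 0 < h by rewrite !lt_min !divr_gt0//= subr_gt0.
have hdl : h <= dl / 2 by rewrite ge_min lexx.
have hs : h <= s / 2 by rewrite !ge_min lexx orbT.
have hr : h <= r - s by rewrite !ge_min lexx !orbT.
have h1 : cnorm (arc0 g (s - h) - arc0 g s) < e / 2.
  by apply: H; rewrite /ball/= opprB addrC subrK gtr0_norm//; lra.
have h2 : cnorm (arc0 g (s + h) - arc0 g s) < e / 2.
  by apply: H; rewrite /ball/= opprD addNKr normrN gtr0_norm//; lra.
rewrite left in h1; last by apply/andP; split; lra.
rewrite right in h2; last by apply/andP; split; lra.
rewrite sub0r cnormN in h1; change (cnorm (arc0 g r) <= e).
rewrite -[arc0 g r](subrK (arc0 g s)).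
rewrite (le_trans (cnorm_le_add _ _))// [leRHS]splitr lerD// ltW//.
Qed.

Lemma cnear_inv (w : C) : w != 0 -> cnear (fun w => w^-1) w.
Proof.
move=> w0; have dQ : derivable ((fun w => w^-1) : C^o -> C^o) w 1.
  by apply: derivableV; [exact: w0|exact: derivable_id].
by have [c dc] := derivable_cdiff dQ; exact: cdiff_near dc.
Qed.

Lemma cder_eix_conj x : cder (fun t => (eix t)^*) x (- 'i%C * (eix x)^*).
Proof.
have -> : - 'i%C * (eix x)^* = (- sin x +i* - cos x)%C.
  by apply: complex_eq => /=; ring.
split; first exact: is_derive_cos.
by apply: is_deriveN; exact: is_derive_sin.
Qed.

Lemma eix_conjK x : (eix x)^* = (eix x)^-1.
Proof.
have e0 : eix x != 0 by rewrite -cnorm_eq0 cnorm_eix oner_eq0.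
by apply: (mulfI e0); rewrite mul_conj cnorm_eix expr1n mulfV.
Qed.

Lemma int_eix_conjX n : (0 < n)%N ->
  cint mu `[0, pi *+ 2] (fun t => (eix t)^* ^+ n) = 0.
Proof.
move=> n0; have nn : (n%:R : C) != 0 by rewrite pnatr_eq0 -lt0n.
have i0 : ('i%C : C) != 0.
  by rewrite -cnorm_eq0 /= expr0n/= add0r expr1n sqrtr1 oner_eq0.
have dF x : cder (fun t => - (n%:R * 'i%C)^-1 * (eix t)^* ^+ n) x ((eix x)^* ^+ n).
  apply: cder_eq (cderM (cder_cst (- (n%:R * 'i%C)^-1) x) (cderX n (cder_eix_conj x))) _.
  rewrite mul0r add0r -[in RHS](prednK n0) [in RHS]exprS; field.
  by rewrite i0 nn.
rewrite (cint_FTC (twopi_ge0) dF); last first.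
  by move=> x; apply: cder_ccont; exact: cderX (cder_eix_conj x).
by rewrite eix_2pi subrr.
Qed.

Lemma int_one : cint mu `[0, pi *+ 2] (fun=> 1) = (pi *+ 2)%:C%C.
Proof.
rewrite (cint_FTC (F := fun t => t%:C%C) (twopi_ge0)).
- by rewrite subr0.
- exact: cder_real.
- by move=> x; exact: ccont_cst.
Qed.

(** The integral of the difference quotient vanishes by [arc_dquot]. The
    integral on the right equals 2 pi, which is computed in [cauchy_series]
    from the expansion used there. *)
Lemma cauchy_formula (z : C) (r : R) : cnorm z < r < 1 ->
  cint mu `[0, pi *+ 2] (fun t => f (polar r t) * (polar r t / (polar r t - z))) =
  f z * cint mu `[0, pi *+ 2] (fun t => polar r t / (polar r t - z)).
Proof.
move=> zr; have /andP[zr1 r1] := zr.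
have r0 : 0 < r by apply: le_lt_trans zr1; exact: cnorm_ge0.
have Dz : disk z by exact: lt_trans r1.
have Dpol t : disk (polar r t) by rewrite /disk /mkset cnorm_pol// ltW.
have pz t : polar r t - z != 0.
  rewrite subr_eq0; apply/eqP => E; move: zr1.
  by rewrite -E cnorm_pol ?ltxx// ltW.
have i0 : ('i%C : C) != 0.
  by rewrite -cnorm_eq0 /= expr0n/= add0r expr1n sqrtr1 oner_eq0.
have [c dc] := df Dz.
have : cint mu `[0, pi *+ 2] (fun t => 'i%C * (f (polar r t) * (polar r t / (polar r t - z)) -
    f z * (polar r t / (polar r t - z)))) = 0.
  rewrite -[RHS](arc_dquot Dz dc zr); apply: eq_cint => t _.
  have pz' : polar r t != z by rewrite -subr_eq0.
  by rewrite /dquot (negbTE pz'); field; exact: pz.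
have ck t : ccont (fun t => polar r t / (polar r t - z)) t.
  apply: (ccont_comp (F := fun w => w / (w - z))); first exact: ccont_pol_angle.
  have dQ : derivable ((fun w => w / (w - z)) : C^o -> C^o) (polar r t) 1.
    have dD : derivable ((fun w => w - z) : C^o -> C^o) (polar r t) 1.
      by apply: derivableB; [exact: derivable_id|exact: derivable_cst].
    have dI : derivable ((fun w => (w - z)^-1) : C^o -> C^o) (polar r t) 1.
      by apply: derivableV; [exact: pz|exact: dD].
    by apply: derivableM; [exact: derivable_id|exact: dI].
  by have [c' dc'] := derivable_cdiff dQ; exact: cdiff_near dc'.
have cf t : ccont (fun t => f (polar r t)) t.
  apply: ccont_comp; first exact: ccont_pol_angle.
  by have [c' dc'] := df (Dpol t); exact: cdiff_near dc'.
have i1 : cintegrable mu `[0, pi *+ 2] (fun t => polar r t / (polar r t - z)).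
  by apply: ccont_integrable => t _; exact: ck.
have i2 : cintegrable mu `[0, pi *+ 2] (fun t => f (polar r t) * (polar r t / (polar r t - z))).
  by apply: ccont_integrable => t _; apply: ccontM; [exact: cf|exact: ck].
rewrite cintZ//; last by apply: cintegrableB => //; exact: cintegrableZ.
rewrite cintB//; last exact: cintegrableZ.
rewrite cintZ// => /eqP; rewrite mulf_eq0 (negbTE i0)/= subr_eq0 => /eqP.
by [].
Qed.

Definition circle_coef (r : R) n : C := ((pi *+ 2)^-1)%:C%C *
  cint mu `[0, pi *+ 2] (fun t => f (polar r t) * (polar r t)^-1 ^+ n).

(** The Cauchy kernel w / (w - z) is expanded in a finite geometric sum with
    remainder (z / w)^N w / (w - z). The same expansion, applied to the
    constant 1, evaluates the integral of the kernel. *)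
Theorem cauchy_series (r : R) : 0 < r < 1 -> exists2 B : R, 0 <= B &
  forall z N, cnorm z < r ->
    cnorm (f z - \sum_(n < N) circle_coef r n * z ^+ n) <=
    B * (cnorm z / r) ^+ N * (r / (r - cnorm z)).
Proof.
move=> /andP[r0 r1]; have rr : 0 <= r := ltW r0.
have Dpol t : disk (polar r t) by rewrite /disk /mkset cnorm_pol.
have p0 t : polar r t != 0 by rewrite -cnorm_eq0 cnorm_pol// gt_eqF.
have nf t : cnear f (polar r t).
  by have [c' dc'] := df (Dpol t); exact: cdiff_near dc'.
have [B B0 HB] : exists2 B, 0 <= B & forall t, 0 <= t <= pi *+ 2 -> cnorm (f (polar r t)) <= B.
  have [||||B B0 HB] := @pol_bounded f (r, r) (0, pi *+ 2) => //=.
  - by rewrite lexx ltW.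
  - exact: twopi_ge0.
  - by move=> a t /andP[h1 h2] _; have -> : a = r by apply/eqP; rewrite eq_le h1 h2.
  by exists B => // t tJ; apply: HB; rewrite ?lexx.
exists (2 * B); first by rewrite mulr_ge0.
move=> z N zr; set q := cnorm z / r; set ka := r / (r - cnorm z).
have rz : 0 < r - cnorm z by rewrite subr_gt0.
have ka0 : 0 <= ka by rewrite divr_ge0// ltW.
have q0 : 0 <= q by rewrite divr_ge0// cnorm_ge0.
have q1 : q < 1 by rewrite ltr_pdivrMr// mul1r.
pose K t := polar r t / (polar r t - z).
have pz t : polar r t - z != 0.
  rewrite subr_eq0; apply/eqP => E; move: zr.
  by rewrite -E cnorm_pol ?ltxx// ltW.
have Kka t : cnorm (K t) <= ka.
  rewrite /K cnormM cnormV cnorm_pol// ler_pM2l// lef_pV2 ?posrE//.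
    by rewrite -{1}(cnorm_pol t rr) cnorm_le_sub.
  by rewrite lt_def cnorm_eq0 pz cnorm_ge0.
have ci t : ccont (fun t => (polar r t)^-1) t.
  by apply: (ccont_comp (F := fun w => w^-1)); [exact: ccont_pol_angle|exact: cnear_inv].
have cX (F : R -> C) n t : ccont F t -> ccont (fun t => F t ^+ n) t.
  move=> cF; elim: n => [|n IH]; first exact: ccont_cst.
  by have -> : (fun t => F t ^+ n.+1) = (fun t => F t * F t ^+ n);
    [apply/funext => ?; rewrite exprS|exact: ccontM].
have cK t : ccont K t.
  apply: ccontM; first exact: ccont_pol_angle.
  apply: (ccont_comp (F := fun w => w^-1)); last exact: cnear_inv.
  exact: cder_ccont (cderB (cder_pol_angle r t) (cder_cst z t)).
have cf t : ccont (fun t => f (polar r t)) t.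
  by apply: ccont_comp => //; exact: ccont_pol_angle.
have KE t M : K t = \sum_(n < M) z ^+ n * (polar r t)^-1 ^+ n + (z / polar r t) ^+ M * K t.
  elim: M => [|M IH]; first by rewrite big_ord0 expr0 mul1r add0r.
  rewrite {1}IH big_ord_recr/= -addrA; congr (_ + _).
  rewrite exprS -exprMn /K; field.
  by rewrite pz p0.
have intE (g : R -> C) M : (forall t, ccont g t) ->
   cint mu `[0, pi *+ 2] (fun t => g t * K t) =
   \sum_(n < M) z ^+ n * cint mu `[0, pi *+ 2] (fun t => g t * (polar r t)^-1 ^+ n) +
   cint mu `[0, pi *+ 2] (fun t => g t * ((z / polar r t) ^+ M * K t)).
  move=> cg.
  have ig n : cintegrable mu `[0, pi *+ 2] (fun t => g t * (polar r t)^-1 ^+ n).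
    by apply: ccont_integrable => t _; apply: ccontM => //; exact: cX.
  under eq_bigr do rewrite -cintZ//.
  rewrite -cint_sum//; last by move=> n _; exact: cintegrableZ.
  rewrite -cintD//.
  - apply: eq_cint => t _; rewrite {1}(KE t M) mulrDr mulr_sumr; congr (_ + _).
    by apply: eq_bigr => i _; rewrite mulrCA.
  - by apply: cintegrable_sum => // i _; exact: cintegrableZ.
  - apply: ccont_integrable => t _; apply: ccontM => //; apply: ccontM => //.
    by apply: cX; apply: ccontM => //; exact: ccont_cst.
have remb (g : R -> C) M (b : R) : (forall t, ccont g t) -> 0 <= b ->
   (forall t, 0 <= t <= pi *+ 2 -> cnorm (g t) <= b) ->
   cnorm (cint mu `[0, pi *+ 2] (fun t => g t * ((z / polar r t) ^+ M * K t))) <=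
   (pi *+ 2) * (2 * b * q ^+ M * ka).
  move=> cg b0 gb; rewrite [leRHS](_ : _ = 2 * (b * (q ^+ M * ka) * (pi *+ 2 - 0))); last first.
    by rewrite subr0; ring.
  apply: cint_itv_bound.
  - exact: twopi_ge0.
  - apply: ccont_integrable => t _; apply: ccontM => //; apply: ccontM => //.
    by apply: cX; apply: ccontM => //; exact: ccont_cst.
  - by apply: mulr_ge0 => //; apply: mulr_ge0 => //; exact: exprn_ge0.
  move=> t tJ; rewrite [leLHS]cnormM; apply: ler_pM; rewrite ?cnorm_ge0 ?gb//.
  rewrite [leLHS]cnormM cnormX cnormM cnormV cnorm_pol//.
  by apply: ler_wpM2l; [exact: exprn_ge0|exact: Kka].
have p20 : 0 < pi *+ 2 :> R by rewrite pmulrn_rgt0// pi_gt0.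
have p2C : ((pi *+ 2)%:C%C : C) != 0 by rewrite -cnorm_eq0 cnorm_real normr_eq0 gt_eqF.
have K2pi : cint mu `[0, pi *+ 2] K = (pi *+ 2)%:C%C.
  apply/eqP; rewrite -subr_eq0 -cnorm_eq0 eq_le cnorm_ge0 andbT.
  apply/ler_addgt0Pr => e e0; rewrite add0r.
  pose k := (pi *+ 2) * (2 * 1 * ka) + 1.
  have k0 : 0 < k.
    rewrite ltr_wpDl//; apply: mulr_ge0; first exact: ltW.
    by apply: mulr_ge0 => //; rewrite mulr1.
  have [M hM] : exists M, q ^+ M.+1 <= e / k.
    have qn1 : `|q| < 1 by rewrite ger0_norm.
    have /cvgrPdist_le/(_ (e / k)) := cvg_expr qn1.
    rewrite divr_gt0// => /(_ isT) [M _ HM]; exists M.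
    by have := HM M.+1 (leqnSn M); rewrite sub0r normrN ger0_norm ?exprn_ge0.
  have := intE (fun=> 1) M.+1 (fun t => ccont_cst 1 t).
  rewrite (@eq_cint _ _ _ mu `[0, pi *+ 2]%classic _ K) => [->|t _]; last by rewrite mul1r.
  rewrite big_ord_recl/= big1 => [|i _]; last first.
    rewrite (@eq_cint _ _ _ mu `[0, pi *+ 2]%classic _ ((fun t => (r%:C%C)^-1 ^+ (bump 0 i) * (eix t)^* ^+ (bump 0 i)))).
      rewrite cintZ//; last first.
        by apply: ccont_integrable => t _; exact: cder_ccont (cderX _ (cder_eix_conj t)).
      by rewrite int_eix_conjX// !mulr0.
    by move=> t _; rewrite mul1r eix_conjK -exprMn /polar invfM.
  rewrite addr0 expr0 mul1r (@eq_cint _ _ _ mu `[0, pi *+ 2]%classic _ (fun=> 1)); last by move=> t _; rewrite expr0 mulr1.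
  rewrite int_one addrC addKr; change (cnorm (cint mu `[0, pi *+ 2] (fun t => 1 * ((z / polar r t) ^+ M.+1 * K t))) <= e).
  apply: le_trans (remb (fun=> 1) M.+1 1 (fun t => ccont_cst 1 t) ler01 _) _.
    by move=> t _; rewrite cnorm1.
  apply: le_trans (_ : q ^+ M.+1 * k <= _); last by rewrite -ler_pdivlMr.
  rewrite [leRHS](_ : _ = (pi *+ 2) * (2 * 1 * q ^+ M.+1 * ka) + q ^+ M.+1); last by rewrite /k; ring.
  by rewrite lerDl exprn_ge0.
have main : cnorm ((pi *+ 2)%:C%C * (f z - \sum_(n < N) circle_coef r n * z ^+ n)) <=
    (pi *+ 2) * (2 * B * q ^+ N * ka).
  have := @cauchy_formula z r; rewrite zr r1 => /(_ isT).
  rewrite -/(K _) K2pi (intE (fun t => f (polar r t)) N cf) => E.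
  have -> : (pi *+ 2)%:C%C * (f z - \sum_(n < N) circle_coef r n * z ^+ n) =
     cint mu `[0, pi *+ 2] (fun t => f (polar r t) * ((z / polar r t) ^+ N * K t)).
    rewrite mulrBr (mulrC _ (f z)) -E mulr_sumr addrC addrA (_ : - _ + _ = 0) ?add0r//.
    apply/eqP; rewrite addrC subr_eq0; apply/eqP; apply: eq_bigr => n _.
    by rewrite /circle_coef !mulrA -real_complexM divff ?gt_eqF// mul1r mulrC.
  exact: remb.
move: main; rewrite cnormM cnorm_real gtr0_norm// ler_pM2l//.
Qed.

End CauchyIntegral.

End Cauchy.

(** * Area measure and Green's formula on the disk *)
Section DiskMeasure.
Context {R : realType}.
Local Notation C := R[i].
Local Notation Re := complex.Re.
Local Notation Im := complex.Im.
Local Notation mu := (@lebesgue_measure R).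
Local Notation Rm := (measurableTypeR R).
Local Notation mu2 := ((lebesgue_measure \x lebesgue_measure)%E : {measure set (Rm * Rm)%type -> \bar R}).

Lemma sqr_lt_sqrt (x y : R) : (x ^+ 2 < y) = (`|x| < Num.sqrt y).
Proof.
rewrite -sqrtr_sqr; have [y0|y0] := ltP 0 y; first by rewrite ltr_sqrt.
by rewrite (ler0_sqrtr y0) ltNge (le_trans y0) ?sqr_ge0// ltNge sqrtr_ge0.
Qed.

Lemma chord_set (r y : R) : [set x : R | x ^+ 2 + y ^+ 2 < r] =
  `]- Num.sqrt (r - y ^+ 2), Num.sqrt (r - y ^+ 2)[%classic.
Proof. by apply/seteqP; split => x /=; rewrite in_itv/= -ltr_norml -sqr_lt_sqrt ltrBrDr. Qed.

(** Substitution x = sin t. *)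
Lemma int_half_circle : (\int[mu]_(x in `[(-1)%R, 1%R]) (Num.sqrt (1 - x ^+ 2))%:E = (pi / 2)%:E)%E.
Proof.
pose G (x : R) := Num.sqrt (1 - x ^+ 2).
have cG : continuous G.
  move=> x; rewrite /G; apply: (@cvg_comp _ _ _ (fun t : R => 1 - t ^+ 2) Num.sqrt _ (nbhs (1 - x ^+ 2))).
    by apply: cvgB; [exact: cvg_cst|exact: exprn_continuous].
  exact: sqrt_continuous.
have dsin : (@sin R)^`()%classic = cos by apply/funext => x; rewrite derive1E derive_val.
have ccos := @continuous_cos R.
have pi20 : - (pi / 2) <= pi / 2 :> R by have := pi_ge0 R; lra.
have := @integration_by_substitution_increasing R sin G (- (pi / 2)) (pi / 2) pi20.
rewrite sinN sin_pihalf dsin => ->; first last.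
- exact: continuous_subspaceT.
- split.
  + by move=> x _; exact: derivable_sin.
  + by apply: cvg_at_right_filter; exact: continuous_sin.
  + by apply: cvg_at_left_filter; exact: continuous_sin.
- by apply: cvgP; apply: cvg_at_left_filter; exact: ccos.
- by apply: cvgP; apply: cvg_at_right_filter; exact: ccos.
- by move=> x _; exact: ccos.
- by move=> x y xI yI; rewrite ltr_sin.
have E : {in `[- (pi / 2), pi / 2]%classic, (fun x => ((G \o sin) * cos) x) =1 (fun x => cos x ^+ 2)}.
  move=> x; rewrite inE/= in_itv/= => xI; rewrite /G fctE/=.
  by rewrite -cos2sin2 sqrtr_sqr ger0_norm ?cos_ge0_pihalf.
have dF (x : R) : is_derive x 1 (fun t : R => (t + sin t * cos t) / 2) (cos x ^+ 2).
  have -> : (fun t : R => (t + sin t * cos t) / 2) = 2^-1 \*: (id + sin * cos).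
    by apply/funext => t; rewrite fctE/= mulrC.
  by apply: is_derive_eq; have := cos2Dsin2 x; rewrite /GRing.scale/=; lra.
have ccos2 : continuous (fun x : R => cos x ^+ 2).
  move=> x; apply: (@cvg_comp _ _ _ cos (fun y : R => y ^+ 2) _ (nbhs (cos x))).
    exact: ccos.
  exact: exprn_continuous.
have FTC := Rint_FTC pi20 dF ccos2.
transitivity (\int[mu]_(x in `[(- (pi / 2))%R, (pi / 2)%R]) (cos x ^+ 2)%:E)%E.
  by apply: eq_integral => x xI; rewrite E.
have ii : mu.-integrable `[(- (pi / 2))%R, (pi / 2)%R] (EFin \o (fun x : R => cos x ^+ 2)).
  apply: continuous_compact_integrable; first exact: segment_compact.
  exact: continuous_subspaceT.
have -> : (\int[mu]_(x in `[(- (pi / 2))%R, (pi / 2)%R]) (cos x ^+ 2)%:E)%E =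
   (Rintegral mu `[(- (pi / 2)), (pi / 2)] (fun x : R => cos x ^+ 2))%:E.
  by rewrite /Rintegral fineK//; exact: integrable_fin_num ii.
rewrite FTC cosN cos_pihalf !mulr0 !addr0; congr _%:E; lra.
Qed.

Lemma chord_measure (r y : R) : mu [set x : R | x ^+ 2 + y ^+ 2 < r] =
  (2 * Num.sqrt (r - y ^+ 2))%:E.
Proof.
rewrite chord_set lebesgue_measure_itv/= lte_fin.
have := sqrtr_ge0 (r - y ^+ 2); set s := Num.sqrt _ => s0.
case: ifPn => [_|]; first by rewrite -EFinB; congr _%:E; ring.
by rewrite -leNgt => h; congr _%:E; lra.
Qed.

Lemma plane_area_disk : mu2 pdisk = pi%:E.
Proof.
  transitivity (\int[mu]_x (2 * Num.sqrt (1 - x ^+ 2))%:E)%E.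
    apply: eq_integral => x _; rewrite -chord_measure; congr (mu _); apply/seteqP; split => y.
      by rewrite /xsection/= inE pdiskE/= addrC.
    by rewrite /xsection/= inE pdiskE/= addrC.
  have -> : (\int[mu]_x (2 * Num.sqrt (1 - x ^+ 2))%:E =
     \int[mu]_(x in `[(-1)%R, 1%R]) (2 * Num.sqrt (1 - x ^+ 2))%:E)%E.
    rewrite [RHS]integral_mkcond; apply: eq_integral => x _; rewrite patchE.
    case: ifPn => //; rewrite notin_setE/= in_itv/= -ler_norml => /negP; rewrite -ltNge => x1.
    rewrite ler0_sqrtr ?mulr0// subr_le0 -real_normK ?num_real//.
    by rewrite exprn_ege1// ltW.
  under eq_integral do rewrite EFinM.
  rewrite ge0_integralZl//; last first.
    apply/measurable_EFinP; apply: measurable_funTS; apply: continuous_measurable_fun => x.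
    apply: (@cvg_comp _ _ _ (fun t : R => 1 - t ^+ 2) Num.sqrt _ (nbhs (1 - x ^+ 2))).
      by apply: cvgB; [exact: cvg_cst|exact: exprn_continuous].
    exact: sqrt_continuous.
  by rewrite int_half_circle -EFinM; congr _%:E; field.
Qed.

Lemma area_disk : (area (R := R) pdisk = 1)%E.
Proof.
have E := plane_area_disk.
rewrite /area/= /mscale/= E/= -EFinM mulVf//.
by rewrite gt_eqF// pi_gt0.
Qed.

Implicit Types (F G : C -> C) (z c : C).

Definition bdd (F : C -> C) : Prop := cmeasurable F /\
  exists M : R, forall z, disk z -> cnorm (F z) <= M.

Definition dint (F : C -> C) : Prop := cintegrable area pdisk (F \o plane).

Lemma disk0 : disk (0 : C).
Proof. by change (cnorm (0 : C) < 1); rewrite cnorm0. Qed.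

Lemma bdd_dint F : bdd F -> dint F.
Proof.
move=> [mF [M FM]]; apply: (@cintegrable_bounded _ _ _ area pdisk pdisk_measurable _ M) => //.
  exact: area_pdisk_lty.
by move=> p Dp; exact: FM.
Qed.

Lemma bdd_cst c : bdd (fun=> c).
Proof. by split; [exact: cmeasurable_cst|exists (cnorm c)]. Qed.

Lemma bdd_id : bdd (fun z => z).
Proof. by split; [exact: cmeasurable_id|exists 1 => z /ltW]. Qed.

Lemma bddD F G : bdd F -> bdd G -> bdd (fun z => F z + G z).
Proof.
move=> [mF [M FM]] [mG [N GN]]; split; first exact: cmeasurableD.
by exists (M + N) => z Dz; rewrite (le_trans (cnorm_le_add _ _))// lerD ?FM ?GN.
Qed.

Lemma bddM F G : bdd F -> bdd G -> bdd (fun z => F z * G z).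
Proof.
move=> [mF [M FM]] [mG [N GN]]; split; first exact: cmeasurableM.
by exists (M * N) => z Dz; rewrite cnormM ler_pM ?cnorm_ge0 ?FM ?GN.
Qed.

Lemma bdd_conj F : bdd F -> bdd (fun z => (F z)^*).
Proof.
move=> [mF [M FM]]; split; last by exists M => z Dz; rewrite cnorm_conj FM.
exact: (@cmeas_conj _ _ _ pdisk (F \o plane)).
Qed.

Lemma bddX F n : bdd F -> bdd (fun z => F z ^+ n).
Proof.
move=> bF; elim: n => [|n IH]; first exact: bdd_cst.
by have := bddM bF IH; congr bdd; apply/funext => z; rewrite exprS.
Qed.

Lemma bddB F G : bdd F -> bdd G -> bdd (fun z => F z - G z).
Proof.
move=> bF bG; have := bddD bF (bddM (bdd_cst (-1)) bG).
by congr bdd; apply/funext => z; rewrite mulN1r.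
Qed.

Definition chi (r : R) (z : C) : C := if cnorm z < r then 1 else 0.

Lemma plane_norm (p : R * R) (r : R) : 0 < r ->
  (cnorm (plane p) < r) = (p.1 ^+ 2 + p.2 ^+ 2 < r ^+ 2).
Proof.
move=> r0; rewrite cnormE/= -[X in _ < X](ger0_norm (ltW r0)) -sqrtr_sqr ltr_sqrt//.
by rewrite exprn_gt0.
Qed.

Lemma cmeasurable_chi r : 0 < r -> cmeasurable (chi r).
Proof.
move=> r0.
have m1 : measurable_fun setT (fun p : Rm * Rm => p.1 ^+ 2 + p.2 ^+ 2 < r ^+ 2).
  apply: measurable_fun_ltr; first exact: measurable_sqr_sum.
  exact: measurable_cst.
split.
  apply: (eq_measurable_fun (fun p : Rm * Rm => if p.1 ^+ 2 + p.2 ^+ 2 < r ^+ 2 then (1 : R) else 0)).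
    by move=> p _; rewrite /chi plane_norm//; case: ifP.
  by apply: measurable_funTS; apply: measurable_fun_ifT => //; exact: measurable_cst.
apply: (eq_measurable_fun (cst (0 : R))); last exact: measurable_cst.
by move=> p _; rewrite /chi; case: ifP.
Qed.

Lemma bdd_chi r : 0 < r -> bdd (chi r).
Proof.
move=> r0; split; first exact: cmeasurable_chi.
by exists 1 => z _; rewrite /chi; case: ifP; rewrite ?cnorm1 ?cnorm0.
Qed.

(** Fundamental theorem of calculus on the chord at height y; f vanishes at
    its two endpoints. *)
Lemma chord_int0 (f g : R -> R) (r y : R) : (forall x : R, is_derive x 1 f (g x)) ->
  continuous g -> (forall x, x ^+ 2 + y ^+ 2 = r -> f x = 0) ->
  (\int[mu]_x (if x ^+ 2 + y ^+ 2 < r then g x else 0)%:E = 0)%E.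
Proof.
move=> df cg f0.
pose A : set R := [set x : R | x ^+ 2 + y ^+ 2 < r].
have -> : (\int[mu]_x (if x ^+ 2 + y ^+ 2 < r then g x else 0)%:E =
   \int[mu]_(x in A) (g x)%:E)%E.
  rewrite [RHS]integral_mkcond; apply: eq_integral => x _; rewrite patchE.
  have -> : (x \in A) = (x ^+ 2 + y ^+ 2 < r) by apply/idP/idP; rewrite inE.
  by case: ifP.
rewrite /A chord_set; set s := Num.sqrt _.
have s0 : 0 <= s := sqrtr_ge0 _.
have [E|sn0] := eqVneq s 0.
  by rewrite E oppr0 set_itvoo0 integral_set0.
have ry : 0 < r - y ^+ 2 by rewrite -sqrtr_gt0 lt_def sn0.
have sE : s ^+ 2 = r - y ^+ 2 by rewrite sqr_sqrtr// ltW.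
have sNs : - s <= s by lra.
have mg (B : set Rm) : measurable_fun B (EFin \o g).
  by apply/measurable_EFinP; apply: measurable_funTS; exact: continuous_measurable_fun.
rewrite integral_itv_bndo_bndc; last by apply: mg.
rewrite integral_itv_obnd_cbnd; last by apply: mg.
have ii : mu.-integrable `[- s, s] (EFin \o g).
  apply: continuous_compact_integrable; first exact: segment_compact.
  exact: continuous_subspaceT.
have := Rint_FTC sNs df cg; rewrite /Rintegral !f0 ?sqrrN ?sE ?subrK// subr0 => h.
by rewrite -[LHS]fineK ?h//; exact: integrable_fin_num ii.
Qed.

(** Fubini's theorem, in whichever order of integration the inner integrals
    vanish. *)
Lemma area_int0 (h : R * R -> R) : measurable_fun (pdisk (R := R)) h ->
  (exists M : R, forall p, pdisk p -> `|h p| <= M) ->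
  (forall p, ~ pdisk p -> h p = 0) ->
  (forall y, (\int[mu]_x (h (x, y))%:E = 0)%E) \/
  (forall x, (\int[mu]_y (h (x, y))%:E = 0)%E) ->
  Rintegral area pdisk h = 0.
Proof.
move=> mh [M hM] h0 sec.
have hE : (EFin \o h) = (EFin \o h) \_ pdisk.
  apply/funext => p; rewrite patchE; case: ifPn => //.
  by rewrite notin_setE/= => /h0 ->.
have ih : mu2.-integrable pdisk (EFin \o h).
  apply: measurable_bounded_integrable => //; first exact: pdisk_measurable.
    by rewrite /= plane_area_disk ltry.
  exists M; split; first exact: num_real.
  by move=> x Mx p Dp /=; rewrite (le_trans (hM _ Dp))// ltW.
have ihT : mu2.-integrable setT (EFin \o h).
  by move/(integrable_mkcond _ (@pdisk_measurable R)): (ih); rewrite -hE.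
have I0 : (\int[mu2]_(p in pdisk) (h p)%:E = 0)%E.
  rewrite integral_mkcond -hE; case: sec => sec.
    rewrite -(@integral21_prod_meas1 _ _ _ _ R mu mu (EFin \o h) ihT).
    by rewrite /fubini_G; apply: integral0_eq => y _; exact: sec.
  rewrite -(@integral12_prod_meas1 _ _ _ _ R mu mu (EFin \o h) ihT).
  by rewrite /fubini_F; apply: integral0_eq => x _; exact: sec.
rewrite /Rintegral; suff -> : (\int[area]_(p in pdisk) (h p)%:E = 0)%E by [].
have md := @pdisk_measurable R.
have mE : measurable_fun (pdisk (R := R)) (EFin \o h) by exact/measurable_EFinP.
move: I0; rewrite integralE [in X in _ -> X]integralE.
rewrite !ge0_integral_mscale//; [|exact: measurable_funeneg|exact: measurable_funepos].
have fa := integrable_pos_fin_num md ih.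
have fb := integrable_neg_fin_num md ih.
set a := (X in (X - _)%E = _ -> _); set b := (X in (_ - X)%E = _ -> _).
move=> ab0; have E : a = b by rewrite -[a](@subeK _ a b)// ab0 add0e.
have key : (((NngNum (@invpi_ge0 R))%:num)%:E * a - ((NngNum (@invpi_ge0 R))%:num)%:E * b = 0)%E.
  by rewrite E subee// fin_numM.
exact: key.
Qed.

Lemma cintegralD F G : dint F -> dint G ->
  cintegral (fun z => F z + G z) = cintegral F + cintegral G.
Proof. exact: (cintD (@pdisk_measurable R)). Qed.

Lemma cintegralB F G : dint F -> dint G ->
  cintegral (fun z => F z - G z) = cintegral F - cintegral G.
Proof. exact: (cintB (@pdisk_measurable R)). Qed.

Lemma cintegralZ c F : dint F -> cintegral (fun z => c * F z) = c * cintegral F.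
Proof. exact: (cintZ (@pdisk_measurable R)). Qed.

Lemma cintegral_sum (I : Type) (r : seq I) (P : pred I) (F : I -> C -> C) :
  (forall i, P i -> dint (F i)) ->
  cintegral (fun z => \sum_(i <- r | P i) F i z) = \sum_(i <- r | P i) cintegral (F i).
Proof. exact: (cint_sum (@pdisk_measurable R)). Qed.

Lemma cintegral_conj F : dint F -> cintegral (fun z => (F z)^*) = (cintegral F)^*.
Proof. exact: (cint_conj (@pdisk_measurable R)). Qed.

Lemma eq_cintegral F G : (forall z, disk z -> F z = G z) -> cintegral F = cintegral G.
Proof.
by move=> FG; apply: (@eq_cint _ _ _ area pdisk) => p; rewrite inE => Dp; exact: FG.
Qed.

Lemma dintB F G : dint F -> dint G -> dint (fun z => F z - G z).
Proof. exact: (cintegrableB (@pdisk_measurable R)). Qed.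

Lemma dintZ c F : dint F -> dint (fun z => c * F z).
Proof. exact: (cintegrableZ (@pdisk_measurable R)). Qed.

Lemma dint_sum (I : Type) (r : seq I) (P : pred I) (F : I -> C -> C) :
  (forall i, P i -> dint (F i)) -> dint (fun z => \sum_(i <- r | P i) F i z).
Proof. exact: (cintegrable_sum (@pdisk_measurable R)). Qed.

Lemma cintegral_bound F (M : R) : dint F -> 0 <= M ->
  (forall z, disk z -> cnorm (F z) <= M) -> cnorm (cintegral F) <= 2 * M.
Proof.
move=> iF M0 FM; have := @cint_bound _ _ _ area pdisk pdisk_measurable (F \o plane) M.
have -> : fine (area (R := R) pdisk) = 1 by rewrite area_disk.
rewrite mulr1; apply => //; first exact: area_pdisk_lty.
by move=> p Dp; exact: FM.
Qed.

Lemma cder_conj (F : R -> C) x c : cder F x c -> cder (fun t => (F t)^*) x c^*.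
Proof.
have cRe z : Re z = Re z^* by case: z.
have cIm z : - Im z = Im z^* by case: z.
move=> [d1 d2]; split.
  apply: (is_derive_eq _ (cRe c)); move: d1; congr (is_derive x 1 _ _).
  by apply/funext => t; exact: cRe.
apply: (is_derive_eq _ (cIm c)); move: (is_deriveN d2); congr (is_derive x 1 _ _).
by apply/funext => t; exact: cIm.
Qed.

Section Green.
Variables (r : R) (r01 : 0 < r <= 1) (n m : nat).
Let rr : C := (r ^+ 2)%:C%C.
Let G z : C := (rr - z * z^*) * (z ^+ n * z^* ^+ m).
(* P and Q are the derivatives of G in z and in conj(z) *)
Let P z : C := - z^* * (z ^+ n * z^* ^+ m) +
  (rr - z * z^*) * (n%:R * z ^+ n.-1 * z^* ^+ m).
Let Q z : C := - z * (z ^+ n * z^* ^+ m) +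
  (rr - z * z^*) * (z ^+ n * (m%:R * z^* ^+ m.-1)).

Let cder_G (g : R -> C) x c : cder g x c -> cder (fun t => G (g t)) x (c * P (g x) + c^* * Q (g x)).
Proof.
move=> dg; have dgc := cder_conj dg.
apply: cder_eq (cderM (cderB (cder_cst rr x) (cderM dg dgc)) (cderM (cderX n dg) (cderX m dgc))) _.
by rewrite /P /Q /=; ring.
Qed.

Let bddP : bdd P.
Proof.
have b1 := bdd_id; have b2 := bdd_conj bdd_id.
apply: bddD.
  apply: bddM; last by apply: bddM; exact: bddX.
  by have := bddB (bdd_cst 0) b2; congr bdd; apply/funext => z; rewrite sub0r.
apply: bddM; first by apply: bddB; [exact: bdd_cst|exact: bddM].
by apply: bddM; [apply: bddM; [exact: bdd_cst|exact: bddX]|exact: bddX].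
Qed.

Let bddQ : bdd Q.
Proof.
have b1 := bdd_id; have b2 := bdd_conj bdd_id.
apply: bddD.
  apply: bddM; last by apply: bddM; exact: bddX.
  by have := bddB (bdd_cst 0) b1; congr bdd; apply/funext => z; rewrite sub0r.
apply: bddM; first by apply: bddB; [exact: bdd_cst|exact: bddM].
by apply: bddM; [exact: bddX|apply: bddM; [exact: bdd_cst|exact: bddX]].
Qed.

Let vanish (z : C) : cnorm z ^+ 2 = r ^+ 2 -> G z = 0.
Proof. by move=> h; rewrite /G mul_conj h subrr mul0r. Qed.

Let ccontG (g : R -> C) c : (forall x, cder g x c) ->
  forall x, ccont (fun t => c * P (g t) + c^* * Q (g t)) x.
Proof.
move=> dg x; have dgx := dg x; have dgc := cder_conj dgx.
have d1 := cderB (cder_cst rr x) (cderM dgx dgc).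
have dn := cderX n dgx; have dm := cderX m dgc.
have d2 := cderM (cderM (cder_cst n%:R x) (cderX n.-1 dgx)) dm.
have d3 := cderM dn (cderM (cder_cst m%:R x) (cderX m.-1 dgc)).
have dP := cderD (cderM (cderN dgc) (cderM dn dm)) (cderM d1 d2).
have dQ := cderD (cderM (cderN dgx) (cderM dn dm)) (cderM d1 d3).
exact: cder_ccont (cderD (cderM (cder_cst c x) dP) (cderM (cder_cst c^* x) dQ)).
Qed.

Let green_dir (c : C) : (c = 1 \/ c = 'i%C) ->
  cintegral (fun z => chi r z * (c * P z + c^* * Q z)) = 0.
Proof.
move/andP: r01 => [r0 r1] cE.
have bF : bdd (fun z => chi r z * (c * P z + c^* * Q z)).
  apply: bddM; first exact: bdd_chi.
  by apply: bddD; apply: bddM => //; exact: bdd_cst.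
have [mF [M FM]] := bF.
have out (p : R * R) : ~ pdisk p -> chi r (plane p) = 0.
  move=> nD; rewrite /chi ifN//; apply/negP => h; apply: nD.
  exact: lt_le_trans h r1.
have dx (y x : R) : cder (fun x => plane (x, y)) x 1.
  by split; [exact: is_derive_id|exact: is_derive_cst].
have dy (x y : R) : cder (fun y => plane (x, y)) y 'i%C.
  by split; [exact: is_derive_cst|exact: is_derive_id].
have norm2 (x y : R) : cnorm (plane (x, y)) ^+ 2 = x ^+ 2 + y ^+ 2 by rewrite sqr_cnorm.
have sec (T : C -> R) (T0 : T 0 = 0) (g : R -> C) (a : R) :
   (forall (F : R -> C) (x : R) (d : C), cder F x d -> is_derive x 1 (fun t => T (F t)) (T d)) ->
   (forall (F : R -> C) (x : R), ccont F x -> T (F t) @[t --> x] --> T (F x)) ->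
   (forall x, cder g x c) -> (forall x, cnorm (g x) ^+ 2 = x ^+ 2 + a ^+ 2) ->
   (\int[mu]_x (T (chi r (g x) * (c * P (g x) + c^* * Q (g x))))%:E = 0)%E.
  move=> dT cT dg ng.
  have -> : (0 = \int[mu]_x (if x ^+ 2 + a ^+ 2 < r ^+ 2 then T (c * P (g x) + c^* * Q (g x)) else 0)%:E)%E.
    apply/esym/(@chord_int0 (fun x => T (G (g x)))).
    + by move=> x; apply: dT; exact: cder_G.
    + by move=> x; apply: (cT (fun t => c * P (g t) + c^* * Q (g t))); exact: ccontG.
    + by move=> x; rewrite -ng => /vanish ->.
  apply: eq_integral => x _; rewrite -ng /chi -(@ltr_pXn2r _ 2)// ?nnegrE ?cnorm_ge0 ?(ltW r0)//.
  by case: ifP => _; rewrite ?mul1r// mul0r T0.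
have secRe g a := @sec (@complex.Re R) erefl g a (fun (F : R -> C) x d h => h.1) (fun (F : R -> C) x h => h.1).
have secIm g a := @sec (@complex.Im R) erefl g a (fun (F : R -> C) x d h => h.2) (fun (F : R -> C) x h => h.2).
apply: complex_eq; rewrite /cintegral/=.
  apply: area_int0; [exact: mF.1| | |].
  - by exists M => p Dp; rewrite (le_trans (ler_Re _))// FM.
  - by move=> p nD; rewrite out// mul0r.
  case: cE => cE; [left => y|right => x].
    by apply: (secRe (fun x => plane (x, y)) y) => x; rewrite ?cE// norm2.
  by apply: (secRe (fun y => plane (x, y)) x) => y; rewrite ?cE// norm2 addrC.
apply: area_int0; [exact: mF.2| | |].
- by exists M => p Dp; rewrite (le_trans (ler_Im _))// FM.
- by move=> p nD; rewrite out// mul0r.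
case: cE => cE; [left => y|right => x].
  by apply: (secIm (fun x => plane (x, y)) y) => x; rewrite ?cE// norm2.
by apply: (secIm (fun y => plane (x, y)) x) => y; rewrite ?cE// norm2 addrC.
Qed.

Definition mom (a b : nat) : C := cintegral (fun z => chi r z * (z ^+ a * z^* ^+ b)).

Let dmom a b : dint (fun z => chi r z * (z ^+ a * z^* ^+ b)).
Proof.
have [r0 _] := andP r01; apply: bdd_dint; apply: bddM; first exact: bdd_chi.
by apply: bddM; apply: bddX; [exact: bdd_id|exact: bdd_conj bdd_id].
Qed.

(** G = (r^2 - |z|^2) z^n conj(z)^m vanishes on the circle of radius r, so
    the integrals over the disk of its derivatives in x and in y are 0
    ([green_dir] with c = 1 and c = i); hence so is that of its derivative P
    in z. Expanding P gives the recursion. *)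
Lemma mom_green : n.+1%:R * mom n m.+1 = n%:R * rr * mom n.-1 m.
Proof.
have [r0 _] := andP r01.
have dP : dint (fun z => chi r z * P z) by apply: bdd_dint; apply: bddM => //; exact: bdd_chi.
have dQ : dint (fun z => chi r z * Q z) by apply: bdd_dint; apply: bddM => //; exact: bdd_chi.
have e1 := green_dir (or_introl (erefl _)); have e2 := green_dir (or_intror (erefl _)).
have i1 : ('i%C : C)^* = - 'i%C by apply: complex_eq; rewrite /= ?oppr0.
rewrite (@eq_cintegral _ (fun z => chi r z * P z + chi r z * Q z)) in e1; last first.
  by move=> z _; rewrite conjC1 !mul1r mulrDr.
rewrite (@eq_cintegral _ (fun z => 'i%C * (chi r z * P z) - 'i%C * (chi r z * Q z))) in e2; last first.
  by move=> z _; rewrite i1; ring.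
rewrite cintegralD// in e1; rewrite cintegralB ?cintegralZ// in e2; try exact: dintZ.
have i0 : ('i%C : C) != 0.
  by rewrite -cnorm_eq0 /= expr0n/= add0r expr1n sqrtr1 oner_eq0.
have P0 : cintegral (fun z => chi r z * P z) = 0.
  have h2 : cintegral (fun z => chi r z * P z) = cintegral (fun z => chi r z * Q z).
    by apply: (mulfI i0); apply/eqP; rewrite -subr_eq0; apply/eqP.
  rewrite -h2 -mulr2n in e1.
  by apply/eqP; have /eqP := e1; rewrite mulrn_eq0.
move: P0; rewrite (@eq_cintegral _ (fun z => n%:R * rr * (chi r z * (z ^+ n.-1 * z^* ^+ m)) -
    n.+1%:R * (chi r z * (z ^+ n * z^* ^+ m.+1)))); last first.
  move=> z _; rewrite /P; case: (n) => [|k]; rewrite ?mulr0n/= ?exprS -?natr1; ring.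
rewrite cintegralB ?cintegralZ//; try exact: dintZ.
by move/eqP; rewrite subr_eq0 => /eqP ->.
Qed.

End Green.

End DiskMeasure.

(** * Moments of disks *)
Section Moments.
Context {R : realType}.
Local Notation C := R[i].
Local Notation Re := complex.Re.
Local Notation Im := complex.Im.
Implicit Types (r : R) (n m : nat).

Lemma bdd_mono n m : bdd (fun z : C => z ^+ n * z^* ^+ m).
Proof. by apply: bddM; apply: bddX; [exact: bdd_id|exact: bdd_conj bdd_id]. Qed.

Lemma chi_conj r (z : C) : (chi r z)^* = chi r z.
Proof. by rewrite /chi; case: ifP; rewrite ?conjC1 ?conjC0. Qed.

Lemma chi1 (z : C) : disk z -> chi 1 z = 1.
Proof. by rewrite /chi /disk/= => ->. Qed.

Lemma dmom r n m : 0 < r -> dint (fun z : C => chi r z * (z ^+ n * z^* ^+ m)).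
Proof. by move=> r0; apply: bdd_dint; apply: bddM; [exact: bdd_chi|exact: bdd_mono]. Qed.

Lemma mom_conj r n m : 0 < r -> mom r m n = (mom r n m)^*.
Proof.
move=> r0; rewrite /mom -cintegral_conj; last exact: dmom.
by apply: eq_cintegral => z _; rewrite !rmorphM/= chi_conj !rmorphXn/= conjCK [_ ^+ m * _]mulrC.
Qed.

Lemma mom_step r n m : 0 < r <= 1 ->
  mom r n.+1 m.+1 = n.+1%:R / n.+2%:R * (r ^+ 2)%:C%C * mom r n m.
Proof.
move=> r01; have /= := mom_green r01 n.+1 m => h.
have n0 : (n.+2%:R : C) != 0 by rewrite pnatr_eq0.
by apply: (mulfI n0); rewrite h; field.
Qed.

(** Each step of the recursion lowers both exponents, until one of them is
    0. *)
Lemma mom_off r n m : 0 < r <= 1 -> n != m -> mom r n m = 0.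
Proof.
move=> r01; have r0 : 0 < r by case/andP: r01.
have lt a b : (a < b)%N -> mom r a b = 0.
  elim: a b => [|a IH] [|b]//=.
    by move=> _; have := mom_green r01 0 b; rewrite !mul0r mul1r.
  by rewrite ltnS => /IH E; rewrite mom_step// E mulr0.
rewrite neq_ltn => /orP[/lt//|/lt E].
by rewrite mom_conj// E conjC0.
Qed.

Lemma mom_diag r n : 0 < r <= 1 -> mom r n n = (r ^+ (2 * n))%:C%C / n.+1%:R * mom r 0 0.
Proof.
move=> r01; elim: n => [|n IH]; first by rewrite muln0 expr0 divr1 mul1r.
rewrite mom_step// IH mulnS exprD real_complexM.
have h1 : (n.+1%:R : C) != 0 by rewrite pnatr_eq0.
have h2 : (n.+2%:R : C) != 0 by rewrite pnatr_eq0.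
move: (n.+1%:R : C) (n.+2%:R : C) h1 h2 (_%:C%C) (_%:C%C) => a b h1 h2 c d.
by field; rewrite h1 h2.
Qed.

Lemma mom00 : mom 1 0 0 = 1 :> C.
Proof.
rewrite /mom (@eq_cintegral _ _ (fun=> 1)); last first.
  by move=> z /chi1 ->; rewrite !expr0 !mulr1.
apply: complex_eq; rewrite /cintegral /=; last by rewrite /Rintegral integral0.
rewrite Rintegral_cst; last exact: pdisk_measurable.
by rewrite area_disk mulr1.
Qed.

Lemma mom_full n m : cintegral (fun z : C => z ^+ n * z^* ^+ m) = (n == m)%:R / n.+1%:R.
Proof.
transitivity (mom (1 : R) n m).
  by apply: eq_cintegral => z /chi1 ->; rewrite mul1r.
have r01 : 0 < (1 : R) <= 1 by rewrite ltr01 lexx.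
have [<-|nm] := eqVneq n m; last by rewrite mom_off// mul0r.
by rewrite mom_diag// mom00 expr1n mulr1.
Qed.

(** The disk of radius r contains a square. *)
Lemma mom00_neq0 r : 0 < r <= 1 -> mom r 0 0 != 0 :> C.
Proof.
move=> /andP[r0 r1].
pose s := r / 2.
have s0 : 0 < s by rewrite divr_gt0.
pose A : set (measurableTypeR R * measurableTypeR R) := `[-s, s] `*` `[-s, s].
have mA : measurable A by apply: measurableX; exact: measurable_itv.
have inA p : A p -> cnorm (plane p) < r.
  rewrite plane_norm//; case: p => x y; rewrite /A/= !in_itv/= -!ler_norml => -[xs ys].
  have h t : `|t| <= s -> t ^+ 2 <= s ^+ 2.
    by move=> ts; rewrite -real_normK ?num_real// lerXn2r ?nnegrE// ltW.
  apply: (le_lt_trans (lerD (h _ xs) (h _ ys))).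
  rewrite /s expr_div_n; have := exprn_gt0 2 r0; lra.
have AD : A `<=` pdisk by move=> p /inA h; exact: lt_le_trans h r1.
have aA : (0 < area A)%E.
  rewrite /area/= /mscale/= /A product_measure1E; try exact: measurable_itv.
  have E : lebesgue_measure (`[- s, s]%classic : set R) = (s + s)%:E.
    by rewrite lebesgue_measure_itv /= lte_fin gtrN // -EFinB opprK.
  rewrite [X in (_ < _ * (X * X))%E]E -!EFinM lte_fin.
  by rewrite mulr_gt0 ?invr_gt0 ?pi_gt0// mulr_gt0// addr_gt0.
have mch := (@cmeasurable_chi R r r0).1.
have h0 (z : C) : 0 <= Re (chi r z) by rewrite /chi; case: ifP => _ /=.
suff : 0 < Re (mom r 0 0).
  by apply: contraPneq => ->; rewrite /= ltxx.
have -> : mom r 0 0 = cintegral (chi r) by apply: eq_cintegral => z _; rewrite !expr0 !mulr1.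
rewrite /cintegral /= /Rintegral fine_gt0//; apply/andP; split; last first.
  apply: (le_lt_trans (y := (\int[area]_(p in pdisk) cst 1%E p)%E)).
    apply: ge0_le_integral => //.
    - exact: pdisk_measurable.
    - by move=> p _; rewrite lee_fin.
    - exact/measurable_EFinP.
    - by move=> p _; rewrite lee_fin /chi; case: ifP.
  rewrite integral_cst; last exact: pdisk_measurable.
  by rewrite area_disk mule1 ltry.
apply: (lt_le_trans aA).
have -> : area A = (\int[area]_(p in A) (Re (chi r (plane p)))%:E)%E.
  rewrite (@eq_integral _ _ _ _ _ (cst 1%E)); first by rewrite integral_cst// mul1e.
  by move=> p; rewrite inE => /inA h; rewrite /chi h.
apply: ge0_subset_integral => //; first exact: pdisk_measurable.
- exact/measurable_EFinP.
- by move=> p _; rewrite lee_fin.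
Qed.

End Moments.

(** * Square-integrable functions *)
Section SquareIntegrable.
Context {R : realType}.
Local Notation C := R[i].
Local Notation Re := complex.Re.
Local Notation Im := complex.Im.
Local Notation sqi := (@square_integrable R).
Local Notation mD := (@pdisk_measurable R).
Implicit Types (F G H : C -> C) (c : C) (n m N : nat).

Definition ip F G : C := cintegral (fun z => F z * (G z)^*).

Definition N2 F : R := Rintegral area pdisk (fun p => cnorm (F (plane p)) ^+ 2).

Definition nrm F : R := Num.sqrt (N2 F).

Lemma sqi_bdd F : bdd F -> sqi F.
Proof.
move=> [mF [M FM]]; split=> //.
apply: measurable_bounded_integrable => //; first exact: pdisk_measurable.
- exact: area_pdisk_lty.
- exact: measurable_sqr_cnorm.
exists (M ^+ 2); split; first exact: num_real.
move=> x Mx p Dp; rewrite /= ger0_norm ?sqr_ge0// (le_trans _ (ltW Mx))//.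
by rewrite lerXn2r ?nnegrE ?cnorm_ge0 ?FM// (le_trans _ (FM _ Dp)) ?cnorm_ge0.
Qed.

Lemma cmul_le_sqr c c' : cnorm (c * c') <= cnorm c ^+ 2 + cnorm c' ^+ 2.
Proof.
rewrite cnormM; have := sqr_ge0 (cnorm c - cnorm c').
have := mulr_ge0 (cnorm_ge0 c) (cnorm_ge0 c'); rewrite sqrrB.
set a := cnorm c; set b := cnorm c'; move: a b => a b; lra.
Qed.

Lemma sqi_dint F G : sqi F -> sqi G -> dint (fun z => F z * G z).
Proof.
move=> [mF iF] [mG iG]; have iFG := integrableD mD iF iG.
have [m1 m2] := cmeasurableM mF mG.
split; apply: (le_integrable mD _ _ iFG); [exact/measurable_EFinP| |exact/measurable_EFinP|].
  move=> p Dp /=; rewrite lee_fin [leRHS]ger0_norm ?addr_ge0 ?sqr_ge0//.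
  exact: le_trans (ler_Re _) (cmul_le_sqr _ _).
move=> p Dp /=; rewrite lee_fin [leRHS]ger0_norm ?addr_ge0 ?sqr_ge0//.
exact: le_trans (ler_Im _) (cmul_le_sqr _ _).
Qed.

Lemma eq_sqi F G : (forall z, disk z -> F z = G z) -> sqi F -> sqi G.
Proof.
move=> FG [[m1 m2] iF]; split; first split.
- by apply: eq_measurable_fun m1 => p; rewrite inE => Dp; rewrite FG.
- by apply: eq_measurable_fun m2 => p; rewrite inE => Dp; rewrite FG.
by apply: (eq_integrable mD) iF => p; rewrite inE => Dp; rewrite FG.
Qed.

Lemma sqi_conj F : sqi F -> sqi (fun z => (F z)^*).
Proof.
move=> [mF iF]; split; first exact: (@cmeas_conj _ _ _ pdisk (F \o plane)).
by apply: (eq_integrable mD) iF => p _; rewrite cnorm_conj.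
Qed.

Lemma sqiD F G : sqi F -> sqi G -> sqi (fun z => F z + G z).
Proof. exact: square_integrableD. Qed.

Lemma sqiZ c F : sqi F -> sqi (fun z => c * F z).
Proof. exact: square_integrableZ. Qed.

Lemma sqiB F G : sqi F -> sqi G -> sqi (fun z => F z - G z).
Proof.
by move=> iF iG; apply: eq_sqi (sqiD iF (sqiZ (-1) iG)) => z _; rewrite mulN1r.
Qed.

Lemma sqi_sum (I : Type) (r : seq I) (P : pred I) (F : I -> C -> C) :
  (forall i, P i -> sqi (F i)) -> sqi (fun z => \sum_(i <- r | P i) F i z).
Proof.
move=> h; elim: r => [|i r IH].
  by apply: eq_sqi (sqi_bdd (bdd_cst 0)) => z _; rewrite big_nil.
have [Pi|nPi] := boolP (P i).
  by apply: eq_sqi (sqiD (h i Pi) IH) => z _; rewrite big_cons Pi.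
by apply: eq_sqi IH => z _; rewrite big_cons (negbTE nPi).
Qed.

Lemma sqi_mono n : sqi (fun z => z ^+ n).
Proof. by apply: sqi_bdd; apply: bddX; exact: bdd_id. Qed.

Lemma sqi_ip F G : sqi F -> sqi G -> dint (fun z => F z * (G z)^*).
Proof. by move=> iF iG; apply: sqi_dint => //; exact: sqi_conj. Qed.

Lemma eq_ip F F' G G' : (forall z, disk z -> F z = F' z) ->
  (forall z, disk z -> G z = G' z) -> ip F G = ip F' G'.
Proof. by move=> h1 h2; apply: eq_cintegral => z Dz; rewrite h1// h2. Qed.

Lemma eq_N2 F G : (forall z, disk z -> F z = G z) -> N2 F = N2 G.
Proof. by move=> h; apply: eq_Rintegral => p; rewrite inE => Dp; rewrite h. Qed.

Lemma N2_ge0 F : 0 <= N2 F.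
Proof. by apply: Rintegral_ge0 => p _; exact: sqr_ge0. Qed.

Lemma nrm_ge0 F : 0 <= nrm F. Proof. exact: sqrtr_ge0. Qed.

Lemma sqr_nrm F : nrm F ^+ 2 = N2 F. Proof. by rewrite sqr_sqrtr// N2_ge0. Qed.

Lemma ip_self F : ip F F = (N2 F)%:C%C.
Proof.
rewrite /ip /cintegral; apply: complex_eq => /=.
  by apply: eq_Rintegral => p _; rewrite mul_conj.
rewrite (@eq_Rintegral _ _ _ _ _ (cst 0)); first by rewrite /Rintegral integral0.
by move=> p _; rewrite mul_conj.
Qed.

Lemma ipC F G : sqi F -> sqi G -> ip G F = (ip F G)^*.
Proof.
move=> iF iG; rewrite /ip -cintegral_conj; last exact: sqi_ip.
by apply: eq_cintegral => z _; rewrite rmorphM/= conjCK mulrC.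
Qed.

Lemma ipDl F G H : sqi F -> sqi G -> sqi H ->
  ip (fun z => F z + G z) H = ip F H + ip G H.
Proof.
move=> iF iG iH; rewrite /ip -cintegralD; [|exact: sqi_ip..].
by apply: eq_cintegral => z _; rewrite mulrDl.
Qed.

Lemma ipZl c F G : sqi F -> sqi G -> ip (fun z => c * F z) G = c * ip F G.
Proof.
move=> iF iG; rewrite /ip -cintegralZ; last exact: sqi_ip.
by apply: eq_cintegral => z _; rewrite mulrA.
Qed.

Lemma ipBl F G H : sqi F -> sqi G -> sqi H ->
  ip (fun z => F z - G z) H = ip F H - ip G H.
Proof.
move=> iF iG iH; rewrite /ip -cintegralB; [|exact: sqi_ip..].
by apply: eq_cintegral => z _; rewrite mulrBl.
Qed.

Lemma ipBr F G H : sqi F -> sqi G -> sqi H ->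
  ip F (fun z => G z - H z) = ip F G - ip F H.
Proof.
move=> iF iG iH; rewrite /ip -cintegralB; [|exact: sqi_ip..].
by apply: eq_cintegral => z _; rewrite rmorphB mulrBr.
Qed.

Lemma ipDr F G H : sqi F -> sqi G -> sqi H ->
  ip F (fun z => G z + H z) = ip F G + ip F H.
Proof.
move=> iF iG iH; rewrite /ip -cintegralD; [|exact: sqi_ip..].
by apply: eq_cintegral => z _; rewrite rmorphD mulrDr.
Qed.

Lemma ipZr c F G : sqi F -> sqi G -> ip F (fun z => c * G z) = c^* * ip F G.
Proof.
move=> iF iG; rewrite /ip -cintegralZ; last exact: sqi_ip.
by apply: eq_cintegral => z _; rewrite rmorphM mulrCA.
Qed.

Lemma ip_suml (I : Type) (r : seq I) (P : pred I) (F : I -> C -> C) G :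
  (forall i, sqi (F i)) -> sqi G ->
  ip (fun z => \sum_(i <- r | P i) F i z) G = \sum_(i <- r | P i) ip (F i) G.
Proof.
move=> iF iG; rewrite /ip -cintegral_sum; last by move=> i _; exact: sqi_ip.
by apply: eq_cintegral => z _; rewrite mulr_suml.
Qed.

Lemma ip_sumr (I : Type) (r : seq I) (P : pred I) F (G : I -> C -> C) :
  (forall i, sqi (G i)) -> sqi F ->
  ip F (fun z => \sum_(i <- r | P i) G i z) = \sum_(i <- r | P i) ip F (G i).
Proof.
move=> iG iF; rewrite /ip -cintegral_sum; last by move=> i _; exact: sqi_ip.
by apply: eq_cintegral => z _; rewrite rmorph_sum mulr_sumr.
Qed.

Lemma N2Z c F : sqi F -> N2 (fun z => c * F z) = cnorm c ^+ 2 * N2 F.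
Proof.
move=> iF; have := ip_self (fun z => c * F z).
rewrite ipZl ?ipZr ?ip_self//; last exact: sqiZ.
by rewrite mulrA mul_conj -real_complexM => /(congr1 (@complex.Re R)).
Qed.

Lemma N2_addE F G : sqi F -> sqi G ->
  N2 (fun z => F z + G z) = N2 F + 2 * Re (ip F G) + N2 G.
Proof.
move=> iF iG; have := ip_self (fun z => F z + G z); have iFG := sqiD iF iG.
rewrite ipDl// !ipDr// !ip_self [ip G F]ipC// => /(congr1 (@complex.Re R)).
rewrite !ReD /= => <-.
ring.
Qed.

(** N2 (s F - <F,G> G) is nonnegative for every real s; this also covers N2
    G = 0. *)
Lemma cauchy_schwarz F G : sqi F -> sqi G -> cnorm (ip F G) ^+ 2 <= N2 F * N2 G.
Proof.
move=> iF iG; set a := ip F G.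
have key (s : R) : 0 <= s ^+ 2 * N2 F - 2 * s * cnorm a ^+ 2 + cnorm a ^+ 2 * N2 G.
  have := N2_ge0 (fun z => s%:C%C * F z + (- a) * G z).
  rewrite N2_addE; [|exact: sqiZ..].
  rewrite !N2Z// ipZl//; last exact: sqiZ.
  rewrite ipZr// cnormN cnorm_real real_normK ?num_real// -/a.
  rewrite rmorphN mulNr mulrN [a^* * a]mulrC mul_conj -real_complexM ReN /= => h.
  by apply: le_trans h _; rewrite le_eqVlt; apply/orP; left; apply/eqP; ring.
have n0 := N2_ge0 F; have := N2_ge0 G; have a0 := sqr_ge0 (cnorm a).
move: (cnorm a ^+ 2) (N2 F) (N2 G) key n0 a0 => q f g key f0 q0.
rewrite le_eqVlt => /predU1P[g0|g0].
  rewrite -g0 mulr0 leNgt; apply/negP => q1.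
  have := key (q / (f + 1)); rewrite -g0 mulr0 addr0 subr_ge0.
  have f1 : 0 < f + 1 by lra.
  have -> : (q / (f + 1)) ^+ 2 * f = (q ^+ 2 / (f + 1)) * (f / (f + 1)) by field; lra.
  have -> : 2 * (q / (f + 1)) * q = (q ^+ 2 / (f + 1)) * 2 by field; lra.
  have q2 : 0 < q ^+ 2 / (f + 1) by rewrite divr_gt0 ?exprn_gt0.
  by rewrite ler_pM2l// ler_pdivlMr//; lra.
have := key g; have -> : g ^+ 2 * f - 2 * g * q + q * g = g * (f * g - q) by ring.
by rewrite pmulr_rge0// subr_ge0.
Qed.

Lemma ip_le_nrm F G : sqi F -> sqi G -> cnorm (ip F G) <= nrm F * nrm G.
Proof.
move=> iF iG; rewrite -(@ler_pXn2r _ 2)// ?nnegrE ?mulr_ge0 ?nrm_ge0 ?cnorm_ge0//.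
by rewrite exprMn !sqr_nrm cauchy_schwarz.
Qed.

Lemma nrmD F G : sqi F -> sqi G -> nrm (fun z => F z + G z) <= nrm F + nrm G.
Proof.
move=> iF iG; rewrite -(@ler_pXn2r _ 2)// ?nnegrE ?addr_ge0 ?nrm_ge0//.
rewrite sqr_nrm N2_addE// sqrrD !sqr_nrm lerD2r lerD2l -[leRHS]mulr_natl.
have h := le_trans (ler_norm _) (le_trans (ler_Re _) (ip_le_nrm iF iG)).
by rewrite ler_wpM2l.
Qed.

Lemma nrmZ c F : sqi F -> nrm (fun z => c * F z) = cnorm c * nrm F.
Proof.
by move=> iF; rewrite /nrm N2Z// sqrtrM ?sqr_ge0// sqrtr_sqr ger0_norm ?cnorm_ge0.
Qed.

(** Fatou's lemma for the squared moduli. *)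
Lemma fatou_sqi (F_ : nat -> C -> C) F (B : R) : (forall n, sqi (F_ n)) ->
  (forall n, N2 (F_ n) <= B) ->
  (forall z, disk z -> cnorm (F_ n z - F z) @[n --> \oo] --> (0 : R)) ->
  sqi F /\ N2 F <= B.
Proof.
move=> iF FB cF.
have mF : cmeasurable F.
  apply: (@cmeas_lim _ _ _ pdisk (fun n => F_ n \o plane)) => [n|p Dp]; first exact: (iF n).1.
  exact: cF.
have cF2 p : pdisk p -> cnorm (F_ n (plane p)) ^+ 2 @[n --> \oo] --> cnorm (F (plane p)) ^+ 2.
  move=> Dp; rewrite expr2; under eq_fun do rewrite expr2.
  suff h : cnorm (F_ n (plane p)) @[n --> \oo] --> cnorm (F (plane p)) by exact: cvgM.
  apply/cvgrPdist_le => e e0; near=> n.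
  apply: (@le_trans _ _ (cnorm (F_ n (plane p) - F (plane p)))).
    rewrite ler_norml lerNl opprB cnorm_le_sub/= cnormBC; exact: cnorm_le_sub.
  near: n; have /cvgr0Pnorm_le/(_ _ e0) := cF _ Dp.
  by apply: filterS => n /=; rewrite ger0_norm ?cnorm_ge0.
have fat := @fatou _ _ _ area pdisk mD (fun n p => (cnorm (F_ n (plane p)) ^+ 2)%:E).
have IB : (\int[area]_(p in pdisk) (cnorm (F (plane p)) ^+ 2)%:E <= B%:E)%E.
  have -> : (\int[area]_(p in pdisk) (cnorm (F (plane p)) ^+ 2)%:E =
     \int[area]_(p in pdisk) limn_einf (fun n => (cnorm (F_ n (plane p)) ^+ 2)%:E))%E.
    apply: eq_integral => p; rewrite inE => Dp; apply/esym.
    have c : (cnorm (F_ n (plane p)) ^+ 2)%:E @[n --> \oo] --> (cnorm (F (plane p)) ^+ 2)%:E.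
      by apply: cvg_EFin; [exact: nearW|exact: cF2].
    rewrite is_cvg_limn_einfE; last by apply: cvgP c.
    exact/cvg_lim.
  apply: le_trans; first apply: fat.
  - by move=> n; apply/measurable_EFinP; exact: measurable_sqr_cnorm (iF n).1.
  - by move=> n p _; rewrite lee_fin sqr_ge0.
  rewrite limn_einf_lim; apply: lime_le; first exact: is_cvg_einfs.
  apply: nearW => n; apply: ereal_inf_le; exists (N2 (F_ n))%:E; last by rewrite lee_fin.
  exists n => //=; rewrite /N2 /Rintegral fineK//.
  exact: (integrable_fin_num mD (iF n).2).
have I0 : (0 <= \int[area]_(p in pdisk) (cnorm (F (plane p)) ^+ 2)%:E)%E.
  by apply: integral_ge0 => p _; rewrite lee_fin sqr_ge0.
have I : ((\int[area]_(p in pdisk) (cnorm (F (plane p)) ^+ 2)%:E)%E \is a fin_num).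
  by rewrite ge0_fin_numE// (le_lt_trans IB)// ltry.
split; last by rewrite -lee_fin /N2 /Rintegral fineK.
split=> //; apply/integrableP; split; first by apply/measurable_EFinP; exact: measurable_sqr_cnorm.
apply: (le_lt_trans _ (ltry B)); apply: (le_trans _ IB).
rewrite le_eqVlt; apply/orP; left; apply/eqP; apply: eq_integral => p _.
by rewrite /= ger0_norm ?sqr_ge0.
Unshelve. all: by end_near. Qed.

Definition psum (c : nat -> C) N (z : C) : C := \sum_(n < N) c n * z ^+ n.

Lemma sqi_psum (c : nat -> C) N : sqi (psum c N).
Proof. by apply: sqi_sum => i _; apply: sqiZ; exact: sqi_mono. Qed.

Lemma ip_mono n m : ip (fun z => z ^+ n) (fun z => z ^+ m) = (n == m)%:R / n.+1%:R.
Proof.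
by rewrite -mom_full; apply: eq_cintegral => z _; rewrite rmorphXn.
Qed.

Lemma ip_psumr F (c : nat -> C) N : sqi F ->
  ip F (psum c N) = \sum_(n < N) (c n)^* * ip F (fun z => z ^+ n).
Proof.
move=> iF; rewrite /psum ip_sumr//; last by move=> i; apply: sqiZ; exact: sqi_mono.
by apply: eq_bigr => i _; rewrite ipZr//; exact: sqi_mono.
Qed.

Lemma ip_psum_mono (c : nat -> C) N m : ip (psum c N) (fun z => z ^+ m) =
  if (m < N)%N then c m / m.+1%:R else 0.
Proof.
rewrite /psum ip_suml//; [|by move=> i; apply: sqiZ; exact: sqi_mono|exact: sqi_mono].
have E (i : 'I_N) : ip (fun z => c i * z ^+ i) (fun z => z ^+ m) =
   if (i : nat) == m then c m / m.+1%:R else 0.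
  rewrite ipZl; [|exact: sqi_mono..].
  rewrite ip_mono; have [->|_] := eqVneq (i : nat) m; last by rewrite mul0r mulr0.
  by rewrite mul1r.
rewrite (eq_bigr _ (fun i _ => E i)) -big_mkcond/=.
case: ifP => [mN|/negbT mN]; first by rewrite (big_pred1 (Ordinal mN)).
by rewrite big_pred0// => i; apply: contraNF mN => /eqP <-.
Qed.

Lemma N2_psum (c : nat -> C) N : N2 (psum c N) = \sum_(n < N) cnorm (c n) ^+ 2 / n.+1%:R.
Proof.
have := ip_self (psum c N); rewrite ip_psumr; last exact: sqi_psum.
move/(congr1 (@complex.Re R)) => /= <-; rewrite Re_sum; apply: eq_bigr => i _.
rewrite ip_psum_mono ltn_ord mulrA [_^* * _]mulrC mul_conj.
have -> : (i.+1%:R : C)^-1 = (i.+1%:R^-1)%:C%C by rewrite fmorphV rmorph_nat.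
by rewrite -real_complexM.
Qed.

(** N2 of F minus its orthogonal projection on the first N monomials is
    nonnegative. *)
Lemma bessel F N : sqi F ->
  \sum_(n < N) n.+1%:R * cnorm (ip F (fun z => z ^+ n)) ^+ 2 <= N2 F.
Proof.
move=> iF; pose c n := n.+1%:R * ip F (fun z => z ^+ n).
have n0 n : (n.+1%:R : R) != 0 by rewrite pnatr_eq0.
have cE n : cnorm (c n) ^+ 2 / n.+1%:R = n.+1%:R * cnorm (ip F (fun z => z ^+ n)) ^+ 2.
  by rewrite /c cnormM cnorm_nat exprMn mulrAC (expr2 n.+1%:R) mulfK.
rewrite -(eq_bigr _ (fun (i : 'I_N) _ => cE i)) -N2_psum.
have := N2_ge0 (fun z => F z + (-1) * psum c N z).
rewrite N2_addE//; last by apply: sqiZ; exact: sqi_psum.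
rewrite N2Z ?ipZr//; try exact: sqi_psum.
rewrite cnormN cnorm1 expr1n mul1r ip_psumr// rmorphN1 mulN1r ReN Re_sum.
rewrite (eq_bigr (fun i : 'I_N => cnorm (c i) ^+ 2 / i.+1%:R)).
  by rewrite -N2_psum; set a := N2 F; set b := N2 (psum _ _); move: a b => a b; lra.
move=> i _; rewrite cE /c rmorphM/= conjC_nat -mulrA [_^* * _]mulrC mul_conj.
by rewrite -(rmorph_nat (real_complex R)) -real_complexM.
Qed.

End SquareIntegrable.

(** * Convergence of complex sequences *)
Section ComplexSequences.
Context {R : realType}.
Local Notation C := R[i].
Local Notation Re := complex.Re.
Local Notation Im := complex.Im.
Implicit Types (u v : nat -> C) (l c : C) (q K : R).

Definition ccvg u l := cnorm (u n - l) @[n --> \oo] --> (0 : R).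

Lemma ccvgP u l : (forall e : R, 0 < e -> \forall n \near \oo, cnorm (u n - l) <= e) <-> ccvg u l.
Proof.
split=> h.
  apply/cvgr0Pnorm_le => e e0; apply: filterS (h e e0) => n.
  by rewrite ger0_norm ?cnorm_ge0.
move=> e e0; have /cvgr0Pnorm_le/(_ _ e0) := h.
by apply: filterS => n /=; rewrite ger0_norm ?cnorm_ge0.
Qed.

Lemma ccvg_squeeze u l (e_ : nat -> R) : (forall n, cnorm (u n - l) <= e_ n) ->
  e_ n @[n --> \oo] --> (0 : R) -> ccvg u l.
Proof.
move=> h he; apply: (squeeze_cvgr _ (cvg_cst 0) he).
by apply: nearW => n; rewrite cnorm_ge0 h.
Qed.

Lemma ccvg_near u v l : (\forall n \near \oo, u n = v n) -> ccvg u l -> ccvg v l.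
Proof.
move=> uv /ccvgP ul; apply/ccvgP => e e0; near=> n.
have <- : u n = v n by near: n.
by near: n; exact: ul.
Unshelve. all: by end_near. Qed.

Lemma ccvg_cst l : ccvg (fun=> l) l.
Proof. by apply/ccvgP => e e0; apply: nearW => n; rewrite subrr cnorm0 ltW. Qed.

Lemma ccvgD u v l c : ccvg u l -> ccvg v c -> ccvg (fun n => u n + v n) (l + c).
Proof.
move=> ul vc; apply: (@ccvg_squeeze _ _ (fun n => cnorm (u n - l) + cnorm (v n - c))).
  by move=> n; rewrite opprD addrACA cnorm_le_add.
by rewrite -[X in _ --> X](addr0 0); apply: cvgD.
Qed.

Lemma ccvgZ u l c : ccvg u l -> ccvg (fun n => c * u n) (c * l).
Proof.
move=> ul; apply: (@ccvg_squeeze _ _ (fun n => cnorm c * cnorm (u n - l))).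
  by move=> n; rewrite -mulrBr cnormM.
by rewrite -[X in _ --> X](mulr0 (cnorm c)); apply: cvgM => //; exact: cvg_cst.
Qed.

Lemma ccvgB u v l c : ccvg u l -> ccvg v c -> ccvg (fun n => u n - v n) (l - c).
Proof.
move=> ul vc; have := ccvgD ul (ccvgZ (-1) vc); rewrite mulN1r.
by apply: ccvg_near; apply: nearW => n; rewrite mulN1r.
Qed.

Lemma ccvg_unique u l c : ccvg u l -> ccvg u c -> l = c.
Proof.
move=> ul uc; apply/eqP; rewrite -subr_eq0 -cnorm_eq0; apply/eqP/le_anti.
rewrite cnorm_ge0 andbT; apply/ler_addgt0Pr => e e0; rewrite add0r.
have e2 : 0 < e / 2 by rewrite divr_gt0.
near \oo => n.
have h1 : cnorm (u n - l) <= e / 2 by near: n; move/ccvgP: ul; exact.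
have h2 : cnorm (u n - c) <= e / 2 by near: n; move/ccvgP: uc; exact.
have -> : l - c = (u n - c) - (u n - l) by ring.
by rewrite (le_trans (cnorm_le_add _ _))// cnormN [leRHS]splitr lerD.
Unshelve. all: by end_near. Qed.

Lemma ccvg_le u l (M : R) : ccvg u l -> (\forall n \near \oo, cnorm (u n) <= M) -> cnorm l <= M.
Proof.
move=> /ccvgP ul uM; apply/ler_addgt0Pr => e e0; change (cnorm l <= M + e); near \oo => n.
rewrite -[X in cnorm X](subKr (u n)) (le_trans (cnorm_le_add _ _))// cnormN lerD//.
  by near: n.
by near: n; exact: ul.
Unshelve. all: by end_near. Qed.

Lemma cvg_geo q K : 0 <= q < 1 -> K * q ^+ n @[n --> \oo] --> (0 : R).
Proof. by move=> /andP[q0 q1]; apply: cvg_geometric; rewrite ger0_norm. Qed.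

Lemma geo_cvg_real (u : nat -> R) K q : 0 <= q < 1 -> (forall n, `|u n| <= K * q ^+ n) ->
  exists s : R, \sum_(n < N) u n @[N --> \oo] --> s.
Proof.
move=> /andP[q0 q1] uK.
have gK n : 0 <= K * q ^+ n by exact: le_trans (uK n).
have cu : cvgn (series u).
  apply: normed_cvg; apply: (series_le_cvg _ gK uK) => //.
  by apply: is_cvg_geometric_series; rewrite ger0_norm.
exists (limn (series u)); move: cu; rewrite /series/=.
by under eq_fun do rewrite big_mkord.
Qed.

Lemma geo_series u K q : 0 <= q < 1 -> (forall n, cnorm (u n) <= K * q ^+ n) ->
  exists s, forall N, cnorm (\sum_(n < N) u n - s) <= K * q ^+ N / (1 - q).
Proof.
move=> q01 uK; have /andP[q0 q1] := q01.
have [a ca] := @geo_cvg_real (fun n => Re (u n)) K q q01 (fun n => le_trans (ler_Re _) (uK n)).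
have [b cb] := @geo_cvg_real (fun n => Im (u n)) K q q01 (fun n => le_trans (ler_Im _) (uK n)).
have dist (f : nat -> R) (x : R) : f n @[n --> \oo] --> x -> `|f n - x| @[n --> \oo] --> (0 : R).
  move=> /cvgrPdist_le h; apply/cvgr0Pnorm_le => e e0; apply: filterS (h e e0) => n.
  by rewrite normr_id distrC.
have cs : ccvg (fun N => \sum_(n < N) u n) (a +i* b)%C.
  apply: (@ccvg_squeeze _ _ (fun N => `|\sum_(n < N) Re (u n) - a| + `|\sum_(n < N) Im (u n) - b|)).
    by move=> N; apply: le_trans (cnorm_le_ReIm _) _; rewrite ReD ImD Re_sum Im_sum.
  by rewrite -[X in _ --> X](addr0 0); apply: cvgD; exact: dist.
exists (a +i* b)%C => N.
have q1' : 0 < 1 - q by rewrite subr_gt0.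
have gK n : 0 <= K * q ^+ n by apply: le_trans (uK n); exact: cnorm_ge0.
have tel m : cnorm (\sum_(n < N + m) u n - \sum_(n < N) u n) <=
   (K * q ^+ N - K * q ^+ (N + m)) / (1 - q).
  elim: m => [|m IH]; first by rewrite addn0 !subrr cnorm0 mul0r.
  rewrite addnS big_ord_recr /= addrAC (le_trans (cnorm_le_add _ _))//.
  apply: le_trans (lerD IH (uK _)) _; rewrite le_eqVlt; apply/orP; left; apply/eqP.
  by rewrite exprS; field; rewrite gt_eqF.
rewrite cnormBC; apply: (ccvg_le (ccvgB cs (ccvg_cst (\sum_(n < N) u n)))).
exists N => // m /= Nm; rewrite -(subnKC Nm) (le_trans (tel _))// ler_pM2r ?invr_gt0//.
by rewrite gerBl.
Qed.

Lemma geo_ccvg u l K q : 0 <= q < 1 -> (forall N, cnorm (u N - l) <= K * q ^+ N) -> ccvg u l.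
Proof. by move=> q01 h; apply: ccvg_squeeze h (cvg_geo _ q01). Qed.

(** The left-hand side is at most the geometric sum of order n. *)
Lemma lin_geo q n : 0 <= q < 1 -> n.+1%:R * q ^+ n <= (1 - q)^-1.
Proof.
move=> /andP[q0 q1]; have q1' : 0 < 1 - q by rewrite subr_gt0.
suff : n.+1%:R * q ^+ n * (1 - q) <= 1 - q ^+ n.+1.
  move=> h; rewrite -[leRHS]div1r ler_pdivlMr// (le_trans h)// gerBl exprn_ge0//.
elim: n => [|n IH]; first by rewrite expr0 expr1 mulr1 mul1r.
have x1 : q ^+ n.+1 <= 1 by apply: exprn_ile1 => //; exact: ltW.
have := ler_wpM2l q0 IH; rewrite [q ^+ n.+2]exprS [q ^+ n.+1]exprS -(natr1 n.+1).
rewrite [q ^+ n.+1]exprS in x1; move: (n.+1%:R) (q ^+ n) (exprn_ge0 n q0) x1 => a b b0 x1 h.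
rewrite -subr_ge0; have -> : 1 - q * (q * b) - (a + 1) * (q * b) * (1 - q) =
  (q * (1 - q * b) - q * (a * b * (1 - q))) + (1 - q) * (1 - q * b) by ring.
by rewrite addr_ge0 ?subr_ge0// mulr_ge0 ?subr_ge0// ltW.
Qed.

End ComplexSequences.

(** * Analyticity of power series *)
Section PowerSeries.
Context {R : realType}.
Local Notation C := R[i].
Implicit Types (c : nat -> C) (z w : C) (K r : R).

(** A polynomial factor of degree three is absorbed by three of the four
    factors q^n of r^n; the last one stays summable. *)
Lemma root_radius r : 0 <= r < 1 -> exists2 q : R, 0 <= q < 1 & r = q ^+ 4.
Proof.
move=> /andP[r0 r1]; exists (Num.sqrt (Num.sqrt r)); last first.
  by rewrite (exprM _ 2 2) sqr_sqrtr ?sqrtr_ge0// sqr_sqrtr.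
rewrite sqrtr_ge0/= -[ltRHS]sqrtr1 ltr_sqrt// -[ltRHS]sqrtr1 ltr_sqrt//.
Qed.

Lemma cube_geo q n : 0 <= q < 1 -> n.+1%:R ^+ 3 * (q ^+ 4) ^+ n <= ((1 - q) ^- 1) ^+ 3 * q ^+ n :> R.
Proof.
move=> q01; have /andP[q0 q1] := q01.
have -> : n.+1%:R ^+ 3 * (q ^+ 4) ^+ n = (n.+1%:R * q ^+ n) ^+ 3 * q ^+ n.
  rewrite -(exprM q 4 n) (exprMn 3 n.+1%:R) -(exprM q n 3) -(mulrA (n.+1%:R ^+ 3)) -(exprD q (n * 3) n).
  by congr (_ * _ ^+ _); lia.
rewrite ler_wpM2r ?exprn_ge0// lerXn2r ?nnegrE ?mulr_ge0 ?exprn_ge0//.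
  by rewrite invr_ge0 subr_ge0 ltW.
exact: lin_geo.
Qed.

(** The remainders E_n satisfy E_(n+1) = w E_n + n z^(n-1) (w - z)^2. The
    factor r^2 on the left avoids the exponent n - 2. *)
Lemma pow_taylor r z w n : 0 < r -> cnorm z <= r -> cnorm w <= r ->
  cnorm (w ^+ n - z ^+ n - n%:R * z ^+ n.-1 * (w - z)) * r ^+ 2 <=
  n%:R ^+ 2 * r ^+ n * cnorm (w - z) ^+ 2.
Proof.
move=> r0 zr wr; elim: n => [|n IH].
  by rewrite !expr0 mul0r mul0r !subrr cnorm0 mul0r expr0n/= !mul0r.
have -> : w ^+ n.+1 - z ^+ n.+1 - n.+1%:R * z ^+ n.+1.-1 * (w - z) =
  w * (w ^+ n - z ^+ n - n%:R * z ^+ n.-1 * (w - z)) + n%:R * z ^+ n.-1 * (w - z) ^+ 2.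
  by case: n {IH} => [|n] /=; rewrite ?exprS -?natr1; ring.
apply: (@le_trans _ _ (r * (n%:R ^+ 2 * r ^+ n * cnorm (w - z) ^+ 2) +
   n%:R * r ^+ n.+1 * cnorm (w - z) ^+ 2)).
  rewrite (le_trans (ler_wpM2r (sqr_ge0 r) (cnorm_le_add _ _)))// mulrDl lerD//.
    move: IH; set E := (_ - _ - _) => IH; rewrite cnormM -(mulrA (cnorm w)).
    exact: (ler_pM (cnorm_ge0 w) (mulr_ge0 (cnorm_ge0 E) (sqr_ge0 r)) wr IH).
  rewrite !cnormM !cnormX cnorm_nat [leLHS]mulrAC ler_wpM2r ?sqr_ge0//.
  case: n {IH} => [|n]; first by rewrite !mul0r.
  rewrite -(mulrA n.+1%:R) ler_wpM2l//= 2!(exprSr r) -(mulrA (r ^+ n)).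
  rewrite ler_wpM2r ?mulr_ge0 ?(ltW r0)// lerXn2r ?nnegrE ?cnorm_ge0//; exact: ltW.
have -> : r * (n%:R ^+ 2 * r ^+ n * cnorm (w - z) ^+ 2) + n%:R * r ^+ n.+1 * cnorm (w - z) ^+ 2 =
   (n%:R ^+ 2 + n%:R) * r ^+ n.+1 * cnorm (w - z) ^+ 2.
  by rewrite (exprS r n); move: (n%:R : R) (r ^+ n) (cnorm _) => a b d; ring.
rewrite ler_wpM2r ?sqr_ge0// ler_wpM2r ?exprn_ge0 ?(ltW r0)// -(natr1 n).
rewrite -subr_ge0; have -> : (n%:R + 1) ^+ 2 - (n%:R ^+ 2 + n%:R) = n%:R + 1 :> R by ring.
by rewrite addr_ge0.
Qed.

(** Second-order Taylor remainders of the monomials ([pow_taylor]), summed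
    against the coefficients. *)
Lemma pseries_cdiff c K : 0 <= K -> (forall n, cnorm (c n) <= K * n.+1%:R) ->
  exists F : C -> C, forall z, disk z ->
    ccvg (fun N => psum c N z) (F z) /\ exists d, cdiff F z d.
Proof.
move=> K0 cK.
have sumz z : disk z -> exists s, ccvg (fun N => psum c N z) s.
  move=> Dz; have z01 : 0 <= cnorm z < 1 by rewrite cnorm_ge0.
  have [q q01 zq] := root_radius z01; have /andP[q0 q1] := q01.
  have [|s hs] := @geo_series _ (fun n => c n * z ^+ n) (K * ((1 - q) ^- 1) ^+ 3) q q01.
    move=> n; rewrite cnormM cnormX zq -mulrA.
    apply: le_trans (ler_wpM2l K0 (cube_geo n q01)).
    rewrite mulrA ler_wpM2r ?exprn_ge0// (le_trans (cK n))// ler_wpM2l//.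
    by rewrite -[leLHS]expr1 ler_weXn2l// ler1n.
  exists s; apply: (geo_ccvg (K := K * ((1 - q) ^- 1) ^+ 3 / (1 - q)) q01) => N.
  by rewrite mulrAC; exact: hs.
pose F z := match pselect (disk z) with left h => projT1 (cid (sumz z h)) | _ => 0 end.
have FE z : disk z -> ccvg (fun N => psum c N z) (F z).
  by move=> Dz; rewrite /F; case: pselect => // h; case: cid.
exists F => z Dz; split; first exact: FE.
pose r := (1 + cnorm z) / 2.
have z1 : cnorm z < 1 := Dz; have z0 := cnorm_ge0 z.
have r0 : 0 < r by rewrite /r; lra.
have r1 : r < 1 by rewrite /r; lra.
have zr : cnorm z < r by rewrite /r; lra.
have r01 : 0 <= r < 1 by rewrite (ltW r0).
have [q q01 rq] := root_radius r01; have /andP[q0 q1] := q01.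
pose L := K * ((1 - q) ^- 1) ^+ 3.
have Kq n : cnorm (c n) * (n.+1%:R ^+ 2 * r ^+ n) <= L * q ^+ n.
  rewrite /L -mulrA; apply: le_trans (ler_wpM2l K0 (cube_geo n q01)).
  rewrite -rq; have -> : K * (n.+1%:R ^+ 3 * r ^+ n) = K * n.+1%:R * (n.+1%:R ^+ 2 * r ^+ n).
    by move: (n.+1%:R : R) (r ^+ n) => a b; ring.
  by apply: ler_wpM2r => //; apply: mulr_ge0; [exact: exprn_ge0|exact/exprn_ge0/ltW].
have L0 : 0 <= L by rewrite mulr_ge0// exprn_ge0// invr_ge0 subr_ge0 ltW.
have r20 : 0 < r ^+ 2 by rewrite exprn_gt0.
have [|D hD] := @geo_series _ (fun n => c n * (n%:R * z ^+ n.-1)) (L / r) q q01.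
  move=> n; rewrite mulrAC ler_pdivlMr//; apply: le_trans (Kq n).
  rewrite !cnormM cnormX cnorm_nat -(mulrA (cnorm (c n))) ler_wpM2l ?cnorm_ge0//.
  have p0 m : 0 <= r ^+ m by exact/exprn_ge0/ltW.
  have zm m : cnorm z ^+ m <= r ^+ m by rewrite lerXn2r ?nnegrE ?(ltW r0) ?(ltW zr).
  case: n => [|n] /=; first by rewrite !mul0r; apply: mulr_ge0 => //; exact: exprn_ge0.
  rewrite (exprSr r n) (mulrA (n.+2%:R ^+ 2)); apply: ler_wpM2r; first exact: ltW.
  apply: ler_pM => //; first by apply: exprn_ge0.
  by rewrite (@le_trans _ _ n.+2%:R) ?ler_nat// -[leLHS]expr1 ler_weXn2l// ler1n.
have cD : ccvg (fun N => \sum_(n < N) c n * (n%:R * z ^+ n.-1)) D.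
  apply: (geo_ccvg (K := L / r / (1 - q)) q01) => N; rewrite mulrAC; exact: hD.
exists D => e e0.
pose M := L / (1 - q) / r ^+ 2.
have M0 : 0 <= M by rewrite !divr_ge0 ?(ltW r20)// subr_ge0 ltW.
have est w : cnorm w <= r -> cnorm (F w - F z - D * (w - z)) <= M * cnorm (w - z) ^+ 2.
  move=> wr; have Dw : disk w by exact: le_lt_trans wr r1.
  have cc := ccvgB (ccvgB (FE w Dw) (FE z Dz)) (ccvgZ (w - z) cD).
  rewrite [D * _]mulrC; apply: (ccvg_le cc); apply: nearW => N.
  have -> : psum c N w - psum c N z - (w - z) * (\sum_(n < N) c n * (n%:R * z ^+ n.-1)) =
     \sum_(n < N) c n * (w ^+ n - z ^+ n - n%:R * z ^+ n.-1 * (w - z)).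
    rewrite /psum mulr_sumr -!sumrB; apply: eq_bigr => i _; ring.
  apply: le_trans (cnorm_sum _ _ _) _.
  apply: (@le_trans _ _ (\sum_(n < N) (L * q ^+ n) * (cnorm (w - z) ^+ 2 / r ^+ 2))).
    apply: ler_sum => i _; rewrite (mulrA (L * _)) ler_pdivlMr// cnormM -(mulrA (cnorm (c i))).
    apply: (@le_trans _ _ (cnorm (c i) * (i%:R ^+ 2 * r ^+ i * cnorm (w - z) ^+ 2))).
      by rewrite ler_wpM2l ?cnorm_ge0// pow_taylor// ltW.
    rewrite (mulrA (cnorm (c i))) ler_wpM2r ?sqr_ge0//; apply: le_trans (Kq i).
    rewrite ler_wpM2l ?cnorm_ge0// ler_wpM2r ?exprn_ge0 ?(ltW r0)//.
    by rewrite lerXn2r ?nnegrE// ler_nat.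
  rewrite -mulr_suml -mulr_sumr /M.
  have -> : L / (1 - q) / r ^+ 2 * cnorm (w - z) ^+ 2 = (L / (1 - q)) * (cnorm (w - z) ^+ 2 / r ^+ 2).
    by rewrite -mulrA [_^-1 * _]mulrC.
  rewrite ler_wpM2r//; first by rewrite divr_ge0 ?sqr_ge0// ltW.
  rewrite ler_wpM2l// -[leRHS]div1r ler_pdivlMr ?subr_gt0//.
  have -> : (\sum_(i < N) q ^+ i) * (1 - q) = 1 - q ^+ N.
    by rewrite -[RHS]opprB subrX1 -mulNr opprB mulrC.
  by rewrite gerBl exprn_ge0.
exists (Num.min (r - cnorm z) (e / (M + 1))).
  by rewrite lt_min subr_gt0 zr divr_gt0// ltr_wpDl.
move=> w; rewrite lt_min => /andP[h1 h2].
apply: le_trans (est w _) _.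
  rewrite -[w](subrK z) (le_trans (cnorm_le_add _ _))//.
  by rewrite -lerBrDr ltW.
rewrite expr2 mulrA ler_wpM2r ?cnorm_ge0//.
have M1 : 0 < M + 1 by rewrite ltr_wpDl.
apply: le_trans (ler_wpM2l M0 (ltW h2)) _.
rewrite mulrCA ler_piMr ?(ltW e0)// ler_pdivrMr// mul1r lerDl//.
Qed.

End PowerSeries.

(** * Taylor coefficients and the L2 norm *)
Section Coefficients.
Context {R : realType}.
Local Notation C := R[i].
Local Notation Re := complex.Re.
Local Notation Im := complex.Im.
Local Notation sqi := (@square_integrable R).
Implicit Types (F G : C -> C) (c : nat -> C) (z w : C) (n m N : nat).

(** When F is a power series with square-summable coefficients, this is its
    n-th coefficient, by orthogonality of the monomials ([power_series_L2]);
    for general F it is the coefficient of the Bergman projection of F. *)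
Definition tay F n : C := n.+1%:R * ip F (fun z => z ^+ n).

Lemma ip_tay F n : ip F (fun z => z ^+ n) = tay F n / n.+1%:R.
Proof. by rewrite /tay mulrC mulKf// pnatr_eq0. Qed.

(** The squared L2 norm of the polynomial with coefficients c_0, ...,
    c_(N-1) ([N2_psum]). *)
Definition wsum c N : R := \sum_(n < N) cnorm (c n) ^+ 2 / n.+1%:R.

Lemma wsum_ge0 c N : 0 <= wsum c N.
Proof. by apply: sumr_ge0 => i _; rewrite divr_ge0 ?sqr_ge0. Qed.

Lemma wsum_add c N m :
  wsum c (N + m) - wsum c N = \sum_(i < m) cnorm (c (N + i)%N) ^+ 2 / (N + i).+1%:R.
Proof. by rewrite /wsum big_split_ord /= addrAC subrr add0r. Qed.

Lemma wsum_le c N m : (N <= m)%N -> wsum c N <= wsum c m.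
Proof.
move=> /subnKC <-; rewrite -subr_ge0 wsum_add.
by apply: sumr_ge0 => i _; rewrite divr_ge0 ?sqr_ge0.
Qed.

Lemma wsum_tay F N : sqi F -> wsum (tay F) N <= N2 F.
Proof.
move=> iF; apply: le_trans (bessel N iF); apply: ler_sum => i _.
by rewrite /tay cnormM cnorm_nat exprMn mulrAC (expr2 i.+1%:R) mulfK.
Qed.

Lemma psumB c N m z : psum c (N + m) z - psum c N z =
  psum (fun n => if (n < N)%N then 0 else c n) (N + m) z.
Proof.
rewrite /psum !big_split_ord /= addrAC subrr add0r [X in _ = X + _]big1 ?add0r.
  by apply: eq_bigr => i _; rewrite ltnNge leq_addr.
by move=> i _; rewrite ltn_ord mul0r.
Qed.

Lemma wsum_cut c N m : wsum (fun n => if (n < N)%N then 0 else c n) (N + m) =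
  wsum c (N + m) - wsum c N.
Proof.
rewrite wsum_add /wsum big_split_ord /= big1 ?add0r.
  by apply: eq_bigr => i _; rewrite ltnNge leq_addr.
by move=> i _; rewrite ltn_ord cnorm0 expr0n mul0r.
Qed.

(** Fatou's lemma, applied to the partial sums and to their differences: the
    latter bounds the norm of F - psum c N by the tail of the convergent sum
    of the squares. *)
Lemma power_series_L2 c F (B : R) : (forall N, wsum c N <= B) ->
  (forall z, disk z -> ccvg (fun N => psum c N z) (F z)) ->
  [/\ sqi F, N2 F <= B, forall n, tay F n = c n &
    nrm (fun z => F z - psum c N z) @[N --> \oo] --> (0 : R)].
Proof.
move=> cB cF.
have pB N : N2 (psum c N) <= B by rewrite N2_psum; exact: cB.
have [iF FB] := @fatou_sqi R (psum c) F B (sqi_psum c) pB cF.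
have cvS : cvgn (wsum c).
  apply: nondecreasing_is_cvgn; first by move=> N m; exact: wsum_le.
  by exists B => _ [N _ <-].
have cS : wsum c N @[N --> \oo] --> limn (wsum c) by exact: cvS.
set s := limn (wsum c) in cS.
have tail N : N2 (fun z => F z - psum c N z) <= s - wsum c N.
  have [] // := @fatou_sqi R (fun m z => psum c (N + m) z - psum c N z)
    (fun z => F z - psum c N z) (s - wsum c N) _ _ _.
  - by move=> m; apply: sqiB; exact: sqi_psum.
  - move=> m; have -> : N2 (fun z => psum c (N + m) z - psum c N z) = wsum c (N + m) - wsum c N.
      by rewrite (@eq_N2 _ _ _ (fun z _ => psumB c N m z)) N2_psum -wsum_cut.
    rewrite lerD2r; apply: nondecreasing_cvgn_le => //.
    by move=> i j; exact: wsum_le.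
  - move=> z Dz; apply: (ccvgB _ (ccvg_cst (psum c N z))); have /ccvgP h := cF z Dz; apply/ccvgP => e e0.
    have [M _ HM] := h e e0; exists M => // m /= Mm; apply: HM => /=.
    exact: leq_trans Mm (leq_addl _ _).
have c0 : nrm (fun z => F z - psum c N z) @[N --> \oo] --> (0 : R).
  apply/cvgr0Pnorm_le => e e0; have e2 : 0 < e ^+ 2 by rewrite exprn_gt0.
  have := cS; move/cvgrPdist_le => /(_ _ e2); apply: filterS => N h.
  rewrite ger0_norm ?nrm_ge0// -(@ler_pXn2r _ 2)// ?nnegrE ?nrm_ge0 ?(ltW e0)//.
  by rewrite sqr_nrm (le_trans (tail N))// (le_trans (ler_norm _)).
split=> // n.
have iz : sqi (fun z => z ^+ n) by exact: sqi_mono.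
have : ccvg (fun N => ip (psum c N) (fun z => z ^+ n)) (ip F (fun z => z ^+ n)).
  apply: (@ccvg_squeeze _ _ _ (fun N => nrm (fun z => F z - psum c N z) * nrm (fun z => z ^+ n))).
    move=> N; rewrite cnormBC -ipBl//; last exact: sqi_psum.
    by apply: ip_le_nrm => //; apply: sqiB => //; exact: sqi_psum.
  by rewrite -[X in _ --> X](mul0r (nrm (fun z : C => z ^+ n))); apply: cvgM => //; exact: cvg_cst.
move/(ccvg_unique (c := c n / n.+1%:R)) => h.
rewrite /tay h; first by rewrite mulrC divfK// pnatr_eq0.
apply: ccvg_near (ccvg_cst _); exists n.+1 => // N /= nN.
by rewrite ip_psum_mono nN.
Qed.

Lemma weighted_growth c (B : R) : 0 <= B -> (forall N, wsum c N <= B) ->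
  forall n, cnorm (c n) <= (B + 1) * n.+1%:R.
Proof.
move=> B0 cB n; have n0 : 0 < n.+1%:R :> R by rewrite ltr0n.
rewrite -(@ler_pXn2r _ 2)// ?nnegrE ?mulr_ge0 ?addr_ge0 ?cnorm_ge0//.
have h : cnorm (c n) ^+ 2 / n.+1%:R <= B.
  apply: le_trans (cB n.+1); rewrite /wsum big_ord_recr/= lerDr; exact: wsum_ge0.
move: h; rewrite ler_pdivrMr// => h; apply: (le_trans h).
have n1 : 1 <= n.+1%:R :> R by rewrite ler1n.
rewrite exprMn; apply: ler_pM => //; first nra.
by rewrite -[leLHS]expr1 ler_weXn2l.
Qed.

End Coefficients.

(** * Completeness of the monomials *)
Section Completeness.
Context {R : realType}.
Local Notation C := R[i].
Local Notation Re := complex.Re.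
Local Notation Im := complex.Im.
Local Notation sqi := (@square_integrable R).
Implicit Types (F G : C -> C) (z w : C) (n m N : nat).

Definition radius_seq (k : nat) : R := 1 - k.+2%:R^-1.

Lemma radius_seq_lt1 k : 0 < radius_seq k < 1.
Proof.
by rewrite /radius_seq subr_gt0 gtrBl invf_lt1 ?invr_gt0 ?ltr1n ?ltr0n.
Qed.

Lemma radius_seq_near (x : R) : x < 1 -> \forall k \near \oo, x < radius_seq k.
Proof.
move=> x1; have h : 0 < 1 - x by rewrite subr_gt0.
near=> k; rewrite /radius_seq ltrBrDr -ltrBrDl invf_plt ?posrE ?ltr0n//.
apply: (@lt_le_trans _ _ k%:R); last by rewrite ler_nat; lia.
by near: k; exact: nbhs_infty_gtr.
Unshelve. all: by end_near. Qed.

(** Truncation to smaller disks, where power series converge uniformly. *)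
Lemma chi_cvg F : dint F ->
  ccvg (fun k => cintegral (fun z => chi (radius_seq k) z * F z)) (cintegral F).
Proof.
move=> iF; have iF' := iF; have [f1 f2] := iF'.
have mc k : cmeasurable (chi (radius_seq k)) by apply: cmeasurable_chi; have /andP[] := radius_seq_lt1 k.
have mF := cintegrable_cmeas iF.
pose g (p : R * R) := `|Re (F (plane p))| + `|Im (F (plane p))|.
apply: (@cint_dominated _ _ _ area pdisk pdisk_measurable
  (fun k p => chi (radius_seq k) (plane p) * F (plane p)) (F \o plane) g).
- by move=> k; exact: (cmeasM (mc k) mF).
- exact: mF.
- exact: (integrableD (@pdisk_measurable R) (integrable_norm f1) (integrable_norm f2)).
- move=> p Dp; apply: (ccvg_near _ (ccvg_cst _)).
  apply: filterS (radius_seq_near Dp) => k h; by rewrite /chi h mul1r.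
- move=> k p Dp; apply: le_trans (cnorm_le_ReIm _).
  rewrite cnormM ler_piMl ?cnorm_ge0// /chi; case: ifP; rewrite ?cnorm1 ?cnorm0//.
Qed.

(** On the disk of radius r the Taylor polynomials converge uniformly, and
    the moments of distinct exponents vanish. *)
Lemma chi_coef F (r rho : R) n : sqi F -> 0 < r -> r < rho -> rho < 1 ->
  (forall w, disk w -> exists c, cdiff F w c) ->
  cintegral (fun z => chi r z * (F z * (z ^+ n)^*)) = circle_coef F rho n * mom r n n.
Proof.
move=> iF r0 rrho rho1 dF; have rho0 : 0 < rho by exact: lt_trans rrho.
have r01 : 0 < r <= 1 by rewrite r0 ltW// (lt_trans rrho).
have rho01 : 0 < rho < 1 by rewrite rho0.
have [B B0 HB] := cauchy_series dF rho01.
pose a := circle_coef F rho; pose q := r / rho.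
have q01 : 0 <= q < 1 by rewrite divr_ge0 ?(ltW r0) ?(ltW rho0)//= ltr_pdivrMr// mul1r.
have bz : bdd (fun z : C => chi r z * (z ^+ n)^*).
  by apply: bddM; [exact: bdd_chi|apply: bdd_conj; apply: bddX; exact: bdd_id].
have sz := sqi_bdd bz.
pose K := B * (rho / (rho - r)).
have K0 : 0 <= K by rewrite mulr_ge0// divr_ge0 ?(ltW rho0)// subr_ge0 ltW.
have iFz : dint (fun z => F z * (chi r z * (z ^+ n)^*)) by exact: sqi_dint.
have iPz N : dint (fun z => psum a N z * (chi r z * (z ^+ n)^*)).
  by apply: sqi_dint => //; exact: sqi_psum.
rewrite (@eq_cintegral _ _ (fun z => F z * (chi r z * (z ^+ n)^*))); last by move=> z _; rewrite mulrCA.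
apply: (@ccvg_unique _ (fun N => cintegral (fun z => psum a N z * (chi r z * (z ^+ n)^*)))).
  apply: (@geo_ccvg _ _ _ (2 * K) q q01) => N.
  rewrite -mulrA cnormBC -cintegralB//; apply: cintegral_bound.
  - exact: dintB.
  - by rewrite mulr_ge0// exprn_ge0//; case/andP: q01.
  move=> z Dz; rewrite -mulrBl mulrCA cnormM /chi; case: ifPn => zr; last first.
    rewrite cnorm0 mul0r mulr_ge0// exprn_ge0//; by case/andP: q01.
  have zrho := lt_trans zr rrho.
  rewrite cnorm1 mul1r cnormM; apply: (@le_trans _ _ (cnorm (F z - psum a N z) * 1)).
    rewrite ler_wpM2l ?cnorm_ge0// cnorm_conj cnormX exprn_ile1 ?cnorm_ge0//; exact: ltW.
  rewrite mulr1 (le_trans (HB z N zrho))// /K -mulrA [leRHS]mulrAC -mulrA ler_wpM2l//.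
  apply: ler_pM.
  - by rewrite exprn_ge0// divr_ge0 ?cnorm_ge0// ltW.
  - by rewrite divr_ge0 ?(ltW rho0)// subr_ge0 ltW.
  - by rewrite lerXn2r ?nnegrE ?divr_ge0 ?cnorm_ge0 ?(ltW r0) ?(ltW rho0)// ler_pM2r ?invr_gt0// ltW.
  by rewrite ler_pM2l// lef_pV2 ?posrE ?subr_gt0// lerD2l lerN2 ltW.
apply: ccvg_near (ccvg_cst _); exists n.+1 => // N /= nN.
rewrite (@eq_cintegral _ _ (fun z => \sum_(m < N) a m * (chi r z * (z ^+ m * z^* ^+ n)))); last first.
  move=> z _; rewrite /psum mulr_suml; apply: eq_bigr => i _; rewrite rmorphXn/=; ring.
rewrite cintegral_sum; last by move=> i _; apply: dintZ; exact: dmom.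
rewrite (bigD1 (Ordinal nN))//= big1 ?addr0.
  by rewrite cintegralZ//; exact: dmom.
move=> i ni; rewrite cintegralZ; last exact: dmom.
by rewrite -/(mom r i n) mom_off ?mulr0.
Qed.

(** By [chi_coef] the coefficients on circles do not depend on the radius;
    letting the radius of the disk tend to 1 identifies them with [tay]. *)
Lemma taylor F : sqi F -> (forall w, disk w -> exists c, cdiff F w c) ->
  forall z, disk z -> ccvg (fun N => psum (tay F) N z) (F z).
Proof.
move=> iF dF.
have coefE n (r : R) : 0 < r -> r < 1 -> circle_coef F r n = tay F n.
  move=> r0 r1.
  have indep (rho rho' : R) : 0 < rho -> rho <= rho' -> rho' < 1 ->
      circle_coef F rho' n = circle_coef F rho n.
    move=> h0 h h1; have h2 : 0 < rho / 2 by rewrite divr_gt0.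
    have h3 : rho / 2 < rho by lra.
    have m0 : mom (rho / 2) n n != 0 :> C.
      have h5 : 0 < rho / 2 <= 1 by rewrite h2/=; lra.
      rewrite mom_diag// mulf_neq0 ?mom00_neq0// mulf_neq0 ?invr_neq0 ?pnatr_eq0//.
      by rewrite -cnorm_eq0 cnorm_real normr_eq0 expf_neq0// gt_eqF.
    have e1 := chi_coef n iF h2 h3 (le_lt_trans h h1) dF.
    have e2 := chi_coef n iF h2 (lt_le_trans h3 h) h1 dF.
    by apply: (mulIf m0); exact: etrans (esym e2) e1.
  have all (rho : R) : 0 < rho -> rho < 1 -> circle_coef F rho n = circle_coef F r n.
    move=> h0 h1; have [h|h] := leP rho r; first by rewrite (indep rho r).
    by rewrite (indep r rho)// ltW.
  have iz : sqi (fun z => z ^+ n) := sqi_mono n.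
  have c1 := chi_cvg (sqi_ip iF iz); have c2 := chi_cvg (sqi_ip iz iz).
  suff : ip F (fun z => z ^+ n) = circle_coef F r n * (n.+1%:R)^-1.
    by rewrite /tay => ->; rewrite mulrCA mulfV ?mulr1 ?pnatr_eq0.
  have e2 : cintegral (fun z : C => z ^+ n * (z ^+ n)^*) = n.+1%:R^-1.
    by have := @ip_mono R n n; rewrite eqxx mul1r.
  rewrite e2 in c2; apply: ccvg_unique c1 _.
  apply: ccvg_near (ccvgZ (circle_coef F r n) c2); apply: nearW => k.
  have /andP[k0 k1] := radius_seq_lt1 k.
  (* the circle must be larger than the disk of integration *)
  pose rho := (1 + radius_seq k) / 2; have rho1 : rho < 1 by rewrite /rho; lra.
  have rhok : radius_seq k < rho by rewrite /rho; lra.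
  rewrite (chi_coef n iF k0 rhok rho1 dF) all//; last exact: lt_trans rhok.
  by congr (_ * _); apply: eq_cintegral => z _; rewrite rmorphXn.
move=> z Dz; pose r := (1 + cnorm z) / 2; have z1 : cnorm z < 1 := Dz.
have z0 := cnorm_ge0 z.
have r0 : 0 < r by rewrite /r; lra.
have r1 : r < 1 by rewrite /r; lra.
have zr : cnorm z < r by rewrite /r; lra.
have r01 : 0 < r < 1 by rewrite r0.
have [B B0 HB] := cauchy_series dF r01.
have q01 : 0 <= cnorm z / r < 1 by rewrite divr_ge0 ?(ltW r0)//= ltr_pdivrMr// mul1r.
apply: (@geo_ccvg _ _ _ (B * (r / (r - cnorm z))) _ q01) => N.
have -> : psum (tay F) N z = \sum_(n < N) circle_coef F r n * z ^+ n.
  by apply: eq_bigr => i _; rewrite coefE.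
by rewrite cnormBC mulrAC; exact: HB.
Qed.

End Completeness.

(** * The Bergman space as a weighted l2 space *)
Section BergmanElements.
Context {R : realType}.
Local Notation C := R[i].
Local Notation Re := complex.Re.
Local Notation Im := complex.Im.
Local Notation sqi := (@square_integrable R).
Local Notation bergman := (@bergman R).
Implicit Types (F G : C -> C) (f g : bergman) (c : nat -> C) (z w : C) (n m N : nat).

Lemma bergman_in f : in_bergman f.
Proof. by apply/asboolP; exact: (valP f). Qed.

Lemma bergman_sqi f : sqi f. Proof. by have [] := bergman_in f. Qed.

Lemma bergman_taylor f z : disk z -> ccvg (fun N => psum (tay f) N z) (f z).
Proof.
have [_ af sf] := bergman_in f.
by apply: taylor => // w Dw; apply: derivable_cdiff; exact: af.
Qed.

Lemma bergman_wsum f N : wsum (tay f) N <= N2 f.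
Proof. by apply: wsum_tay; exact: bergman_sqi. Qed.

Lemma bergman_N2_le f (B : R) : (forall N, wsum (tay f) N <= B) -> N2 f <= B.
Proof. by move=> h; have [] := power_series_L2 h (@bergman_taylor f). Qed.

Lemma bergman_nrm_cvg f : nrm (fun z => f z - psum (tay f) N z) @[N --> \oo] --> (0 : R).
Proof. by have [] := power_series_L2 (bergman_wsum f) (@bergman_taylor f). Qed.

Lemma bergman_eq f g : (forall z, disk z -> f z = g z) -> f = g.
Proof.
move=> fg; apply: val_inj; apply/funext => z /=.
have [Dz|nDz] := pselect (disk z); first exact: fg.
by have [-> // _ _] := bergman_in f; have [-> // _ _] := bergman_in g.
Qed.

Lemma bergman_ext f g : (forall n, tay f n = tay g n) -> f = g.
Proof.
move=> fg; apply: bergman_eq => z Dz; apply: ccvg_unique (bergman_taylor f Dz) _.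
have -> : psum (tay f) = psum (tay g); last exact: bergman_taylor.
by apply/funext => N; apply/funext => w; apply: eq_bigr => i _; rewrite fg.
Qed.

Lemma bnormE f : bnorm f = nrm f.
Proof. by rewrite /bnorm /nrm -[N2 f]/(Re (N2 f)%:C%C) -ip_self. Qed.

(** [weighted_growth] makes the power series converge to an analytic
    function, and [power_series_L2] puts it in L2. *)
Lemma synthesis c (B : R) : (forall N, wsum c N <= B) ->
  exists f : bergman, forall n, tay f n = c n.
Proof.
move=> cB; have B0 : 0 <= B := le_trans (wsum_ge0 c 0) (cB 0).
have B1 : 0 <= B + 1 by rewrite addr_ge0.
have [F HF] := pseries_cdiff B1 (weighted_growth B0 cB).
have FP : in_bergman (fun z => if cnorm z < 1 then F z else 0).
  have cF z : disk z -> ccvg (fun N => psum c N z) (if cnorm z < 1 then F z else 0).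
    by move=> Dz; rewrite (Dz : cnorm z < 1); exact: (HF z Dz).1.
  have [sF _ _ _] := power_series_L2 cB cF.
  split=> //; first by move=> z; rewrite /disk/= => /negP; rewrite -leNgt ltNge => ->.
  move=> z Dz; have [d dF] := (HF z Dz).2.
  apply: near_eq_derivable (cdiff_derivable dF).
  by near=> w; rewrite /= ifT//; near: w; exact: disk_nbhs.
pose f := Bergman (introT (asboolP _) FP : _ \in bergman_pred).
have cf z : disk z -> ccvg (fun N => psum c N z) (f z).
  by move=> Dz; rewrite /f/= (Dz : cnorm z < 1); exact: (HF z Dz).1.
by exists f; have [] := power_series_L2 cB cf.
Unshelve. all: by end_near. Qed.

(** The inverse of the Taylor map, with value 0 outside the weighted l2
    space. *)
Definition ofseq c : bergman :=
  match pselect (exists f : bergman, forall n, tay f n = c n) with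
  | left h => projT1 (cid h) | right _ => 0 end.

Lemma tay_ofseq c (B : R) : (forall N, wsum c N <= B) -> forall n, tay (ofseq c) n = c n.
Proof.
by move=> cB n; rewrite /ofseq; case: pselect => [h|[]]; [case: cid|exact: synthesis cB].
Qed.

Lemma N2_ofseq c (B : R) : (forall N, wsum c N <= B) -> N2 (ofseq c) <= B.
Proof.
move=> cB; apply: bergman_N2_le => N; have -> : wsum (tay (ofseq c)) N = wsum c N => //.
by apply: eq_bigr => i _; rewrite (tay_ofseq cB).
Qed.

(** The Bergman projection, defined through coefficients. *)
Definition bproj F : bergman := ofseq (tay F).

Lemma tay_bproj F n : sqi F -> tay (bproj F) n = tay F n.
Proof. by move=> iF; apply: (tay_ofseq (B := N2 F)) => N; exact: wsum_tay. Qed.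

Lemma N2_bproj F : sqi F -> N2 (bproj F) <= N2 F.
Proof. by move=> iF; apply: N2_ofseq => N; exact: wsum_tay. Qed.

Lemma nrm_bproj F : sqi F -> nrm (bproj F) <= nrm F.
Proof. by move=> iF; rewrite ler_wsqrtr// N2_bproj. Qed.

Lemma ip_cvg F g : sqi F ->
  ccvg (fun N => \sum_(n < N) tay F n * (tay g n)^* / n.+1%:R) (ip F g).
Proof.
move=> iF; have ig := bergman_sqi g.
apply: (@ccvg_squeeze _ _ _ (fun N => nrm F * nrm (fun z => g z - psum (tay g) N z))).
  move=> N; have ip1 := sqi_psum (tay g) N.
  have -> : \sum_(n < N) tay F n * (tay g n)^* / n.+1%:R = ip F (psum (tay g) N).
    by rewrite ip_psumr//; apply: eq_bigr => i _; rewrite ip_tay mulrA [_^* * _]mulrC.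
  by rewrite cnormBC -ipBr//; apply: ip_le_nrm => //; exact: sqiB.
by rewrite -[X in _ --> X](mulr0 (nrm F)); apply: cvgM; [exact: cvg_cst|exact: bergman_nrm_cvg].
Qed.

(** P is the orthogonal projection: F - P F has the same coefficients as 0. *)
Lemma ip_bproj F g : sqi F -> ip (bproj F) g = ip F g.
Proof.
move=> iF; apply: ccvg_unique (ip_cvg g (bergman_sqi _)) _.
have -> : (fun N => \sum_(n < N) tay (bproj F) n * (tay g n)^* / n.+1%:R) =
   (fun N => \sum_(n < N) tay F n * (tay g n)^* / n.+1%:R); last exact: ip_cvg.
by apply/funext => N; apply: eq_bigr => i _; rewrite tay_bproj.
Qed.

Lemma tay_lin (a : C) F G n : sqi F -> sqi G ->
  tay (fun z => a * F z + G z) n = a * tay F n + tay G n.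
Proof.
move=> iF iG; have iz := @sqi_mono R n.
rewrite /tay ipDl//; last exact: sqiZ.
by rewrite ipZl// mulrDr mulrCA.
Qed.

Lemma tay_linear (a : C) f g n : tay (a *: f + g : bergman) n = a * tay f n + tay g n.
Proof. by have := tay_lin a n (bergman_sqi f) (bergman_sqi g). Qed.

Lemma tay0 n : tay (0 : bergman) n = 0.
Proof.
have := tay_linear 1 0 0 n; rewrite scaler0 addr0 mul1r => /eqP.
by rewrite -subr_eq0 opprD addNKr oppr_eq0 => /eqP.
Qed.

Lemma tayZ (a : C) f n : tay (a *: f : bergman) n = a * tay f n.
Proof. by have := tay_linear a f 0 n; rewrite addr0 tay0 addr0. Qed.

Lemma tayD f g n : tay (f + g : bergman) n = tay f n + tay g n.
Proof. by have := tay_linear 1 f g n; rewrite scale1r mul1r. Qed.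

Lemma tayB f g n : tay (f - g : bergman) n = tay f n - tay g n.
Proof. by rewrite tayD -scaleN1r tayZ mulN1r. Qed.

Lemma tay_sum (I : Type) (r : seq I) (P : pred I) (f : I -> bergman) n :
  tay (\sum_(i <- r | P i) f i : bergman) n = \sum_(i <- r | P i) tay (f i) n.
Proof.
elim: r => [|i r IH]; first by rewrite !big_nil tay0.
by rewrite !big_cons; case: (P i); rewrite ?tayD IH.
Qed.

Lemma tay_le F n : sqi F -> cnorm (tay F n) <= n.+1%:R * nrm F.
Proof.
move=> iF; rewrite /tay cnormM cnorm_nat ler_wpM2l//.
apply: le_trans (ip_le_nrm iF (@sqi_mono R n)) _.
rewrite ler_piMr ?nrm_ge0// /nrm.
have : (N2 (fun z : C => z ^+ n))%:C%C = (n.+1%:R^-1 : R)%:C%C.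
  by rewrite -ip_self ip_mono eqxx mul1r fmorphV rmorph_nat.
move=> /(congr1 (@complex.Re R)) /= ->.
by rewrite -[leRHS]sqrtr1 ler_wsqrtr// invf_le1 ?ler1n ?ltr0n.
Qed.

Lemma tay_psum c N n : tay (psum c N) n = if (n < N)%N then c n else 0.
Proof.
rewrite /tay ip_psum_mono; case: ifP => _; last by rewrite mulr0.
by rewrite mulrC divfK// pnatr_eq0.
Qed.

Lemma bbasis_tay n m : tay (bbasis n : bergman) m =
  if m == n then (Num.sqrt n.+1%:R)%:C%C else 0.
Proof.
have -> : tay (bbasis n : bergman) m = tay (fun z => (Num.sqrt n.+1%:R)%:C%C * z ^+ n) m.
  by congr (_ * _); apply: eq_ip => // z Dz; rewrite bbasisE (Dz : cnorm z < 1).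
rewrite /tay ipZl ?ip_mono; [|exact: sqi_mono..].
rewrite eq_sym; have [->|nm] := eqVneq m n; last by rewrite mul0r !mulr0.
by rewrite mul1r mulrCA divff ?mulr1 ?pnatr_eq0.
Qed.

Lemma nrm_bound F (M : R) : 0 <= M -> sqi F -> (forall z, disk z -> cnorm (F z) <= M) -> nrm F <= M.
Proof.
move=> M0 iF FM; rewrite -(@ler_pXn2r _ 2)// ?nnegrE ?nrm_ge0// sqr_nrm /N2.
apply: (@le_trans _ _ (Rintegral area pdisk (cst (M ^+ 2)))).
  apply: le_Rintegral.
  - exact: pdisk_measurable.
  - exact: iF.2.
  - apply: (eq_integrable (@pdisk_measurable R)) (sqi_bdd (bdd_cst M%:C%C)).2 => p _.
    by rewrite cnorm_real /= real_normK ?num_real.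
  - by move=> p Dp; rewrite lerXn2r ?nnegrE ?cnorm_ge0 ?FM.
rewrite Rintegral_cst ?area_disk ?mulr1//; exact: pdisk_measurable.
Qed.

Lemma sqi_mulb (a : C -> C) F : bdd a -> sqi F -> sqi (fun z => a z * F z).
Proof.
move=> [ma [M aM]] [mF iF]; split; first exact: cmeasurableM.
have mP := cmeasurableM ma mF.
have iM := integrableZl (@pdisk_measurable R) (M ^+ 2) iF.
apply: (le_integrable (@pdisk_measurable R) _ _ iM).
  by apply/measurable_EFinP; exact: measurable_sqr_cnorm mP.
move=> p Dp /=; have M0 := le_trans (cnorm_ge0 _) (aM _ Dp).
rewrite lee_fin cnormM exprMn !ger0_norm; [|exact: mulr_ge0 (sqr_ge0 _) (sqr_ge0 _)..].
by rewrite ler_wpM2r ?sqr_ge0// lerXn2r ?nnegrE ?cnorm_ge0 ?aM.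
Qed.

Lemma nrm_mulb (a : C -> C) F (M : R) : 0 <= M -> bdd a -> sqi F ->
  (forall z, disk z -> cnorm (a z) <= M) -> nrm (fun z => a z * F z) <= M * nrm F.
Proof.
move=> M0 ba iF aM; have iaF := sqi_mulb ba iF.
rewrite -(@ler_pXn2r _ 2)// ?nnegrE ?mulr_ge0 ?nrm_ge0// exprMn !sqr_nrm /N2.
rewrite -RintegralZl; [|exact: pdisk_measurable|exact: iF.2].
apply: le_Rintegral.
- exact: pdisk_measurable.
- exact: iaF.2.
- exact: (integrable_scale (@pdisk_measurable R) (M ^+ 2) iF.2).
move=> p Dp; rewrite cnormM exprMn ler_wpM2r ?sqr_ge0//.
by rewrite lerXn2r ?nnegrE ?cnorm_ge0 ?aM.
Qed.

End BergmanElements.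

(** * Negative binomial series *)
Section KernelSeries.
Context {R : realType}.
Local Notation C := R[i].
Implicit Types (x : C) (s t : R) (k n N : nat).

(** Partial sums of (1 - x)^(-(k+1)). *)
Definition negbin (A : nzRingType) k N (x : A) : A := \sum_(n < N) 'C(n + k, k)%:R * x ^+ n.

(** Pascal: the coefficients for k + 1 are the partial sums of those for k. *)
Lemma negbin_step (A : comNzRingType) k N (x : A) :
  (1 - x) * negbin k.+1 N x = negbin k N x - 'C(N + k, k.+1)%:R * x ^+ N.
Proof.
rewrite /negbin; elim: N => [|N IH].
  by rewrite !big_ord0 add0n bin_small// mul0r mulr0 subr0.
rewrite !big_ord_recr/= mulrDr IH addSn addnS binS natrD exprS; ring.
Qed.

Lemma negbin0 (A : comNzRingType) N (x : A) : (1 - x) * negbin 0 N x = 1 - x ^+ N.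
Proof.
rewrite -[RHS]opprB subrX1 -mulNr opprB; congr (_ * _).
by apply: eq_bigr => i _; rewrite bin0 mul1r.
Qed.

Lemma negbin_le k N s : 0 <= s < 1 -> negbin k N s <= (1 - s)^-1 ^+ k.+1.
Proof.
move=> /andP[s0 s1]; have s1' : 0 < 1 - s by rewrite subr_gt0.
have [P N0] : negbin 0 N s <= (1 - s)^-1 /\ True.
  by split=> //; rewrite -[leRHS]mulr1 mulrC ler_pdivlMr// mulrC negbin0 gerBl exprn_ge0.
elim: k => [|k IH]; first by rewrite expr1.
rewrite exprS mulrC ler_pdivlMr// mulrC negbin_step; apply: le_trans IH.
by rewrite gerBl mulr_ge0 ?exprn_ge0.
Qed.

Lemma negbin_coef k n s : 0 <= s < 1 -> 'C(n + k, k)%:R * s ^+ n <= (1 - s)^-1 ^+ k.+1.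
Proof.
move=> s01; apply: le_trans (negbin_le k n.+1 s01).
rewrite /negbin big_ord_recr/= lerDr; apply: sumr_ge0 => i _.
by rewrite mulr_ge0// exprn_ge0//; case/andP: s01.
Qed.

(** The coefficients are bounded by a multiple of s^(-n) for any s strictly
    between t and 1. *)
Lemma negbin_coef0 k t : 0 <= t < 1 -> 'C(n + k, k.+1)%:R * t ^+ n @[n --> \oo] --> (0 : R).
Proof.
move=> /andP[t0 t1]; pose s := (1 + t) / 2.
have s0 : 0 < s by rewrite /s; lra.
have s1 : s < 1 by rewrite /s; lra.
have ts : t < s by rewrite /s; lra.
have s01 : 0 <= s < 1 by rewrite (ltW s0).
have q01 : 0 <= t / s < 1 by rewrite divr_ge0 ?(ltW s0)//= ltr_pdivrMr// mul1r.
have := cvg_geo ((1 - s)^-1 ^+ k.+2) q01; apply: squeeze_cvgr; last exact: cvg_cst.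
apply: nearW => n; rewrite mulr_ge0 ?exprn_ge0//=.
have -> : t ^+ n = s ^+ n * (t / s) ^+ n.
  by rewrite -exprMn mulrCA divff ?mulr1// gt_eqF.
rewrite mulrA ler_wpM2r ?exprn_ge0//; first by case/andP: q01.
apply: le_trans (negbin_coef k.+1 n s01); rewrite ler_wpM2r ?exprn_ge0 ?(ltW s0)//.
by rewrite ler_nat addnS binS leq_addr.
Qed.

(** Induction on k by [negbin_step]: dividing by 1 - x costs a factor at
    most 1 / (1 - t). *)
Lemma negbin_cvg k t : 0 <= t < 1 -> exists2 e_ : nat -> R, e_ n @[n --> \oo] --> (0 : R) &
  forall (x : C) N, cnorm x <= t -> cnorm (negbin k N x - (1 - x)^-1 ^+ k.+1) <= e_ N.
Proof.
move=> t01; have /andP[t0 t1] := t01; have t1' : 0 < 1 - t by rewrite subr_gt0.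
have x1 (x : C) : cnorm x <= t -> 1 - t <= cnorm (1 - x).
  move=> xt; apply: le_trans (cnorm_le_sub _ _); rewrite cnorm1; lra.
have nx (x : C) : cnorm x <= t -> 1 - x != 0.
  by move=> /x1 h; rewrite -cnorm_eq0 gt_eqF// (lt_le_trans t1').
have div (x y e : C) : cnorm x <= t -> (1 - x) * y = e -> cnorm y <= cnorm e / (1 - t).
  move=> xt <-; rewrite cnormM mulrAC ler_peMl ?cnorm_ge0//.
  by rewrite ler_pdivlMr// mul1r x1.
elim: k => [|k [e_ ce He]].
  exists (fun n => 1 * t ^+ n / (1 - t)).
    rewrite -[X in _ --> X](mul0r (1 - t)^-1); apply: cvgM; last exact: cvg_cst.
    exact: cvg_geo.
  move=> x N xt; have h : (1 - x) * (negbin 0 N x - (1 - x)^-1 ^+ 1) = - x ^+ N.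
    by rewrite mulrBr negbin0 expr1 mulfV ?nx//; ring.
  apply: le_trans (div _ _ _ xt h) _; rewrite cnormN cnormX mul1r ler_pM2r ?invr_gt0//.
  by rewrite lerXn2r ?nnegrE ?cnorm_ge0.
exists (fun n => (e_ n + 'C(n + k, k.+1)%:R * t ^+ n) / (1 - t)).
  rewrite -[X in _ --> X](mul0r (1 - t)^-1); apply: cvgM; last exact: cvg_cst.
  by rewrite -[X in _ --> X](addr0 0); apply: cvgD => //; exact: negbin_coef0.
move=> x N xt.
have h : (1 - x) * (negbin k.+1 N x - (1 - x)^-1 ^+ k.+2) =
    (negbin k N x - (1 - x)^-1 ^+ k.+1) - 'C(N + k, k.+1)%:R * x ^+ N.
  rewrite mulrBr negbin_step [in LHS]exprS mulrA mulfV ?nx// mul1r; ring.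
apply: le_trans (div _ _ _ xt h) _; rewrite ler_pM2r ?invr_gt0//.
apply: le_trans (cnorm_le_add _ _) _; rewrite cnormN lerD ?He//.
rewrite cnormM cnorm_nat cnormX ler_wpM2l// lerXn2r ?nnegrE ?cnorm_ge0//.
Qed.

End KernelSeries.

(** * Bounded operators and Toeplitz operators *)
Section Operators.
Context {R : realType}.
Local Notation C := R[i].
Local Notation Re := complex.Re.
Local Notation Im := complex.Im.
Local Notation sqi := (@square_integrable R).
Local Notation bergman := (@bergman R).
Implicit Types (F G : C -> C) (f g : bergman) (z w : C) (n m N : nat)
  (T U : bergman -> bergman) (M : R).

Definition op_le T M : Prop := forall f, nrm (T f) <= M * nrm f.

Lemma nrm_scale (c : C) f : nrm (c *: f : bergman) = cnorm c * nrm f.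
Proof. exact: (nrmZ c (bergman_sqi f)). Qed.

Lemma nrm_add f g : nrm (f + g : bergman) <= nrm f + nrm g.
Proof. exact: (nrmD (bergman_sqi f) (bergman_sqi g)). Qed.

Lemma nrm_opp f : nrm (- f : bergman) = nrm f.
Proof. by rewrite -scaleN1r nrm_scale cnormN cnorm1 mul1r. Qed.

Lemma nrm_sub f g : nrm (f - g : bergman) <= nrm f + nrm g.
Proof. by rewrite (le_trans (nrm_add _ _))// nrm_opp. Qed.

Lemma nrm0 : nrm (0 : bergman) = 0.
Proof. by have := nrm_scale 0 0; rewrite scale0r cnorm0 mul0r. Qed.

Lemma lin0 T : linear T -> T 0 = 0.
Proof. by move=> lT; have := lT (-1) 0 0; rewrite scaler0 addr0 scaleN1r addNr. Qed.

Lemma linZ T (c : C) f : linear T -> T (c *: f) = c *: T f.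
Proof. by move=> lT; have := lT c f 0; rewrite addr0 lin0// addr0. Qed.

Lemma linD T f g : linear T -> T (f + g) = T f + T g.
Proof. by move=> lT; have := lT 1 f g; rewrite !scale1r. Qed.

Lemma linB T f g : linear T -> T (f - g) = T f - T g.
Proof. by move=> lT; rewrite linD// -scaleN1r linZ// scaleN1r. Qed.

Lemma lin_sum T (I : Type) (r : seq I) (P : pred I) (F : I -> bergman) : linear T ->
  T (\sum_(i <- r | P i) F i) = \sum_(i <- r | P i) T (F i).
Proof.
move=> lT; elim: r => [|i r IH]; first by rewrite !big_nil lin0.
by rewrite !big_cons; case: (P i); rewrite ?linD// IH.
Qed.

Lemma opnorm_le T M : op_le T M -> 0 <= M -> (opnorm T <= M%:E)%E.
Proof.
move=> TM M0; apply: ge_ereal_sup => _ [f /= f1 <-]; rewrite lee_fin.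
rewrite !bnormE in f1 *; apply: le_trans (TM f) _; rewrite -[leRHS]mulr1 ler_wpM2l//.
Qed.

(** If f has norm 0, all its multiples have norm at most 1, which forces T f
    to have norm 0. *)
Lemma opnorm_op_le T M : linear T -> (opnorm T <= M%:E)%E -> op_le T M.
Proof.
move=> lT TM f.
have h g : nrm g <= 1 -> nrm (T g) <= M.
  move=> g1; rewrite -lee_fin; apply: le_trans TM; apply: ereal_sup_ubound.
  by exists g => /=; rewrite bnormE.
have M0 : 0 <= M by apply: le_trans (h 0 _); rewrite ?nrm_ge0 ?nrm0.
have [f0|f0] := eqVneq (nrm f) 0.
  rewrite f0 mulr0 leNgt; apply/negP => b0.
  pose t := (M + 1) / nrm (T f).
  have t0 : 0 <= t by rewrite divr_ge0 ?addr_ge0// ltW.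
  have := h (t%:C%C *: f); rewrite linZ// !nrm_scale f0 mulr0 ler01 => /(_ isT).
  by rewrite cnorm_real ger0_norm// /t divfK ?gt_eqF//; lra.
have f1 : 0 < nrm f by rewrite lt_def f0 nrm_ge0.
have := h ((nrm f)^-1%:C%C *: f); rewrite linZ// !nrm_scale cnorm_real ger0_norm ?invr_ge0 ?nrm_ge0//.
by rewrite mulVf// lexx => /(_ isT); rewrite mulrC ler_pdivrMr.
Qed.

Lemma bounded_operatorP T :
  bounded_operator T <-> linear T /\ exists2 M, 0 <= M & op_le T M.
Proof.
split=> [[lT oT]|[lT [M M0 TM]]]; last first.
  by split=> //; apply: le_lt_trans (opnorm_le TM M0) (ltry _).
split=> //.
have o0 : (0 <= opnorm T)%E.
  apply: (@le_trans _ _ (bnorm (T 0))%:E); first by rewrite lee_fin bnormE nrm_ge0.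
  by apply: ereal_sup_ubound; exists 0 => //=; rewrite bnormE nrm0 ler01.
have of_ : opnorm T \is a fin_num by rewrite ge0_fin_numE.
exists (fine (opnorm T)); first exact: fine_ge0.
by apply: opnorm_op_le => //; rewrite fineK.
Qed.

Lemma nrm_tay_le f g M : 0 <= M -> (forall n, cnorm (tay g n) <= M * cnorm (tay f n)) ->
  nrm g <= M * nrm f.
Proof.
move=> M0 h; rewrite -(@ler_pXn2r _ 2)// ?nnegrE ?mulr_ge0 ?nrm_ge0// exprMn !sqr_nrm.
apply: bergman_N2_le => N; apply: le_trans (ler_wpM2l (sqr_ge0 M) (bergman_wsum f N)).
rewrite /wsum mulr_sumr; apply: ler_sum => i _; rewrite mulrA ler_wpM2r ?invr_ge0//.
by rewrite -exprMn lerXn2r ?nnegrE ?mulr_ge0 ?cnorm_ge0.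
Qed.

Lemma tay_nrm_lim F (G_ : nat -> C -> C) n (l : C) : sqi F -> (forall N, sqi (G_ N)) ->
  nrm (fun z => F z - G_ N z) @[N --> \oo] --> (0 : R) ->
  ccvg (fun N => tay (G_ N) n) l -> tay F n = l.
Proof.
move=> iF iG h; apply: ccvg_unique.
apply: (@ccvg_squeeze _ _ _ (fun N => n.+1%:R * nrm (fun z => F z - G_ N z))).
  move=> N; have -> : tay (G_ N) n - tay F n = - tay (fun z => F z - G_ N z) n.
    by rewrite /tay ipBl//; [ring|exact: sqi_mono].
  by rewrite cnormN; apply: tay_le; exact: sqiB.
by rewrite -[X in _ --> X](mulr0 n.+1%:R); apply: cvgM => //; exact: cvg_cst.
Qed.

Lemma bdd_kernel k z : disk z -> bdd (bkernel k z).
Proof.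
move=> z1; have z0 : 0 < 1 - cnorm z by rewrite subr_gt0.
split.
  apply: (@cmeasurableV _ (fun w => (1 - z^* * w) ^+ (2 + k))).
  apply: (@cmeasurableX _ (fun w => 1 - z^* * w)).
  have := cmeasurableD (cmeasurable_cst 1)
    (cmeasurableM (cmeasurable_cst (- z^*)) (@cmeasurable_id R)).
  by congr cmeasurable; apply/funext => w; rewrite mulNr.
exists (((1 - cnorm z) ^+ (2 + k))^-1) => w Dw.
have zw : 0 < cnorm (1 - z^* * w) by exact: lt_le_trans (cnorm_sub1 z1 Dw).
rewrite /bkernel cnormV cnormX lef_pV2 ?posrE ?exprn_gt0//.
by rewrite lerXn2r ?nnegrE ?cnorm_ge0 ?(ltW z0)// cnorm_sub1.
Qed.

Lemma kernel0_conj z w : (bkernel 0 z w)^* = ((1 - w^* * z) ^+ 2)^-1.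
Proof.
by rewrite /bkernel addn0 fmorphV rmorphXn/= rmorphB rmorphM/= conjCK rmorph1 mulrC.
Qed.

(** The partial sums of the kernel K^k_z, in the variable conj(z) w. *)
Definition ksum k z N (w : C) : C := negbin k.+1 N (z^* * w).

Lemma ksumE k z N w : ksum k z N w = psum (fun n => 'C(n + k.+1, k.+1)%:R * z^* ^+ n) N w.
Proof. by apply: eq_bigr => i _; rewrite exprMn mulrA. Qed.

Lemma sqi_ksum k z N : sqi (ksum k z N).
Proof. by apply: eq_sqi (sqi_psum _ N) => w _; rewrite ksumE. Qed.

Lemma kernel_nrm_cvg k z : disk z ->
  nrm (fun w => bkernel k z w - ksum k z N w) @[N --> \oo] --> (0 : R).
Proof.
move=> Dz; have z01 : 0 <= cnorm z < 1 by rewrite cnorm_ge0.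
have [e_ ce He] := negbin_cvg k.+1 z01.
apply: squeeze_cvgr ce; last exact: cvg_cst.
apply: nearW => N; rewrite nrm_ge0/=.
have est w : disk w -> cnorm (bkernel k z w - ksum k z N w) <= e_ N.
  move=> Dw; rewrite cnormBC /bkernel -exprVn; apply: He.
  by rewrite cnormM cnorm_conj ler_piMr ?cnorm_ge0//; exact: ltW.
apply: nrm_bound => //.
  exact: le_trans (cnorm_ge0 _) (est 0 disk0).
by apply: sqiB; [exact: sqi_bdd (bdd_kernel k Dz)|exact: sqi_ksum].
Qed.

Definition bmul a f : bergman := bproj (fun z => a z * f z).

Lemma tay_bmul a f n : bdd a -> tay (bmul a f) n = tay (fun z => a z * f z) n.
Proof. by move=> ba; apply: tay_bproj; apply: sqi_mulb => //; exact: bergman_sqi. Qed.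

Lemma bmul_linear a : bdd a -> linear (bmul a).
Proof.
move=> ba c f g; apply: bergman_ext => n; rewrite tay_linear !tay_bmul//.
rewrite -tay_lin; [|exact: sqi_mulb (bergman_sqi _)..].
congr (_ * _); apply: eq_ip => // z _.
have -> : (c *: f + g : bergman) z = c * f z + g z by [].
by rewrite mulrDr mulrCA.
Qed.

Lemma bmul_le a M : 0 <= M -> bdd a -> (forall z, disk z -> cnorm (a z) <= M) -> op_le (bmul a) M.
Proof.
move=> M0 ba aM f; have sf := bergman_sqi f.
exact: le_trans (nrm_bproj (sqi_mulb ba sf)) (nrm_mulb M0 ba sf aM).
Qed.

Lemma ip_bmul a f g : bdd a -> ip (bmul a f) g = ip (fun z => a z * f z) g.
Proof. by move=> ba; apply: ip_bproj; apply: sqi_mulb => //; exact: bergman_sqi. Qed.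

(** Both sides have the value at z of the limit of the inner products of a f
    with the partial sums of the reproducing kernel. *)
Lemma toeplitz_bdd a : bdd a -> toeplitz a = bmul a.
Proof.
move=> ba; apply/funext => f; set h := bmul a f.
have saf := sqi_mulb ba (bergman_sqi f).
suff E z : disk z -> cintegral (fun w => a w * f w / (1 - w^* * z) ^+ 2) = h z.
  rewrite /toeplitz /to_bergman; set F := fun z : C => if _ then _ else _.
  have -> : F = val h; last by rewrite valKd.
  apply/funext => z; rewrite /F; case: ifPn => Dz; first exact: E.
  by have [h0 _ _] := bergman_in h; apply/esym/h0/negP.
move=> Dz; have skz := sqi_bdd (bdd_kernel 0 Dz).
have -> : cintegral (fun w => a w * f w / (1 - w^* * z) ^+ 2) = ip (fun w => a w * f w) (bkernel 0 z).
  by apply: eq_cintegral => w _; rewrite kernel0_conj.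
apply: (ccvg_unique _ (bergman_taylor h Dz)).
apply: (@ccvg_squeeze _ _ _ (fun N => nrm (fun w => a w * f w) * nrm (fun w => bkernel 0 z w - ksum 0 z N w))).
  move=> N; have -> : psum (tay h) N z = ip (fun w => a w * f w) (ksum 0 z N).
    rewrite (@eq_ip _ _ (fun w => a w * f w) _ _ _ (fun w _ => ksumE 0 z N w))// ip_psumr//.
    apply: eq_bigr => i _; rewrite tay_bmul// /tay rmorphM rmorphXn/= conjCK conjC_nat bin1 addn1.
    by rewrite mulrAC.
  rewrite cnormBC -ipBr//; last exact: sqi_ksum.
  by apply: ip_le_nrm => //; apply: sqiB => //; exact: sqi_ksum.
by rewrite -[X in _ --> X](mulr0 (nrm (fun w => a w * f w))); apply: cvgM; [exact: cvg_cst|exact: kernel_nrm_cvg].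
Qed.

Lemma cmeasurable_trunc a M : cmeasurable a -> cmeasurable (fun z => if cnorm (a z) <= M then a z else 0).
Proof.
move=> [a1 a2]; have mn := measurable_sqr_cnorm (conj a1 a2).
(* the truncation is decided on squares, whose measurability is known; for
   negative M nothing is kept *)
pose s : R := if 0 <= M then M ^+ 2 else - 1.
have E z : (cnorm (a z) <= M) = (cnorm (a z) ^+ 2 <= s).
  rewrite /s; case: ifPn => M0; first by rewrite ler_pXn2r// nnegrE cnorm_ge0.
  rewrite -ltNge in M0; rewrite [LHS]leNgt (lt_le_trans M0) ?cnorm_ge0//=.
  by apply/esym/negbTE; rewrite -ltNge (lt_le_trans _ (sqr_ge0 _))// ltrN10.
have mb : measurable_fun pdisk (fun p => cnorm (a (plane p)) ^+ 2 <= s).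
  by apply: measurable_fun_ler => //; exact: measurable_cst.
have part (h : C -> R) : h 0 = 0 -> measurable_fun pdisk (fun p => h (a (plane p))) ->
   measurable_fun pdisk (fun p => h (if cnorm (a (plane p)) <= M then a (plane p) else 0)).
  move=> h0 mh.
  have mi : measurable_fun pdisk (fun p => if cnorm (a (plane p)) ^+ 2 <= s then h (a (plane p)) else 0).
    apply: measurable_fun_if => //; first exact: pdisk_measurable.
    by apply: measurable_funS mh; [exact: pdisk_measurable|exact: subIsetl].
  by apply: eq_measurable_fun mi => p _; rewrite E; case: ifP; rewrite ?h0.
by split; apply: part.
Qed.

(** An essentially bounded symbol is cut off at its essential bound; this
    changes the integrals defining the operator on a null set only. *)
Lemma Linfty_trunc (a : C -> C) : Linfty a -> exists2 a' : C -> C, bdd a' & toeplitz a = toeplitz a'.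
Proof.
move=> [ma [M aM]]; pose a' z := if cnorm (a z) <= M then a z else 0.
have ma' : cmeasurable a' by exact: cmeasurable_trunc.
exists a'.
  split=> //; exists `|M| => z _; rewrite /a'; case: ifPn => h; last by rewrite cnorm0.
  exact: le_trans h (ler_norm _).
apply/funext => f; rewrite /toeplitz /to_bergman; congr (insubd _ _).
apply/funext => z; case: ifPn => // Dz.
have mk := (sqi_mulb (bdd_conj (bdd_kernel 0 Dz)) (bergman_sqi f)).1.
have E (b : C -> C) w : b w * f w / (1 - w^* * z) ^+ 2 = b w * ((bkernel 0 z w)^* * f w).
  by rewrite kernel0_conj -mulrA; congr (_ * _); rewrite mulrC.
have [m1 m2] := cmeasurableM ma mk; have [n1 n2] := cmeasurableM ma' mk.
have ae (h : C -> R) : ae_eq area pdisk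
    (fun p => (h (a (plane p) * ((bkernel 0 z (plane p))^* * f (plane p))))%:E)
    (fun p => (h (a' (plane p) * ((bkernel 0 z (plane p))^* * f (plane p))))%:E).
  by apply: filterS aM => p ap Dp; rewrite /a' ap.
rewrite (@eq_cintegral _ _ _ (fun w _ => E a w)) (@eq_cintegral _ _ _ (fun w _ => E a' w)).
apply: complex_eq; rewrite /cintegral /= /Rintegral; congr fine.
  apply: ae_eq_integral (ae (@complex.Re R)); [exact: pdisk_measurable|exact/measurable_EFinP..].
apply: ae_eq_integral (ae (@complex.Im R)); [exact: pdisk_measurable|exact/measurable_EFinP..].
Qed.

Lemma bdd_Linfty (a : C -> C) : bdd a -> Linfty a.
Proof. by move=> [ma [M aM]]; split=> //; exists M; apply: aeW => p Dp; exact: aM. Qed.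

End Operators.

(** * Diagonal operators *)
Section Radial.
Context {R : realType}.
Local Notation C := R[i].
Local Notation bergman := (@bergman R).
Implicit Types (f g : bergman) (z w : C) (n m N : nat) (M : R).

Definition bdiag (x : nat -> C) f : bergman := ofseq (fun n => x n * tay f n).

Lemma tay_bdiag (x : nat -> C) M f n : (forall n, cnorm (x n) <= M) ->
  tay (bdiag x f) n = x n * tay f n.
Proof.
move=> xM; have M0 : 0 <= M := le_trans (cnorm_ge0 _) (xM 0).
apply: (@tay_ofseq _ _ (M ^+ 2 * N2 f)) => N.
apply: le_trans (ler_wpM2l (sqr_ge0 M) (bergman_wsum f N)).
rewrite /wsum mulr_sumr; apply: ler_sum => i _; rewrite [leRHS]mulrA ler_wpM2r ?invr_ge0//.
by rewrite cnormM exprMn ler_wpM2r ?sqr_ge0// lerXn2r ?nnegrE ?cnorm_ge0.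
Qed.

Variables (S : bergman -> bergman) (lambda : nat -> C).
Hypothesis bS : bounded_operator S.
Hypothesis radS : forall n : nat, S (bbasis n) = lambda n *: bbasis n.

Lemma nrm_bbasis n : nrm (bbasis n : bergman) = 1.
Proof.
have nz := @sqi_mono R n.
have -> : nrm (bbasis n : bergman) = nrm (fun z : C => (Num.sqrt n.+1%:R)%:C%C * z ^+ n).
  by congr (Num.sqrt _); apply: eq_N2 => z Dz; rewrite bbasisE (Dz : cnorm z < 1).
rewrite /nrm N2Z// cnorm_real real_normK ?num_real// sqr_sqrtr//.
have : (N2 (fun z : C => z ^+ n))%:C%C = (n.+1%:R^-1 : R)%:C%C.
  by rewrite -ip_self ip_mono eqxx mul1r fmorphV rmorph_nat.
by move=> /(congr1 (@complex.Re R)) /= ->; rewrite mulfV ?pnatr_eq0// sqrtr1.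
Qed.

Lemma radial_bound M : op_le S M -> forall n, cnorm (lambda n) <= M.
Proof.
by move=> SM n; have := SM (bbasis n); rewrite radS nrm_scale nrm_bbasis !mulr1.
Qed.

(** S is known on the basis; boundedness of S and of the coefficient
    functionals extends the relation to the L2 limits of polynomials. *)
Lemma radial_tay f n : tay (S f) n = lambda n * tay f n.
Proof.
have [lS [M M0 SM]] := (bounded_operatorP S).1 bS.
pose s m : C := (Num.sqrt m.+1%:R)%:C%C.
have s0 m : s m != 0.
  by rewrite -cnorm_eq0 cnorm_real normr_eq0 sqrtr_eq0 -ltNge ltr0n.
pose fN N : bergman := \sum_(m < N) (tay f m / s m) *: bbasis m.
have fNE N m : tay (fN N) m = tay (psum (tay f) N) m.
  rewrite tay_psum tay_sum; case: ifP => [mN|/negbT mN].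
    rewrite (bigD1 (Ordinal mN))//= tayZ bbasis_tay eqxx divfK// big1 ?addr0// => i im.
    rewrite tayZ bbasis_tay; case: eqP => [E|_]; last by rewrite mulr0.
    by case/eqP: im; apply: val_inj.
  rewrite big1// => i _; rewrite tayZ bbasis_tay; case: eqP => [E|_]; last by rewrite mulr0.
  by rewrite E ltn_ord in mN.
have fNz N z : disk z -> fN N z = psum (tay f) N z.
  move=> Dz; apply: ccvg_unique (bergman_taylor (fN N) Dz) _.
  apply: ccvg_near (ccvg_cst _); exists N => // K /= NK.
  rewrite /psum -(subnKC NK) big_split_ord/= [X in _ = _ + X]big1 ?addr0.
    by apply: eq_bigr => i _; rewrite fNE tay_psum ltn_ord.
  by move=> i _; rewrite fNE tay_psum ltnNge leq_addr mul0r.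
apply: (@tay_nrm_lim _ _ (fun N => S (fN N) : C -> C)).
- exact: bergman_sqi.
- by move=> N; exact: bergman_sqi.
- have c : M * nrm (fun z => f z - psum (tay f) N z) @[N --> \oo] --> (0 : R).
    by rewrite -[X in _ --> X](mulr0 M); apply: cvgM; [exact: cvg_cst|exact: bergman_nrm_cvg].
  apply: squeeze_cvgr c; last exact: cvg_cst.
  apply: nearW => N; rewrite nrm_ge0/=.
  have -> : nrm (fun z => S f z - S (fN N) z) = nrm (S (f - fN N)) by rewrite linB.
  apply: le_trans (SM _) _; rewrite ler_wpM2l// ler_wsqrtr// le_eqVlt; apply/orP; left.
  by apply/eqP/eq_N2 => z Dz; rewrite -fNz.
apply: ccvg_near (ccvg_cst _); exists n.+1 => // N /= nN.
rewrite /fN lin_sum// tay_sum (bigD1 (Ordinal nN))//= big1 ?addr0.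
  by rewrite linZ// radS !tayZ bbasis_tay eqxx -/(s n) [RHS]mulrCA divfK.
move=> i im; rewrite linZ// radS !tayZ bbasis_tay.
case: eqP => [E|_]; last by rewrite !mulr0.
by case/eqP: im; apply: val_inj.
Qed.

End Radial.

(** * Localized operators *)
Section Localization.
Context {R : realType}.
Local Notation C := R[i].
Local Notation Re := complex.Re.
Local Notation sqi := (@square_integrable R).
Local Notation bergman := (@bergman R).
Implicit Types (f g h : bergman) (z w : C) (n m N M j s : nat) (T U : bergman -> bergman).

(** Multiplication by z^j, see [bshiftE]. *)
Definition bshift j f : bergman := ofseq (fun n => if (n < j)%N then 0 else tay f (n - j)).

Let shift_wsum j f N :
  wsum (fun n => if (n < j)%N then 0 else tay f (n - j)) (j + N) =
  \sum_(i < N) cnorm (tay f i) ^+ 2 / (j + i).+1%:R.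
Proof.
rewrite /wsum big_split_ord/= big1 ?add0r.
  by apply: eq_bigr => i _; rewrite ltnNge leq_addr addKn.
by move=> i _; rewrite ltn_ord cnorm0 expr0n mul0r.
Qed.

Lemma tay_bshift j f n : tay (bshift j f) n = if (n < j)%N then 0 else tay f (n - j).
Proof.
apply: (@tay_ofseq _ _ (N2 f)) => N; apply: le_trans (wsum_le _ (leq_addl j N)) _.
rewrite shift_wsum; apply: le_trans (bergman_wsum f N).
apply: ler_sum => i _; rewrite ler_wpM2l ?sqr_ge0// lef_pV2 ?posrE ?ltr0n// ler_nat.
by rewrite ltnS leq_addl.
Qed.

Lemma bshiftE j f z : disk z -> bshift j f z = z ^+ j * f z.
Proof.
move=> Dz; have /ccvgP c1 := bergman_taylor (bshift j f) Dz.
apply: (@ccvg_unique _ (fun N => psum (tay (bshift j f)) (j + N) z)).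
  apply/ccvgP => e e0; have [K _ HK] := c1 e e0; exists K => // N /= KN.
  by apply: HK; exact: leq_trans KN (leq_addl _ _).
apply: ccvg_near (ccvgZ (z ^+ j) (bergman_taylor f Dz)); apply: nearW => N.
rewrite /psum big_split_ord/= [X in _ = X + _]big1 ?add0r.
  rewrite mulr_sumr; apply: eq_bigr => i _.
  by rewrite tay_bshift ltnNge leq_addr/= addKn exprD mulrCA.
by move=> i _; rewrite tay_bshift ltn_ord mul0r.
Qed.

Lemma bshift_linear j : linear (bshift j).
Proof.
move=> c f g; apply: bergman_ext => n; rewrite tay_linear !tay_bshift.
by case: ifP => _; rewrite ?mulr0 ?addr0// tay_linear.
Qed.

Lemma nrm_bshiftE j f : nrm (bshift j f) = nrm (fun z => z ^+ j * f z).
Proof. by congr (Num.sqrt _); apply: eq_N2 => z; exact: bshiftE. Qed.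

Lemma nrm_bshift j f : nrm (bshift j f) <= nrm f.
Proof.
rewrite nrm_bshiftE -[leRHS]mul1r; apply: nrm_mulb => //.
- by apply: bddX; exact: bdd_id.
- exact: bergman_sqi.
by move=> z Dz; rewrite cnormX exprn_ile1 ?cnorm_ge0//; exact: ltW.
Qed.

Definition bcut M f : bergman := bdiag (fun n => (n < M)%:R) f.

Lemma tay_bcut M f n : tay (bcut M f) n = if (n < M)%N then tay f n else 0.
Proof.
rewrite (tay_bdiag (M := 1)); first by case: ifP; rewrite ?mul1r ?mul0r.
by move=> k; case: ltnP; rewrite ?cnorm1 ?cnorm0.
Qed.

Lemma bcut_linear M : linear (bcut M).
Proof.
move=> c f g; apply: bergman_ext => n; rewrite tay_linear !tay_bcut.
by case: ifP => _; rewrite ?mulr0 ?addr0// tay_linear.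
Qed.

Lemma nrm_bcut M f : nrm (bcut M f) <= nrm f.
Proof.
rewrite -[leRHS]mul1r; apply: nrm_tay_le => // n; rewrite tay_bcut mul1r.
by case: ifP; rewrite ?cnorm0 ?cnorm_ge0.
Qed.

Definition vanishes_below N f : Prop := forall n, (n < N)%N -> tay f n = 0.

Lemma vanishes_below_cut N f : vanishes_below N (f - bcut N f).
Proof. by move=> n nN; rewrite tayB tay_bcut nN subrr. Qed.

Lemma nrm_sub_cut N f : nrm (f - bcut N f) <= nrm f.
Proof.
rewrite -[leRHS]mul1r; apply: nrm_tay_le => // n; rewrite tayB tay_bcut mul1r.
by case: ifP => _; rewrite ?subrr ?cnorm0 ?cnorm_ge0// subr0.
Qed.

Definition comm T j f : bergman := T (bshift j f) - bshift j (T f).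

(** The second clause says that T does not move mass from high to much lower
    indices, the third that T almost commutes with low powers of z on
    functions of high order. The second clause is what makes the third one
    stable under composition. *)
Definition localized T : Prop := [/\ bounded_operator T,
  forall e : R, 0 < e -> exists2 eta : R, 0 < eta &
    forall N M f, vanishes_below N f -> M%:R <= eta * N%:R -> nrm (bcut M (T f)) <= e * nrm f &
  forall e : R, 0 < e -> exists2 dl : R, 0 < dl &
    forall N j f, vanishes_below N f -> j%:R <= dl * N%:R -> nrm (comm T j f) <= e * nrm f].

(** The integer part M of x N is a threshold such that M is at most a
    fraction x of N and j at most a fraction y of M. If M = 0, then j = 0. *)
Lemma trunc_half (x y : R) N j : 0 < x -> 0 < y <= 1 -> j%:R <= x * y / 2 * N%:R ->
  exists M, M%:R <= x * N%:R /\ (j = 0%N \/ ((0 < M)%N /\ j%:R <= y * M%:R)).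
Proof.
move=> x0 /andP[y0 y1] jN; have xN : 0 <= x * N%:R by rewrite mulr_ge0 ?(ltW x0).
have /andP[h1 h2] := truncn_itv xN.
exists (Num.truncn (x * N%:R)); split=> //.
have jE : j%:R <= y / 2 * (x * N%:R).
  by apply: le_trans jN _; rewrite le_eqVlt; apply/orP; left; apply/eqP; field.
move: h1 h2 jE; move: (x * N%:R) (Num.truncn _) => t [|M] h1 h2 jE.
  left; apply/eqP; rewrite -leqn0 -ltnS -(ltr_nat R); apply: le_lt_trans jE _; nra.
right; split=> //; apply: le_trans jE _; have : 1 <= M.+1%:R :> R by rewrite ler1n.
rewrite -(natr1 M.+1) in h2; move: (M.+1%:R) h1 h2 => m h1 h2 m1; nra.
Qed.

Lemma bcut0 f : bcut 0 f = 0.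
Proof. by apply: bergman_ext => n; rewrite tay_bcut tay0. Qed.

Lemma comm0 T f : comm T 0 f = 0.
Proof.
have b0 g : bshift 0 g = g by apply: bergman_ext => n; rewrite tay_bshift subn0.
by rewrite /comm !b0 subrr.
Qed.

Lemma split_cut M f : f = bcut M f + (f - bcut M f).
Proof. by rewrite addrC subrK. Qed.

Lemma op_le_ge0 T (M : R) : op_le T M -> 0 <= M.
Proof.
by move=> h; have := h (bbasis 0); rewrite nrm_bbasis mulr1; apply: le_trans; exact: nrm_ge0.
Qed.

Lemma min1_gt0 (x : R) : 0 < x -> 0 < Num.min 1 x <= 1.
Proof. by move=> x0; rewrite lt_min ltr01 x0 ge_min lexx. Qed.

Lemma localized_lin (c : C) T U : localized T -> localized U -> localized (c *: T + U).
Proof.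
move=> [bT iT cT] [bU iU cU].
have [lT [MT MT0 TM]] := (bounded_operatorP T).1 bT.
have [lU [MU MU0 UM]] := (bounded_operatorP U).1 bU.
have k0 : 0 < cnorm c + 1 by rewrite ltr_wpDl ?cnorm_ge0.
have est (e : R) (a b : bergman) (q : R) : 0 < e -> 0 <= q ->
    nrm a <= e / (cnorm c + 1) / 2 * q -> nrm b <= e / 2 * q -> nrm (c *: a + b) <= e * q.
  move=> e0 q0 ha hb; apply: le_trans (nrm_add _ _) _; rewrite nrm_scale.
  apply: le_trans (lerD (ler_wpM2l (cnorm_ge0 c) ha) hb) _.
  have -> : cnorm c * (e / (cnorm c + 1) / 2 * q) + e / 2 * q =
     (cnorm c / (cnorm c + 1) + 1) / 2 * (e * q) by field; rewrite gt_eqF.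
  rewrite ler_piMl ?mulr_ge0 ?(ltW e0)// ler_pdivrMr// mul1r.
  have : cnorm c / (cnorm c + 1) <= 1 by rewrite ler_pdivrMr// mul1r lerDl.
  lra.
split.
- apply/bounded_operatorP; split.
    move=> a f g; change (c *: T (a *: f + g) + U (a *: f + g) =
      a *: (c *: T f + U f) + (c *: T g + U g)).
    by rewrite lT lU !scalerDr !scalerA [c * a]mulrC addrACA.
  exists (cnorm c * MT + MU); first by rewrite addr_ge0 ?mulr_ge0 ?cnorm_ge0.
  move=> f; change (nrm (c *: T f + U f) <= (cnorm c * MT + MU) * nrm f).
  apply: le_trans (nrm_add _ _) _; rewrite nrm_scale mulrDl lerD// -mulrA.
  by rewrite ler_wpM2l ?cnorm_ge0.
- move=> e e0; have e1 : 0 < e / (cnorm c + 1) / 2 by rewrite !divr_gt0.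
  have e2 : 0 < e / 2 by rewrite divr_gt0.
  have [a a0 Ha] := iT _ e1; have [b b0 Hb] := iU _ e2.
  exists (Num.min a b); first by rewrite lt_min a0.
  move=> N M f fN MN; change (nrm (bcut M (c *: T f + U f)) <= e * nrm f).
  rewrite bcut_linear; apply: est => //; first exact: nrm_ge0.
    by apply: (Ha N) => //; apply: le_trans MN _; rewrite ler_wpM2r// ge_min lexx.
  by apply: (Hb N) => //; apply: le_trans MN _; rewrite ler_wpM2r// ge_min lexx orbT.
- move=> e e0; have e1 : 0 < e / (cnorm c + 1) / 2 by rewrite !divr_gt0.
  have e2 : 0 < e / 2 by rewrite divr_gt0.
  have [a a0 Ha] := cT _ e1; have [b b0 Hb] := cU _ e2.
  exists (Num.min a b); first by rewrite lt_min a0.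
  move=> N j f fN jN.
  have -> : comm (c *: T + U) j f = c *: comm T j f + comm U j f.
    change (c *: T (bshift j f) + U (bshift j f) - bshift j (c *: T f + U f) =
      c *: comm T j f + comm U j f).
    by rewrite bshift_linear /comm scalerBr opprD addrACA.
  apply: est => //; first exact: nrm_ge0.
    by apply: (Ha N) => //; apply: le_trans jN _; rewrite ler_wpM2r// ge_min lexx.
  by apply: (Hb N) => //; apply: le_trans jN _; rewrite ler_wpM2r// ge_min lexx orbT.
Qed.

Lemma nrm_comm T j f (M : R) : op_le T M -> nrm (comm T j f) <= 2 * M * nrm f.
Proof.
move=> TM; have M0 := op_le_ge0 TM; apply: le_trans (nrm_sub _ _) _.
have h1 : nrm (T (bshift j f)) <= M * nrm f.
  by apply: le_trans (TM _) _; rewrite ler_wpM2l// nrm_bshift.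
have h2 : nrm (bshift j (T f)) <= M * nrm f by apply: le_trans (nrm_bshift _ _) (TM f).
by have := lerD h1 h2; rewrite -mulrA mulr_natl mulr2n.
Qed.

Lemma comm_lin T j f g : linear T -> comm T j (f + g) = comm T j f + comm T j g.
Proof.
move=> lT; rewrite /comm (linD _ _ (@bshift_linear j)) (linD _ _ lT) (linD _ _ lT).
by rewrite (linD _ _ (@bshift_linear j)) opprD addrACA.
Qed.

(** U f is split at an index K proportional to N: the part below K is small
    because U is localized, and T is localized on the part above K. *)
Lemma localized_comp T U : localized T -> localized U -> localized (T \o U).
Proof.
move=> [bT iT cT] [bU iU cU].
have [lT [MT MT0 TM]] := (bounded_operatorP T).1 bT.
have [lU [MU MU0 UM]] := (bounded_operatorP U).1 bU.
have t0 : 0 < MT + 1 by rewrite ltr_wpDl.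
have u0 : 0 < MU + 1 by rewrite ltr_wpDl.
have frac (x y q e : R) : 0 <= x -> 0 <= q -> 0 < e -> x < y -> x * (e / y * q) <= e * q.
  move=> x0 q0 e0 xy; have y0 : 0 < y by exact: le_lt_trans xy.
  have -> : x * (e / y * q) = x / y * (e * q) by ring.
  by rewrite ler_piMl ?mulr_ge0 ?(ltW e0)// ler_pdivrMr// mul1r ltW.
split.
- apply/bounded_operatorP; split.
    by move=> a f g; rewrite /= lU lT.
  exists (MT * MU); first exact: mulr_ge0.
  by move=> f /=; apply: le_trans (TM _) _; rewrite -mulrA ler_wpM2l.
- move=> e e0; have e2 : 0 < e / 2 by rewrite divr_gt0.
  have e3 : 0 < e / 2 / (MU + 1) by rewrite divr_gt0.
  have e4 : 0 < e / 2 / (MT + 1) by rewrite divr_gt0.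
  have [a a0 Ha] := iT _ e3; have [b b0 Hb] := iU _ e4.
  have /andP[a0' a1] := min1_gt0 a0.
  exists (b * Num.min 1 a / 2); first by rewrite !divr_gt0// mulr_gt0.
  move=> N M f fN MN; have f0 := nrm_ge0 f.
  have [K [KN KM]] := trunc_half b0 (min1_gt0 a0) MN.
  case: KM => [->|[K0 MK]]; first by rewrite bcut0 nrm0 mulr_ge0 ?(ltW e0).
  rewrite /= [U f](split_cut K) (linD _ _ lT) (linD _ _ (@bcut_linear M)).
  apply: le_trans (nrm_add _ _) _; have -> : e * nrm f = e / 2 * nrm f + e / 2 * nrm f by field.
  apply: lerD.
    apply: le_trans (nrm_bcut _ _) _; apply: le_trans (TM _) _.
    apply: le_trans (ler_wpM2l MT0 (Hb N K f fN KN)) _.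
    by apply: frac => //; rewrite ltrDl.
  apply: le_trans (Ha K M _ (@vanishes_below_cut K _) _) _.
    by apply: le_trans MK _; rewrite ler_wpM2r// ge_min lexx orbT.
  apply: le_trans (ler_wpM2l (ltW e3) (le_trans (nrm_sub_cut _ _) (UM f))) _.
  rewrite mulrCA; apply: frac => //; by rewrite ltrDl.
- move=> e e0; have e2 : 0 < e / 3 by rewrite divr_gt0.
  have e3 : 0 < e / 3 / (MU + 1) by rewrite divr_gt0.
  have e4 : 0 < e / 3 / (2 * MT + 1) by rewrite divr_gt0// ltr_wpDl// mulr_ge0.
  have e5 : 0 < e / 3 / (MT + 1) by rewrite divr_gt0.
  have [a a0 Ha] := cT _ e3; have [b b0 Hb] := iU _ e4; have [d d0 Hd] := cU _ e5.
  have /andP[a0' a1] := min1_gt0 a0.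
  exists (Num.min d (b * Num.min 1 a / 2)); first by rewrite lt_min d0 !divr_gt0// mulr_gt0.
  move=> N j f fN jN; have f0 := nrm_ge0 f.
  have jd : j%:R <= d * N%:R by apply: le_trans jN _; rewrite ler_wpM2r// ge_min lexx.
  have jb : j%:R <= b * Num.min 1 a / 2 * N%:R.
    by apply: le_trans jN _; rewrite ler_wpM2r// ge_min lexx orbT.
  have -> : comm (T \o U) j f = comm T j (U f) + T (comm U j f).
    by rewrite {3}/comm (linB _ _ lT) [RHS]addrC /comm /= addrA subrK.
  have [K [KN KM]] := trunc_half b0 (min1_gt0 a0) jb.
  apply: le_trans (nrm_add _ _) _.
  have -> : e * nrm f = (e / 3 * nrm f + e / 3 * nrm f) + e / 3 * nrm f by field.
  apply: lerD; last first.
    apply: le_trans (TM _) _; apply: le_trans (ler_wpM2l MT0 (Hd N j f fN jd)) _.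
    by apply: frac => //; rewrite ltrDl.
  case: KM => [->|[K0 MK]].
    by rewrite comm0 nrm0 addr_ge0// mulr_ge0// ltW.
  rewrite [U f](split_cut K) comm_lin//; apply: le_trans (nrm_add _ _) _; apply: lerD.
    apply: le_trans (nrm_comm _ _ TM) _.
    have MT2 : 0 <= 2 * MT by rewrite mulr_ge0.
    apply: le_trans (ler_wpM2l MT2 (Hb N K f fN KN)) _.
    by apply: frac => //; rewrite ltrDl.
  apply: le_trans (Ha K j _ (@vanishes_below_cut K _) _) _.
    by apply: le_trans MK _; rewrite ler_wpM2r// ge_min lexx orbT.
  apply: le_trans (ler_wpM2l (ltW e3) (le_trans (nrm_sub_cut _ _) (UM f))) _.
  rewrite mulrCA; apply: frac => //; by rewrite ltrDl.
Qed.

Lemma localized_lim T : bounded_operator T ->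
  (forall e : R, 0 < e -> exists2 U, localized U & (opnorm (T - U)%R < e%:E)%E) ->
  localized T.
Proof.
move=> bT H; have [lT [MT MT0 TM]] := (bounded_operatorP T).1 bT.
have app (e : R) : 0 < e -> exists2 U, localized U & forall f, nrm (T f - U f) <= e * nrm f.
  move=> e0; have [U lU h] := H e e0; exists U => // f.
  have [bU _ _] := lU; have [linU _] := (bounded_operatorP U).1 bU.
  have lTU : linear (T - U).
    move=> a g k; change (T (a *: g + k) - U (a *: g + k) = a *: (T g - U g) + (T k - U k)).
    by rewrite lT linU scalerBr opprD addrACA.
  exact: (opnorm_op_le lTU (ltW h) f).
split=> //.
- move=> e e0; have e2 : 0 < e / 2 by rewrite divr_gt0.
  have [U [_ iU _] UT] := app _ e2; have [a a0 Ha] := iU _ e2.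
  exists a => // N M f fN MN.
  have -> : T f = (T f - U f) + U f by rewrite subrK.
  have -> : e * nrm f = e / 2 * nrm f + e / 2 * nrm f by field.
  rewrite (linD _ _ (@bcut_linear M)); apply: le_trans (nrm_add _ _) (lerD _ _).
    exact: le_trans (nrm_bcut _ _) (UT f).
  exact: (Ha N).
- move=> e e0; have e2 : 0 < e / 3 by rewrite divr_gt0.
  have [U [bU _ cU] UT] := app _ e2; have [a a0 Ha] := cU _ e2.
  exists a => // N j f fN jN.
  have -> : comm T j f = (T (bshift j f) - U (bshift j f)) + (comm U j f - bshift j (T f - U f)).
    rewrite /comm (linB _ _ (@bshift_linear j)) opprB.
    by rewrite [X in _ = _ + X]addrA subrK [RHS]addrA subrK.
  have -> : e * nrm f = e / 3 * nrm f + (e / 3 * nrm f + e / 3 * nrm f) by field.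
  apply: le_trans (nrm_add _ _) (lerD _ _).
    by apply: le_trans (UT _) _; rewrite ler_wpM2l ?(ltW e2)// nrm_bshift.
  apply: le_trans (nrm_sub _ _) (lerD _ _); first exact: (Ha N).
  exact: le_trans (nrm_bshift _ _) (UT f).
Qed.

Definition unshift s f : bergman := ofseq (fun n => tay f (s + n)).

Lemma tay_unshift s f n : tay (unshift s f) n = tay f (s + n).
Proof.
apply: (@tay_ofseq _ _ (s.+1%:R * N2 f)) => N.
apply: (@le_trans _ _ (s.+1%:R * (wsum (tay f) (s + N) - wsum (tay f) s))).
  rewrite wsum_add /wsum mulr_sumr; apply: ler_sum => i _.
  rewrite [leRHS]mulrCA ler_wpM2l ?sqr_ge0// ler_pdivlMr ?ltr0n// ler_pdivrMl ?ltr0n//.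
  by rewrite -natrM ler_nat; nia.
rewrite ler_wpM2l// (le_trans _ (bergman_wsum f (s + N)))// gerBl; exact: wsum_ge0.
Qed.

Lemma bshift_unshift s f : vanishes_below s f -> bshift s (unshift s f) = f.
Proof.
move=> sf; apply: bergman_ext => n; rewrite tay_bshift; case: ltnP => sn; first by rewrite sf.
by rewrite tay_unshift subnKC.
Qed.

(** With 2 s <= N the weights 1/(n+1) and 1/(n+s+1) differ by a factor at
    most 2 on the indices that occur. *)
Lemma N2_unshift s N f : (s + s <= N)%N -> vanishes_below N f -> N2 (unshift s f) <= 2 * N2 f.
Proof.
move=> sN fN; apply: bergman_N2_le => K.
apply: (@le_trans _ _ (2 * (wsum (tay f) (s + K) - wsum (tay f) s))); last first.
  by rewrite ler_wpM2l// (le_trans _ (bergman_wsum f (s + K)))// gerBl wsum_ge0.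
rewrite wsum_add /wsum mulr_sumr; apply: ler_sum => i _; rewrite tay_unshift.
have [h|h] := ltnP (s + i) N; first by rewrite fN// cnorm0 expr0n !mul0r mulr0.
rewrite [leRHS]mulrCA ler_wpM2l ?sqr_ge0// ler_pdivlMr ?ltr0n// ler_pdivrMl ?ltr0n//.
by rewrite -natrM ler_nat; lia.
Qed.

(** (n+1)/(n+s+1) is at most M/(s+1) for n < M. *)
Lemma N2_bshift_low s M g : (forall n, (M <= n)%N -> tay g n = 0) ->
  s.+1%:R * N2 (bshift s g) <= M%:R * N2 g.
Proof.
move=> gM; rewrite mulrC -ler_pdivlMr ?ltr0n//; apply: bergman_N2_le => K.
apply: le_trans (wsum_le _ (leq_addl s K)) _.
have -> : wsum (tay (bshift s g)) (s + K) = \sum_(i < K) cnorm (tay g i) ^+ 2 / (s + i).+1%:R.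
  by rewrite -shift_wsum; apply: eq_bigr => i _; rewrite tay_bshift.
rewrite ler_pdivlMr ?ltr0n// mulrC; apply: le_trans (ler_wpM2l (ler0n _ M) (bergman_wsum g K)).
rewrite /wsum !mulr_sumr; apply: ler_sum => i _.
have [h|h] := leqP M i; first by rewrite gM// cnorm0 expr0n !mul0r !mulr0.
rewrite [leLHS]mulrCA [leRHS]mulrCA ler_wpM2l ?sqr_ge0// ler_pdivrMr ?ltr0n//.
by rewrite mulrAC ler_pdivlMr ?ltr0n// -!natrM ler_nat; nia.
Qed.

Lemma ip_shift j (F G : C -> C) : ip (fun z => z ^+ j * F z) G = ip F (fun z => (z ^+ j)^* * G z).
Proof. by apply: eq_cintegral => z _; rewrite rmorphM/= conjCK mulrA [F z * _]mulrC. Qed.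

Lemma ip_bprojr g (F : C -> C) : sqi F -> ip g (bproj F) = ip g F.
Proof.
move=> iF; have sg := bergman_sqi g.
by rewrite (ipC (bergman_sqi (bproj F)) sg) ip_bproj// -ipC.
Qed.

Lemma sqi_zbarj j F : sqi F -> sqi (fun z => (z ^+ j)^* * F z).
Proof. by apply: sqi_mulb; apply: bdd_conj; apply: bddX; exact: bdd_id. Qed.

Lemma nrm_zbarj j F : nrm (fun z => (z ^+ j)^* * F z) = nrm (fun z => z ^+ j * F z).
Proof.
by rewrite /nrm /N2; congr (Num.sqrt _); apply: eq_Rintegral => p _; rewrite !cnormM cnorm_conj.
Qed.

(** The squared distance of conj(z)^j g to the Bergman space is the sum of
    |g_n|^2 [1/(n+j+1) - (n-j+1)/(n+1)^2], and the bracket equals j^2 /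
    ((n+1)^2 (n+j+1)). *)
Lemma N2_hankel j M g : (0 < M)%N -> (j <= M)%N -> vanishes_below M g ->
  N2 (fun z => (z ^+ j)^* * g z - bproj (fun z => (z ^+ j)^* * g z) z) <=
  (j%:R / M%:R) ^+ 2 * N2 g.
Proof.
move=> M0 jM gM; set F := fun z => _ * g z; set P := bproj F.
have sg := bergman_sqi g; have sF : sqi F by exact: sqi_zbarj.
have sP := bergman_sqi P.
have N2E : N2 (fun z => F z - P z) = N2 F - N2 P.
  rewrite (@eq_N2 _ _ (fun z => F z + (-1) * P z)); last by move=> z _; rewrite mulN1r.
  rewrite N2_addE ?ipZr ?N2Z//; last exact: sqiZ.
  rewrite -[ip F P]ip_bproj// ip_self cnormN cnorm1 expr1n mul1r rmorphN1 mulN1r ReN/=.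
  ring.
rewrite N2E lerBlDr.
have -> : N2 F = N2 (bshift j g).
  rewrite -!sqr_nrm nrm_zbarj -nrm_bshiftE//.
have tP n : tay P n = n.+1%:R * (tay g (n + j) / (n + j).+1%:R).
  rewrite tay_bproj// -ip_tay; congr (_ * _); apply: eq_cintegral => z _.
  by rewrite /F exprD rmorphM/=; ring.
apply: bergman_N2_le => K; have Kj : (K <= j + (j + K))%N by lia.
apply: le_trans (wsum_le _ Kj) _.
have -> : wsum (tay (bshift j g)) (j + (j + K)) =
    \sum_(i < j + K) cnorm (tay g i) ^+ 2 / (j + i).+1%:R.
  by rewrite -shift_wsum; apply: eq_bigr => i _; rewrite tay_bshift.
apply: le_trans (lerD (ler_wpM2l (sqr_ge0 _) (bergman_wsum g (j + K))) (bergman_wsum P K)).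
rewrite /wsum !big_split_ord/= mulrDr -addrA.
rewrite big1 ?add0r; last first.
  by move=> i _; rewrite gM ?(leq_trans (ltn_ord i))// cnorm0 expr0n mul0r.
rewrite ler_wpDl//.
  by rewrite mulr_ge0 ?sqr_ge0//; apply: sumr_ge0 => i _; rewrite divr_ge0 ?sqr_ge0.
rewrite mulr_sumr -big_split/=; apply: ler_sum => i _; rewrite tP [(i + j)%N]addnC.
have [h|h] := ltnP (j + i) M.
  by rewrite gM// !cnormM !cnorm0 !mul0r !mulr0 expr0n/= !mul0r mulr0 addr0.
move: (tay g (j + i)) => x; rewrite !cnormM cnormV !cnorm_nat.
rewrite (exprMn 2 i.+1%:R) (exprMn 2 (cnorm x)) (exprVn (j + i).+1%:R).
move: (cnorm x ^+ 2) (sqr_ge0 (cnorm x)) => q q0.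
have a0 : 0 < (i.+1%:R : R) by rewrite ltr0n.
have m0 : 0 < (M%:R : R) by rewrite ltr0n.
have hM : (M%:R : R) <= j%:R + i.+1%:R by rewrite -natrD ler_nat; lia.
have j0 : 0 <= (j%:R : R) by [].
have -> : (j + (j + i)).+1%:R = j%:R + (j%:R + i.+1%:R) :> R by rewrite -!natrD; congr (_%:R); lia.
have -> : (j + i).+1%:R = j%:R + i.+1%:R :> R by rewrite -natrD addnS.
move: (i.+1%:R : R) (M%:R : R) (j%:R : R) a0 m0 hM j0 => a m b a0 m0 hM b0.
have c0 : 0 < b + a by lra.
have d0 : 0 < b + (b + a) by lra.
have key : b ^+ 2 / ((b + a) ^+ 2 * (b + (b + a))) <= (b / m) ^+ 2 / (b + a).
  rewrite expr_div_n ler_pdivrMr ?mulr_gt0 ?exprn_gt0//.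
  have -> : b ^+ 2 / m ^+ 2 / (b + a) * ((b + a) ^+ 2 * (b + (b + a))) =
     b ^+ 2 * (((b + a) * (b + (b + a))) / m ^+ 2) by field; rewrite !gt_eqF.
  rewrite ler_peMr ?sqr_ge0// ler_pdivlMr ?exprn_gt0// mul1r expr2.
  apply: ler_pM; rewrite ?(ltW m0)//; lra.
have -> : q / (b + (b + a)) = q * (b ^+ 2 / ((b + a) ^+ 2 * (b + (b + a)))) + a ^+ 2 * (q * (b + a) ^- 2) / a.
  by field; rewrite !gt_eqF.
rewrite lerD2r; apply: le_trans (ler_wpM2l q0 key) _.
by rewrite le_eqVlt; apply/orP; left; apply/eqP; rewrite expr_div_n; field; rewrite !gt_eqF.
Qed.

(** For the second clause, f = z^s g with s = N/2 and g of comparable norm;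
    the factor z^s is moved to the other side of the inner product, where it
    multiplies a function of low order and is small by [N2_bshift_low]. For
    the third, the low-order part of the commutator is small by the second
    clause, and the high-order part h satisfies |h|^2 = <a f, conj(z)^j h -
    P(conj(z)^j h)>, to which [N2_hankel] applies. *)
Lemma localized_toeplitz (a : C -> C) : bdd a -> localized (toeplitz a).
Proof.
move=> ba; rewrite toeplitz_bdd//; have [ma [A' aA']] := ba.
have A'0 : 0 <= A' := le_trans (cnorm_ge0 _) (aA' 0 disk0).
pose A := A' + 1; have A0 : 0 < A by rewrite ltr_wpDl.
have aA z : disk z -> cnorm (a z) <= A by move=> Dz; rewrite (le_trans (aA' z Dz))// lerDl.
have TA := bmul_le (ltW A0) ba aA.
have saf f : sqi (fun z => a z * f z) := sqi_mulb ba (bergman_sqi f).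
have naf f : nrm (fun z => a z * f z) <= A * nrm f := nrm_mulb (ltW A0) ba (bergman_sqi f) aA.
have low (e : R) : 0 < e -> exists2 eta : R, 0 < eta <= 1 &
    forall N M f, vanishes_below N f -> M%:R <= eta * N%:R -> nrm (bcut M (bmul a f)) <= e * nrm f.
  (* the estimates below give |g| <= 2 A sqrt(eta) |f| *)
  move=> e0; pose eta := (e / (2 * A)) ^+ 2.
  have eta0 : 0 < eta by rewrite exprn_gt0// divr_gt0// mulr_gt0.
  exists (Num.min 1 eta); first exact: min1_gt0.
  move=> N M f fN MN'; have MN : M%:R <= eta * N%:R.
    by apply: le_trans MN' _; rewrite ler_wpM2r// ge_min lexx orbT.
  (* half of the order of f is factored out: s + s <= N keeps the norm of
     the quotient comparable *)
  pose s := N./2; set g := bcut M _.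
  have sN : (s + s <= N)%N by rewrite addnn /s -{2}(odd_double_half N) leq_addl.
  have sN2 : (N%:R : R) <= 2 * s.+1%:R.
    by rewrite -natrM ler_nat /s -{1}(odd_double_half N); case: (odd N) => /=; lia.
  have fs : vanishes_below s f by move=> n ns; apply: fN; lia.
  have gM n : (M <= n)%N -> tay g n = 0 by move=> Mn; rewrite tay_bcut ltnNge Mn.
  have g1 := N2_bshift_low s gM; have f1 := N2_unshift sN fN.
  set ft := unshift s f in f1.
  have gip : ip (bmul a f) g = (N2 g)%:C%C.
    rewrite -ip_self; apply: ccvg_unique (ip_cvg g (bergman_sqi _)) _.
    have -> : (fun K => \sum_(n < K) tay (bmul a f) n * (tay g n)^* / n.+1%:R) =
      (fun K => \sum_(n < K) tay g n * (tay g n)^* / n.+1%:R); last exact: ip_cvg (bergman_sqi _).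
    apply/funext => K; apply: eq_bigr => i _; rewrite tay_bcut.
    by case: ifP => // _; rewrite conjC0 !mulr0.
  have key : N2 g <= (A * nrm ft) * nrm (bshift s g).
    have -> : N2 g = cnorm (ip (bmul a f) g).
      by rewrite gip cnorm_real ger0_norm// N2_ge0.
    rewrite ip_bmul//.
    rewrite (@eq_ip _ _ (fun z => z ^+ s * (a z * ft z)) g g)//; last first.
      by move=> z Dz; rewrite mulrCA -bshiftE// bshift_unshift.
    rewrite ip_shift; apply: le_trans (ip_le_nrm (saf ft) (sqi_zbarj s (bergman_sqi g))) _.
    rewrite nrm_zbarj -nrm_bshiftE; apply: ler_pM; rewrite ?nrm_ge0//.
  have f2 : nrm ft ^+ 2 <= 2 * nrm f ^+ 2 by rewrite !sqr_nrm.
  have g2 : nrm (bshift s g) ^+ 2 <= 2 * eta * nrm g ^+ 2.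
    have s0 : 0 < s.+1%:R :> R by rewrite ltr0n.
    rewrite !sqr_nrm -(ler_pM2l s0); apply: le_trans g1 _.
    apply: (@le_trans _ _ (eta * N%:R * N2 g)); first by rewrite ler_wpM2r// N2_ge0.
    have -> : s.+1%:R * (2 * eta * N2 g) = eta * (2 * s.+1%:R) * N2 g by ring.
    by rewrite ler_wpM2r ?N2_ge0// ler_wpM2l// ltW.
  rewrite -sqr_nrm in key.
  have etaE : 4 * A ^+ 2 * eta = e ^+ 2 by rewrite /eta; field; rewrite gt_eqF.
  have n0 := nrm_ge0 g; have nf0 := nrm_ge0 f.
  move: key f2 g2 (nrm_ge0 ft) (nrm_ge0 (bshift s g)) n0 nf0.
  move: (nrm g) (nrm ft) (nrm (bshift s g)) (nrm f) => x u v y key f2 g2 u0 v0 x0 y0.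
  rewrite -(@ler_pXn2r _ 2)// ?nnegrE ?mulr_ge0 ?(ltW e0)//.
  have [->|xn0] := eqVneq x 0; first by rewrite expr0n/= sqr_ge0.
  have xp : 0 < x ^+ 2 by rewrite exprn_gt0// lt_def xn0.
  rewrite -(ler_pM2r xp) exprMn -etaE.
  have -> : x ^+ 2 * x ^+ 2 = (x ^+ 2) ^+ 2 by ring.
  apply: (@le_trans _ _ ((A * u * v) ^+ 2)).
    by rewrite lerXn2r ?nnegrE ?mulr_ge0 ?(ltW A0)// ltW.
  have -> : (A * u * v) ^+ 2 = A ^+ 2 * (u ^+ 2 * v ^+ 2) by ring.
  have -> : 4 * A ^+ 2 * eta * y ^+ 2 * x ^+ 2 = A ^+ 2 * ((2 * y ^+ 2) * (2 * eta * x ^+ 2)) by ring.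
  by rewrite ler_wpM2l ?sqr_ge0// ler_pM ?sqr_ge0.
split.
- by apply/bounded_operatorP; split; [exact: bmul_linear|exists A => //; exact: ltW].
- by move=> e /low[eta /andP[h _] H]; exists eta.
move=> e e0; have e3 : 0 < e / 3 by rewrite divr_gt0.
have [eta /andP[eta0 eta1] He] := low _ e3.
pose y := Num.min 1 (e / 3 / A); have y01 : 0 < y <= 1 by apply: min1_gt0; rewrite divr_gt0.
have /andP[y0 y1] := y01.
exists (eta * y / 2); first by rewrite divr_gt0// mulr_gt0.
move=> N j f fN jN; have [M [MN [->|[M0 jM]]]] := trunc_half eta0 y01 jN.
  by rewrite comm0 nrm0 mulr_ge0 ?nrm_ge0// ltW.
have jM' : (j <= M)%N by rewrite -(ler_nat R) (le_trans jM)// ler_piMl.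
set h := comm _ j f; pose g := h - bcut M h.
have -> : h = bcut M h + g := split_cut M h.
have -> : e * nrm f = (e / 3 * nrm f + e / 3 * nrm f) + e / 3 * nrm f by field.
apply: le_trans (nrm_add _ _) (lerD _ _).
  rewrite /h /comm (linB _ _ (@bcut_linear M)); apply: le_trans (nrm_sub _ _) (lerD _ _).
    apply: le_trans (He N M _ _ MN) _; last by rewrite ler_wpM2l ?(ltW e3)// nrm_bshift.
    by move=> n nN; rewrite tay_bshift; case: ifP => // _; apply: fN; exact: leq_ltn_trans (leq_subr _ _) nN.
  apply: le_trans (He N M f fN MN).
  apply: (@le_trans _ _ (nrm (bshift j (bcut M (bmul a f))))); last exact: nrm_bshift.
  rewrite -[leRHS]mul1r; apply: nrm_tay_le => // n; rewrite mul1r tay_bcut !tay_bshift.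
  case: ifP => nM; last by rewrite cnorm0 cnorm_ge0.
  case: ifP => // _; rewrite tay_bcut ifT//; exact: leq_ltn_trans (leq_subr _ _) nM.
have gM : vanishes_below M g := @vanishes_below_cut M h.
have sf := bergman_sqi f; have sg := bergman_sqi g.
pose F z := (z ^+ j)^* * g z; have sF : sqi F := sqi_zbarj j sg.
have gip : ip h g = (N2 g)%:C%C.
  rewrite -ip_self; apply: ccvg_unique (ip_cvg g (bergman_sqi _)) _.
  have -> : (fun K => \sum_(n < K) tay h n * (tay g n)^* / n.+1%:R) =
    (fun K => \sum_(n < K) tay g n * (tay g n)^* / n.+1%:R); last exact: ip_cvg (bergman_sqi _).
  apply/funext => K; apply: eq_bigr => i _; rewrite {3}/g tayB tay_bcut.
  case: ifP => iM; last by rewrite subr0.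
  by rewrite subrr conjC0 !mulr0.
have hip : ip h g = ip (fun z => a z * f z) (fun z => F z - bproj F z).
  have sP := bergman_sqi (bproj F).
  have -> : ip h g = ip (bmul a (bshift j f)) g - ip (bshift j (bmul a f)) g.
    by rewrite -ipBl//; exact: bergman_sqi.
  have -> : ip (fun z => a z * f z) (fun z => F z - bproj F z) =
      ip (fun z => a z * f z) F - ip (fun z => a z * f z) (bproj F) by exact: ipBr.
  congr (_ - _).
    rewrite ip_bmul// (@eq_ip _ _ (fun z => z ^+ j * (a z * f z)) g g)//; first by rewrite ip_shift.
    by move=> z Dz; rewrite bshiftE// mulrCA.
  rewrite (@eq_ip _ _ (fun z => z ^+ j * bmul a f z) g g)//; last by move=> z; exact: bshiftE.
  by rewrite ip_shift -/F -ip_bprojr// ip_bmul.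
have key : N2 g <= (A * nrm f) * (j%:R / M%:R * nrm g).
  have -> : N2 g = cnorm (ip h g) by rewrite gip cnorm_real ger0_norm// N2_ge0.
  rewrite hip; apply: le_trans (ip_le_nrm (saf f) _) _; first by apply: sqiB => //; exact: bergman_sqi.
  apply: ler_pM; rewrite ?nrm_ge0//.
  rewrite -(@ler_pXn2r _ 2)// ?nnegrE ?mulr_ge0 ?nrm_ge0 ?invr_ge0// exprMn !sqr_nrm.
  exact: N2_hankel.
rewrite -sqr_nrm in key; have M0' : 0 < M%:R :> R by rewrite ltr0n.
have jy : j%:R / M%:R <= y by rewrite ler_pdivrMr.
have yA : A * y <= e / 3 by rewrite mulrC -ler_pdivlMr// /y ge_min lexx orbT.
have [g0|g0] := eqVneq (nrm g) 0; first by rewrite g0 mulr_ge0 ?nrm_ge0// ltW.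
have gp : 0 < nrm g by rewrite lt_def g0 nrm_ge0.
rewrite -(ler_pM2r gp) -expr2; apply: le_trans key _.
have -> : A * nrm f * (j%:R / M%:R * nrm g) = (A * (j%:R / M%:R)) * nrm f * nrm g by ring.
rewrite ler_wpM2r ?nrm_ge0// ler_wpM2r ?nrm_ge0//; apply: le_trans yA.
by rewrite ler_wpM2l// ltW.
Qed.

Lemma toeplitz_algebra_localized T : toeplitz_algebra T -> localized T.
Proof.
apply: smallest_sub => [|_ [a /Linfty_trunc[a' ba' ->] <-]]; last exact: localized_toeplitz.
split.
- by move=> U [].
- by move=> c U V; exact: localized_lin.
- by move=> U V; exact: localized_comp.
- by move=> U; exact: localized_lim.
Qed.

Definition slowly_oscillating (x : nat -> C) : Prop := forall e : R, 0 < e ->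
  exists2 dl : R, 0 < dl &
  forall n j, j%:R <= dl * n%:R -> cnorm (x (n + j)%N - x n) <= e.

(** The commutator of S with z^j, applied to e_n, is (lambda_(n+j) -
    lambda_n) z^j e_n, and the norm of z^j e_n stays away from 0 for j <= n. *)
Lemma localized_slow (S : bergman -> bergman) (lambda : nat -> C) :
  bounded_operator S -> (forall n : nat, S (bbasis n) = lambda n *: bbasis n) ->
  localized S -> slowly_oscillating lambda.
Proof.
move=> bS radS [_ _ cS] e e0; have e2 : 0 < e / 2 by rewrite divr_gt0.
have [dl dl0 H] := cS _ e2; have /andP[m0 m1] := min1_gt0 dl0.
exists (Num.min 1 dl) => // n j jn.
have jdl : j%:R <= dl * n%:R by apply: le_trans jn _; rewrite ler_wpM2r// ge_min lexx orbT.
have j1 : (j <= n)%N.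
  by rewrite -(ler_nat R); apply: le_trans jn _; rewrite ler_piMl// ge_min lexx.
have bn : vanishes_below n (bbasis n : bergman).
  by move=> m mn; rewrite bbasis_tay; case: eqP => // E; rewrite E ltnn in mn.
have := H n j _ bn jdl; rewrite nrm_bbasis mulr1; set h := comm _ _ _ => hh.
have th : tay h (n + j) = (lambda (n + j)%N - lambda n) * (Num.sqrt n.+1%:R)%:C%C.
  rewrite /h /comm tayB (radial_tay bS radS) !tay_bshift ltnNge leq_addl/= addnK.
  by rewrite (radial_tay bS radS) bbasis_tay eqxx mulrBl.
have N2h : cnorm (tay h (n + j)) ^+ 2 / (n + j).+1%:R <= N2 h.
  apply: le_trans (bergman_wsum h (n + j).+1); rewrite /wsum big_ord_recr/= lerDr.
  exact: wsum_ge0.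
move: N2h; rewrite -sqr_nrm th cnormM cnorm_real exprMn real_normK ?num_real// sqr_sqrtr// => N2h.
rewrite -(@ler_pXn2r _ 2)// ?nnegrE ?cnorm_ge0 ?(ltW e0)//.
have h2 : nrm h ^+ 2 <= (e / 2) ^+ 2 by rewrite lerXn2r ?nnegrE ?nrm_ge0// ltW.
have h3 := le_trans N2h h2.
have nj : (n + j).+1%:R <= 2 * n.+1%:R :> R by rewrite -natrM ler_nat; lia.
move: h3; rewrite ler_pdivrMr ?ltr0n// => h3.
have n0 : 0 < n.+1%:R :> R by rewrite ltr0n.
rewrite -(ler_pM2r n0); apply: le_trans h3 _.
apply: le_trans (ler_wpM2l (sqr_ge0 _) nj) _; rewrite expr_div_n.
have -> : e ^+ 2 / 2 ^+ 2 * (2 * n.+1%:R) = e ^+ 2 * n.+1%:R / 2 by field.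
have : 0 <= e ^+ 2 * n.+1%:R by rewrite mulr_ge0 ?sqr_ge0.
by move: (e ^+ 2 * _) => t; lra.
Qed.

End Localization.

(** * Boundedness of the Berezin transforms *)
Section Forms.
Context {R : realType}.
Local Notation C := R[i].
Local Notation Re := complex.Re.
Local Notation sqi := (@square_integrable R).
Local Notation bergman := (@bergman R).
Implicit Types (f g h : bergman) (z w : C) (n m N k j : nat).

Definition form := bergman -> bergman -> C.

Definition sesq (Q : form) : Prop :=
  (forall c f g h, Q (c *: f + g) h = c * Q f h + Q g h) /\
  (forall c f g h, Q h (c *: f + g) = c^* * Q h f + Q h g).

Definition mulz f : bergman := bshift 1 f.

Definition mula z f : bergman := f - z^* *: mulz f.

Definition mulb z f : bergman := z *: f - mulz f.

(** With Q the form of S, its k-th iterate at the kernel K^k_z is the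
    alternating sum in the Berezin transform ([iter_binomial]). *)
Definition Lform (Q : form) : form := fun g h => Q g h - Q (mulz g) (mulz h).

(** The multipliers are a = 1 - conj(z) w and b = z - w. *)
Definition Mform z (Q : form) : form :=
  fun g h => Q (mula z g) (mula z h) - Q (mulb z g) (mulb z h).

Lemma sesqB (Q : form) f f' g g' : sesq Q ->
  Q (f - f') (g - g') = Q f g - Q f g' - Q f' g + Q f' g'.
Proof.
move=> [l r].
have eB (a b : bergman) : a - b = (-1) *: b + a by rewrite scaleN1r addrC.
rewrite !eB l !r rmorphN1; ring.
Qed.

Lemma sesqZ (Q : form) (a b : C) f g : sesq Q -> Q (a *: f) (b *: g) = a * b^* * Q f g.
Proof.
move=> [l r].
have l0 (h : bergman) : Q 0 h = 0.
  by have := l (-1) 0 0 h; rewrite scaler0 addr0 mulN1r addNr.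
have r0 (h : bergman) : Q h 0 = 0.
  by have := r (-1) 0 0 h; rewrite scaler0 addr0 rmorphN1 mulN1r addNr.
have := l a f 0 (b *: g); rewrite addr0 l0 addr0 => ->.
have := r b g 0 f; rewrite addr0 r0 addr0 => ->.
by rewrite mulrA.
Qed.

Lemma sesq1Z (Q : form) (b : C) f g : sesq Q -> Q f (b *: g) = b^* * Q f g.
Proof. by move=> sQ; have := sesqZ 1 b f g sQ; rewrite scale1r mul1r. Qed.

Lemma sesqZ1 (Q : form) (a : C) f g : sesq Q -> Q (a *: f) g = a * Q f g.
Proof. by move=> sQ; have := sesqZ a 1 f g sQ; rewrite scale1r conjC1 mulr1. Qed.

Lemma mulz_linear : linear mulz. Proof. exact: bshift_linear. Qed.

Lemma sesq_L (Q : form) : sesq Q -> sesq (Lform Q).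
Proof.
move=> [l r]; split=> c f g h; rewrite /Lform mulz_linear; last by rewrite !r; ring.
by rewrite !l; ring.
Qed.

(** Polarized form of |a|^2 - |b|^2 = (1 - |z|^2)(1 - |w|^2). *)
Lemma form_identity (Q : form) z g h : sesq Q ->
  (1 - z * z^*) * Lform Q g h = Mform z Q g h.
Proof.
move=> sQ; rewrite /Mform /Lform /mula /mulb !sesqB// !sesqZ// !sesq1Z// !sesqZ1// conjCK.
ring.
Qed.

Lemma iter_sesq (Q : form) k : sesq Q -> sesq (iter k Lform Q).
Proof. by move=> sQ; elim: k => //= k IH; exact: sesq_L. Qed.

Lemma iter_identity (Q : form) z k g h : sesq Q ->
  (1 - z * z^*) ^+ k * iter k Lform Q g h = iter k (Mform z) Q g h.
Proof.
move=> sQ; elim: k g h => [|k IH] g h; first by rewrite mul1r.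
rewrite iterS exprSr -mulrA form_identity; last exact: iter_sesq.
by rewrite /Mform mulrBr !IH.
Qed.

Lemma iter_binomial (Q : form) k g h :
  iter k Lform Q g h = \sum_(j < k.+1) 'C(k, j)%:R * (-1) ^+ j *
    Q (iter j mulz g) (iter j mulz h).
Proof.
elim: k g h => [|k IH] g h; first by rewrite big_ord1 !mul1r.
rewrite iterS /Lform !IH [in RHS]big_ord_recl [X in X - _]big_ord_recl /= !bin0 !mul1r.
rewrite -addrA; congr (_ + _).
have E j : Q (iter j mulz (mulz g)) (iter j mulz (mulz h)) = Q (iter j.+1 mulz g) (iter j.+1 mulz h).
  by rewrite -!iterSr.
under [X in _ - X]eq_bigr do rewrite E.
under [X in _ = X]eq_bigr do rewrite /bump leq0n add1n binS natrD !mulrDl.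
rewrite [RHS]big_split/=; congr (_ + _).
  by rewrite [RHS]big_ord_recr/= bin_small// !mul0r addr0; apply: eq_bigr => i _; rewrite /bump leq0n.
rewrite -sumrN; apply: eq_bigr => i _; rewrite exprS; ring.
Qed.

Lemma nrm_le_pointwise (F G : C -> C) : sqi F -> sqi G ->
  (forall z, disk z -> cnorm (F z) <= cnorm (G z)) -> nrm F <= nrm G.
Proof.
move=> iF iG h; apply: ler_wsqrtr; apply: le_Rintegral.
- exact: pdisk_measurable.
- exact: iF.2.
- exact: iG.2.
by move=> p Dp; rewrite lerXn2r ?nnegrE ?cnorm_ge0 ?h.
Qed.

Definition kernel_vec k z : bergman := to_bergman (fun w => w ^+ 0 * bkernel k z w).

Lemma kernel_vecE k z w : disk z -> disk w -> kernel_vec k z w = bkernel k z w.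
Proof. by move=> Dz Dw; rewrite /kernel_vec bkernelE// (Dw : cnorm w < 1) expr0 mul1r. Qed.

Lemma iter_kernel_vec k j z : disk z -> to_bergman (fun w => w ^+ j * bkernel k z w) = iter j mulz (kernel_vec k z).
Proof.
move=> Dz; apply: bergman_eq => w Dw; rewrite bkernelE// (Dw : cnorm w < 1).
elim: j => [|j IH]; first by rewrite mul1r kernel_vecE.
by rewrite iterS /mulz bshiftE// -IH exprS mulrA expr1.
Qed.

Lemma tay_kernel_vec k z n : disk z -> tay (kernel_vec k z) n = 'C(n + k.+1, k.+1)%:R * z^* ^+ n.
Proof.
move=> Dz; apply: (@tay_nrm_lim _ _ (ksum k z)).
- exact: bergman_sqi.
- by move=> N; exact: sqi_ksum.
- have -> : (fun N => nrm (fun w => kernel_vec k z w - ksum k z N w)) =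
    (fun N => nrm (fun w => bkernel k z w - ksum k z N w)); last exact: kernel_nrm_cvg.
  by apply/funext => N; congr (Num.sqrt _); apply: eq_N2 => w Dw; rewrite kernel_vecE.
apply: ccvg_near (ccvg_cst _); exists n.+1 => // N /= nN.
have -> : ksum k z N = psum (fun n => 'C(n + k.+1, k.+1)%:R * z^* ^+ n) N.
  by apply/funext => w; exact: ksumE.
by rewrite tay_psum nN.
Qed.

Lemma tay_iter_mulz j f n : tay (iter j mulz f) n = if (n < j)%N then 0 else tay f (n - j).
Proof.
elim: j n => [|j IH] n; first by rewrite subn0.
rewrite iterS tay_bshift; case: n => [|n] //=; rewrite IH subn1 /= ltnS.
by case: ifP => // _; rewrite subSS.
Qed.

Lemma nrm_kernel_vec0 z : disk z -> nrm (kernel_vec 0 z) <= (1 - cnorm z ^+ 2)^-1.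
Proof.
move=> Dz; have z1 : cnorm z ^+ 2 < 1 by rewrite expr_lt1 ?cnorm_ge0.
have h0 : 0 < 1 - cnorm z ^+ 2 by rewrite subr_gt0.
rewrite -(@ler_pXn2r _ 2)// ?nnegrE ?nrm_ge0 ?invr_ge0 ?(ltW h0)// sqr_nrm.
apply: bergman_N2_le => N.
have t01 : 0 <= cnorm z ^+ 2 < 1 by rewrite sqr_ge0.
apply: le_trans (negbin_le 1 N t01); rewrite /wsum /negbin; apply: ler_sum => i _.
rewrite tay_kernel_vec// !bin1 addn1 cnormM cnorm_nat cnormX cnorm_conj exprMn -!exprM [(i * 2)%N]mulnC.
by rewrite mulrAC (expr2 i.+1%:R) mulfK.
Qed.

(** The function (z - w)^i (1 - conj(z) w)^(-(n+2)) of w. *)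
Definition kernel_power_vec z n i : bergman := iter i (mulb z) (kernel_vec n z).

Lemma kernel_power_vecE z n i w : disk z -> disk w -> kernel_power_vec z n i w = (z - w) ^+ i * bkernel n z w.
Proof.
move=> Dz Dw; elim: i => [|i IH]; first by rewrite mul1r /kernel_power_vec /= kernel_vecE.
rewrite /kernel_power_vec iterS -/(kernel_power_vec z n i).
have -> : mulb z (kernel_power_vec z n i) w = z * kernel_power_vec z n i w - mulz (kernel_power_vec z n i) w by [].
by rewrite /mulz bshiftE// expr1 IH exprS; ring.
Qed.

Lemma mula_kernel_power_vec z n i : disk z -> mula z (kernel_power_vec z n.+1 i) = kernel_power_vec z n i.
Proof.
move=> Dz; apply: bergman_eq => w Dw.
have -> : mula z (kernel_power_vec z n.+1 i) w = kernel_power_vec z n.+1 i w - z^* * mulz (kernel_power_vec z n.+1 i) w by [].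
rewrite /mulz bshiftE// !kernel_power_vecE// expr1.
have nz : 1 - z^* * w != 0.
  rewrite -cnorm_eq0 gt_eqF// (lt_le_trans _ (cnorm_sub1 Dz Dw))// subr_gt0; exact: Dz.
have -> u : u - z^* * (w * u) = (1 - z^* * w) * u by ring.
by rewrite mulrCA; congr (_ * _); rewrite /bkernel addnS exprS invfM mulVKf.
Qed.

Lemma mulb_kernel_power_vec z n i : mulb z (kernel_power_vec z n i) = kernel_power_vec z n i.+1.
Proof. by []. Qed.

(** |z - w| <= |1 - conj(z) w| on the disk. *)
Lemma nrm_kernel_power_vec z i : disk z -> nrm (kernel_power_vec z i i) <= (1 - cnorm z ^+ 2)^-1.
Proof.
move=> Dz; apply: le_trans (nrm_kernel_vec0 Dz).
apply: nrm_le_pointwise; [exact: bergman_sqi..|move=> w Dw].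
have h0 : 0 < cnorm (1 - z^* * w).
  by rewrite (lt_le_trans _ (cnorm_sub1 Dz Dw))// subr_gt0; exact: Dz.
have z1 : cnorm z ^+ 2 <= 1 by rewrite expr_le1 ?cnorm_ge0 ?(ltW Dz).
have w1 : cnorm w ^+ 2 <= 1 by rewrite expr_le1 ?cnorm_ge0 ?(ltW Dw).
have ab : cnorm (z - w) <= cnorm (1 - z^* * w).
  rewrite -(@ler_pXn2r _ 2)// ?nnegrE ?cnorm_ge0// -subr_ge0.
  have -> : cnorm (1 - z^* * w) ^+ 2 - cnorm (z - w) ^+ 2 = (1 - cnorm z ^+ 2) * (1 - cnorm w ^+ 2).
    by rewrite !sqr_cnorm; case: z w {Dz Dw h0 z1 w1} => [a b] [c d] /=; ring.
  by rewrite mulr_ge0 ?subr_ge0.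
rewrite kernel_power_vecE// kernel_vecE// /bkernel addn0 [leRHS]cnormV cnormM cnormV !cnormX exprD invfM mulrCA.
rewrite ler_piMr ?invr_ge0 ?exprn_ge0 ?cnorm_ge0// ler_pdivrMr ?exprn_gt0// mul1r.
by rewrite lerXn2r ?nnegrE ?cnorm_ge0.
Qed.

(** Multiplication by a lowers the exponent of the denominator and
    multiplication by b raises that of the numerator, so that after k steps
    the two exponents differ by exactly 2; such vectors have norm at most
    that of K^0_z. *)
Lemma Mform_bound (Q : form) (M : R) z k i : disk z -> 0 <= M ->
  (forall g, cnorm (Q g g) <= M * nrm g ^+ 2) ->
  cnorm (iter k (Mform z) Q (kernel_power_vec z (i + k) i) (kernel_power_vec z (i + k) i)) <=
  2 ^+ k * (M * (1 - cnorm z ^+ 2)^-1 ^+ 2).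
Proof.
move=> Dz M0 QM.
have z1 : 0 <= (1 - cnorm z ^+ 2)^-1 by rewrite invr_ge0 subr_ge0 expr_le1 ?cnorm_ge0 ?(ltW Dz).
elim: k i => [|k IH] i.
  rewrite addn0 /= mul1r; apply: le_trans (QM _) _; rewrite ler_wpM2l//.
  by rewrite lerXn2r ?nnegrE ?nrm_ge0 ?nrm_kernel_power_vec.
rewrite iterS /Mform addnS mula_kernel_power_vec// mulb_kernel_power_vec exprS -mulrA mulr_natl mulr2n.
apply: le_trans (cnorm_le_add _ _) _; rewrite cnormN lerD//.
by have := IH i.+1; rewrite addSn.
Qed.

Lemma berezin_forms k (S : bergman -> bergman) z : disk z ->
  berezin k S z = k.+1%:R * (1 - z * z^*) ^+ (2 + k) *
    iter k Lform (fun g h => inner (S g) h) (kernel_vec k z) (kernel_vec k z).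
Proof.
move=> Dz; rewrite /berezin iter_binomial mul_conj; congr (_ * _ * _).
  by rewrite -(rmorph1 (real_complex R)) -rmorphB -rmorphXn.
by apply: eq_bigr => j _; rewrite iter_kernel_vec.
Qed.

(** (1 - |z|^2)^k of the factor (1 - |z|^2)^(k+2) is used up by the k
    applications of [form_identity], and the remaining square by the norm of
    K^0_z. *)
Lemma berezin_bound k (S : bergman -> bergman) (M : R) z : linear S -> op_le S M -> disk z ->
  cnorm (berezin k S z) <= k.+1%:R * 2 ^+ k * M.
Proof.
move=> lS SM Dz; have M0 := op_le_ge0 SM.
pose Q : form := fun g h => inner (S g) h.
have sQ : sesq Q.
  split=> c f g h.
    rewrite /Q lS; exact: (etrans (ipDl (sqiZ c (bergman_sqi (S f))) (bergman_sqi (S g)) (bergman_sqi h))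
      (congr1 (fun t => t + _) (ipZl c (bergman_sqi (S f)) (bergman_sqi h)))).
  exact: (etrans (ipDr (bergman_sqi (S h)) (sqiZ c (bergman_sqi f)) (bergman_sqi g))
      (congr1 (fun t => t + _) (ipZr c (bergman_sqi (S h)) (bergman_sqi f)))).
have QM g : cnorm (Q g g) <= M * nrm g ^+ 2.
  apply: le_trans (ip_le_nrm (bergman_sqi _) (bergman_sqi _)) _.
  by rewrite expr2 mulrA ler_wpM2r ?nrm_ge0.
have := @Mform_bound Q M z k 0 Dz M0 QM; rewrite add0n -iter_identity// -/(kernel_vec k z) => h.
rewrite berezin_forms// -/Q (exprD _ 2 k) mulrA -mulrA -mulrA cnormM cnorm_nat cnormM.
have z1 : 0 < 1 - cnorm z ^+ 2 by rewrite subr_gt0 expr_lt1 ?cnorm_ge0.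
have E : cnorm ((1 - z * z^*) ^+ 2) = (1 - cnorm z ^+ 2) ^+ 2.
  rewrite cnormX mul_conj -(rmorph1 (real_complex R)) -rmorphB cnorm_real ger0_norm//.
  exact: ltW.
rewrite E -(mulrA k.+1%:R); apply: ler_wpM2l => //.
apply: le_trans (ler_wpM2l (sqr_ge0 (1 - cnorm z ^+ 2)) h) _.
by rewrite le_eqVlt; apply/orP; left; apply/eqP; field; rewrite gt_eqF.
Qed.

End Forms.

(** * Berezin transforms of diagonal operators *)
Section RadialBerezin.
Context {R : realType}.
Local Notation C := R[i].
Local Notation Re := complex.Re.
Local Notation sqi := (@square_integrable R).
Local Notation bergman := (@bergman R).
Implicit Types (f g h : bergman) (z w : C) (n m N P p k j : nat) (x : nat -> C).

Definition trunc P x n : C := if (n < P)%N then x n else 0.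

Lemma bdiag_linear x (M : R) : (forall n, cnorm (x n) <= M) -> linear (bdiag x).
Proof.
move=> xM c f g; apply: bergman_ext => n.
by rewrite tay_linear !(tay_bdiag _ _ xM) tay_linear mulrDr mulrCA.
Qed.

Lemma bdiag_op_le x (M : R) : (forall n, cnorm (x n) <= M) -> op_le (bdiag x) M.
Proof.
move=> xM f; have M0 : 0 <= M := le_trans (cnorm_ge0 _) (xM 0).
apply: nrm_tay_le => // n; rewrite (tay_bdiag _ _ xM) cnormM ler_wpM2r ?cnorm_ge0//.
Qed.

Lemma trunc_le x (M : R) P : (forall n, cnorm (x n) <= M) -> forall n, cnorm (trunc P x n) <= M.
Proof.
move=> xM n; rewrite /trunc; case: ifP => // _.
by rewrite cnorm0; exact: le_trans (cnorm_ge0 _) (xM 0).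
Qed.

Lemma inner_trunc x (M : R) P f g : (forall n, cnorm (x n) <= M) ->
  inner (bdiag (trunc P x) f) g = \sum_(p < P) x p * (tay f p * (tay g p)^* / p.+1%:R).
Proof.
move=> xM; apply: ccvg_unique (ip_cvg g (bergman_sqi _)) _.
apply: ccvg_near (ccvg_cst _); exists P => // N /= PN.
rewrite -(subnKC PN) big_split_ord/= [X in _ = _ + X]big1 ?addr0.
  apply: eq_bigr => i _; rewrite (tay_bdiag _ _ (trunc_le P xM)) /trunc ltn_ord.
  by rewrite -!mulrA.
move=> i _; rewrite (tay_bdiag _ _ (trunc_le P xM)) /trunc ltnNge leq_addr/=.
by rewrite !mul0r.
Qed.

Lemma inner_trunc_cvg x (M : R) f g : (forall n, cnorm (x n) <= M) ->
  ccvg (fun P => inner (bdiag (trunc P x) f) g) (inner (bdiag x f) g).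
Proof.
move=> xM; apply: ccvg_near (ip_cvg g (bergman_sqi _)); apply: nearW => P.
rewrite (inner_trunc _ _ _ xM); apply: eq_bigr => i _.
by rewrite (tay_bdiag _ _ xM) -!mulrA.
Qed.

Lemma ccvg_sum (I : Type) (r : seq I) (u : I -> nat -> C) (l : I -> C) :
  (forall i, ccvg (u i) (l i)) -> ccvg (fun n => \sum_(i <- r) u i n) (\sum_(i <- r) l i).
Proof.
move=> h; elim: r => [|i r IH].
  by rewrite big_nil; apply: ccvg_near (ccvg_cst _); apply: nearW => n; rewrite big_nil.
rewrite big_cons; apply: ccvg_near (ccvgD (h i) IH); apply: nearW => n.
by rewrite big_cons.
Qed.

Lemma berezin_trunc_cvg k x (M : R) z : (forall n, cnorm (x n) <= M) ->
  ccvg (fun P => berezin k (bdiag (trunc P x)) z) (berezin k (bdiag x) z).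
Proof.
move=> xM; apply: ccvgZ; apply: ccvg_sum => j; apply: ccvgZ.
exact: inner_trunc_cvg xM.
Qed.

Lemma sum_reindex (k p : nat) (F : nat -> C) :
  \sum_(j < k.+1) (if (j <= p)%N then 'C(k, j)%:R * F j else 0) =
  \sum_(m < p.+1) 'C(k, p - m)%:R * F (p - m)%N.
Proof.
rewrite [RHS](reindex_inj rev_ord_inj)/=.
have -> : \sum_(j < p.+1) 'C(k, p - (p.+1 - j.+1))%:R * F (p - (p.+1 - j.+1))%N =
   \sum_(j < p.+1) 'C(k, j)%:R * F j.
  apply: eq_bigr => j _; rewrite subSS subKn//; have := ltn_ord j; lia.
pose n := (k + p).+1.
rewrite (big_ord_widen n (fun j => if (j <= p)%N then 'C(k, j)%:R * F j else 0)); last by rewrite /n; lia.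
rewrite (big_ord_widen n (fun j => 'C(k, j)%:R * F j)); last by rewrite /n; lia.
rewrite [LHS]big_mkcond [RHS]big_mkcond; apply: eq_bigr => j _; rewrite !ltnS.
case: (leqP j p) => jp; case: (leqP j k) => jk //.
by rewrite bin_small// mul0r.
Qed.

Lemma berezin_trunc k x (M : R) P z : (forall n, cnorm (x n) <= M) -> disk z ->
  berezin k (bdiag (trunc P x)) z = \sum_(p < P) x p * \sum_(m < p.+1)
    (kerb k m p)%:C%C * (z ^+ m * z^* ^+ m * (1 - z * z^*) ^+ (2 + k)).
Proof.
move=> xM Dz; rewrite /berezin.
have -> : ((1 - cnorm z ^+ 2) ^+ (2 + k))%:C%C = (1 - z * z^*) ^+ (2 + k).
  by rewrite mul_conj rmorphXn rmorphB rmorph1.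
set W := _ ^+ (2 + k).
pose G j p : C := (-1) ^+ j * ('C(p - j + k.+1, k.+1)%:R ^+ 2 * (z * z^*) ^+ (p - j) / p.+1%:R).
have E (j : nat) : inner (bdiag (trunc P x) (to_bergman (fun w => w ^+ j * bkernel k z w)))
      (to_bergman (fun w => w ^+ j * bkernel k z w)) =
    \sum_(p < P) x p * (if (j <= p)%N then 'C(p - j + k.+1, k.+1)%:R ^+ 2 * (z * z^*) ^+ (p - j) / p.+1%:R else 0).
  rewrite iter_kernel_vec// (inner_trunc _ _ _ xM); apply: eq_bigr => p _; congr (_ * _).
  rewrite tay_iter_mulz; case: (ltnP p j) => jp; first by rewrite mul0r mul0r.
  rewrite tay_kernel_vec// rmorphM rmorphXn/= conjCK conjC_nat exprMn; ring.
under eq_bigr do rewrite E mulr_sumr.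
rewrite exchange_big mulr_sumr /=; apply: eq_bigr => p _.
have -> : \sum_(j < k.+1) 'C(k, j)%:R * (-1) ^+ j * (x p *
    (if (j <= p)%N then 'C(p - j + k.+1, k.+1)%:R ^+ 2 * (z * z^*) ^+ (p - j) / p.+1%:R else 0)) =
    x p * \sum_(j < k.+1) (if (j <= p)%N then 'C(k, j)%:R * G j p else 0).
  rewrite mulr_sumr; apply: eq_bigr => j _; rewrite /G; case: ifP => _; last by rewrite !mulr0.
  ring.
rewrite (sum_reindex k p (fun j => G j p)) mulrCA; congr (_ * _); rewrite mulr_sumr; apply: eq_bigr => m _.
rewrite /G /kerb subKn; last by have := ltn_ord m; lia.
have cX (a : R) n : (a ^+ n)%:C%C = a%:C%C ^+ n :> C by rewrite rmorphXn.
have cV (a : R) : (a^-1)%:C%C = a%:C%C^-1 :> C by rewrite fmorphV.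
have cn n : (n%:R : R)%:C%C = n%:R :> C by rewrite rmorph_nat.
have cN1 : (-1 : R)%:C%C = -1 :> C by rewrite rmorphN1.
rewrite !(real_complexM, cX, cV, cn, cN1) (exprMn m z).
rewrite (expr2 'C(m + k.+1, k.+1)%:R).
move: ('C(k, _)%:R : C) ('C(m + _, _)%:R : C) ((-1) ^+ _ : C) (p.+1%:R^-1 : C) => a b c d; ring.
Qed.

End RadialBerezin.

(** * Eigenvalues of radial Toeplitz operators *)
Section Eigenvalues.
Context {R : realType}.
Local Notation C := R[i].
Local Notation Re := complex.Re.
Local Notation sqi := (@square_integrable R).
Local Notation bergman := (@bergman R).
Implicit Types (f g h : bergman) (z w : C) (n m N P p k j b : nat) (x : nat -> C).

Lemma bdd_zzbar n m b : bdd (fun z : C => z ^+ n * z^* ^+ m * (1 - z * z^*) ^+ b).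
Proof.
apply: bddM; first exact: bdd_mono.
apply: bddX; apply: bddB; first exact: bdd_cst.
by apply: bddM; [exact: bdd_id|exact: bdd_conj bdd_id].
Qed.

(** Induction on b: (1-t)^(b+1) t^n = (1-t)^b t^n - (1-t)^b t^(n+1). *)
Lemma beta_integral n m b : cintegral (fun z : C => z ^+ n * z^* ^+ m * (1 - z * z^*) ^+ b) =
  (n == m)%:R * ((n`!%:R * b`!%:R) / (n + b).+1`!%:R).
Proof.
elim: b n m => [|b IH] n m.
  rewrite (@eq_cintegral _ _ (fun z => z ^+ n * z^* ^+ m)); last by move=> z _; rewrite expr0 mulr1.
  rewrite mom_full addn0 fact0 mulr1; congr (_ * _).
  by rewrite factS natrM invfM mulrCA mulfV ?mulr1// pnatr_eq0 -lt0n fact_gt0.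
rewrite (@eq_cintegral _ _ (fun z => z ^+ n * z^* ^+ m * (1 - z * z^*) ^+ b -
    z ^+ n.+1 * z^* ^+ m.+1 * (1 - z * z^*) ^+ b)); last first.
  by move=> z _; rewrite !exprS; ring.
rewrite cintegralB; [|exact: bdd_dint (bdd_zzbar _ _ _)..].
rewrite !IH eqSS -mulrBr; congr (_ * _).
rewrite addSn addnS (factS (n + b).+1) (factS n) (factS b) (natrM _ (n + b).+2) (natrM _ n.+1) (natrM _ b.+1).
have h1 : ((n + b).+1`!%:R : C) != 0 by rewrite pnatr_eq0 -lt0n fact_gt0.
have h2 : ((n + b).+2%:R : C) != 0 by rewrite pnatr_eq0.
have -> : (n.+1%:R : C) = (n + b).+2%:R - b.+1%:R.
  by rewrite -natrB; [congr (_%:R); lia|lia].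
move: h1 h2; move: ((n + b).+1`!%:R : C) ((n + b).+2%:R : C) (n`!%:R : C) (b`!%:R : C) (b.+1%:R : C).
by move=> c d e u v h1 h2; field; rewrite h1 h2.
Qed.

Lemma eq_bdd (F G : C -> C) : (forall z, disk z -> F z = G z) -> bdd F -> bdd G.
Proof.
move=> FG [[m1 m2] [M FM]]; split; last by exists M => z Dz; rewrite -FG ?FM.
split.
  by apply: eq_measurable_fun m1 => p; rewrite inE => Dp; rewrite FG.
by apply: eq_measurable_fun m2 => p; rewrite inE => Dp; rewrite FG.
Qed.

Lemma bdd_sum (I : Type) (r : seq I) (F : I -> C -> C) :
  (forall i, bdd (F i)) -> bdd (fun z => \sum_(i <- r) F i z).
Proof.
move=> h; elim: r => [|i r IH].
  by apply: eq_bdd (bdd_cst 0) => z _; rewrite big_nil.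
by apply: eq_bdd (bddD (h i) IH) => z _; rewrite big_cons.
Qed.

(** The Berezin transform of a finitely supported diagonal operator, as a
    polynomial in z and conj(z); see [berezin_trunc]. *)
Definition bpoly k x P z : C := \sum_(p < P) x p * \sum_(m < p.+1)
    (kerb k m p)%:C%C * (z ^+ m * z^* ^+ m * (1 - z * z^*) ^+ (2 + k)).

Lemma bdd_bpoly k x P : bdd (bpoly k x P).
Proof.
apply: bdd_sum => p; apply: bddM; first exact: bdd_cst.
by apply: bdd_sum => m; apply: bddM; [exact: bdd_cst|exact: bdd_zzbar].
Qed.

Lemma bpoly_cvg k x (M : R) z : (forall n, cnorm (x n) <= M) -> disk z ->
  ccvg (fun P => bpoly k x P z) (berezin k (bdiag x) z).
Proof.
move=> xM Dz; apply: ccvg_near (berezin_trunc_cvg k z xM); apply: nearW => P.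
exact: berezin_trunc.
Qed.

Lemma bpoly_le k x (M : R) P z : (forall n, cnorm (x n) <= M) -> disk z ->
  cnorm (bpoly k x P z) <= k.+1%:R * 2 ^+ k * M.
Proof.
move=> xM Dz; rewrite /bpoly -(berezin_trunc k P xM Dz); have tM := trunc_le P xM.
exact: berezin_bound (bdiag_linear tM) (bdiag_op_le tM) Dz.
Qed.

(** Measurability comes from the pointwise limit [bpoly_cvg]. *)
Lemma berezin_bdd k x (M : R) : (forall n, cnorm (x n) <= M) -> bdd (berezin k (bdiag x)).
Proof.
move=> xM; split; last first.
  by exists (k.+1%:R * 2 ^+ k * M) => z; exact: berezin_bound (bdiag_linear xM) (bdiag_op_le xM).
apply: (@cmeas_lim _ _ _ pdisk (fun P => bpoly k x P \o plane)).
  by move=> P; exact: (bdd_bpoly k x P).1.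
by move=> p Dp; exact: bpoly_cvg xM Dp.
Qed.

Lemma bpoly_moment k x P n m :
  n.+1%:R * cintegral (fun z => bpoly k x P z * (z ^+ m * z^* ^+ n)) =
  (m == n)%:R * \sum_(p < P) x p * (kerw k n p)%:C%C.
Proof.
have d i j : dint (fun z : C => z ^+ (i + m) * z^* ^+ (i + n) * (1 - z * z^*) ^+ j).
  exact: bdd_dint (bdd_zzbar _ _ _).
rewrite (@eq_cintegral _ _ (fun z => \sum_(p < P) x p * \sum_(i < p.+1) (kerb k i p)%:C%C *
    (z ^+ (i + m) * z^* ^+ (i + n) * (1 - z * z^*) ^+ (2 + k)))); last first.
  move=> z _; rewrite /bpoly mulr_suml; apply: eq_bigr => p _; rewrite -mulrA; congr (_ * _).
  rewrite mulr_suml; apply: eq_bigr => i _; rewrite !exprD; ring.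
rewrite cintegral_sum; last by move=> p _; apply: dintZ; apply: dint_sum => i _; exact: dintZ.
rewrite !mulr_sumr; apply: eq_bigr => p _; rewrite cintegralZ; last first.
  by apply: dint_sum => i _; exact: dintZ.
rewrite cintegral_sum; last by move=> i _; exact: dintZ.
rewrite mulrCA [RHS]mulrCA; congr (_ * _).
have -> : (kerw k n p)%:C%C = \sum_(i < p.+1) (kerb k i p)%:C%C * (kerJ k n i)%:C%C :> C.
  by rewrite /kerw rmorph_sum; apply: eq_bigr => i _; rewrite rmorphM.
rewrite !mulr_sumr; apply: eq_bigr => i _; rewrite cintegralZ//.
rewrite beta_integral eqn_add2l mulrCA [RHS]mulrCA; congr (_ * _).
rewrite /kerJ /frat !real_complexM.
have cn (l : nat) : (l%:R : R)%:C%C = l%:R :> C by rewrite rmorph_nat.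
have cV (a : R) : (a^-1)%:C%C = a%:C%C^-1 :> C by rewrite fmorphV.
rewrite cV !cn; case: (m =P n) => [->|_]; last by rewrite !mul0r mulr0.
rewrite !mul1r.
rewrite [(i + n)%N]addnC.
have -> : (n + i + (2 + k)).+1 = (n + i + k.+3)%N by lia.
by rewrite -!mulrA; congr (_ * _); exact: mulrCA.
Qed.

Definition moment (phi : C -> C) m n : C := cintegral (fun z => phi z * (z ^+ m * z^* ^+ n)).

(** Dominated convergence for the truncated operators, whose Berezin
    transforms are bounded uniformly in the truncation by [berezin_bound]. *)
Lemma berezin_moment_cvg k x (M : R) m n : (forall n, cnorm (x n) <= M) ->
  ccvg (fun P => (m == n)%:R * \sum_(p < P) x p * (kerw k n p)%:C%C)
    (n.+1%:R * moment (berezin k (bdiag x)) m n).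
Proof.
move=> xM; pose K := k.+1%:R * 2 ^+ k * M.
have K0 : 0 <= K by rewrite mulr_ge0// (le_trans (cnorm_ge0 _) (xM 0)).
have c : ccvg (fun P => cintegral (fun z => bpoly k x P z * (z ^+ m * z^* ^+ n)))
     (moment (berezin k (bdiag x)) m n).
  have bB P : bdd (fun z => bpoly k x P z * (z ^+ m * z^* ^+ n)).
    by apply: bddM; [exact: bdd_bpoly|exact: bdd_mono].
  have bL : bdd (fun z => berezin k (bdiag x) z * (z ^+ m * z^* ^+ n)).
    by apply: bddM; [exact: berezin_bdd xM|exact: bdd_mono].
  apply: (@cint_dominated _ _ _ area pdisk (@pdisk_measurable R)
    (fun P => (fun z => bpoly k x P z * (z ^+ m * z^* ^+ n)) \o plane)
    ((fun z => berezin k (bdiag x) z * (z ^+ m * z^* ^+ n)) \o plane) (cst K)).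
  - by move=> P; exact: (bB P).1.
  - exact: bL.1.
  - apply: measurable_bounded_integrable => //; first exact: pdisk_measurable.
      exact: area_pdisk_lty.
    by exists K; split; [exact: num_real|move=> y Ky p _ /=; rewrite ger0_norm// ltW].
  - move=> p Dp; have := ccvgZ (plane p ^+ m * (plane p)^* ^+ n) (bpoly_cvg k xM Dp).
    have -> : plane p ^+ m * (plane p)^* ^+ n * berezin k (bdiag x) (plane p) =
      berezin k (bdiag x) (plane p) * (plane p ^+ m * (plane p)^* ^+ n) by rewrite mulrC.
    by apply: ccvg_near; apply: nearW => P; rewrite mulrC.
  move=> P p Dp; rewrite /= cnormM; apply: le_trans (bpoly_le k P xM Dp).
  rewrite ler_piMr ?cnorm_ge0// cnormM !cnormX cnorm_conj -exprD.
  by rewrite exprn_ile1 ?cnorm_ge0// ltW//; exact: Dp.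
apply: ccvg_near (ccvgZ n.+1%:R c); apply: nearW => P; exact: bpoly_moment.
Qed.

Lemma berezin_moment_off k x (M : R) m n : (forall n, cnorm (x n) <= M) -> m != n ->
  moment (berezin k (bdiag x)) m n = 0.
Proof.
move=> xM mn; have := berezin_moment_cvg k m n xM; rewrite (negbTE mn) => c.
have E : n.+1%:R * moment (berezin k (bdiag x)) m n = 0.
  by apply: ccvg_unique c _; apply: ccvg_near (ccvg_cst _); apply: nearW => P; rewrite mul0r.
by apply/eqP; move/eqP: E; rewrite mulf_eq0 pnatr_eq0.
Qed.

Definition eigen (phi : C -> C) n : C := n.+1%:R * moment phi n n.

Lemma berezin_eigen_cvg k x (M : R) n : (forall n, cnorm (x n) <= M) ->
  ccvg (fun P => \sum_(p < P) x p * (kerw k n p)%:C%C) (eigen (berezin k (bdiag x)) n).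
Proof.
move=> xM; have := berezin_moment_cvg k n n xM; rewrite eqxx.
by apply: ccvg_near; apply: nearW => P; rewrite mul1r.
Qed.

Lemma bmul_diag (phi : C -> C) f n : bdd phi ->
  (forall m n, m != n -> moment phi m n = 0) -> tay (bmul phi f) n = eigen phi n * tay f n.
Proof.
move=> bphi off; have sf := bergman_sqi f; have [_ [M phiM]] := bphi.
have M0 : 0 <= M := le_trans (cnorm_ge0 _) (phiM 0 disk0).
rewrite tay_bmul//.
apply: (@tay_nrm_lim _ _ (fun N z => phi z * psum (tay f) N z)).
- exact: sqi_mulb.
- by move=> N; apply: sqi_mulb => //; exact: sqi_psum.
- have c : M * nrm (fun z => f z - psum (tay f) N z) @[N --> \oo] --> (0 : R).
    by rewrite -[X in _ --> X](mulr0 M); apply: cvgM; [exact: cvg_cst|exact: bergman_nrm_cvg].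
  apply: squeeze_cvgr c; last exact: cvg_cst.
  apply: nearW => N; rewrite nrm_ge0/=.
  have sd : sqi (fun z => f z - psum (tay f) N z) by apply: sqiB => //; exact: sqi_psum.
  have -> : nrm (fun z => phi z * f z - phi z * psum (tay f) N z) =
     nrm (fun z => phi z * (f z - psum (tay f) N z)).
    by congr (Num.sqrt _); apply: eq_N2 => z _; rewrite mulrBr.
  exact: nrm_mulb.
apply: ccvg_near (ccvg_cst _); exists n.+1 => // N /= nN.
have d m : dint (fun z => phi z * (z ^+ m * z^* ^+ n)).
  by apply: bdd_dint; apply: bddM => //; exact: bdd_mono.
rewrite {2}/tay /ip (@eq_cintegral _ _ (fun z => \sum_(m < N) tay f m * (phi z * (z ^+ m * z^* ^+ n)))); last first.
  move=> z _; rewrite /psum mulr_sumr mulr_suml; apply: eq_bigr => i _.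
  by rewrite rmorphXn/=; move: (tay f i) (phi z) => a c; ring.
rewrite cintegral_sum; last by move=> i _; exact: dintZ.
rewrite (bigD1 (Ordinal nN))//= big1 ?addr0; last first.
  by move=> i ni; rewrite cintegralZ// -/(moment phi i n) off ?mulr0.
by rewrite cintegralZ// -/(moment phi n n) /eigen; move: (tay f n) (moment phi n n) => a c; ring.
Qed.

Lemma moment_bound (phi : C -> C) (G : C -> C) (A : R) : 0 <= A -> bdd phi -> bdd G ->
  (forall z, disk z -> cnorm (phi z) <= A) ->
  forall H : C -> R, bdd (fun z => (H z)%:C%C) ->
  (forall z, disk z -> cnorm (G z) <= H z) ->
  cnorm (cintegral (fun z => phi z * G z)) <= 2 * A * cnorm (cintegral (fun z => (H z)%:C%C)).
Proof.
move=> A0 bp bG phiA H bH GH.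
have [i1 i2] := bdd_dint (bddM bp bG); have [h1 _] := bdd_dint bH.
have mD := @pdisk_measurable R.
have hA := integrable_scale mD A h1.
have bnd (p : R * R) : pdisk p -> cnorm (phi (plane p) * G (plane p)) <= A * H (plane p).
  by move=> Dp; rewrite cnormM; apply: ler_pM; rewrite ?cnorm_ge0 ?phiA ?GH.
have HI : Rintegral area pdisk (fun p : measurableTypeR R * measurableTypeR R => A * H (plane p)) <=
    A * cnorm (cintegral (fun z => (H z)%:C%C)).
  rewrite RintegralZl//; apply: ler_wpM2l => //.
  exact: le_trans (ler_norm _) (ler_Re (cintegral (fun z => (H z)%:C%C))).
move: (cnorm (cintegral (fun z => (H z)%:C%C))) HI => X HI.
have -> : 2 * A * X = A * X + A * X by ring.
apply: le_trans (cnorm_le_ReIm _) _; rewrite /cintegral/=; apply: lerD.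
  apply: le_trans (le_normr_Rintegral mD i1) _; apply: le_trans HI.
  apply: le_Rintegral => //; first exact: (integrable_norm i1).
  by move=> p Dp; apply: le_trans (ler_Re _) (bnd p Dp).
apply: le_trans (le_normr_Rintegral mD i2) _; apply: le_trans HI.
apply: le_Rintegral => //; first exact: (integrable_norm i2).
by move=> p Dp; apply: le_trans (ler_Im _) (bnd p Dp).
Qed.

(** The second difference of (n+1) t^n is t^n [(n+1)(1-t)^2 - 2 t (1-t)],
    and the integral of t^n [(n+1)(1-t)^2 + 2 t (1-t)] is 4 / ((n+2)(n+3)). *)
Lemma eigen_d2 (phi : C -> C) : bdd phi -> exists A : R, forall n,
  n.+2%:R ^+ 2 * cnorm (eigen phi n.+2 - 2 * eigen phi n.+1 + eigen phi n) <= A.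
Proof.
move=> bphi; have [_ [M phiM]] := bphi.
have M0 : 0 <= M := le_trans (cnorm_ge0 _) (phiM 0 disk0).
exists (2 * M * 4) => n.
pose G z : C := n.+1%:R * (z ^+ n * z^* ^+ n * (1 - z * z^*) ^+ 2) -
  2 * (z ^+ n.+1 * z^* ^+ n.+1 * (1 - z * z^*) ^+ 1).
pose H z : R := n.+1%:R * (cnorm z ^+ 2) ^+ n * (1 - cnorm z ^+ 2) ^+ 2 +
  2 * ((cnorm z ^+ 2) ^+ n.+1 * (1 - cnorm z ^+ 2)).
have bG : bdd G.
  by apply: bddB; (apply: bddM; [exact: bdd_cst|exact: bdd_zzbar]).
have HE z : (H z)%:C%C = n.+1%:R * (z ^+ n * z^* ^+ n * (1 - z * z^*) ^+ 2) +
  2 * (z ^+ n.+1 * z^* ^+ n.+1 * (1 - z * z^*) ^+ 1) :> C.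
  have cX (a : R) l : (a ^+ l)%:C%C = a%:C%C ^+ l :> C by rewrite rmorphXn.
  have cn l : (l%:R : R)%:C%C = l%:R :> C by rewrite rmorph_nat.
  have cB (a c : R) : (a - c)%:C%C = a%:C%C - c%:C%C :> C by rewrite rmorphB.
  have c1 : (1 : R)%:C%C = 1 :> C by [].
  rewrite /H real_complexD !real_complexM !cX !cB !c1 !cn -!exprMn mul_conj expr1 cX.
  by congr (_ + _); rewrite -[LHS]mulrA.
have bH : bdd (fun z => (H z)%:C%C).
  have : bdd (fun z : C => n.+1%:R * (z ^+ n * z^* ^+ n * (1 - z * z^*) ^+ 2) +
      2 * (z ^+ n.+1 * z^* ^+ n.+1 * (1 - z * z^*) ^+ 1)).
    by apply: bddD; (apply: bddM; [exact: bdd_cst|exact: bdd_zzbar]).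
  by apply: eq_bdd => z _; rewrite HE.
have GH z : disk z -> cnorm (G z) <= H z.
  move=> Dz; apply: le_trans (cnorm_le_add _ _) _; rewrite cnormN.
  have E (u : R) : cnorm (1 - z * z^*) = 1 - cnorm z ^+ 2.
    rewrite mul_conj -(rmorph1 (real_complex R)) -rmorphB cnorm_real ger0_norm// subr_ge0.
    by rewrite expr_le1 ?cnorm_ge0 ?(ltW Dz).
  rewrite !cnormM !cnormX cnorm_conj !cnorm_nat (E 0) expr1 /H lerD//.
    by rewrite mulrA -exprD -exprM addnn mul2n.
  by rewrite -exprD -exprM addnn mul2n.
have phiG : eigen phi n.+2 - 2 * eigen phi n.+1 + eigen phi n = cintegral (fun z => phi z * G z).
  have d m : dint (fun z => phi z * (z ^+ m * z^* ^+ m)).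
    by apply: bdd_dint; apply: bddM => //; exact: bdd_mono.
  rewrite /eigen /moment -!cintegralZ//; last exact: dintZ.
  rewrite -cintegralB; [|exact: dintZ|by apply: dintZ; exact: dintZ].
  rewrite -cintegralD; [|apply: dintB; [exact: dintZ|by apply: dintZ; exact: dintZ]|exact: dintZ].
  apply: eq_cintegral => z _; rewrite /G !exprS -!natr1; move: (phi z) => a; ring.
rewrite phiG; apply: le_trans (ler_wpM2l (sqr_ge0 _) (moment_bound M0 bphi bG phiM bH GH)) _.
have -> : cintegral (fun z => (H z)%:C%C) = (4 / (n.+2%:R * n.+3%:R))%:C%C :> C.
  rewrite (@eq_cintegral _ _ _ (fun z _ => HE z)).
  rewrite cintegralD ?cintegralZ; try (try apply: dintZ; exact: bdd_dint (bdd_zzbar _ _ _)).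
  rewrite !beta_integral !eqxx !mul1r.
  have -> : (n + 2).+1`! = (n.+3 * (n.+2 * (n.+1 * n`!)))%N by rewrite addn2 !factS.
  have -> : (n.+1 + 1).+1`! = (n.+3 * (n.+2 * (n.+1 * n`!)))%N by rewrite addn1 !factS.
  rewrite (factS n) !real_complexM.
  have cn l : (l%:R : R)%:C%C = l%:R :> C by rewrite rmorph_nat.
  have cV (a : R) : (a^-1)%:C%C = a%:C%C^-1 :> C by rewrite fmorphV.
  rewrite cV real_complexM !cn.
  have -> : (2`!%:R : C) = 2 by [].
  have -> : (1`!%:R : C) = 1 by [].
  rewrite (natrM _ n.+3) (natrM _ n.+2) (natrM _ n.+1).
  have f0 : (n`!%:R : C) != 0 by rewrite pnatr_eq0 -lt0n fact_gt0.
  have n1 : (n.+1%:R : C) != 0 by rewrite pnatr_eq0.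
  have n2 : (n.+2%:R : C) != 0 by rewrite pnatr_eq0.
  have n3 : (n.+3%:R : C) != 0 by rewrite pnatr_eq0.
  move: (n`!%:R : C) (n.+1%:R : C) (n.+2%:R : C) (n.+3%:R : C) f0 n1 n2 n3 => a b c e f0 n1 n2 n3.
  by field; rewrite f0 n1 n2 n3.
have n2 : 0 < n.+2%:R :> R by rewrite ltr0n.
have n3 : 0 < n.+3%:R :> R by rewrite ltr0n.
have n23 : n.+2%:R <= n.+3%:R :> R by rewrite ler_nat.
rewrite cnorm_real ger0_norm ?divr_ge0 ?mulr_ge0//.
move: (n.+2%:R : R) (n.+3%:R : R) n2 n3 n23 => a b a0 b0 ab.
have -> : a ^+ 2 * (2 * M * (4 / (a * b))) = 2 * M * 4 * (a / b) by field; rewrite !gt_eqF.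
by rewrite ler_piMr ?mulr_ge0// ler_pdivrMr// mul1r.
Qed.

End Eigenvalues.

(** * Slow oscillation and the spaces d1, d2 *)
Section Sequences.
Context {R : realType}.
Local Notation C := R[i].
Local Notation Re := complex.Re.
Local Notation bergman := (@bergman R).
Implicit Types (f g h : bergman) (z w : C) (n m N P p k j : nat) (x y : nat -> C).

Lemma supnorm_le x (M : R) : (forall n, cnorm (x n) <= M) -> (supnorm x <= M%:E)%E.
Proof. by move=> h; apply: ge_ereal_sup => _ [n _ <-]; rewrite lee_fin. Qed.

Lemma le_supnorm x (M : R) : (supnorm x <= M%:E)%E -> forall n, cnorm (x n) <= M.
Proof.
by move=> h n; rewrite -lee_fin; apply: le_trans h; apply: ereal_sup_ubound; exists n.
Qed.

Lemma sup_bounded (u : nat -> R) : (forall n, 0 <= u n) ->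
  (ereal_sup (range (fun n => (u n)%:E)) < +oo)%E <-> exists M, forall n, u n <= M.
Proof.
move=> u0; split=> [h|[M h]]; last first.
  apply: (@le_lt_trans _ _ M%:E); last exact: ltry.
  by apply: ge_ereal_sup => _ [n _ <-]; rewrite lee_fin.
exists (fine (ereal_sup (range (fun n => (u n)%:E)))) => n; rewrite -lee_fin fineK.
  by apply: ereal_sup_ubound; exists n.
rewrite ge0_fin_numE//; apply: (@le_trans _ _ (u 0%N)%:E); first by rewrite lee_fin.
by apply: ereal_sup_ubound; exists 0%N.
Qed.

Lemma linftyP x : linfty x <-> exists M, forall n, cnorm (x n) <= M.
Proof. by apply: sup_bounded => n; exact: cnorm_ge0. Qed.

(** The mean of the first differences over the indices n, ..., 2n is at most
    2 M / (n+1) by telescoping, and each of them differs from the one at n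
    by at most A / (n+2) by the bound on second differences. *)
Lemma d2_bound_d1_bound x (M A : R) : (forall n, cnorm (x n) <= M) ->
  (forall n, n.+2%:R ^+ 2 * cnorm (x n.+2 - 2 * x n.+1 + x n) <= A) ->
  forall n, n.+1%:R * cnorm (x n.+1 - x n) <= 2 * M + A.
Proof.
move=> xM xA n.
have A0 : 0 <= A by apply: le_trans (xA 0); rewrite mulr_ge0 ?sqr_ge0 ?cnorm_ge0.
pose D m := x m.+1 - x m.
have n2 : 0 < n.+2%:R :> R by rewrite ltr0n.
have step i : cnorm (D (n + i)%N - D n) <= i%:R * (A / n.+2%:R ^+ 2).
  elim: i => [|i IH]; first by rewrite addn0 subrr cnorm0 mul0r.
  have -> : D (n + i.+1)%N - D n = (x (n + i).+2 - 2 * x (n + i).+1 + x (n + i)) + (D (n + i)%N - D n).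
    by rewrite /D addnS; ring.
  apply: le_trans (cnorm_le_add _ _) _.
  have -> (q : R) : i.+1%:R * q = q + i%:R * q by rewrite -natr1; ring.
  apply: lerD => //.
  rewrite ler_pdivlMr ?exprn_gt0// mulrC; apply: le_trans (xA (n + i)%N).
  rewrite ler_wpM2r ?cnorm_ge0// lerXn2r ?nnegrE// ler_nat; lia.
have tel l : \sum_(i < l) D (n + i)%N = x (n + l)%N - x n.
  elim: l => [|l IH]; first by rewrite big_ord0 addn0 subrr.
  by rewrite big_ord_recr/= IH /D addnS; ring.
have E : n.+1%:R * D n = (x (n + n.+1)%N - x n) - \sum_(i < n.+1) (D (n + i)%N - D n).
  rewrite sumrB tel sumr_const card_ord -mulr_natl; ring.
have -> : n.+1%:R * cnorm (x n.+1 - x n) = cnorm (n.+1%:R * D n) by rewrite cnormM cnorm_nat.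
rewrite E; apply: le_trans (cnorm_le_add _ _) _; rewrite cnormN lerD//.
  by apply: le_trans (cnorm_le_add _ _) _; rewrite cnormN mulrDl mul1r lerD.
apply: le_trans (cnorm_sum _ _ _) _.
apply: (@le_trans _ _ (\sum_(i < n.+1) (A / n.+2%:R))); last first.
  rewrite sumr_const card_ord -[leLHS]mulr_natl [leLHS]mulrCA.
  by rewrite ler_piMr// ler_pdivrMr// mul1r ler_nat.
apply: ler_sum => i _; apply: le_trans (step i) _.
have -> : i%:R * (A / n.+2%:R ^+ 2) = A / n.+2%:R * (i%:R / n.+2%:R).
  by move: (n.+2%:R : R) n2 => a a0; field; rewrite gt_eqF.
rewrite ler_piMr ?divr_ge0 ?(ltW n2)// ler_pdivrMr// mul1r ler_nat; have := ltn_ord i; lia.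
Qed.

Lemma d2_sub_d1 x : d2 x -> d1 x.
Proof.
move=> [lx /sup_bounded[|A xA]]; first by move=> n; rewrite mulr_ge0 ?sqr_ge0 ?cnorm_ge0.
have [M xM] := (linftyP x).1 lx; split=> //.
apply/sup_bounded; first by move=> n; rewrite mulr_ge0 ?cnorm_ge0.
by exists (2 * M + A); exact: d2_bound_d1_bound.
Qed.

Lemma closure_d2_d1 x : linfty_closure d2 x -> linfty_closure d1 x.
Proof.
by move=> [lx H]; split=> // e e0; have [y /d2_sub_d1 dy xy] := H e e0; exists y.
Qed.

(** For y in d1, y_(n+j) - y_n is at most a constant times j / (n+1);
    uniform limits inherit slow oscillation. *)
Lemma closure_d1_slow x : linfty_closure d1 x -> slowly_oscillating x.
Proof.
move=> [_ H] e e0; have e3 : 0 < e / 3 by rewrite divr_gt0.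
have [y [ly dy] xy] := H _ e3.
have [A yA] := (sup_bounded (fun n => mulr_ge0 (ler0n R n.+1) (cnorm_ge0 (y n.+1 - y n)))).1 dy.
have xyn := le_supnorm (ltW xy).
have A1 : 0 < A + 1.
  by rewrite ltr_wpDl//; apply: le_trans (yA 0); rewrite mulr_ge0 ?cnorm_ge0.
exists (e / 3 / (A + 1)); first by rewrite divr_gt0.
move=> n j jn.
have n1 : 0 < n.+1%:R :> R by rewrite ltr0n.
have tel i : cnorm (y (n + i)%N - y n) <= i%:R * ((A + 1) / n.+1%:R).
  elim: i => [|i IH]; first by rewrite addn0 subrr cnorm0 mul0r.
  have -> : y (n + i.+1)%N - y n = (y (n + i).+1 - y (n + i)%N) + (y (n + i)%N - y n).
    by rewrite addnS; ring.
  apply: le_trans (cnorm_le_add _ _) _.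
  have -> (q : R) : i.+1%:R * q = q + i%:R * q by rewrite -natr1; ring.
  apply: lerD => //; rewrite ler_pdivlMr// mulrC.
  apply: (@le_trans _ _ A); last by rewrite lerDl.
  apply: le_trans (yA (n + i)%N); rewrite ler_wpM2r ?cnorm_ge0// ler_nat; lia.
have tj : cnorm (y (n + j)%N - y n) <= e / 3.
  apply: le_trans (tel j) _; apply: (@le_trans _ _ (e / 3 / (A + 1) * n%:R * ((A + 1) / n.+1%:R))).
    by rewrite ler_wpM2r// divr_ge0// ltW.
  have -> : e / 3 / (A + 1) * n%:R * ((A + 1) / n.+1%:R) = e / 3 * (n%:R / n.+1%:R).
    by move: (n.+1%:R : R) (n%:R : R) n1 => a b a0; field; rewrite !gt_eqF.
  by rewrite ler_piMr ?(ltW e3)// ler_pdivrMr// mul1r ler_nat.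
have -> : x (n + j)%N - x n = ((x - y) (n + j)%N - (x - y) n) + (y (n + j)%N - y n).
  have E m : (x - y) m = x m - y m by [].
  by rewrite !E; ring.
have -> : e = (e / 3 + e / 3) + e / 3 by field.
apply: le_trans (cnorm_le_add _ _) (lerD _ tj).
by apply: le_trans (cnorm_le_add _ _) _; rewrite cnormN lerD.
Qed.

(** A small relative gap of n and p means that the larger one exceeds the
    smaller by a small fraction of it. The bound eta <= 1/8 excludes the
    pair of a positive index with 0. *)
Lemma slow_relgap x : slowly_oscillating x -> forall e : R, 0 < e ->
  exists2 dl : R, 0 < dl & forall n p, relgap n p < dl -> cnorm (x p - x n) <= e.
Proof.
move=> sx e e0; have [d d0 H] := sx e e0.
(* relgap n (n + j) < eta^2 reads j < eta (2 n + j + 2), which gives j <= d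
   n for these values of eta *)
pose eta := Num.min (1 / 8) (d / 8).
have eta0 : 0 < eta by rewrite lt_min !divr_gt0.
have eta1 : eta <= 1 / 8 by rewrite ge_min lexx.
have eta2 : eta <= d / 8 by rewrite ge_min lexx orbT.
have half n j : relgap n (n + j) < eta ^+ 2 -> cnorm (x (n + j)%N - x n) <= e.
  rewrite /relgap => h; apply: H.
  have q0 : 0 <= ((n + j)%:R - n%:R) / (n + j + n).+2%:R :> R.
    by rewrite divr_ge0// subr_ge0 ler_nat leq_addr.
  move: h; rewrite ltr_pXn2r ?nnegrE ?(ltW eta0)// ltr_pdivrMr ?ltr0n//.
  have -> : (n + j + n).+2%:R = 2 * n%:R + j%:R + 2 :> R.
    by rewrite -natrM -!natrD; congr (_%:R); lia.
  rewrite natrD addrAC subrr add0r.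
  case: j {q0} => [|j]; first by move=> _; rewrite mulr_ge0// ltW.
  case: n => [|n]; last first.
    have : 1 <= n.+1%:R :> R by rewrite ler1n.
    by move: (n.+1%:R : R) (j.+1%:R : R) (ler0n R j.+1) => a b b0 a1 h; nra.
  have : 1 <= j.+1%:R :> R by rewrite ler1n.
  by move: (j.+1%:R : R) => b b1 h; nra.
exists (eta ^+ 2); first by rewrite exprn_gt0.
move=> n p; have [np|pn] := leqP n p; first by rewrite -(subnKC np); exact: half.
have -> : relgap n p = relgap p n :> R.
  by rewrite /relgap [(n + p)%N]addnC !expr_div_n -[in LHS]opprB sqrrN.
rewrite cnormBC -(subnKC (ltnW pn)); exact: half.
Qed.

(** The averaging kernel has mass one, so the difference is an average of
    lambda_p - lambda_n. Indices p with a small relative gap to n contribute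
    at most e/2 by [slow_relgap]; the others have mass O(1/k) by
    [kerw_relgap]. *)
Lemma slow_eigen x (M : R) : (forall n, cnorm (x n) <= M) -> slowly_oscillating x ->
  forall e : R, 0 < e -> \forall k \near \oo,
    forall n, cnorm (eigen (berezin k (bdiag x)) n - x n) <= e.
Proof.
move=> xM sx e e0; have e2 : 0 < e / 2 by rewrite divr_gt0.
have M0 : 0 <= M := le_trans (cnorm_ge0 _) (xM 0).
have [d d0 H] := slow_relgap sx e2.
have [K0 HK] := archi_div (2 * M / d * 6) e2.
exists K0.+1 => // k /= Kk n.
have k0 : (0 < k)%N by lia.
have wd p : 0 <= kerw k n p :> R := kerw_ge0 k n p.
have dist p : cnorm (x p - x n) <= e / 2 + 2 * M / d * relgap n p.
  have [h|h] := ltP (relgap n p) d.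
    by apply: le_trans (H n p h) _; rewrite lerDl mulr_ge0 ?relgap_ge0// divr_ge0 ?mulr_ge0// ltW.
  apply: (@le_trans _ _ (2 * M)).
    by apply: le_trans (cnorm_le_add _ _) _; rewrite cnormN mulrDl mul1r lerD.
  apply: (@le_trans _ _ (2 * M / d * relgap n p)); last by rewrite lerDr ltW.
  by rewrite -mulrA ler_peMr ?mulr_ge0// mulrC ler_pdivlMr// mul1r.
have c1 := berezin_eigen_cvg k n xM.
have cw : ccvg (fun P => \sum_(p < P) (kerw k n p)%:C%C) (1 : C).
  have := @cvg_kerw_sum R k n => /cvgrPdist_le h; apply/ccvgP => t t0.
  apply: filterS (h t t0) => P; rewrite distrC; congr (_ <= _).
  have -> : \sum_(p < P) (kerw k n p)%:C%C - 1 = (\sum_(p < P) kerw k n p - 1)%:C%C :> C.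
    by rewrite rmorphB rmorph1 rmorph_sum.
  by rewrite cnorm_real.
have c2 := ccvgB c1 (ccvgZ (x n) cw); rewrite mulr1 in c2.
apply: (ccvg_le c2); apply: nearW => P.
have -> : \sum_(p < P) x p * (kerw k n p)%:C%C - x n * \sum_(p < P) (kerw k n p)%:C%C =
   \sum_(p < P) (x p - x n) * (kerw k n p)%:C%C.
  by rewrite mulr_sumr -sumrB; apply: eq_bigr => p _; rewrite mulrBl.
apply: le_trans (cnorm_sum _ _ _) _.
apply: (@le_trans _ _ (\sum_(p < P) (e / 2 + 2 * M / d * relgap n p) * kerw k n p)).
  by apply: ler_sum => p _; rewrite cnormM cnorm_real ger0_norm// ler_wpM2r.
have -> : \sum_(p < P) (e / 2 + 2 * M / d * relgap n p) * kerw k n p =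
   e / 2 * \sum_(p < P) kerw k n p + 2 * M / d * \sum_(p < P) kerw k n p * relgap n p.
  rewrite !mulr_sumr -big_split/=; apply: eq_bigr => p _.
  by move: (kerw k n p) (relgap n p) => a b; ring.
have -> : e = e / 2 + e / 2 by field.
apply: lerD.
  have -> : (e / 2 + e / 2) / 2 = e / 2 by field.
  by rewrite ler_piMr ?(ltW e2)// kerw_sum_le1.
have Md : 0 <= 2 * M / d by rewrite divr_ge0 ?mulr_ge0// ltW.
apply: le_trans (ler_wpM2l Md (kerw_relgap n P k0)) _.
by rewrite mulrA; apply: HK; lia.
Qed.

End Sequences.

(** * The four conditions for a radial operator *)
Section MainEquivalences.
Context {R : realType}.
Local Notation C := R[i].
Local Notation bergman := (@bergman R).
Variables (S : bergman -> bergman) (lambda : nat -> C).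
Hypothesis bS : bounded_operator S.
Hypothesis radS : forall n : nat, S (bbasis n) = lambda n *: bbasis n.

Lemma radial_bounded : exists M, forall n, cnorm (lambda n) <= M.
Proof.
have [lS [M M0 SM]] := (bounded_operatorP S).1 bS.
by exists M; exact: (radial_bound radS SM).
Qed.

Lemma radial_bdiag : S = bdiag lambda.
Proof.
have [M lM] := radial_bounded; apply/funext => f; apply: bergman_ext => n.
by rewrite (radial_tay bS radS) (tay_bdiag _ _ lM).
Qed.

Lemma berezin_toeplitz_tay k f n :
  tay (toeplitz (berezin k S) f) n = eigen (berezin k S) n * tay f n.
Proof.
have [M lM] := radial_bounded; have bB := berezin_bdd k lM.
rewrite radial_bdiag toeplitz_bdd//; apply: bmul_diag => // m l ml.
exact: berezin_moment_off lM ml.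
Qed.

Lemma berezin_Linfty k : Linfty (berezin k S).
Proof.
have [M lM] := radial_bounded.
by apply: bdd_Linfty; rewrite radial_bdiag; exact: berezin_bdd lM.
Qed.

Lemma berezin_defect_tay k f n : tay ((toeplitz (berezin k S) - S) f) n =
  (eigen (berezin k S) n - lambda n) * tay f n.
Proof.
have -> : (toeplitz (berezin k S) - S) f = toeplitz (berezin k S) f - S f by [].
by rewrite tayB berezin_toeplitz_tay (radial_tay bS radS) mulrBl.
Qed.

Lemma berezin_defect_linear k : linear (toeplitz (berezin k S) - S).
Proof.
move=> c f g; apply: bergman_ext => n.
by rewrite tay_linear !berezin_defect_tay tay_linear mulrDr mulrCA.
Qed.

(** The difference is a diagonal operator. *)
Lemma opnorm_defect_le k (e : R) : 0 <= e ->
  (opnorm (toeplitz (berezin k S) - S)%R <= e%:E)%E <->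
  forall n, cnorm (eigen (berezin k S) n - lambda n) <= e.
Proof.
move=> e0; have tayT := berezin_defect_tay k; have lT := berezin_defect_linear k.
split=> [h|h].
  have oT := opnorm_op_le lT h; apply: (radial_bound _ oT) => n.
  apply: bergman_ext => m; rewrite tayT tayZ bbasis_tay.
  by case: eqP => [->//|_]; rewrite !mulr0.
apply: opnorm_le => // f; apply: nrm_tay_le => // n.
by rewrite tayT cnormM ler_wpM2r ?cnorm_ge0.
Qed.

Lemma algebra_slow : toeplitz_algebra S -> slowly_oscillating lambda.
Proof. by move=> /toeplitz_algebra_localized; exact: localized_slow. Qed.

Lemma slow_berezin : slowly_oscillating lambda ->
  opnorm (toeplitz (berezin k S) - S) @[k --> \oo] --> 0%E.
Proof.
move=> sl; have [M lM] := radial_bounded.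
have o0 k : (0 <= opnorm (toeplitz (berezin k S) - S)%R)%E.
  apply: (@le_trans _ _ (bnorm ((toeplitz (berezin k S) - S)%R 0%R))%:E); first by rewrite lee_fin bnormE nrm_ge0.
  by apply: ereal_sup_ubound; exists 0 => //=; rewrite bnormE nrm0 ler01.
apply/fine_cvgP.
have near_le (e : R) : 0 < e -> \forall k \near \oo, (opnorm (toeplitz (berezin k S) - S)%R <= e%:E)%E.
  move=> e0; apply: filterS (slow_eigen lM sl e0) => k h.
  by apply/(opnorm_defect_le k (ltW e0)) => n; rewrite radial_bdiag; exact: h.
split.
  apply: filterS (near_le 1 ltr01) => k h; rewrite ge0_fin_numE//.
  exact: le_lt_trans h (ltry _).
apply/cvgr0Pnorm_le => e e0; apply: filterS (near_le e e0) => k h /=.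
rewrite ger0_norm ?fine_ge0// -lee_fin fineK// ge0_fin_numE//.
exact: le_lt_trans h (ltry _).
Qed.

Lemma berezin_near : opnorm (toeplitz (berezin k S) - S) @[k --> \oo] --> 0%E ->
  forall e : R, 0 < e -> exists k, (opnorm (toeplitz (berezin k S) - S)%R <= e%:E)%E.
Proof.
move=> /fine_cvgP[nf /cvgr0Pnorm_le c] e e0.
near \oo => k; exists k.
have fk : opnorm (toeplitz (berezin k S) - S) \is a fin_num by near: k.
rewrite -(fineK fk) lee_fin; apply: le_trans (ler_norm _) _.
by near: k; exact: c.
Unshelve. all: by end_near. Qed.

Lemma berezin_algebra : opnorm (toeplitz (berezin k S) - S) @[k --> \oo] --> 0%E ->
  toeplitz_algebra S.
Proof.
move=> /berezin_near c A [[_ _ _ cl] sub]; apply: cl => // e e0.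
have e2 : 0 < e / 2 by rewrite divr_gt0.
have [k hk] := c _ e2; exists (toeplitz (berezin k S)).
  by apply: sub; exists (berezin k S) => //; exact: berezin_Linfty.
have hn := opnorm_op_le (berezin_defect_linear k) hk.
apply: (@le_lt_trans _ _ (e / 2)%:E); last by rewrite lte_fin ltr_pdivrMr// ltr_pMr// ltr1n.
apply: opnorm_le (ltW e2) => f; have := hn f.
have -> : (toeplitz (berezin k S) - S) f = - ((S - toeplitz (berezin k S)) f).
  change (toeplitz (berezin k S) f - S f = - (S f - toeplitz (berezin k S) f)).
  by rewrite opprB.
by rewrite nrm_opp.
Qed.

(** The approximating sequences are the eigenvalues of T_(B_k S). *)
Lemma berezin_closure_d2 : opnorm (toeplitz (berezin k S) - S) @[k --> \oo] --> 0%E ->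
  linfty_closure d2 lambda.
Proof.
move=> /berezin_near c; have [M lM] := radial_bounded.
split; first by apply/linftyP; exists M.
move=> e e0; have e2 : 0 < e / 2 by rewrite divr_gt0.
have [k /(opnorm_defect_le k (ltW e2)) hk] := c _ e2.
have bB := berezin_bdd k lM; rewrite -radial_bdiag in bB.
exists (eigen (berezin k S)).
  split.
    apply/linftyP; exists (e / 2 + M) => n.
    by rewrite -[eigen _ n](subrK (lambda n)) (le_trans (cnorm_le_add _ _))// lerD.
  apply/sup_bounded; first by move=> n; rewrite mulr_ge0 ?sqr_ge0 ?cnorm_ge0.
  exact: eigen_d2.
apply: (@le_lt_trans _ _ (e / 2)%:E); last by rewrite lte_fin ltr_pdivrMr// ltr_pMr// ltr1n.
by apply: supnorm_le => n; rewrite cnormBC; exact: hk.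
Qed.

End MainEquivalences.

Theorem theorem4p3 (R : realType) (S : bergman (R := R) -> bergman (R := R))
  (lambda : nat -> R[i])
  (bS : bounded_operator S)
  (radS : forall n : nat, S (bbasis n) = lambda n *: bbasis n) :
  [<-> toeplitz_algebra S;
       opnorm (toeplitz (berezin k S) - S) @[k --> \oo] --> 0%E;
       linfty_closure d2 lambda;
       linfty_closure d1 lambda].
Proof.
have sl := slow_berezin bS radS.
tfae.
- by move=> /(algebra_slow bS radS)/sl.
- exact: berezin_closure_d2.
- exact: closure_d2_d1.
- by move=> /closure_d1_slow/sl; exact: berezin_algebra.
Qed.
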